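(* There exists a unique classical solution $(u,m)$ to the system \[ \begin{cases} u_t + \frac{\sigma^2}{2} u_{xx} - ru + G(u_x,m)^2 = 0, & 0<t<T,\ 0<x<L,\\ m_t - \frac{\sigma^2}{2} m_{xx} - \{G(u_x,m)m\}_x = 0, & 0<t<T,\ 0<x<L,\\ m(0,x)=m_0(x),\quad u(T,x)=u_T(x), & 0\le x\le L,\\ u_x(t,0)=u_x(t,L)=0, & 0\le t\le T,\\ \frac{\sigma^2}{2} m_x(t,x) + G(u_x,m)m(t,x) = 0, & 0\le t\le T,\ x\in\{0,L\}, \end{cases} \] where $G(u_x,m)(t,x) := \frac12\left(b + c\int_0^L u_x(t,y)m(t,y)\,dy - u_x(t,x)\right)$.
   Context: Standing setting: $L,T,\sigma,r>0$ are constants, $\epsilon>0$, and $b=\frac{2}{2+\epsilon}$, $c=\frac{\epsilon}{2+\epsilon}$. The data satisfy: $u_T,m_0\in C^{2+\gamma}([0,L])$ for some $\gamma>0$; $u_T'(0)=u_T'(L)=0$ and $m_0(0)=m_0'(0)=m_0(L)=m_0'(L)=0$; $m_0$ is a probability density on $[0,L]$; $u_T\ge 0$. *)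

(* Defs.v *)
From Stdlib Require Import Reals.
From Coquelicot Require Import Coquelicot.
Open Scope R_scope.

Definition Icc (a b : R) (x : R) : Prop := a <= x <= b.

Definition deriv_within (D : R -> Prop) (f : R -> R) (f' x : R) : Prop :=
  filterlim (fun y => (f y - f x) / (y - x))
            (within (fun y => D y /\ y <> x) (locally x)) (locally f').

Definition deriv_on (a b : R) (f f' : R -> R) : Prop :=
  forall x, Icc a b x -> deriv_within (Icc a b) f (f' x) x.

Definition holder_on (a b gamma : R) (f : R -> R) : Prop :=
  exists C, forall x y, Icc a b x -> Icc a b y -> x <> y ->
    Rabs (f x - f y) <= C * Rpower (Rabs (x - y)) gamma.

Definition C2gamma (a b gamma : R) (f f1 f2 : R -> R) : Prop :=
  deriv_on a b f f1 /\ deriv_on a b f1 f2 /\ holder_on a b gamma f2.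

Definition rect (T L : R) (p : R * R) : Prop :=
  0 <= fst p <= T /\ 0 <= snd p <= L.
Definition orect (T L : R) (p : R * R) : Prop :=
  0 < fst p < T /\ 0 < snd p < L.

Definition cont_on (D : R * R -> Prop) (f : R -> R -> R) : Prop :=
  forall p, D p ->
    filterlim (fun q : R * R => f (fst q) (snd q)) (within D (locally p))
              (locally (f (fst p) (snd p))).

Definition bcoef (eps : R) : R := 2 / (2 + eps).
Definition ccoef (eps : R) : R := eps / (2 + eps).

Definition Gfun (eps L : R) (ux m : R -> R -> R) (t x : R) : R :=
  / 2 * (bcoef eps + ccoef eps * RInt (fun y => ux t y * m t y) 0 L - ux t x).

Definition classical_solution (sigma r T L eps : R) (uT m0 : R -> R)
    (u m : R -> R -> R) : Prop :=
  exists ux mx ut uxx mt mxx : R -> R -> R,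
    cont_on (rect T L) u /\ cont_on (rect T L) m /\
    cont_on (rect T L) ux /\ cont_on (rect T L) mx /\
    cont_on (orect T L) ut /\ cont_on (orect T L) uxx /\
    cont_on (orect T L) mt /\ cont_on (orect T L) mxx /\
    (forall t, 0 <= t <= T ->
       deriv_on 0 L (u t) (ux t) /\ deriv_on 0 L (m t) (mx t)) /\
    (forall t x, 0 < t < T -> 0 < x < L ->
       is_derive (fun s => u s x) t (ut t x) /\
       is_derive (fun y => ux t y) x (uxx t x) /\
       is_derive (fun s => m s x) t (mt t x) /\
       is_derive (fun y => mx t y) x (mxx t x)) /\
    (forall t x, 0 < t < T -> 0 < x < L ->
       ut t x + sigma ^ 2 / 2 * uxx t x - r * u t x
         + (Gfun eps L ux m t x) ^ 2 = 0) /\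
    (forall t x, 0 < t < T -> 0 < x < L ->
       exists gmx : R,
         is_derive (fun y => Gfun eps L ux m t y * m t y) x gmx /\
         mt t x - sigma ^ 2 / 2 * mxx t x - gmx = 0) /\
    (forall x, 0 <= x <= L -> m 0 x = m0 x /\ u T x = uT x) /\
    (forall t, 0 <= t <= T -> ux t 0 = 0 /\ ux t L = 0) /\
    (forall t x, 0 <= t <= T -> (x = 0 \/ x = L) ->
       sigma ^ 2 / 2 * mx t x + Gfun eps L ux m t x * m t x = 0).

(* Main.v *)
Require Import Defs.
From Stdlib Require Import Reals Lra Lia Psatz ClassicalEpsilon.
From Coquelicot Require Import Coquelicot.
Open Scope R_scope.

(** With [nu = sigma^2 / 2] and [v = u_x], the system couples [v] and [m] only through the scalar
    [p t = b + c * int v m], since [G = (p - v) / 2].  For a given [p], the equation of [v] (in reversed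
    time) and then that of [m] are one-dimensional heat equations with a first-order source.  They are
    solved on the level of sine and cosine coefficients, whose sums are controlled by the smoothing
    estimate [ksum]; the a priori bounds [|v| <= K0] and [m >= 0] come from Stampacchia truncation.

    Existence.  The classical duality computation for mean field games shows that two solutions with
    parameters [p1], [p2] satisfy
    [int e^(-r t) (p1 - p2) (V1 - V2) <= int e^(-r t) (p1 - p2)^2], where [V = int v m].
    As [c < 1] and [p -> V] is Lipschitz in [L2], the damped iteration [p - ta (p - b - c V)] is a
    contraction for small [ta].  For the regularity of the fixed point, the Fourier coefficients of the
    flux are [fl_k = phi_k - (nu lam + rho / lam) w_k]; the [k]-th coefficient of [w_t] is [lam_k fl_k].  They
    are summable as soon as the source [phi] is Hoelder continuous in time with values in [L2].  This
    gives [v_x] and [m_x] up to the boundary, hence [p] is locally Lipschitz, hence so are [v] and [m]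
    in [L2], and then one more power of [lam_k] is summable, which gives [v_t], [m_t] and [m_xx].

    Uniqueness.  The same duality identity yields [p1 = p2], and energy estimates conclude. *)

(** * Continuity and integrals *)

(** [v] runs backward and [m] forward, so a fixed-point argument for the pair could only be expected
    to contract on short horizons; in the scalar [p], monotonicity replaces smallness of [T]. The
    equation of [v] is quadratic in [v]. It is made globally Lipschitz by clipping at a bound [K0]
    of the terminal slope, and |v| <= K0 shows afterwards that the clip never acts.

    Exponents: passing from square sums to absolute sums of coefficients uses the weights k^(-5/4).
    This costs time to the power -5/16 beyond the usual -j/2 for [j] derivatives, and leaves
    n^(-1/8) for the tails beyond [n]. Solutions are Hoelder of exponent 3/8 in time with values in
    L2; 3/8 > 5/16 makes the flux summable, and a Lipschitz source, 1 > 1/2 + 5/16, makes the time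
    derivative summable.

    Functions are continuous on the whole line or plane, so that integrals exist without side
    conditions; data on a segment are extended by projecting the variable onto it. *)

Definition cont1 (f : R -> R) : Prop := forall x : R, continuous f x.
Definition cont2 (f : R -> R -> R) : Prop :=
  forall p : R * R, continuous (fun q : R * R => f (fst q) (snd q)) p.

Lemma c_plus {U : UniformSpace} (f g : U -> R) x :
  continuous f x -> continuous g x -> continuous (fun y => f y + g y) x.
Proof. intros; apply (continuous_plus f g); assumption. Qed.
Lemma c_opp {U : UniformSpace} (f : U -> R) x :
  continuous f x -> continuous (fun y => - f y) x.
Proof. intros; apply (continuous_opp f); assumption. Qed.
Lemma c_minus {U : UniformSpace} (f g : U -> R) x :
  continuous f x -> continuous g x -> continuous (fun y => f y - g y) x.
Proof. intros; apply (continuous_minus f g); assumption. Qed.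
Lemma c_mult {U : UniformSpace} (f g : U -> R) x :
  continuous f x -> continuous g x -> continuous (fun y => f y * g y) x.
Proof. intros; apply (continuous_mult f g); assumption. Qed.
Lemma c_comp {U : UniformSpace} (h : R -> R) (f : U -> R) x :
  continuous f x -> continuous h (f x) -> continuous (fun y => h (f y)) x.
Proof. intros; apply (continuous_comp f h); assumption. Qed.
Lemma c_const {U : UniformSpace} (c : R) (x : U) : continuous (fun _ : U => c) x.
Proof. apply continuous_const. Qed.
Lemma c_pow {U : UniformSpace} (f : U -> R) n x :
  continuous f x -> continuous (fun y => f y ^ n) x.
Proof.
  intros H; induction n; simpl; [apply c_const | apply c_mult; assumption].
Qed.
Lemma c_cont1 {U : UniformSpace} (h : R -> R) (f : U -> R) x :
  cont1 h -> continuous f x -> continuous (fun y => h (f y)) x.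
Proof. intros H1 H2; apply c_comp; auto. Qed.
Lemma c_cont2 {U : UniformSpace} (h : R -> R -> R) (f g : U -> R) x :
  cont2 h -> continuous f x -> continuous g x -> continuous (fun y => h (f y) (g y)) x.
Proof.
  intros H1 H2 H3; apply (continuous_comp_2 f g h); auto.
Qed.
Lemma cont1_exp : cont1 exp.
Proof. intros x; apply continuous_exp. Qed.
Lemma cont1_derive (f g : R -> R) : (forall x, is_derive f x (g x)) -> cont1 f.
Proof. intros H x. apply (ex_derive_continuous f). exists (g x); apply H. Qed.
Lemma cont1_sin : cont1 sin.
Proof. apply (cont1_derive _ cos). intros; auto_derive; [trivial | ring]. Qed.
Lemma cont1_cos : cont1 cos.
Proof. apply (cont1_derive _ (fun x => - sin x)). intros; auto_derive; [trivial | ring]. Qed.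
Lemma cont1_Rabs : cont1 Rabs.
Proof. intros x; apply continuous_Rabs. Qed.
Lemma Rmax_abs a b : Rmax a b = (a + b + Rabs (a - b)) / 2.
Proof. unfold Rmax, Rabs. destruct (Rle_dec a b); destruct (Rcase_abs (a - b)); lra. Qed.
Lemma Rmin_abs a b : Rmin a b = (a + b - Rabs (a - b)) / 2.
Proof. unfold Rmin, Rabs. destruct (Rle_dec a b); destruct (Rcase_abs (a - b)); lra. Qed.
Lemma c_abs {U : UniformSpace} (f : U -> R) x :
  continuous f x -> continuous (fun y => Rabs (f y)) x.
Proof. intros; apply (c_cont1 Rabs); auto using cont1_Rabs. Qed.
Lemma c_ext {U : UniformSpace} (f g : U -> R) x :
  (forall y, f y = g y) -> continuous f x -> continuous g x.
Proof. intros E H. apply (continuous_ext f); auto. Qed.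
Lemma c_max {U : UniformSpace} (f g : U -> R) x :
  continuous f x -> continuous g x -> continuous (fun y => Rmax (f y) (g y)) x.
Proof.
  intros. apply (c_ext (fun y => (f y + g y + Rabs (f y - g y)) * / 2)).
  - intros; rewrite Rmax_abs; reflexivity.
  - apply c_mult; [| apply c_const]. apply c_plus; [apply c_plus; auto |].
    apply c_abs, c_minus; auto.
Qed.
Lemma c_min {U : UniformSpace} (f g : U -> R) x :
  continuous f x -> continuous g x -> continuous (fun y => Rmin (f y) (g y)) x.
Proof.
  intros. apply (c_ext (fun y => (f y + g y - Rabs (f y - g y)) * / 2)).
  - intros; rewrite Rmin_abs; reflexivity.
  - apply c_mult; [| apply c_const]. apply c_minus; [apply c_plus; auto |].
    apply c_abs, c_minus; auto.
Qed.
Lemma c_div {U : UniformSpace} (f : U -> R) c x :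
  continuous f x -> continuous (fun y => f y / c) x.
Proof. intros; unfold Rdiv; apply c_mult; [auto | apply c_const]. Qed.
Lemma c_fst x : continuous (fun q : R * R => fst q) x.
Proof. apply continuous_fst. Qed.
Lemma c_snd x : continuous (fun q : R * R => snd q) x.
Proof. apply continuous_snd. Qed.

(** The cases with partial applications such as [Rplus ?c] catch functions whose binder was removed
    by eta-reduction; hypotheses [cont1 f] and [cont2 f] serve as leaves. *)
Ltac ctn1 :=
  match goal with
  | |- cont1 _ => intros ?
  | |- cont2 _ => intros ?
  | |- continuous (fun _ => ?c) _ => apply c_const
  | |- continuous (fun y => y) _ => apply continuous_id
  | |- continuous (fun q => fst q) _ => apply c_fst
  | |- continuous (fun q => snd q) _ => apply c_snd
  | H : cont1 ?f |- continuous ?f _ => apply H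
  | |- continuous (Rplus ?c) _ => apply (c_plus (fun _ => c) (fun y => y))
  | |- continuous (Rminus ?c) _ => apply (c_minus (fun _ => c) (fun y => y))
  | |- continuous (Rmult ?c) _ => apply (c_mult (fun _ => c) (fun y => y))
  | |- continuous Ropp _ => apply (c_opp (fun y => y))
  | |- continuous exp _ => apply cont1_exp
  | |- continuous fst _ => apply c_fst
  | |- continuous snd _ => apply c_snd
  | |- continuous (fun y => _ + _) _ => apply c_plus
  | |- continuous (fun y => _ - _) _ => apply c_minus
  | |- continuous (fun y => - _) _ => apply c_opp
  | |- continuous (fun y => _ * _) _ => apply c_mult
  | |- continuous (fun y => _ / ?c) _ => apply c_div
  | |- continuous (fun y => _ ^ _) _ => apply c_pow
  | |- continuous (fun y => Rabs _) _ => apply c_abs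
  | |- continuous (fun y => Rmax _ _) _ => apply c_max
  | |- continuous (fun y => Rmin _ _) _ => apply c_min
  | |- continuous (fun y => exp (@?g y)) _ => apply (c_cont1 exp g _ cont1_exp)
  | |- continuous (fun y => sin (@?g y)) _ => apply (c_cont1 sin g _ cont1_sin)
  | |- continuous (fun y => cos (@?g y)) _ => apply (c_cont1 cos g _ cont1_cos)
  | H : cont1 ?f |- continuous (fun y => ?f (@?a y)) _ => apply (c_cont1 f a _ H)
  | H : cont2 ?f |- continuous (?f ?t) _ =>
      apply (c_cont2 f (fun _ => t) (fun y => y) _ H)
  | H : cont2 ?f |- continuous (fun y => ?f (@?a y) (@?b y)) _ =>
      apply (c_cont2 f a b _ H)
  | H : context [cont1 ?f] |- continuous ?f _ => apply H
  | H : forall n, cont1 (?f n) |- continuous (fun y => ?f ?n (@?a y)) _ =>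
      apply (c_cont1 (f n) a _ (H n))
  | H : forall n, cont2 (?f n) |- continuous (fun y => ?f ?n (@?a y) (@?b y)) _ =>
      apply (c_cont2 (f n) a b _ (H n))
  end.
Ltac ctn := repeat ctn1; auto.

Lemma cont1_slice f t : cont2 f -> cont1 (f t).
Proof. intros H; ctn. Qed.
Lemma cont2_pt f : cont2 f -> forall x y, continuity_2d_pt f x y.
Proof. intros H x y. apply continuity_2d_pt_filterlim. exact (H (x, y)). Qed.
Lemma cont1_pt (f : R -> R) (x : R) : continuous f x <-> continuity_pt f x.
Proof. symmetry. apply continuity_pt_filterlim. Qed.
Lemma derive_cont (f : R -> R) (x l : R) : is_derive f x l -> continuous f x.
Proof. intros H. apply (ex_derive_continuous f). exists l; exact H. Qed.

Lemma exR (f : R -> R) (a b : R) : cont1 f -> ex_RInt f a b.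
Proof. intros H. apply (ex_RInt_continuous (V := R_CompleteNormedModule)). intros; apply H. Qed.
Lemma RI_plus (f g : R -> R) (a b : R) : cont1 f -> cont1 g ->
  RInt (fun x => f x + g x) a b = RInt f a b + RInt g a b.
Proof. intros. apply (RInt_plus f g); apply exR; auto. Qed.
Lemma RI_minus (f g : R -> R) (a b : R) : cont1 f -> cont1 g ->
  RInt (fun x => f x - g x) a b = RInt f a b - RInt g a b.
Proof. intros. apply (RInt_minus f g); apply exR; auto. Qed.
Lemma RI_scal (c : R) (f : R -> R) (a b : R) : cont1 f ->
  RInt (fun x => c * f x) a b = c * RInt f a b.
Proof. intros. apply (RInt_scal f); apply exR; auto. Qed.
Lemma RI_const (c a b : R) : RInt (fun _ => c) a b = c * (b - a).
Proof. rewrite RInt_const. unfold scal; simpl; unfold mult; simpl. ring. Qed.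
Lemma RI_ext (f g : R -> R) (a b : R) : a <= b -> (forall x, a <= x <= b -> f x = g x) ->
  RInt f a b = RInt g a b.
Proof.
  intros H E. apply RInt_ext. rewrite Rmin_left, Rmax_right by lra. intros; apply E; lra.
Qed.
Lemma RI_le (f g : R -> R) (a b : R) : cont1 f -> cont1 g -> a <= b ->
  (forall x, a <= x <= b -> f x <= g x) -> RInt f a b <= RInt g a b.
Proof.
  intros. apply RInt_le; auto; try (apply exR; auto). intros; apply H2; lra.
Qed.
Lemma RI_ge0 (f : R -> R) (a b : R) : cont1 f -> a <= b ->
  (forall x, a <= x <= b -> 0 <= f x) -> 0 <= RInt f a b.
Proof.
  intros. assert (E : RInt (fun _ : R => 0) a b = 0) by (rewrite RI_const; apply Rmult_0_l).
  rewrite <- E. apply RI_le; auto; ctn.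
Qed.
Lemma RI_ub (f : R -> R) (M a b : R) : cont1 f -> a <= b ->
  (forall x, a <= x <= b -> f x <= M) -> RInt f a b <= M * (b - a).
Proof.
  intros. rewrite <- RI_const. apply RI_le; auto; ctn.
Qed.
Lemma RI_abs (f : R -> R) (a b : R) : cont1 f -> a <= b -> Rabs (RInt f a b) <= RInt (fun x => Rabs (f x)) a b.
Proof.
  intros. apply abs_RInt_le; auto. apply exR; auto.
Qed.
Lemma RI_abs_ub (f : R -> R) (M a b : R) : cont1 f -> a <= b ->
  (forall x, a <= x <= b -> Rabs (f x) <= M) -> Rabs (RInt f a b) <= M * (b - a).
Proof.
  intros. eapply Rle_trans; [apply RI_abs; auto |]. apply RI_ub; auto. ctn.
Qed.
Lemma RI_chasles (f : R -> R) (a b c : R) : cont1 f -> RInt f a b + RInt f b c = RInt f a c.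
Proof. intros. apply (RInt_Chasles f); apply exR; auto. Qed.
Lemma RI_point (f : R -> R) (a : R) : RInt f a a = 0.
Proof. exact (RInt_point (V := R_CompleteNormedModule) a f). Qed.
Lemma RI_ftc (F f : R -> R) a b : (forall x, is_derive F x (f x)) -> cont1 f ->
  RInt f a b = F b - F a.
Proof.
  intros H1 H2. apply is_RInt_unique. apply (is_RInt_derive F f); auto.
Qed.
Lemma RI_ftc_seg (F f : R -> R) a b : a <= b -> (forall x, a <= x <= b -> is_derive F x (f x)) ->
  (forall x, a <= x <= b -> continuous f x) -> RInt f a b = F b - F a.
Proof.
  intros H0 H1 H2. apply is_RInt_unique.
  apply (is_RInt_derive F f); rewrite Rmin_left, Rmax_right by lra; auto.
Qed.
Lemma RI_derive (f : R -> R) a x : cont1 f -> is_derive (fun y => RInt f a y) x (f x).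
Proof.
  intros H. apply (is_derive_RInt f (fun y => RInt f a y) a x); auto.
  apply filter_forall. intros y. apply (RInt_correct (V := R_CompleteNormedModule) f), exR; auto.
Qed.
Lemma RI_cont (f : R -> R) (a : R) : cont1 f -> cont1 (fun x => RInt f a x).
Proof. intros H. apply (cont1_derive _ f). intros; apply RI_derive; auto. Qed.
Lemma RI_ibp (F f G g : R -> R) a b : (forall x, is_derive F x (f x)) -> cont1 f ->
  (forall x, is_derive G x (g x)) -> cont1 g ->
  RInt (fun x => F x * g x) a b = F b * G b - F a * G a - RInt (fun x => f x * G x) a b.
Proof.
  intros HF cf HG cg.
  assert (cF : cont1 F) by (apply (cont1_derive _ f); auto).
  assert (cG : cont1 G) by (apply (cont1_derive _ g); auto).
  assert (E : RInt (fun x => f x * G x + F x * g x) a b = F b * G b - F a * G a).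
  { rewrite (RI_ftc (fun x => F x * G x)); auto.
    - intros x. apply (is_derive_mult F G); auto. intros; apply Rmult_comm.
    - ctn. }
  rewrite RI_plus in E by ctn. lra.
Qed.

(** Uniform continuity with tolerance 1: the segment from the corner (a,c) to (t,x) is cut into [N]
    steps shorter than the modulus, each changes [f] by less than 1, so [f] differs from [f a c] by
    at most [N]. *)
Lemma cont2_bound f a b c d : cont2 f -> exists M, 0 < M /\
  forall t x, a <= t <= b -> c <= x <= d -> Rabs (f t x) <= M.
Proof.
  intros H.
  destruct (Rle_dec a b) as [Hab|]; [| exists 1; split; [lra | intros; lra]].
  destruct (Rle_dec c d) as [Hcd|]; [| exists 1; split; [lra | intros; lra]].
  assert (U := uniform_continuity_2d f a b c d
    (fun x y _ _ => cont2_pt f H x y) (mkposreal 1 Rlt_0_1)).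
  destruct U as [[de Hde] U]; simpl in U.
  destruct (archimed_cor1 (de / (Rabs (b - a) + Rabs (d - c) + 1))) as [N [HN HN0]].
  { apply Rdiv_lt_0_compat; auto. assert (h1 := Rabs_pos (b-a)); assert (h2 := Rabs_pos (d-c)); lra. }
  set (D := Rabs (b - a) + Rabs (d - c) + 1) in *.
  assert (HD : 0 < D) by (unfold D; assert (h1 := Rabs_pos (b-a)); assert (h2 := Rabs_pos (d-c)); lra).
  assert (HNp : 0 < INR N) by (apply lt_0_INR; lia).
  assert (Hst : forall k : nat, (k <= N)%nat -> forall t x, a <= t <= b -> c <= x <= d ->
     Rabs (f (a + INR k / INR N * (t - a)) (c + INR k / INR N * (x - c)) - f a c) <= INR k).
  { induction k; intros Hk t x Ht Hx.
    - simpl INR. replace (a + 0 / INR N * (t - a)) with a by (field; lra).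
      replace (c + 0 / INR N * (x - c)) with c by (field; lra).
      rewrite Rminus_diag_eq, Rabs_R0; auto; lra.
    - specialize (IHk ltac:(lia) t x Ht Hx).
      assert (Hk1 : INR (S k) <= INR N) by (apply le_INR; lia).
      rewrite S_INR in *.
      assert (Hk0 := pos_INR k).
      assert (B1 : 0 <= INR k / INR N <= 1).
      { split; [apply Rdiv_le_0_compat; lra |]. apply Rle_div_l; lra. }
      assert (B2 : 0 <= (INR k + 1) / INR N <= 1).
      { split; [apply Rdiv_le_0_compat; lra |]. apply Rle_div_l; lra. }
      assert (B3 : (INR k + 1) / INR N - INR k / INR N = / INR N) by (field; lra).
      assert (B4 : / INR N * D < de).
      { apply Rmult_lt_compat_r with (r := D) in HN; auto.
        replace (de / D * D) with de in HN by (field; lra). lra. }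
      assert (Bi : 0 < / INR N) by (apply Rinv_0_lt_compat; auto).
      assert (Q : Rabs (f (a + (INR k + 1) / INR N * (t - a)) (c + (INR k + 1) / INR N * (x - c))
                 - f (a + INR k / INR N * (t - a)) (c + INR k / INR N * (x - c))) < 1).
      { apply U; try nra.
        - replace (a + (INR k + 1) / INR N * (t - a) - (a + INR k / INR N * (t - a)))
            with (/ INR N * (t - a)) by (rewrite <- B3; ring).
          rewrite Rabs_right by nra.
          assert (t - a <= D). { unfold D. rewrite (Rabs_right (b-a)) by lra. assert (h := Rabs_pos (d-c)); lra. }
          nra.
        - replace (c + (INR k + 1) / INR N * (x - c) - (c + INR k / INR N * (x - c)))
            with (/ INR N * (x - c)) by (rewrite <- B3; ring).
          rewrite Rabs_right by nra.
          assert (x - c <= D). { unfold D. rewrite (Rabs_right (d-c)) by lra. assert (h := Rabs_pos (b-a)); lra. }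
          nra. }
      set (A := f (a + (INR k + 1) / INR N * (t - a)) (c + (INR k + 1) / INR N * (x - c))) in *.
      set (B := f (a + INR k / INR N * (t - a)) (c + INR k / INR N * (x - c))) in *.
      replace (A - f a c) with ((A - B) + (B - f a c)) by ring.
      eapply Rle_trans; [apply Rabs_triang |]. lra. }
  exists (Rabs (f a c) + INR N). split.
  { assert (h := Rabs_pos (f a c)); lra. }
  intros t x Ht Hx. specialize (Hst N (le_n _) t x Ht Hx).
  replace (a + INR N / INR N * (t - a)) with t in Hst by (field; lra).
  replace (c + INR N / INR N * (x - c)) with x in Hst by (field; lra).
  replace (f t x) with ((f t x - f a c) + f a c) by ring.
  eapply Rle_trans; [apply Rabs_triang |]. lra.
Qed.
Lemma cont1_bound f a b : cont1 f -> exists M, 0 < M /\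
  forall x, a <= x <= b -> Rabs (f x) <= M.
Proof.
  intros H. destruct (cont2_bound (fun t x => f t) a b 0 0) as [M [HM HB]].
  { ctn. }
  exists M; split; auto. intros; apply (HB x 0); lra.
Qed.

(** * Epsilon-delta continuity and integrals depending on a parameter *)

Lemma cont1_eps f : (forall x e, 0 < e -> exists d, 0 < d /\
    forall y, Rabs (y - x) < d -> Rabs (f y - f x) <= e) -> cont1 f.
Proof.
  intros H x. apply filterlim_locally. intros [e He].
  destruct (H x (e / 2)) as [d [Hd HH]]; [lra |].
  exists (mkposreal d Hd). intros y Hy.
  unfold ball in *; simpl in *; unfold AbsRing_ball in *; simpl in *.
  unfold abs, minus, plus, opp in *; simpl in *.
  assert (K := HH y Hy). unfold Rminus in K. lra.
Qed.
Lemma cont1_eps_inv f : cont1 f -> forall x e, 0 < e -> exists d, 0 < d /\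
    forall y, Rabs (y - x) < d -> Rabs (f y - f x) < e.
Proof.
  intros H x e He. specialize (H x).
  apply (proj1 (filterlim_locally f (f x))) with (eps := mkposreal e He) in H.
  destruct H as [[d Hd] H]. exists d; split; [exact Hd | intros y Hy; apply (H y Hy)].
Qed.
Lemma cont2_eps f : (forall t x e, 0 < e -> exists d, 0 < d /\
    forall s y, Rabs (s - t) < d -> Rabs (y - x) < d -> Rabs (f s y - f t x) <= e) -> cont2 f.
Proof.
  intros H [t x]. apply filterlim_locally. intros [e He].
  destruct (H t x (e / 2)) as [d [Hd HH]]; [lra |].
  exists (mkposreal d Hd). intros [s y] [Hs Hy]. simpl in *.
  unfold ball in *; simpl in *; unfold AbsRing_ball in *; simpl in *.
  unfold abs, minus, plus, opp in *; simpl in *.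
  assert (K := HH s y Hs Hy). unfold Rminus in K. lra.
Qed.
Lemma cont2_eps_inv f : cont2 f -> forall t x e, 0 < e -> exists d, 0 < d /\
    forall s y, Rabs (s - t) < d -> Rabs (y - x) < d -> Rabs (f s y - f t x) < e.
Proof.
  intros H t x e He. destruct (cont2_pt f H t x (mkposreal e He)) as [[d Hd] HH].
  exists d; split; auto.
Qed.
Lemma cont2_unif f : (forall e, 0 < e -> exists g, cont2 g /\ forall t x, Rabs (f t x - g t x) <= e) ->
  cont2 f.
Proof.
  intros H. apply cont2_eps. intros t x e He.
  destruct (H (e / 3)) as [g [Hg HB]]; [lra |].
  destruct (cont2_eps_inv g Hg t x (e / 3)) as [d [Hd HH]]; [lra |].
  exists d; split; auto. intros s y Hs Hy. specialize (HH s y Hs Hy).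
  assert (B1 := HB s y). assert (B2 := HB t x).
  replace (f s y - f t x) with ((f s y - g s y) + (g s y - g t x) - (f t x - g t x)) by ring.
  eapply Rle_trans; [apply Rabs_triang |]. rewrite Rabs_Ropp.
  assert (h := Rabs_triang (f s y - g s y) (g s y - g t x)). lra.
Qed.
Lemma cont2_unif_mod f a b c d e : cont2 f -> 0 < e -> exists de, 0 < de /\
  forall t x s y, a <= t <= b -> c <= x <= d -> a <= s <= b -> c <= y <= d ->
   Rabs (s - t) < de -> Rabs (y - x) < de -> Rabs (f s y - f t x) < e.
Proof.
  intros H He.
  destruct (uniform_continuity_2d f a b c d (fun x y _ _ => cont2_pt f H x y) (mkposreal e He))
    as [[de Hde] U].
  exists de; split; auto.
Qed.

Lemma RI_param_cont (f : R -> R -> R) (a b : R) : cont2 f -> cont1 (fun t => RInt (fun x => f t x) a b).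
Proof.
  intros H.
  assert (W : forall a b, a <= b -> cont1 (fun t => RInt (fun x => f t x) a b)).
  { clear a b. intros a b Hab. apply cont1_eps. intros t e He.
    destruct (cont2_unif_mod f (t - 1) (t + 1) a b (e / (b - a + 1)) H) as [d [Hd HH]].
    { apply Rdiv_lt_0_compat; lra. }
    exists (Rmin d 1). split; [apply Rmin_pos; lra |]. intros s Hs.
    assert (Hs1 := Rmin_l d 1). assert (Hs2 := Rmin_r d 1).
    assert (Hs3 : Rabs (s - t) < 1) by lra. apply Rabs_def2 in Hs3.
    rewrite <- RI_minus by ctn.
    eapply Rle_trans; [apply (RI_abs_ub _ (e / (b - a + 1))) |]; [ctn | lra | | ].
    - intros x Hx. left. apply HH; try lra. rewrite Rminus_diag_eq, Rabs_R0; auto.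
    - apply (Rmult_le_reg_r (b - a + 1)); [lra |].
      replace (e / (b - a + 1) * (b - a) * (b - a + 1)) with (e * (b - a)) by (field; lra). nra. }
  destruct (Rle_dec a b) as [Hab|Hab]; [apply W; auto |].
  intros t. apply (c_ext (fun t => - RInt (fun x => f t x) b a)).
  - intros y. rewrite <- (opp_RInt_swap (fun x => f y x)); [unfold opp; simpl; ring | apply exR; ctn].
  - apply c_opp. apply (W b a). lra.
Qed.
(** Moving [t] with the endpoint fixed is the one-variable case; the remaining piece between [x] and
    [y] is at most a local bound of [f] times |y - x|. *)
Lemma RI_param_cont2 (f : R -> R -> R) (a : R) : cont2 f -> cont2 (fun t x => RInt (fun y => f t y) a x).
Proof.
  intros H. apply cont2_eps. intros t x e He.
  assert (H1 := RI_param_cont f a x H).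
  destruct (cont1_eps_inv _ H1 t (e / 2)) as [d1 [Hd1 K1]]; [lra |].
  destruct (cont2_bound f (t - 1) (t + 1) (x - 1) (x + 1) H) as [M [HM HB]].
  exists (Rmin d1 (Rmin 1 (e / (2 * M)))). split.
  { repeat apply Rmin_pos; try lra. apply Rdiv_lt_0_compat; lra. }
  intros s y Hs Hy.
  assert (q1 := Rmin_l d1 (Rmin 1 (e / (2 * M)))). assert (q2 := Rmin_r d1 (Rmin 1 (e / (2 * M)))).
  assert (q3 := Rmin_l 1 (e / (2 * M))). assert (q4 := Rmin_r 1 (e / (2 * M))).
  assert (Hs' : Rabs (s - t) < 1) by lra. assert (Hy' : Rabs (y - x) < 1) by lra.
  apply Rabs_def2 in Hs'. apply Rabs_def2 in Hy'.
  assert (ck : cont1 (fun y => f s y)) by ctn.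
  rewrite <- (RI_chasles (fun y => f s y) a x y) by auto.
  replace (RInt (fun y0 => f s y0) a x + RInt (fun y0 => f s y0) x y - RInt (fun y0 => f t y0) a x)
    with ((RInt (fun y0 => f s y0) a x - RInt (fun y0 => f t y0) a x) + RInt (fun y0 => f s y0) x y) by ring.
  eapply Rle_trans; [apply Rabs_triang |].
  assert (K2 : Rabs (RInt (fun y0 => f s y0) a x - RInt (fun y0 => f t y0) a x) < e / 2) by (apply K1; lra).
  assert (K3 : Rabs (RInt (fun y0 => f s y0) x y) <= M * Rabs (y - x)).
  { destruct (Rle_dec x y).
    - rewrite (Rabs_right (y - x)) by lra. apply RI_abs_ub; auto. intros; apply HB; lra.
    - rewrite <- (opp_RInt_swap (fun x => f s x)) by (apply exR; auto).
      unfold opp; simpl. rewrite Rabs_Ropp. rewrite (Rabs_left (y - x)) by lra.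
      replace (- (y - x)) with (x - y) by ring.
      apply RI_abs_ub; auto; try lra. intros; apply HB; lra. }
  assert (M * Rabs (y - x) <= e / 2).
  { apply Rle_trans with (M * (e / (2 * M))); [apply Rmult_le_compat_l; lra |].
    right; field; lra. }
  lra.
Qed.
Lemma RI_param_derive (f ft : R -> R -> R) a b t : cont2 f -> cont2 ft ->
  (forall t x, is_derive (fun s => f s x) t (ft t x)) ->
  is_derive (fun t => RInt (fun x => f t x) a b) t (RInt (fun x => ft t x) a b).
Proof.
  intros Hf Hft D.
  replace (RInt (fun x => ft t x) a b) with (RInt (fun x => Derive (fun u => f u x) t) a b).
  - apply (is_derive_RInt_param f).
    + apply filter_forall. intros s x _. exists (ft s x); apply D.
    + intros x _. apply continuity_2d_pt_ext with ft.
      * intros u v. symmetry. apply is_derive_unique, D.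
      * apply cont2_pt; auto.
    + apply filter_forall. intros s. apply exR; ctn.
  - apply RInt_ext. intros x _. apply is_derive_unique, D.
Qed.
(** The integral over [x] of the partial primitive in [t] is an antiderivative of the inner integral
    on the left, so the fundamental theorem evaluates the left side. *)
Lemma RI_fubini (f : R -> R -> R) (a b c d : R) : cont2 f ->
  RInt (fun t => RInt (fun x => f t x) c d) a b = RInt (fun x => RInt (fun t => f t x) a b) c d.
Proof.
  intros H.
  assert (Hs : cont2 (fun x t => f t x)) by (intros p; apply (c_cont2 f snd fst); ctn).
  assert (H2 : cont2 (fun t x => RInt (fun s => f s x) a t)).
  { assert (K := RI_param_cont2 (fun x t => f t x) a Hs).
    intros p. apply (c_cont2 (fun x t => RInt (fun y => f y x) a t) snd fst); auto using c_snd, c_fst. }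
  rewrite (RI_ftc (fun t => RInt (fun x => RInt (fun s => f s x) a t) c d)).
  - rewrite (RInt_ext (fun x => RInt (fun s : R => f s x) a a) (fun _ => 0)) by
      (intros; apply RI_point).
    rewrite RI_const, Rmult_0_l. apply Rminus_0_r.
  - intros t. apply (RI_param_derive (fun t x => RInt (fun s => f s x) a t)); auto.
    intros s x. apply (RI_derive (fun s => f s x)). ctn.
  - apply RI_param_cont; auto.
Qed.

(** * Finite sums, Gronwall lemmas and singular integrals *)

(** Equations between integrals come typed in a carrier that is merely convertible to [R]; retyping
    them lets [ring] and [field] recognise the structure. *)
Ltac req := match goal with |- @eq _ ?a ?b => change (@eq R a b) end.
Ltac rg := first [ring | req; ring].
Ltac fd := first [field | req; field].

Fixpoint sm (a : nat -> R) (n : nat) : R :=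
  match n with O => 0 | S n => sm a n + a n end.

Lemma sm_ext a b n : (forall k, (k < n)%nat -> a k = b k) -> sm a n = sm b n.
Proof.
  induction n; intros H; simpl; auto. rewrite IHn, H by (intros; auto; apply H; lia); auto.
Qed.
Lemma sm_plus a b n : sm (fun k => a k + b k) n = sm a n + sm b n.
Proof. induction n; simpl; [ring | rewrite IHn; ring]. Qed.
Lemma sm_minus a b n : sm (fun k => a k - b k) n = sm a n - sm b n.
Proof. induction n; simpl; [ring | rewrite IHn; ring]. Qed.
Lemma sm_scal c a n : sm (fun k => c * a k) n = c * sm a n.
Proof. induction n; simpl; [ring | rewrite IHn; ring]. Qed.
Lemma sm_le a b n : (forall k, (k < n)%nat -> a k <= b k) -> sm a n <= sm b n.
Proof.
  induction n; intros H; simpl; [lra |].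
  apply Rplus_le_compat; [apply IHn; intros; apply H; lia | apply H; lia].
Qed.
Lemma sm_zero n : sm (fun _ => 0) n = 0.
Proof. induction n; simpl; lra. Qed.
Lemma sm_ge0 a n : (forall k, (k < n)%nat -> 0 <= a k) -> 0 <= sm a n.
Proof. intros. rewrite <- (sm_zero n). apply sm_le; auto. Qed.
Lemma sm_abs a n : Rabs (sm a n) <= sm (fun k => Rabs (a k)) n.
Proof.
  induction n; simpl; [rewrite Rabs_R0; lra |].
  eapply Rle_trans; [apply Rabs_triang | lra].
Qed.
Lemma sm_split a n m : sm a (n + m) = sm a n + sm (fun i => a (n + i)%nat) m.
Proof.
  induction m; simpl; [rewrite Nat.add_0_r; ring |].
  rewrite Nat.add_succ_r; simpl. rewrite IHm; ring.
Qed.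
Lemma sm_mono a n m : (forall k, 0 <= a k) -> (n <= m)%nat -> sm a n <= sm a m.
Proof.
  intros H Hn. replace m with (n + (m - n))%nat by lia. rewrite sm_split.
  assert (0 <= sm (fun i => a (n + i)%nat) (m - n)) by (apply sm_ge0; auto). lra.
Qed.
Lemma sm_single a n k : (k < n)%nat -> (forall j, j <> k -> a j = 0) -> sm a n = a k.
Proof.
  intros Hk H. induction n; [lia |]. simpl.
  destruct (Nat.eq_dec k n) as [-> | Hn].
  - rewrite (sm_ext _ (fun _ => 0)), sm_zero by (intros; apply H; lia). ring.
  - rewrite IHn by lia. rewrite (H n) by lia. ring.
Qed.
Lemma sm_head a n : sm a (S n) = a O + sm (fun k => a (S k)) n.
Proof. induction n; simpl in *; [ring | rewrite IHn; simpl; ring]. Qed.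
Lemma c_sm {U : UniformSpace} (f : nat -> U -> R) n (x : U) :
  (forall k, (k < n)%nat -> continuous (f k) x) -> continuous (fun y => sm (fun k => f k y) n) x.
Proof.
  induction n; intros H; simpl; [apply c_const |].
  apply c_plus; [apply IHn; intros; apply H; lia | apply H; lia].
Qed.
Lemma sm_derive (f f' : nat -> R -> R) n (x : R) :
  (forall k, (k < n)%nat -> is_derive (f k) x (f' k x)) ->
  is_derive (fun y => sm (fun k => f k y) n) x (sm (fun k => f' k x) n).
Proof.
  induction n; intros H; simpl.
  - apply (is_derive_const (K := R_AbsRing) (V := R_NormedModule)).
  - apply (is_derive_plus (fun y => sm (fun k => f k y) n) (f n));
      [apply IHn; intros; apply H; lia | apply H; lia].
Qed.
Lemma RI_sm (f : nat -> R -> R) n (a b : R) : (forall k, cont1 (f k)) ->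
  RInt (fun x => sm (fun k => f k x) n) a b = sm (fun k => RInt (f k) a b) n.
Proof.
  intros H. induction n; simpl; [rewrite RI_const; apply Rmult_0_l |].
  rewrite (RI_plus (fun x => sm (fun k => f k x) n) (f n)); auto.
  - rewrite IHn; auto.
  - intros x. apply c_sm; intros; apply H.
Qed.
Lemma sm_cs a b n : (sm (fun k => a k * b k) n) ^ 2 <= sm (fun k => a k ^ 2) n * sm (fun k => b k ^ 2) n.
Proof.
  induction n; cbn [sm]; [lra |].
  set (X := sm (fun k => a k * b k) n) in *.
  assert (HA : 0 <= sm (fun k => a k ^ 2) n) by (apply sm_ge0; intros; apply pow2_ge_0).
  assert (HB : 0 <= sm (fun k => b k ^ 2) n) by (apply sm_ge0; intros; apply pow2_ge_0).
  set (A := sm (fun k => a k ^ 2) n) in *. set (B := sm (fun k => b k ^ 2) n) in *.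
  (* The cross term of the induction step: |X| <= sqrt A sqrt B by induction, then the square of
     sqrt A |b n| - sqrt B |a n| is nonnegative. *)
  assert (K : 2 * X * (a n * b n) <= A * (b n) ^ 2 + B * (a n) ^ 2).
  { assert (HX : Rabs X <= sqrt A * sqrt B).
    { rewrite <- sqrt_mult by auto. apply sqrt_le_1_alt in IHn. rewrite <- Rsqr_pow2, sqrt_Rsqr_abs in IHn. auto. }
    assert (SA := sqrt_sqrt A HA). assert (SB := sqrt_sqrt B HB).
    assert (S1 := sqrt_pos A). assert (S2 := sqrt_pos B).
    assert (K1 : X * (a n * b n) <= sqrt A * sqrt B * (Rabs (a n) * Rabs (b n))).
    { rewrite <- Rabs_mult. eapply Rle_trans; [apply Rle_abs |]. rewrite Rabs_mult.
      apply Rmult_le_compat_r; [apply Rabs_pos | auto]. }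
    assert (K2 := pow2_ge_0 (sqrt A * Rabs (b n) - sqrt B * Rabs (a n))).
    assert (R1 : Rabs (a n) ^ 2 = a n ^ 2) by (rewrite <- !Rsqr_pow2; symmetry; apply Rsqr_abs).
    assert (R2 : Rabs (b n) ^ 2 = b n ^ 2) by (rewrite <- !Rsqr_pow2; symmetry; apply Rsqr_abs).
    nra. }
  nra.
Qed.
Lemma sm_cs_sqrt a b n : sm (fun k => Rabs (a k * b k)) n
  <= sqrt (sm (fun k => a k ^ 2) n) * sqrt (sm (fun k => b k ^ 2) n).
Proof.
  rewrite <- sqrt_mult; try (apply sm_ge0; intros; apply pow2_ge_0).
  assert (H := sm_cs (fun k => Rabs (a k)) (fun k => Rabs (b k)) n).
  rewrite (sm_ext (fun k => Rabs (a k * b k)) (fun k => Rabs (a k) * Rabs (b k))) by (intros; apply Rabs_mult).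
  rewrite (sm_ext (fun k => a k ^ 2) (fun k => Rabs (a k) ^ 2)) by
    (intros; rewrite <- !Rsqr_pow2; apply Rsqr_abs).
  rewrite (sm_ext (fun k => b k ^ 2) (fun k => Rabs (b k) ^ 2)) by
    (intros; rewrite <- !Rsqr_pow2; apply Rsqr_abs).
  apply sqrt_le_1_alt in H. rewrite <- Rsqr_pow2, sqrt_Rsqr in H; auto.
  apply sm_ge0; intros; apply Rmult_le_pos; apply Rabs_pos.
Qed.

(** Discriminant argument: the integral of (f - s g)^2 is a nonnegative quadratic in [s], tested at
    s = X/B. The degenerate case B = 0 needs its own test value. *)
Lemma RI_cs (f g : R -> R) (a b : R) : cont1 f -> cont1 g -> a <= b ->
  (RInt (fun x => f x * g x) a b) ^ 2 <= RInt (fun x => f x ^ 2) a b * RInt (fun x => g x ^ 2) a b.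
Proof.
  intros cf cg Hab.
  set (X := RInt (fun x => f x * g x) a b). set (A := RInt (fun x => f x ^ 2) a b).
  set (B := RInt (fun x => g x ^ 2) a b).
  assert (K : forall s, 0 <= A - 2 * s * X + s ^ 2 * B).
  { intros s.
    assert (H : 0 <= RInt (fun x => (f x - s * g x) ^ 2) a b).
    { apply RI_ge0; auto; [ctn | intros; apply pow2_ge_0]. }
    rewrite (RInt_ext _ (fun x => f x ^ 2 + ((- 2 * s) * (f x * g x) + s ^ 2 * g x ^ 2))) in H
      by (intros; req; ring).
    rewrite RI_plus in H by ctn. rewrite RI_plus in H by ctn.
    rewrite RI_scal in H by ctn. rewrite (RI_scal (s ^ 2)) in H by ctn.
    fold X A B in H. lra. }
  assert (HB : 0 <= B) by (apply RI_ge0; auto; [ctn | intros; apply pow2_ge_0]).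
  assert (HA : 0 <= A) by (apply RI_ge0; auto; [ctn | intros; apply pow2_ge_0]).
  destruct (Req_dec B 0) as [E | E].
  - assert (X = 0).
    { destruct (Req_dec X 0) as [|N]; auto. exfalso.
      (* With B = 0 the quadratic is affine in [s]; this [s] gives it the value -1. *)
      assert (H := K ((A + 1) / (2 * X))). rewrite E in H.
      replace (A - 2 * ((A + 1) / (2 * X)) * X + ((A + 1) / (2 * X)) ^ 2 * 0) with (- 1) in H by (field; auto). lra. }
    rewrite H; nra.
  - assert (H := K (X / B)).
    replace (A - 2 * (X / B) * X + (X / B) ^ 2 * B) with ((A * B - X ^ 2) / B) in H by (field; auto).
    assert (0 <= (A * B - X ^ 2) / B * B) by (apply Rmult_le_pos; auto).
    replace ((A * B - X ^ 2) / B * B) with (A * B - X ^ 2) in H0 by (field; auto). lra.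
Qed.

(** * Monotonicity from derivatives and Gronwall inequalities *)

Lemma decr_of_derive (f f' : R -> R) a b : a <= b ->
  (forall x, a <= x <= b -> is_derive f x (f' x)) ->
  (forall x, a <= x <= b -> f' x <= 0) -> f b <= f a.
Proof.
  intros Hab D N.
  destruct (MVT_gen f a b f') as [c [Hc E]]; rewrite ?Rmin_left, ?Rmax_right in * by lra.
  - intros; apply D; lra.
  - intros; apply cont1_pt. apply (derive_cont _ _ (f' x)), D; lra.
  - assert (f' c <= 0) by (apply N; lra). nra.
Qed.
Lemma const_of_derive (f : R -> R) a b : a <= b ->
  (forall x, a <= x <= b -> is_derive f x 0) -> f b = f a.
Proof.
  intros Hab D.
  destruct (MVT_gen f a b (fun _ => 0)) as [c [Hc E]]; rewrite ?Rmin_left, ?Rmax_right in * by lra.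
  - intros; apply D; lra.
  - intros; apply cont1_pt. apply (derive_cont _ _ 0), D; lra.
  - lra.
Qed.

Lemma exp_weight_derive (Z : R -> R) A C (x d : R) : is_derive Z x d ->
  is_derive (fun t => exp (- C * t) * (A + C * Z t)) x (C * exp (- C * x) * (d - (A + C * Z x))).
Proof.
  intros D. auto_derive; [exists d; exact D |].
  replace (Derive (fun x0 => Z x0) x) with d by (symmetry; apply is_derive_unique, D). ring.
Qed.
(** exp(-C t) (A + C int_0^t y) is nonincreasing: its derivative carries the factor y(t) - (A + C
    int y) <= 0. *)
Lemma gronwall (y : R -> R) A C T : cont1 y -> 0 <= C ->
  (forall t, 0 <= t <= T -> y t <= A + C * RInt y 0 t) ->
  forall t, 0 <= t <= T -> y t <= A * exp (C * t).
Proof.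
  intros cy HC H t Ht.
  assert (K : exp (- C * t) * (A + C * RInt y 0 t) <= exp (- C * 0) * (A + C * RInt y 0 0)).
  { apply (decr_of_derive (fun t => exp (- C * t) * (A + C * RInt y 0 t))
      (fun t => C * exp (- C * t) * (y t - (A + C * RInt y 0 t)))); [lra | |].
    - intros x Hx. apply (exp_weight_derive (fun t => RInt y 0 t)), RI_derive; auto.
    - intros x Hx. assert (h := H x ltac:(lra)). assert (e := exp_pos (- C * x)).
      assert (0 <= C * exp (- C * x)) by (apply Rmult_le_pos; lra). nra. }
  rewrite RI_point, Rmult_0_r, exp_0, Rmult_0_r in K.
  assert (h := H t Ht). assert (e := exp_pos (C * t)).
  assert (E : exp (C * t) * exp (- C * t) = 1) by (rewrite <- exp_plus; replace (C * t + - C * t) with 0 by ring; apply exp_0).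
  assert (exp (C * t) * (exp (- C * t) * (A + C * RInt y 0 t)) <= exp (C * t) * (1 * (A + 0))) by (apply Rmult_le_compat_l; lra).
  replace (exp (C * t) * (exp (- C * t) * (A + C * RInt y 0 t))) with
    ((exp (C * t) * exp (- C * t)) * (A + C * RInt y 0 t)) in H0 by ring.
  rewrite E in H0. lra.
Qed.
(** Up to time [t] the source contributes at most C int_0^t z, since [z >= 0]; this constant plays
    the role of [A] in [gronwall] on [0,t]. *)
Lemma gronwall_src (y z : R -> R) C T : cont1 y -> cont1 z -> 0 <= C ->
  (forall t, 0 <= t <= T -> 0 <= z t) ->
  (forall t, 0 <= t <= T -> y t <= C * RInt (fun s => y s + z s) 0 t) ->
  forall t, 0 <= t <= T -> y t <= C * exp (C * T) * RInt z 0 t.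
Proof.
  intros cy cz HC Hz H t Ht.
  assert (Zt : 0 <= RInt z 0 t) by (apply RI_ge0; auto; [lra | intros; apply Hz; lra]).
  apply Rle_trans with (C * RInt z 0 t * exp (C * t)).
  - apply (gronwall y (C * RInt z 0 t) C t); auto; [| lra].
    intros s Hs. eapply Rle_trans; [apply H; lra |]. rewrite RI_plus by auto.
    assert (RInt z 0 s <= RInt z 0 t).
    { rewrite <- (RI_chasles z 0 s t) by auto.
      assert (0 <= RInt z s t) by (apply RI_ge0; auto; [lra | intros; apply Hz; lra]). lra. }
    nra.
  - assert (exp (C * t) <= exp (C * T)).
    { destruct (Req_dec (C * t) (C * T)) as [-> |]; [lra |]. left; apply exp_increasing. nra. }
    assert (0 <= C * RInt z 0 t) by nra. nra.
Qed.

(** * Geometric limits and the contraction principle *)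

Lemma limit_geom {X : Type} (u : nat -> X -> R) D th : 0 <= th < 1 -> 0 <= D ->
  (forall n x, Rabs (u (S n) x - u n x) <= D * th ^ n) ->
  exists f : X -> R, forall n x, Rabs (u n x - f x) <= D / (1 - th) * th ^ n.
Proof.
  intros Hth HD H.
  assert (P0 : forall n, 0 <= th ^ n) by (intros; apply pow_le; lra).
  assert (K : forall n m x, Rabs (u (n + m)%nat x - u n x) <= D / (1 - th) * (th ^ n - th ^ (n + m))).
  { intros n m x. induction m.
    - rewrite Nat.add_0_r, !Rminus_diag_eq, Rabs_R0 by auto. lra.
    - rewrite Nat.add_succ_r.
      replace (u (S (n + m)) x - u n x) with ((u (S (n + m)) x - u (n + m)%nat x) + (u (n + m)%nat x - u n x)) by ring.
      eapply Rle_trans; [apply Rabs_triang |].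
      assert (h := H (n + m)%nat x).
      replace (D / (1 - th) * (th ^ n - th ^ S (n + m))) with
        (D / (1 - th) * (th ^ n - th ^ (n + m)) + D * th ^ (n + m)) by (simpl; field; lra). lra. }
  assert (K' : forall n m x, Rabs (u (n + m)%nat x - u n x) <= D / (1 - th) * th ^ n).
  { intros n m x. eapply Rle_trans; [apply K |].
    assert (0 <= D / (1 - th)) by (apply Rdiv_le_0_compat; lra).
    apply Rmult_le_compat_l; auto. assert (h := P0 (n + m)%nat); lra. }
  assert (EL : forall x, ex_finite_lim_seq (fun n => u n x)).
  { intros x. apply ex_lim_seq_cauchy_corr. intros [e He]. simpl.
    destruct (pow_lt_1_zero th ltac:(rewrite Rabs_right; lra) (e / (2 * (D / (1 - th) + 1)))) as [N HN].
    { assert (0 <= D / (1 - th)) by (apply Rdiv_le_0_compat; lra). apply Rdiv_lt_0_compat; lra. }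
    assert (Q : forall n, (N <= n)%nat -> Rabs (u n x - u N x) < e / 2).
    { intros n Hn. replace n with (N + (n - N))%nat by lia.
      eapply Rle_lt_trans; [apply K' |].
      specialize (HN N (le_n _)). rewrite Rabs_right in HN by (apply Rle_ge; auto).
      assert (D0 : 0 <= D / (1 - th)) by (apply Rdiv_le_0_compat; lra).
      apply Rle_lt_trans with ((D / (1 - th)) * (e / (2 * (D / (1 - th) + 1)))); [apply Rmult_le_compat_l; lra |].
      apply (Rmult_lt_reg_r (2 * (D / (1 - th) + 1))); [lra |].
      replace (D / (1 - th) * (e / (2 * (D / (1 - th) + 1))) * (2 * (D / (1 - th) + 1))) with
        (D / (1 - th) * e) by (set (q := D / (1 - th)) in *; field; lra). nra. }
    exists N. intros n m Hn Hm.
    replace (u n x - u m x) with ((u n x - u N x) - (u m x - u N x)) by ring.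
    eapply Rle_lt_trans; [apply Rabs_triang |]. rewrite Rabs_Ropp.
    assert (h1 := Q n Hn). assert (h2 := Q m Hm). lra. }
  exists (fun x => real (Lim_seq (fun n => u n x))). intros n x.
  assert (LS := Lim_seq_correct' _ (EL x)).
  apply (is_lim_seq_incr_n _ n) in LS.
  assert (L2 : is_lim_seq (fun m => Rabs (u n x - u (m + n)%nat x)) (Rabs (u n x - real (Lim_seq (fun n => u n x))))).
  { apply (is_lim_seq_abs (fun m => u n x - u (m + n)%nat x) (Finite _)).
    apply is_lim_seq_minus'; auto. apply is_lim_seq_const. }
  apply (is_lim_seq_le _ (fun _ => D / (1 - th) * th ^ n) _ _ ) with (3 := is_lim_seq_const _) in L2; auto.
  intros m. rewrite Rabs_minus_sym, Nat.add_comm. apply K'.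
Qed.

Lemma geom_small D th e : 0 <= th < 1 -> 0 < e -> exists N, forall n, (N <= n)%nat -> D * th ^ n <= e.
Proof.
  intros H He.
  destruct (pow_lt_1_zero th ltac:(rewrite Rabs_right; lra) (e / (Rabs D + 1))) as [N HN].
  { apply Rdiv_lt_0_compat; auto. assert (h := Rabs_pos D); lra. }
  exists N. intros n Hn. specialize (HN n Hn).
  assert (0 <= th ^ n) by (apply pow_le; lra). rewrite Rabs_right in HN by lra.
  assert (h := Rabs_pos D). assert (h' := Rle_abs D).
  apply Rle_trans with ((Rabs D + 1) * th ^ n); [nra |].
  apply Rle_trans with ((Rabs D + 1) * (e / (Rabs D + 1))); [apply Rmult_le_compat_l; lra | right; field; lra].
Qed.

(** Banach's theorem for real functions on a bare set, in the sup norm weighted by [wt]; [P] is the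
    invariant class, closed under uniform limits. The weight will be an exponential in time, which
    makes the Picard map contract on the whole of [0,T]. *)
Lemma contraction {X : Type} (P : (X -> R) -> Prop) (Phi : (X -> R) -> X -> R) (wt : X -> R) th W f0 D0 :
  (forall x, 0 < wt x <= W) -> 0 <= th < 1 -> 0 <= D0 ->
  (forall f, P f -> P (Phi f)) ->
  (forall f g D, P f -> P g -> 0 <= D -> (forall x, Rabs (f x - g x) <= D * wt x) ->
     forall x, Rabs (Phi f x - Phi g x) <= th * D * wt x) ->
  (forall (u : nat -> X -> R) f, (forall n, P (u n)) ->
     (forall e, 0 < e -> exists N, forall n, (N <= n)%nat -> forall x, Rabs (u n x - f x) <= e) -> P f) ->
  P f0 -> (forall x, Rabs (Phi f0 x - f0 x) <= D0 * wt x) ->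
  exists f, P f /\ forall x, Phi f x = f x.
Proof.
  intros Hw Hth HD0 HP HC HL H0 HD.
  set (u := fix u n := match n with O => f0 | S n => Phi (u n) end).
  assert (Pu : forall n, P (u n)) by (induction n; simpl; auto).
  assert (Pth : forall n, 0 <= th ^ n) by (intros; apply pow_le; lra).
  assert (Du : forall n x, Rabs (u (S n) x - u n x) <= (D0 * th ^ n) * wt x).
  { induction n; intros x.
    - simpl. rewrite Rmult_1_r. apply HD.
    - replace (D0 * th ^ S n * wt x) with (th * (D0 * th ^ n) * wt x) by (simpl; ring).
      apply (HC (u (S n)) (u n)); auto. apply Rmult_le_pos; auto. }
  assert (Du' : forall n x, Rabs (u (S n) x - u n x) <= (D0 * W) * th ^ n).
  { intros n x. eapply Rle_trans; [apply Du |]. specialize (Hw x).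
    assert (0 <= D0 * th ^ n) by (apply Rmult_le_pos; auto). nra. }
  assert (HW : forall x : X, 0 <= W) by (intros x; specialize (Hw x); lra).
  (* The sign of [W] is read off at a point of [X]; for empty [X] any function is a fixed point. *)
  destruct (Classical_Prop.classic (inhabited X)) as [[x0] | NX].
  2:{ exists f0. split; auto. intros x. exfalso; apply NX; constructor; auto. }
  assert (HW0 := HW x0).
  destruct (limit_geom u (D0 * W) th Hth) as [f Hf]; auto. { apply Rmult_le_pos; auto. }
  assert (Pf : P f).
  { apply (HL u); auto. intros e He. destruct (geom_small (D0 * W / (1 - th)) th e Hth He) as [N HN].
    exists N. intros n Hn x. eapply Rle_trans; [apply Hf | apply HN; auto]. }
  exists f. split; auto. intros x.
  apply Rminus_diag_uniq. destruct (Req_dec (Phi f x - f x) 0) as [|N]; auto. exfalso.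
  assert (Hq : 0 < Rabs (Phi f x - f x)) by (apply Rabs_pos_lt; auto).
  destruct (geom_small (D0 / (1 - th) * (2 * W + 1)) th (Rabs (Phi f x - f x) / 2) Hth) as [M HM]; [lra |].
  specialize (HM M (le_n _)).
  (* The contraction hypothesis needs the distance to the limit measured with the weight. The
     geometric limit is retaken at the single point [y], and uniqueness of limits identifies it with
     [f y]. *)
  assert (Hf2 : forall n y, Rabs (u n y - f y) <= (D0 / (1 - th) * th ^ n) * wt y).
  { intros n y.
    assert (Q := limit_geom (X := unit) (fun k _ => u k y) (D0 * wt y) th Hth).
    destruct Q as [g Hg]. { specialize (Hw y). apply Rmult_le_pos; lra. }
    { intros k _. replace (D0 * wt y * th ^ k) with (D0 * th ^ k * wt y) by ring. apply Du. }
    assert (E : g tt = f y).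
    { apply Rminus_diag_uniq. destruct (Req_dec (g tt - f y) 0) as [|N']; auto. exfalso.
      assert (Hq' : 0 < Rabs (g tt - f y)) by (apply Rabs_pos_lt; auto).
      destruct (geom_small (D0 * W / (1 - th)) th (Rabs (g tt - f y) / 3) Hth) as [N1 HN1]; [lra |].
      destruct (geom_small (D0 * wt y / (1 - th)) th (Rabs (g tt - f y) / 3) Hth) as [N2 HN2]; [lra |].
      specialize (HN1 (N1 + N2)%nat ltac:(lia)). specialize (HN2 (N1 + N2)%nat ltac:(lia)).
      assert (h1 := Hf (N1 + N2)%nat y). assert (h2 := Hg (N1 + N2)%nat tt).
      assert (h3 := Rabs_triang (u (N1 + N2)%nat y - f y) (- (u (N1 + N2)%nat y - g tt))).
      rewrite Rabs_Ropp in h3.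
      replace (u (N1 + N2)%nat y - f y + - (u (N1 + N2)%nat y - g tt)) with (g tt - f y) in h3 by ring. lra. }
    specialize (Hg n tt). rewrite E in Hg.
    replace (D0 / (1 - th) * th ^ n * wt y) with (D0 * wt y / (1 - th) * th ^ n) by (field; lra). auto. }
  assert (c0 : 0 <= D0 / (1 - th)) by (apply Rdiv_le_0_compat; lra).
  assert (A1 := HC (u M) f (D0 / (1 - th) * th ^ M) (Pu M) Pf ltac:(apply Rmult_le_pos; auto) (Hf2 M) x).
  assert (A2 := Hf2 (S M) x). change (u (S M)) with (Phi (u M)) in A2.
  assert (T := Rabs_triang (Phi (u M) x - f x) (- (Phi (u M) x - Phi f x))).
  rewrite Rabs_Ropp in T.
  replace (Phi (u M) x - f x + - (Phi (u M) x - Phi f x)) with (Phi f x - f x) in T by ring.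
  specialize (Hw x). simpl pow in A2.
  assert (q0 : 0 <= D0 / (1 - th) * th ^ M) by (apply Rmult_le_pos; auto).
  assert (q1 : th * (D0 / (1 - th) * th ^ M) * wt x <= (D0 / (1 - th) * th ^ M) * W).
  { rewrite Rmult_comm, <- Rmult_assoc, (Rmult_comm (wt x * th)). apply Rmult_le_compat_l; auto.
    nra. }
  assert (q2 : D0 / (1 - th) * (th * th ^ M) * wt x <= (D0 / (1 - th) * th ^ M) * W).
  { replace (D0 / (1 - th) * (th * th ^ M) * wt x) with (th * (D0 / (1 - th) * th ^ M) * wt x) by ring. auto. }
  nra.
Qed.

(** * Real powers, tails of power sums, singular integrals *)

Lemma Rpower_exp_bound q : 0 < q -> exists C, 0 < C /\ forall y, 0 < y -> exp (- y) <= C * Rpower y (- q).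
Proof.
  (* The maximum of y^q exp(-y), attained at y = q. *)
  intros Hq. exists (exp (q * ln q - q)). split; [apply exp_pos |]. intros y Hy.
  unfold Rpower. rewrite <- exp_plus.
  assert (H : ln (y / q) <= y / q - 1).
  { assert (h := exp_ineq1_le (ln (y / q))). rewrite exp_ln in h by (apply Rdiv_lt_0_compat; auto). lra. }
  rewrite ln_div in H by auto.
  assert (q * (ln y - ln q) <= y - q).
  { apply (Rmult_le_compat_l q) in H; [| lra]. replace (q * (y / q - 1)) with (y - q) in H by (field; lra). auto. }
  destruct (Req_dec (- y) (q * ln q - q + - q * ln y)) as [-> |]; [lra |].
  left; apply exp_increasing. lra.
Qed.
Lemma Rpower_derive a x : 0 < x -> is_derive (fun y => Rpower y a) x (a * Rpower x (a - 1)).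
Proof.
  intros Hx. apply is_derive_Reals. apply derivable_pt_lim_power; auto.
Qed.
Lemma Rpower_cont a x : 0 < x -> continuous (fun y => Rpower y a) x.
Proof. intros. eapply derive_cont. apply Rpower_derive; auto. Qed.
Lemma Rpower_pos a x : 0 < Rpower x a.
Proof. apply exp_pos. Qed.
Lemma Rpower_le_l a x y : 0 <= a -> 0 < x <= y -> Rpower x a <= Rpower y a.
Proof. intros. apply Rle_Rpower_l; lra. Qed.
Lemma Rpower_neg_le a x y : 0 <= a -> 0 < x <= y -> Rpower y (- a) <= Rpower x (- a).
Proof.
  intros. rewrite !Rpower_Ropp. apply Rinv_le_contravar; [apply Rpower_pos |]. apply Rpower_le_l; lra.
Qed.

(** The summable weight of all Cauchy-Schwarz estimates on coefficients. Its tail n^(-1/4) enters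
    under a square root, whence the n^(-1/8) in the later bounds. *)
Definition qk (k : nat) : R := Rpower (INR k) (- (5 / 4)).
Lemma qk_tail n m : (1 <= n)%nat -> sm (fun i => qk (n + i)) m <= 5 * Rpower (INR n) (- (1 / 4)).
Proof.
  intros Hn.
  assert (N1 : 1 <= INR n) by (apply (le_INR 1); auto).
  (* Comparison with the integral of y^(-5/4) by the mean value theorem; the factor 4 is the inverse
     of the exponent 1/4, and the first term of the tail adds one more. *)
  assert (K : forall j, (1 <= j)%nat -> qk (S j) <= 4 * (Rpower (INR j) (- (1/4)) - Rpower (INR (S j)) (- (1/4)))).
  { intros j Hj. assert (J1 : 1 <= INR j) by (apply (le_INR 1); auto). rewrite S_INR.
    destruct (MVT_gen (fun y => Rpower y (- (1/4))) (INR j) (INR j + 1)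
      (fun y => - (1/4) * Rpower y (- (1/4) - 1))) as [c [Hc E]];
      rewrite ?Rmin_left, ?Rmax_right in * by lra.
    - intros; apply Rpower_derive; lra.
    - intros; apply cont1_pt, Rpower_cont; lra.
    - unfold qk. rewrite S_INR.
      replace (- (1/4) - 1) with (- (5/4)) in E by lra.
      assert (Rpower (INR j + 1) (- (5 / 4)) <= Rpower c (- (5/4))) by (apply Rpower_neg_le; lra). lra. }
  assert (K2 : forall m, sm (fun i => qk (S n + i)) m <= 4 * (Rpower (INR n) (- (1/4)) - Rpower (INR (n + m)) (- (1/4)))).
  { clear m. induction m; cbn [sm].
    - rewrite Nat.add_0_r. lra.
    - assert (h := K (n + m)%nat ltac:(lia)). rewrite Nat.add_succ_r.
      change (S n + m)%nat with (S (n + m)). lra. }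
  destruct m; cbn [sm].
  - assert (h := Rpower_pos (- (1/4)) (INR n)). lra.
  - change (sm (fun i => qk (n + i)) m + qk (n + m)) with (sm (fun i => qk (n + i)) (S m)).
    rewrite sm_head, Nat.add_0_r.
    rewrite (sm_ext _ (fun i => qk (S n + i))) by (intros; f_equal; lia).
    assert (h := K2 m). assert (h1 := Rpower_pos (- (1/4)) (INR (n + m))).
    assert (qk n <= Rpower (INR n) (- (1/4))) by (unfold qk; apply Rle_Rpower; lra). lra.
Qed.
Lemma tail_lim e : 0 < e -> exists n, (1 <= n)%nat /\ forall j, (n <= j)%nat -> Rpower (INR j) (- (1 / 4)) <= e.
Proof.
  intros He. destruct (archimed_cor1 (e ^ 4)) as [N [HN HN0]]; [apply pow_lt; auto |].
  exists N. split; [lia |]. intros j Hj.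
  assert (HNp : 0 < INR N) by (apply lt_0_INR; lia).
  assert (Hjp : INR N <= INR j) by (apply le_INR; auto).
  apply Rle_trans with (Rpower (INR N) (- (1/4))); [apply Rpower_neg_le; lra |].
  rewrite Rpower_Ropp, <- (Rinv_inv e).
  assert (0 < / e) by (apply Rinv_0_lt_compat; auto).
  apply Rinv_le_contravar; auto.
  replace (/ e) with (Rpower ((/ e) ^ 4) (1/4)).
  - apply Rpower_le_l; [lra |]. split; [apply pow_lt; auto |].
    rewrite <- (Rinv_inv (INR N)), pow_inv. apply Rinv_le_contravar; [apply Rinv_0_lt_compat; auto | lra].
  - rewrite <- Rpower_pow by auto. rewrite Rpower_mult. replace (INR 4 * (1/4)) with 1 by (simpl; lra).
    apply Rpower_1; auto.
Qed.
(** Telescoping: 1/(n+2)^2 <= 1/(n+1) - 1/(n+2), carried along as the sharper bound 2 - 1/(n+1). *)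
Lemma inv_sq_sum n : sm (fun k => / (INR k + 1) ^ 2) n <= 2.
Proof.
  set (f := fun k => / (INR k + 1) ^ 2).
  assert (P : forall k, 0 <= f k).
  { intros k. unfold f. left; apply Rinv_0_lt_compat, pow_lt. assert (h := pos_INR k); lra. }
  assert (K : sm f (S n) <= 2 - / (INR n + 1)).
  { induction n; [unfold f; simpl; lra |].
    change (sm f (S (S n))) with (sm f (S n) + f (S n)). rewrite S_INR. assert (h := pos_INR n).
    assert (f (S n) <= / (INR n + 1) - / (INR n + 1 + 1)).
    { unfold f. rewrite S_INR.
      replace (/ (INR n + 1) - / (INR n + 1 + 1)) with (/ ((INR n + 1) * (INR n + 1 + 1))) by (field; lra).
      apply Rinv_le_contravar; nra. }
    lra. }
  assert (h := pos_INR n).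
  assert (0 < / (INR n + 1)) by (apply Rinv_0_lt_compat; lra).
  assert (h2 := sm_mono f n (S n) P ltac:(lia)). lra.
Qed.

(* The integrand may blow up like an integrable power of [t - s] at the right endpoint. *)
Lemma RI_singular (h : R -> R) t C th : cont1 h -> 0 <= t -> 0 < th -> 0 <= C ->
  (forall s, 0 <= s < t -> h s <= C * Rpower (t - s) (th - 1)) ->
  RInt h 0 t <= C / th * Rpower t th.
Proof.
  intros ch Ht0 Hth HC H.
  assert (CT : 0 <= C / th) by (apply Rdiv_le_0_compat; lra).
  destruct (Req_dec t 0) as [-> | Ht1].
  { rewrite RI_point. apply Rmult_le_pos; auto. left; apply Rpower_pos. }
  assert (Ht : 0 < t) by lra.
  destruct (cont1_bound h 0 t ch) as [M [HM HB]].
  assert (K : forall e, 0 < e < t -> RInt h 0 t <= C / th * Rpower t th + M * e).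
  { intros e He. rewrite <- (RI_chasles h 0 (t - e) t) by auto.
    assert (K1 : RInt h (t - e) t <= M * e).
    { replace (M * e) with (M * (t - (t - e))) by ring. apply RI_ub; auto; [lra |].
      intros x Hx. assert (h1 := HB x ltac:(lra)). assert (h2 := Rle_abs (h x)). lra. }
    assert (D : forall x, 0 <= x <= t - e ->
        is_derive (fun s => - (C / th) * Rpower (t - s) th) x (C * Rpower (t - x) (th - 1))).
    { intros x Hx.
      evar_last.
      - apply (is_derive_scal (fun s => Rpower (t - s) th) x (- (C / th))).
        apply (is_derive_comp (fun y => Rpower y th) (fun s => t - s) x).
        + apply Rpower_derive. lra.
        + auto_derive; [trivial | reflexivity].
      - unfold scal; simpl; unfold mult; simpl. field. lra. }
    assert (cD : forall x, 0 <= x <= t - e -> continuous (fun x => C * Rpower (t - x) (th - 1)) x).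
    { intros x Hx. apply c_mult; [apply c_const |].
      apply (c_comp (fun y => Rpower y (th - 1)) (fun x => t - x)); [ctn | apply Rpower_cont; lra]. }
    assert (K2 : RInt h 0 (t - e) <= RInt (fun x => C * Rpower (t - x) (th - 1)) 0 (t - e)).
    { apply RInt_le; [lra | apply exR; auto | |].
      - apply (ex_RInt_continuous (V := R_CompleteNormedModule)). rewrite Rmin_left, Rmax_right by lra. auto.
      - intros; apply H; lra. }
    rewrite (RI_ftc_seg (fun s => - (C / th) * Rpower (t - s) th) (fun x => C * Rpower (t - x) (th - 1))) in K2 by (first [exact D | exact cD | lra]).
    replace (t - (t - e)) with e in K2 by ring. rewrite Rminus_0_r in K2.
    assert (0 <= C / th * Rpower e th) by (apply Rmult_le_pos; auto; left; apply Rpower_pos). lra. }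
  apply le_epsilon. intros e He.
  set (d := Rmin (t / 2) (e / M)).
  assert (Hd : 0 < d) by (apply Rmin_pos; [lra | apply Rdiv_lt_0_compat; auto]).
  assert (d1 := Rmin_l (t / 2) (e / M)). assert (d2 := Rmin_r (t / 2) (e / M)). fold d in d1, d2.
  assert (h1 := K d ltac:(lra)).
  assert (M * d <= e).
  { apply Rle_trans with (M * (e / M)); [apply Rmult_le_compat_l; lra | right; field; lra]. }
  lra.
Qed.

(** * Sine and cosine coefficients *)

Definition lamL (L : R) (k : nat) : R := INR k * PI / L.
(* Parity [true] is the sine basis, [false] the cosine basis. *)
Definition ee (L : R) (b : bool) (k : nat) (x : R) : R :=
  if b then sin (lamL L k * x) else cos (lamL L k * x).
Definition sg (b : bool) : R := if b then 1 else -1.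
Definition cfL (L : R) (b : bool) (g : R -> R) (k : nat) : R :=
  RInt (fun x => g x * ee L b k x) 0 L.
(** Inverse squared norm of the basis function; the coefficients [cfL] are left unnormalised. The
    sine of index 0 is the zero function, and its weight is a harmless default. *)
Definition ckL (L : R) (k : nat) : R := match k with O => 1 / L | S _ => 2 / L end.
Definition tpL (L : R) (b : bool) (a : nat -> R) (N : nat) (x : R) : R :=
  sm (fun k => ckL L k * a k * ee L b k x) N.
(** Squared L2 distance from [g] to the span of the first [N] basis functions, as given by
    Pythagoras. *)
Definition dNL (L : R) (b : bool) (g : R -> R) (N : nat) : R :=
  RInt (fun x => g x ^ 2) 0 L - sm (fun k => ckL L k * cfL L b g k ^ 2) N.

Arguments ee L b k x : simpl never.
Arguments lamL L k : simpl never.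

Section Fourier.
Variable L : R.
Hypothesis HL : 0 < L.
Local Notation lam := (lamL L).
Local Notation e := (ee L).
Local Notation cf := (cfL L).
Local Notation ck := (ckL L).
Local Notation tp := (tpL L).
Local Notation dN := (dNL L).

Lemma lam0 : lam 0 = 0.
Proof. unfold lamL. simpl. fd. lra. Qed.
Lemma lam_S k : lam k = INR k * lam 1.
Proof. unfold lamL. simpl. fd. lra. Qed.
Lemma lam1_pos : 0 < lam 1.
Proof. unfold lamL. simpl. assert (h := PI_RGT_0). apply Rdiv_lt_0_compat; lra. Qed.
Lemma lam_ge0 k : 0 <= lam k.
Proof. rewrite lam_S. apply Rmult_le_pos; [apply pos_INR | left; apply lam1_pos]. Qed.
Lemma lam_pos k : (1 <= k)%nat -> 0 < lam k.
Proof. intros. rewrite lam_S. apply Rmult_lt_0_compat; [apply lt_0_INR; lia | apply lam1_pos]. Qed.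
Lemma lam_inj j k : j <> k -> lam j <> lam k.
Proof.
  intros H E. rewrite (lam_S j), (lam_S k) in E. assert (h := lam1_pos).
  apply Rmult_eq_reg_r in E; [| lra]. apply INR_eq in E. auto.
Qed.
Lemma ck_bounds k : 1 / L <= ck k <= 2 / L.
Proof.
  assert (0 < / L) by (apply Rinv_0_lt_compat; auto).
  destruct k; simpl; unfold Rdiv; lra.
Qed.
Lemma ck_pos k : 0 < ck k.
Proof.
  assert (h := ck_bounds k). assert (0 < 1 / L) by (apply Rdiv_lt_0_compat; lra). lra.
Qed.
Lemma sg_sq b : sg b * sg b = 1.
Proof. destruct b; simpl; rg. Qed.
Lemma sg_neg b : sg (negb b) = - sg b.
Proof. destruct b; simpl; rg. Qed.
Lemma e_derive b k x : is_derive (e b k) x (sg b * lam k * e (negb b) k x).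
Proof. destruct b; unfold ee, sg; simpl; auto_derive; auto; rg. Qed.
Lemma e_cont b k : cont1 (e b k).
Proof. apply (cont1_derive _ (fun x => sg b * lam k * e (negb b) k x)). intros; apply e_derive. Qed.
Lemma e_le b k x : Rabs (e b k x) <= 1.
Proof. apply Rabs_le. destruct b; unfold ee; [apply SIN_bound | apply COS_bound]. Qed.
Lemma sin_L k : e true k L = 0.
Proof.
  unfold ee, lamL. replace (INR k * PI / L * L) with (INR k * PI) by (fd; lra).
  apply sin_eq_0_1. exists (Z.of_nat k). rewrite INR_IZR_INZ; auto.
Qed.
Lemma sin_0' k : e true k 0 = 0.
Proof. unfold ee. rewrite Rmult_0_r. apply sin_0. Qed.
Lemma e_true0 x : e true 0 x = 0.
Proof. unfold ee. rewrite lam0, Rmult_0_l. apply sin_0. Qed.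
Lemma e_false0 x : e false 0 x = 1.
Proof. unfold ee. rewrite lam0, Rmult_0_l. apply cos_0. Qed.
Lemma e_bdry b j k x : x = 0 \/ x = L -> e b j x * e (negb b) k x = 0.
Proof.
  intros [-> | ->]; destruct b; simpl negb; rewrite ?sin_0', ?sin_L; rg.
Qed.

(** Integration by parts in both orders relates the scalar product [X] in one parity to [Y] in the
    other by lam_k X = lam_j Y and lam_j X = lam_k Y; hence (lam_k^2 - lam_j^2) X = 0. *)
Lemma orth b j k : j <> k -> RInt (fun x => e b j x * e b k x) 0 L = 0.
Proof.
  intros H.
  assert (D : forall j k, RInt (fun x => e b j x * (sg (negb b) * lam k * e b k x)) 0 L
     = - RInt (fun x => (sg b * lam j * e (negb b) j x) * e (negb b) k x) 0 L).
  { clear H j k. intros j k.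
    rewrite (RI_ibp (e b j) (fun x => sg b * lam j * e (negb b) j x) (e (negb b) k)
       (fun x => sg (negb b) * lam k * e b k x)).
    - rewrite !e_bdry by auto. rg.
    - intros; apply e_derive.
    - assert (c := e_cont (negb b) j). ctn.
    - intros x. assert (h := e_derive (negb b) k x). rewrite Bool.negb_involutive in h. exact h.
    - assert (c := e_cont b k). ctn. }
  assert (c1 := e_cont b j). assert (c2 := e_cont b k).
  assert (c3 := e_cont (negb b) j). assert (c4 := e_cont (negb b) k).
  assert (E1 := D j k). assert (E2 := D k j).
  rewrite (RInt_ext _ (fun x => (sg (negb b) * lam k) * (e b j x * e b k x))) in E1 by (intros; req; rg).
  rewrite (RInt_ext (fun x => sg b * lam j * e (negb b) j x * e (negb b) k x)
     (fun x => (sg b * lam j) * (e (negb b) j x * e (negb b) k x))) in E1 by (intros; req; rg).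
  rewrite (RInt_ext _ (fun x => (sg (negb b) * lam j) * (e b j x * e b k x))) in E2 by (intros; req; rg).
  rewrite (RInt_ext (fun x => sg b * lam k * e (negb b) k x * e (negb b) j x)
     (fun x => (sg b * lam k) * (e (negb b) j x * e (negb b) k x))) in E2 by (intros; req; rg).
  rewrite !RI_scal in E1 by ctn. rewrite !RI_scal in E2 by ctn.
  set (X := RInt (fun x => e b j x * e b k x) 0 L) in *.
  set (Y := RInt (fun x => e (negb b) j x * e (negb b) k x) 0 L) in *.
  rewrite sg_neg in *.
  assert (S2 : sg b = 1 \/ sg b = -1) by (destruct b; simpl; auto).
  assert (F1 : lam k * X = lam j * Y) by (destruct S2 as [S2 | S2]; rewrite S2 in *; lra).
  assert (F2 : lam j * X = lam k * Y) by (destruct S2 as [S2 | S2]; rewrite S2 in *; lra).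
  assert (F3 : (lam k - lam j) * (lam k + lam j) * X = 0) by (replace ((lam k - lam j) * (lam k + lam j) * X) with (lam k * (lam k * X) - lam j * (lam j * X)) by ring; rewrite F1, F2; ring).
  assert (lam k <> lam j) by (apply lam_inj; auto).
  assert (0 < lam k + lam j).
  { assert (h1 := lam_ge0 k). assert (h2 := lam_ge0 j).
    destruct (Req_dec (lam k) 0); [| lra]. destruct (Req_dec (lam j) 0); lra. }
  apply Rmult_integral in F3. destruct F3 as [F3 |]; auto.
  apply Rmult_integral in F3. destruct F3; lra.
Qed.
(** For k >= 1 the squared norms of sine and cosine add up to [L], and they are equal because the
    derivative of sin cos integrates to zero. *)
Lemma norm_e b k : (b = true -> k <> O) -> ck k * RInt (fun x => e b k x * e b k x) 0 L = 1.
Proof.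
  intros H. destruct k as [| k].
  - destruct b; [exfalso; apply H; auto |]. simpl.
    rewrite (RInt_ext _ (fun _ => 1)) by (intros; req; rewrite e_false0; rg).
    rewrite RI_const. fd. lra.
  - assert (P := lam_pos (S k) ltac:(lia)).
    assert (c1 := e_cont true (S k)). assert (c2 := e_cont false (S k)).
    set (X := RInt (fun x => e true (S k) x * e true (S k) x) 0 L).
    set (Y := RInt (fun x => e false (S k) x * e false (S k) x) 0 L).
    assert (E1 : X + Y = L).
    { unfold X, Y. rewrite <- RI_plus by ctn.
      rewrite (RInt_ext _ (fun _ => 1)).
      - rewrite RI_const; rg.
      - intros; req. unfold ee. assert (h := sin2_cos2 (lam (S k) * x)). unfold Rsqr in h. lra. }
    assert (E2 : lam (S k) * Y - lam (S k) * X = 0).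
    { unfold X, Y. rewrite <- !RI_scal by ctn. rewrite <- RI_minus by ctn.
      rewrite (RInt_ext _ (fun x => (sg true * lam (S k) * e false (S k) x) * e false (S k) x
         + e true (S k) x * (sg false * lam (S k) * e true (S k) x))) by (intros; req; simpl sg; rg).
      rewrite (RI_ftc (fun x => e true (S k) x * e false (S k) x)).
      - rewrite !sin_L, !sin_0'. rg.
      - intros x. apply (is_derive_mult (e true (S k)) (e false (S k))).
        + apply e_derive.
        + apply (e_derive false).
        + intros; apply Rmult_comm.
      - ctn. }
    assert (X = Y) by nra.
    assert (X = L / 2) by lra. cbn [ckL].
    destruct b; [fold X | fold Y]; [rewrite H1 | rewrite <- H0, H1]; fd; lra.
Qed.

Lemma cf_cont b g k : cont1 g -> cont1 (fun x => g x * e b k x).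
Proof. intros H. assert (c := e_cont b k). ctn. Qed.
Lemma cf_plus b f g k : cont1 f -> cont1 g -> cf b (fun x => f x + g x) k = cf b f k + cf b g k.
Proof.
  intros. unfold cfL. rewrite <- RI_plus by (apply cf_cont; auto).
  apply RInt_ext; intros; req; rg.
Qed.
Lemma cf_minus b f g k : cont1 f -> cont1 g -> cf b (fun x => f x - g x) k = cf b f k - cf b g k.
Proof.
  intros. unfold cfL. rewrite <- RI_minus by (apply cf_cont; auto).
  apply RInt_ext; intros; req; rg.
Qed.
Lemma cf_scal b c f k : cont1 f -> cf b (fun x => c * f x) k = c * cf b f k.
Proof.
  intros. unfold cfL. rewrite <- RI_scal by (apply cf_cont; auto).
  apply RInt_ext; intros; req; rg.
Qed.
Lemma cf_ext b f g k : (forall x, 0 <= x <= L -> f x = g x) -> cf b f k = cf b g k.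
Proof. intros H. apply RI_ext; [lra |]. intros; rewrite H; auto. Qed.
Lemma cf_true0 g : cf true g 0 = 0.
Proof.
  unfold cfL. rewrite (RInt_ext _ (fun _ => 0)); [rewrite RI_const; apply Rmult_0_l |].
  intros; req. rewrite e_true0. rg.
Qed.
Lemma cf_bound b g M k : cont1 g -> (forall x, 0 <= x <= L -> Rabs (g x) <= M) -> Rabs (cf b g k) <= M * L.
Proof.
  intros cg H. unfold cfL. replace (M * L) with (M * (L - 0)) by rg.
  apply RI_abs_ub; [apply cf_cont; auto | lra |]. intros x Hx. rewrite Rabs_mult.
  assert (h := H x Hx). assert (h2 := e_le b k x). assert (h3 := Rabs_pos (g x)). assert (h4 := Rabs_pos (e b k x)). nra.
Qed.
(** Differentiation exchanges the two parities. In the cosine case the test function is a sine and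
    kills the boundary terms; in the sine case [h] itself must vanish at the ends. *)
Lemma cf_ibp b (h h' : R -> R) k : (forall x, is_derive h x (h' x)) -> cont1 h' ->
  b = false \/ (h 0 = 0 /\ h L = 0) -> cf (negb b) h' k = sg b * lam k * cf b h k.
Proof.
  intros D ch B. assert (chh : cont1 h) by (apply (cont1_derive _ h'); auto).
  assert (c1 := e_cont b k). assert (c2 := e_cont (negb b) k).
  unfold cfL.
  rewrite (RInt_ext _ (fun x => e (negb b) k x * h' x)) by (intros; req; rg).
  rewrite (RI_ibp (e (negb b) k) (fun x => sg (negb b) * lam k * e b k x) h h'); auto.
  - rewrite (RInt_ext (fun x => sg (negb b) * lam k * e b k x * h x)
      (fun x => (sg (negb b) * lam k) * (h x * e b k x))) by (intros; req; rg).
    rewrite RI_scal by ctn. rewrite sg_neg.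
    assert (E : e (negb b) k L * h L = 0 /\ e (negb b) k 0 * h 0 = 0).
    { destruct B as [-> | [H0 H1]]; simpl negb; [rewrite sin_L, sin_0' | rewrite H0, H1]; split; rg. }
    destruct E as [-> ->]. rg.
  - intros x. assert (h1 := e_derive (negb b) k x). rewrite Bool.negb_involutive in h1. exact h1.
  - ctn.
Qed.

(** * Partial sums, best approximation, completeness *)

Lemma tp_cont b a N : cont1 (tp b a N).
Proof.
  intros x. unfold tpL. apply (c_sm (fun k x => ck k * a k * e b k x)).
  intros k _. assert (c := e_cont b k). ctn.
Qed.
Lemma ip_tp b g a N : cont1 g ->
  RInt (fun x => g x * tp b a N x) 0 L = sm (fun k => ck k * a k * cf b g k) N.
Proof.
  intros cg. unfold tpL.
  rewrite (RInt_ext _ (fun x => sm (fun k => (ck k * a k) * (g x * e b k x)) N)).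
  - rewrite (RI_sm (fun k x => (ck k * a k) * (g x * e b k x))).
    + apply sm_ext. intros. rewrite RI_scal by (apply cf_cont; auto). reflexivity.
    + intros k. assert (c := e_cont b k). ctn.
  - intros; req. rewrite <- sm_scal. apply sm_ext. intros; rg.
Qed.
Lemma cf_tp b a N k : (b = true -> a O = 0) -> cf b (tp b a N) k = if Compare_dec.lt_dec k N then a k else 0.
Proof.
  intros H. unfold cfL.
  rewrite (RInt_ext _ (fun x => e b k x * tp b a N x)) by (intros; req; rg).
  rewrite ip_tp by apply e_cont.
  destruct (Compare_dec.lt_dec k N) as [Hk | Hk].
  - rewrite (sm_single _ N k Hk).
    + unfold cfL. destruct (Bool.bool_dec b true) as [-> | Hb].
      * destruct k as [| k]; [rewrite H by auto; rg |].
        rewrite (Rmult_comm (ck (S k)) (a (S k))), Rmult_assoc, norm_e; [rg | auto].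
      * rewrite (Rmult_comm (ck k) (a k)), Rmult_assoc, norm_e; [rg | intros; contradiction].
    + intros j Hj. unfold cfL. rewrite orth; [rg | auto].
  - rewrite (sm_ext _ (fun _ => 0)), sm_zero; auto.
    intros j Hj. unfold cfL. rewrite orth; [rg | lia].
Qed.
Lemma tp_sq b a N : (b = true -> a O = 0) ->
  RInt (fun x => tp b a N x ^ 2) 0 L = sm (fun k => ck k * a k ^ 2) N.
Proof.
  intros H. rewrite (RInt_ext _ (fun x => tp b a N x * tp b a N x)) by (intros; req; rg).
  rewrite ip_tp by apply tp_cont. apply sm_ext. intros k Hk. rewrite cf_tp by auto.
  destruct (Compare_dec.lt_dec k N); [rg | lia].
Qed.
(** Pythagoras for a partial sum with arbitrary coefficients; it gives the meaning of [dN], Bessel's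
    inequality and minimality. *)
Lemma dist_tp b g a N : cont1 g -> (b = true -> a O = 0) ->
  RInt (fun x => (g x - tp b a N x) ^ 2) 0 L
    = dN b g N + sm (fun k => ck k * (cf b g k - a k) ^ 2) N.
Proof.
  intros cg H. assert (ct := tp_cont b a N).
  rewrite (RInt_ext _ (fun x => g x ^ 2 - 2 * (g x * tp b a N x) + tp b a N x ^ 2)) by (intros; req; rg).
  rewrite RI_plus by ctn. rewrite RI_minus by ctn. rewrite RI_scal by ctn.
  rewrite ip_tp, tp_sq by auto. unfold dNL.
  rewrite (sm_ext (fun k => ck k * (cf b g k - a k) ^ 2)
    (fun k => ck k * cf b g k ^ 2 - 2 * (ck k * a k * cf b g k) + ck k * a k ^ 2)) by (intros; rg).
  rewrite sm_plus, sm_minus, sm_scal. rg.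
Qed.
Lemma dN_dist b g N : cont1 g ->
  dN b g N = RInt (fun x => (g x - tp b (cf b g) N x) ^ 2) 0 L.
Proof.
  intros cg. rewrite dist_tp; auto.
  - rewrite (sm_ext _ (fun _ => 0)), sm_zero by (intros; rg). rg.
  - intros ->. apply cf_true0.
Qed.
Lemma dN_ge0 b g N : cont1 g -> 0 <= dN b g N.
Proof.
  intros cg. rewrite dN_dist by auto. assert (ct := tp_cont b (cf b g) N).
  apply RI_ge0; [ctn | lra | intros; apply pow2_ge_0].
Qed.
Lemma bessel b g N : cont1 g -> sm (fun k => ck k * cf b g k ^ 2) N <= RInt (fun x => g x ^ 2) 0 L.
Proof. intros cg. assert (h := dN_ge0 b g N cg). unfold dNL in h. lra. Qed.
Lemma dN_best b g a N : cont1 g -> (b = true -> a O = 0) ->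
  dN b g N <= RInt (fun x => (g x - tp b a N x) ^ 2) 0 L.
Proof.
  intros. rewrite dist_tp by auto.
  assert (0 <= sm (fun k => ck k * (cf b g k - a k) ^ 2) N).
  { apply sm_ge0. intros. apply Rmult_le_pos; [left; apply ck_pos | apply pow2_ge_0]. }
  lra.
Qed.
(* Since [cos_1 cos_k] is a combination of [cos_(k+1)] and [cos_(k-1)], functions orthogonal to
   all cosines are stable under multiplication by polynomials in [cos_1]; a power of such a
   polynomial peaking at [x0] then detects the value at [x0]. *)
Lemma e_mul_cos1 b k x : e b (S k) x * e false 1 x = / 2 * (e b (S (S k)) x + e b k x).
Proof.
  assert (E1 : lam (S (S k)) * x = lam (S k) * x + lam 1 * x).
  { rewrite (lam_S (S (S k))), (lam_S (S k)), !S_INR. rg. }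
  assert (E2 : lam k * x = lam (S k) * x - lam 1 * x).
  { rewrite (lam_S (S k)), (lam_S k), !S_INR. rg. }
  unfold ee. destruct b; rewrite E1, E2.
  - rewrite sin_plus, sin_minus. field.
  - rewrite cos_plus, cos_minus. field.
Qed.
Definition null (g : R -> R) : Prop := cont1 g /\ forall k, cf false g k = 0.
Lemma null_cos1 g : null g -> null (fun x => g x * e false 1 x).
Proof.
  intros [cg H]. assert (c1 := e_cont false 1). split; [ctn |]. intros k.
  destruct k as [| k].
  - rewrite <- (H 1%nat). unfold cfL. apply RInt_ext. intros; req. rewrite e_false0. rg.
  - assert (c2 := e_cont false (S (S k))). assert (c3 := e_cont false k).
    unfold cfL.
    rewrite (RInt_ext _ (fun x => / 2 * (g x * e false (S (S k)) x) + / 2 * (g x * e false k x))).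
    + rewrite RI_plus by ctn. rewrite !RI_scal by ctn.
      change (/ 2 * cf false g (S (S k)) + / 2 * cf false g k = 0). rewrite !H. rg.
    + intros; req.
      transitivity (g x * (e false (S k) x * e false 1 x)); [rg |]. rewrite e_mul_cos1. rg.
Qed.
Lemma null_lin f g a c : null f -> null g -> null (fun x => a * f x + c * g x).
Proof.
  intros [cf' Hf] [cg Hg]. split; [ctn |]. intros k.
  rewrite cf_plus by ctn. rewrite !cf_scal by auto. rewrite Hf, Hg. rg.
Qed.
Lemma null_ext f g : (forall x, f x = g x) -> null f -> null g.
Proof.
  intros E [cf' H]. split.
  - intros x. apply (c_ext f); auto.
  - intros k. rewrite <- (H k). symmetry. apply cf_ext. auto.
Qed.
Lemma null_peak g y0 n : null g -> null (fun x => g x * (1 - (e false 1 x - y0) ^ 2 / 4) ^ n).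
Proof.
  intros H. induction n.
  - apply (null_ext g); auto. intros; simpl; rg.
  - set (h := fun x => g x * (1 - (e false 1 x - y0) ^ 2 / 4) ^ n) in *.
    assert (H1 := null_cos1 h IHn). assert (H2 := null_cos1 _ H1).
    apply (null_ext (fun x => 1 * ((1 - y0 ^ 2 / 4) * h x + (y0 / 2) * (h x * e false 1 x))
        + (- / 4) * (h x * e false 1 x * e false 1 x))).
    + intros x. unfold h. simpl. fd.
    + apply (null_lin (fun x => (1 - y0 ^ 2 / 4) * h x + (y0 / 2) * (h x * e false 1 x))); auto.
      apply null_lin; auto.
Qed.
Lemma cos1_decr x y : 0 <= x -> x < y -> y <= L -> e false 1 y < e false 1 x.
Proof.
  intros. assert (P := lam1_pos). unfold ee. apply cos_decreasing_1.
  - apply Rmult_le_pos; lra.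
  - replace PI with (lam 1 * L) by (unfold lamL; simpl; fd; lra). apply Rmult_le_compat_l; lra.
  - apply Rmult_le_pos; lra.
  - replace PI with (lam 1 * L) by (unfold lamL; simpl; fd; lra). apply Rmult_le_compat_l; lra.
  - apply Rmult_lt_compat_l; lra.
Qed.
Lemma null_nonpos g x0 : null g -> 0 <= x0 <= L -> g x0 <= 0.
Proof.
  intros Hn Hx0. destruct (Rle_dec (g x0) 0) as [|Hp]; auto. exfalso.
  assert (g0 : 0 < g x0) by lra. destruct Hn as [cg Hz].
  destruct (cont1_eps_inv g cg x0 (g x0 / 2)) as [de [Hde Hc]]; [lra |].
  set (c := e false 1). assert (cc : cont1 c) by apply e_cont.
  (* Drops of the strictly decreasing cos_1 at distance [de] to the right and left of [x0]. If that
     point leaves [0,L] there is nothing to separate on this side, and 1 is a default. *)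
  set (k1 := if Rle_dec (x0 + de) L then c x0 - c (x0 + de) else 1).
  set (k2 := if Rle_dec 0 (x0 - de) then c (x0 - de) - c x0 else 1).
  assert (Hk1 : 0 < k1).
  { unfold k1. destruct (Rle_dec (x0 + de) L); [| lra].
    assert (h := cos1_decr x0 (x0 + de) ltac:(lra) ltac:(lra) ltac:(lra)). fold c in h. lra. }
  assert (Hk2 : 0 < k2).
  { unfold k2. destruct (Rle_dec 0 (x0 - de)); [| lra].
    assert (h := cos1_decr (x0 - de) x0 ltac:(lra) ltac:(lra) ltac:(lra)). fold c in h. lra. }
  set (ka := Rmin 1 (Rmin k1 k2)).
  assert (Hka : 0 < ka) by (unfold ka; repeat apply Rmin_pos; lra).
  assert (Hka1 : ka <= 1) by apply Rmin_l.
  assert (Hka2 : ka <= k1) by (eapply Rle_trans; [apply Rmin_r | apply Rmin_l]).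
  assert (Hka3 : ka <= k2) by (eapply Rle_trans; [apply Rmin_r | apply Rmin_r]).
  assert (Far : forall x, 0 <= x <= L -> de <= Rabs (x - x0) -> ka <= Rabs (c x - c x0)).
  { intros x Hx Hd. unfold Rabs in Hd. destruct (Rcase_abs (x - x0)).
    - unfold k2 in Hka3. destruct (Rle_dec 0 (x0 - de)); [| lra].
      assert (c (x0 - de) <= c x).
      { destruct (Req_dec x (x0 - de)) as [-> |]; [lra |]. left. apply cos1_decr; lra. }
      rewrite Rabs_right; lra.
    - unfold k1 in Hka2. destruct (Rle_dec (x0 + de) L); [| lra].
      assert (c x <= c (x0 + de)).
      { destruct (Req_dec x (x0 + de)) as [-> |]; [lra |]. left. apply cos1_decr; lra. }
      rewrite Rabs_left1; lra. }
  destruct (cont1_eps_inv c cc x0 (ka / 2)) as [et [Het Hce]]; [lra |].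
  set (rho := Rmin (Rmin de et) (L / 2) / 2).
  assert (Hrho : 0 < rho).
  { unfold rho. apply Rdiv_lt_0_compat; [| lra]. repeat apply Rmin_pos; lra. }
  assert (Hr1 : rho < de /\ rho < et /\ rho < L / 2).
  { assert (h1 := Rmin_l (Rmin de et) (L / 2)). assert (h2 := Rmin_r (Rmin de et) (L / 2)).
    assert (h3 := Rmin_l de et). assert (h4 := Rmin_r de et). unfold rho in *. lra. }
  (* A one-sided interval of length [rho], because [x0] may be an end point; rho < L/2 leaves room
     on at least one side. *)
  assert (J : exists a b, 0 <= a /\ a + rho = b /\ b <= L /\ forall x, a <= x <= b -> Rabs (x - x0) <= rho).
  { destruct (Rle_dec (x0 + rho) L).
    - exists x0, (x0 + rho). repeat split; try lra. intros; apply Rabs_le; lra.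
    - exists (x0 - rho), x0. repeat split; try lra. intros; apply Rabs_le; lra. }
  destruct J as [a [b' [Ha [Hab [Hb HJ]]]]].
  destruct (cont1_bound g 0 L cg) as [M [HM HB]].
  set (w := fun x => 1 - (c x - c x0) ^ 2 / 4).
  assert (cw : cont1 w) by (unfold w; ctn).
  assert (cb : forall x, -1 <= c x <= 1) by (intros; apply COS_bound).
  assert (Hw0 : forall x, 0 <= w x <= 1).
  { intros x. unfold w. assert (h1 := cb x). assert (h2 := cb x0).
    assert (Rabs (c x - c x0) <= 2) by (apply Rabs_le; lra).
    assert ((c x - c x0) ^ 2 <= 4).
    { rewrite <- Rsqr_pow2, Rsqr_abs, Rsqr_pow2. assert (h := Rabs_pos (c x - c x0)). nra. }
    assert (h := pow2_ge_0 (c x - c x0)). lra. }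
  (* The peak function [w] is at least [r1] on the interval, where cos_1 moves by at most ka/2, and
     at most [r2] at distance [de] or more, where it moves by at least [ka]. *)
  set (r1 := 1 - ka ^ 2 / 16). set (r2 := 1 - ka ^ 2 / 4).
  assert (Hr12 : 0 <= r2 < r1) by (unfold r1, r2; split; nra).
  (* The integral of g w^n vanishes. Near [x0] it collects at least g(x0)/2 r1^n rho, elsewhere it
     loses at most M r2^n L; as r2 < r1, a large [n] contradicts g(x0) > 0. *)
  assert (Key : forall n, 0 >= g x0 / 2 * r1 ^ n * rho - M * r2 ^ n * L).
  { intros n.
    assert (Z : RInt (fun x => g x * w x ^ n) 0 L = 0).
    { assert (h := proj2 (null_peak g (c x0) n (conj cg Hz)) O). etransitivity; [| exact h]. unfold cfL.
      apply RInt_ext. intros; req. rewrite e_false0. unfold w, c. rg. }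
    assert (cgw : cont1 (fun x => g x * w x ^ n)) by ctn.
    rewrite <- (RI_chasles _ 0 a L cgw), <- (RI_chasles _ a b' L cgw) in Z.
    assert (Rp : 0 <= r2 ^ n) by (apply pow_le; lra).
    assert (Low : forall x, 0 <= x <= L -> - (M * r2 ^ n) <= g x * w x ^ n).
    { intros x Hx. destruct (Rle_dec de (Rabs (x - x0))) as [Hf | Hf].
      - assert (W : w x <= r2).
        { assert (h := Far x Hx Hf). unfold w, r2.
          assert (ka ^ 2 <= (c x - c x0) ^ 2).
          { rewrite <- (Rsqr_pow2 (c x - c x0)), Rsqr_abs, Rsqr_pow2. apply pow_incr; lra. }
          lra. }
        assert (Wn : 0 <= w x ^ n <= r2 ^ n).
        { split; [apply pow_le; apply Hw0 | apply pow_incr; split; [apply Hw0 | auto]]. }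
        assert (h := HB x Hx). apply Rabs_le_between in h. nra.
      - assert (h := Hc x ltac:(lra)). apply Rabs_def2 in h.
        assert (0 <= w x ^ n) by (apply pow_le; apply Hw0).
        assert (0 <= M * r2 ^ n) by nra.
        assert (0 <= g x * w x ^ n) by (apply Rmult_le_pos; lra). lra. }
    assert (I1 : - (M * r2 ^ n) * (a - 0) <= RInt (fun x => g x * w x ^ n) 0 a).
    { rewrite <- RI_const. apply RI_le; auto; [ctn |]. intros; apply Low; lra. }
    assert (I3 : - (M * r2 ^ n) * (L - b') <= RInt (fun x => g x * w x ^ n) b' L).
    { rewrite <- RI_const. apply RI_le; auto; [ctn |]. intros; apply Low; lra. }
    assert (I2 : (g x0 / 2 * r1 ^ n) * (b' - a) <= RInt (fun x => g x * w x ^ n) a b').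
    { rewrite <- RI_const. apply RI_le; auto; [ctn | lra |]. intros x Hx.
      assert (h := HJ x Hx). assert (h1 := Hc x ltac:(lra)). apply Rabs_def2 in h1.
      assert (h2 := Hce x ltac:(lra)).
      assert (W : r1 <= w x).
      { unfold w, r1. assert ((c x - c x0) ^ 2 <= (ka / 2) ^ 2).
        { rewrite <- (Rsqr_pow2 (c x - c x0)), Rsqr_abs, Rsqr_pow2. apply pow_incr. split; [apply Rabs_pos | lra]. }
        nra. }
      assert (Wn : 0 <= r1 ^ n <= w x ^ n) by (split; [apply pow_le; lra | apply pow_incr; lra]).
      nra. }
    assert (0 <= M * r2 ^ n) by nra.
    replace (b' - a) with rho in I2 by lra. nra. }
  assert (Hq : 0 <= r2 / r1 < 1).
  { split; [apply Rdiv_le_0_compat; lra | apply Rlt_div_l; lra]. }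
  destruct (geom_small (M * L) (r2 / r1) (g x0 / 4 * rho) Hq) as [N HN]; [nra |].
  specialize (HN N (le_n _)). specialize (Key N).
  assert (R1 : 0 < r1 ^ N) by (apply pow_lt; lra).
  unfold Rdiv in HN. rewrite Rpow_mult_distr, pow_inv in HN.
  assert (HN' : M * L * r2 ^ N <= g x0 / 4 * rho * r1 ^ N).
  { apply (Rmult_le_compat_r (r1 ^ N)) in HN; [| lra].
    replace (M * L * (r2 ^ N * / r1 ^ N) * r1 ^ N) with (M * L * r2 ^ N) in HN by (fd; lra). unfold Rdiv; lra. }
  assert (0 < g x0 * rho * r1 ^ N) by (apply Rmult_lt_0_compat; [apply Rmult_lt_0_compat |]; auto).
  set (P1 := r1 ^ N) in *. set (P2 := r2 ^ N) in *. clearbody P1 P2 rho. lra.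
Qed.
Lemma complete_cos g : cont1 g -> (forall k, cf false g k = 0) -> forall x, 0 <= x <= L -> g x = 0.
Proof.
  intros cg H x Hx.
  assert (h1 := null_nonpos g x (conj cg H) Hx).
  assert (h2 := null_nonpos (fun x => (-1) * g x) x).
  assert (N : null (fun x => (-1) * g x)).
  { split; [ctn |]. intros k. rewrite cf_scal, H by auto. rg. }
  specialize (h2 N Hx). simpl in h2. lra.
Qed.
Lemma zero_closure g : cont1 g -> (forall x, 0 < x < L -> g x = 0) -> forall x, 0 <= x <= L -> g x = 0.
Proof.
  intros cg H x Hx. destruct (Req_dec (g x) 0) as [|N]; auto. exfalso.
  destruct (cont1_eps_inv g cg x (Rabs (g x))) as [d [Hd Hc]]; [apply Rabs_pos_lt; auto |].
  set (h := Rmin d L / 2). assert (Hh : 0 < h) by (unfold h; apply Rdiv_lt_0_compat; [apply Rmin_pos |]; lra).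
  assert (h1 := Rmin_l d L). assert (h2 := Rmin_r d L).
  assert (Hy : exists y, 0 < y < L /\ Rabs (y - x) < d).
  { destruct (Rle_dec x (L / 2)).
    - exists (x + h / 2). unfold h in *. split; [lra |]. rewrite Rabs_right; lra.
    - exists (x - h / 2). unfold h in *. split; [lra |]. rewrite Rabs_left; lra. }
  destruct Hy as [y [Hy1 Hy2]]. specialize (Hc y Hy2). rewrite (H y Hy1) in Hc.
  replace (0 - g x) with (- g x) in Hc by rg. rewrite Rabs_Ropp in Hc. lra.
Qed.
(** The sine case reduces to cosines: cos_k sin_1 is a combination of sines, so g sin_1 has no
    cosine coefficients and vanishes, and sin_1 > 0 inside the interval. *)
Lemma complete b g : cont1 g -> (forall k, cf b g k = 0) -> forall x, 0 <= x <= L -> g x = 0.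
Proof.
  intros cg H. destruct b; [| apply complete_cos; auto].
  assert (c1 := e_cont true 1).
  assert (Z : forall x, 0 <= x <= L -> g x * e true 1 x = 0).
  { apply complete_cos; [ctn |]. intros k. destruct k as [| k].
    - rewrite <- (H 1%nat). unfold cfL. apply RInt_ext. intros; req. rewrite e_false0; rg.
    - assert (c2 := e_cont true (S (S k))). assert (c3 := e_cont true k).
      unfold cfL.
      rewrite (RInt_ext _ (fun x => / 2 * (g x * e true (S (S k)) x) - / 2 * (g x * e true k x))).
      + rewrite RI_minus by ctn. rewrite !RI_scal by ctn.
        change (/ 2 * cf true g (S (S k)) - / 2 * cf true g k = 0). rewrite !H. rg.
      + intros; req.
        assert (E1 : lam (S (S k)) * x = lam (S k) * x + lam 1 * x).
        { rewrite (lam_S (S (S k))), (lam_S (S k)), !S_INR. rg. }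
        assert (E2 : lam k * x = lam (S k) * x - lam 1 * x).
        { rewrite (lam_S (S k)), (lam_S k), !S_INR. rg. }
        unfold ee. rewrite E1, E2, sin_plus, sin_minus. fd. }
  apply zero_closure; auto. intros x Hx. specialize (Z x ltac:(lra)).
  apply Rmult_integral in Z. destruct Z as [|Z]; auto. exfalso.
  assert (P := lam1_pos).
  assert (0 < e true 1 x); [| lra]. unfold ee. apply sin_gt_0; [apply Rmult_lt_0_compat; lra |].
  replace PI with (lam 1 * L) by (unfold lamL; simpl; fd; lra). apply Rmult_lt_compat_l; lra.
Qed.
End Fourier.

(** * Absolutely convergent Fourier series *)

(** Absolute summability in Cauchy form: tails are bounded without naming the sum, so uniformity in
    a parameter only moves a quantifier. *)
Definition summ (a : nat -> R) : Prop := forall e, 0 < e -> exists N, forall n, (N <= n)%nat ->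
  forall m, sm (fun i => Rabs (a (n + i)%nat)) m <= e.
Definition srL (L : R) (b : bool) (a : nat -> R) (x : R) : R :=
  real (Lim_seq (fun N => tpL L b a N x)).

Lemma eq_eps x y : (forall e, 0 < e -> Rabs (x - y) <= e) -> x = y.
Proof.
  intros H. apply Rminus_diag_uniq. destruct (Req_dec (x - y) 0) as [|N]; auto. exfalso.
  assert (P := Rabs_pos_lt _ N). assert (h := H (Rabs (x - y) / 2) ltac:(lra)). lra.
Qed.
Lemma le_eps x y : (forall e, 0 < e -> x <= y + e) -> x <= y.
Proof. apply le_epsilon. Qed.
Lemma summ_of_bound a S : (forall n, sm (fun k => Rabs (a k)) n <= S) -> summ a.
Proof.
  intros H.
  destruct (ex_finite_lim_seq_incr (sm (fun k => Rabs (a k))) S) as [l Hl]; auto.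
  { intros n. simpl. assert (h := Rabs_pos (a n)). lra. }
  intros e He.
  assert (Hl' := Hl). apply is_lim_seq_spec in Hl'. destruct (Hl' (mkposreal e He)) as [N HN]. simpl in HN.
  assert (U : forall n, sm (fun k => Rabs (a k)) n <= l).
  { apply is_lim_seq_incr_compare; auto. intros n. simpl. assert (h := Rabs_pos (a n)). lra. }
  exists N. intros n Hn m.
  assert (E := sm_split (fun k => Rabs (a k)) n m).
  assert (h1 := U (n + m)%nat). assert (h2 := HN n Hn). apply Rabs_def2 in h2. lra.
Qed.

Section Series.
Variable L : R.
Hypothesis HL : 0 < L.
Local Notation lam := (lamL L).
Local Notation e := (ee L).
Local Notation cf := (cfL L).
Local Notation ck := (ckL L).
Local Notation tp := (tpL L).
Local Notation dN := (dNL L).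
Local Notation sr := (srL L).

Lemma tp_tail b a N m x :
  Rabs (tp b a (N + m) x - tp b a N x) <= 2 / L * sm (fun i => Rabs (a (N + i)%nat)) m.
Proof.
  unfold tpL. rewrite sm_split.
  match goal with |- Rabs (?u + ?v - ?u) <= _ => replace (u + v - u) with v by ring end.
  eapply Rle_trans; [apply sm_abs |]. rewrite <- sm_scal. apply sm_le. intros i _.
  rewrite !Rabs_mult. assert (h1 := e_le L b (N + i) x). assert (h2 := ck_bounds L HL (N + i)).
  assert (h3 := ck_pos L HL (N + i)). rewrite (Rabs_right (ck (N + i))) by lra.
  assert (h4 := Rabs_pos (a (N + i)%nat)). assert (h5 := Rabs_pos (e b (N + i) x)).
  apply Rle_trans with (ck (N + i) * Rabs (a (N + i)%nat) * 1).
  - apply Rmult_le_compat_l; auto. apply Rmult_le_pos; lra.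
  - rewrite Rmult_1_r. apply Rmult_le_compat_r; lra.
Qed.
Lemma sr_lim b a x : summ a -> is_lim_seq (fun N => tp b a N x) (sr b a x).
Proof.
  intros H. apply (Lim_seq_correct' (fun N => tp b a N x)). apply ex_lim_seq_cauchy_corr. intros [ep Hep]. simpl.
  destruct (H (ep * L / 5)) as [N HN].
  { assert (0 < ep * L) by (apply Rmult_lt_0_compat; auto). lra. }
  assert (Q : forall n, (N <= n)%nat -> Rabs (tp b a n x - tp b a N x) < ep / 2).
  { intros n Hn. replace n with (N + (n - N))%nat by lia.
    eapply Rle_lt_trans; [apply tp_tail |].
    assert (h := HN N (le_n _) (n - N)%nat).
    apply Rle_lt_trans with (2 / L * (ep * L / 5)).
    - apply Rmult_le_compat_l; auto. apply Rdiv_le_0_compat; lra.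
    - replace (2 / L * (ep * L / 5)) with (2 * ep / 5) by (field; lra). lra. }
  exists N. intros n m Hn Hm.
  replace (tp b a n x - tp b a m x) with ((tp b a n x - tp b a N x) - (tp b a m x - tp b a N x)) by ring.
  eapply Rle_lt_trans; [apply Rabs_triang |]. rewrite Rabs_Ropp.
  assert (h1 := Q n Hn). assert (h2 := Q m Hm). lra.
Qed.
Lemma sr_tail b a n ep x : summ a -> (forall m, sm (fun i => Rabs (a (n + i)%nat)) m <= ep) ->
  Rabs (sr b a x - tp b a n x) <= 2 / L * ep.
Proof.
  intros H Hn. assert (LS := sr_lim b a x H). apply (is_lim_seq_incr_n _ n) in LS.
  assert (L2 : is_lim_seq (fun m => Rabs (tp b a (m + n)%nat x - tp b a n x)) (Rabs (sr b a x - tp b a n x))).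
  { apply (is_lim_seq_abs (fun m => tp b a (m + n)%nat x - tp b a n x) (Finite _)).
    apply is_lim_seq_minus'; auto. apply is_lim_seq_const. }
  apply (is_lim_seq_le _ (fun _ => 2 / L * ep) _ _ ) with (3 := is_lim_seq_const _) in L2; auto.
  intros m. rewrite Nat.add_comm. eapply Rle_trans; [apply tp_tail |].
  apply Rmult_le_compat_l; auto. apply Rdiv_le_0_compat; lra.
Qed.
(** Uniform limit of continuous partial sums. The tails must be uniform over all real [t];
    coefficients known only on [0,T] are first composed with [clamp]. *)
Lemma sr_cont2 b (a : R -> nat -> R) : (forall k, cont1 (fun t => a t k)) ->
  (forall ep, 0 < ep -> exists N, forall n, (N <= n)%nat -> forall t m, sm (fun i => Rabs (a t (n + i)%nat)) m <= ep) ->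
  cont2 (fun t x => sr b (a t) x).
Proof.
  intros Ha H. apply cont2_unif. intros ep Hep.
  destruct (H (ep * L / 2)) as [N HN].
  { assert (0 < ep * L) by (apply Rmult_lt_0_compat; auto). lra. }
  exists (fun t x => tp b (a t) N x). split.
  - intros p. unfold tpL. apply (c_sm (fun k (q : R * R) => ck k * a (fst q) k * e b k (snd q))). intros k _.
    assert (c1 := e_cont L b k). assert (c2 := Ha k). ctn.
    apply (c_cont1 (fun t => a t k) fst); ctn.
  - intros t x. eapply Rle_trans.
    + apply (sr_tail b (a t) N (ep * L / 2)).
      * intros e' He'. destruct (H e' He') as [N' HN']. exists N'. intros; apply HN'; auto.
      * intros; apply HN; auto.
    + right; field; lra.
Qed.
Lemma sr_cont b a : summ a -> cont1 (sr b a).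
Proof.
  intros H. assert (K := sr_cont2 b (fun _ => a)). apply (cont1_slice (fun t x => sr b a x) 0).
  apply K; [intros; ctn |]. intros ep Hep. destruct (H ep Hep) as [N HN]. exists N; auto.
Qed.
Lemma cf_close b f g k M : cont1 f -> cont1 g -> (forall x, 0 <= x <= L -> Rabs (f x - g x) <= M) ->
  Rabs (cf b f k - cf b g k) <= M * L.
Proof.
  intros. rewrite <- cf_minus by auto. apply cf_bound; auto. ctn.
Qed.
Lemma cf_sr b a k : summ a -> (b = true -> a O = 0) -> cf b (sr b a) k = a k.
Proof.
  intros H H0. apply eq_eps. intros ep Hep.
  destruct (H (ep / 2)) as [N HN]; [lra |].
  (* The partial sum is long enough both for the tail bound and to contain the index [k]. *)
  assert (K := cf_close b (sr b a) (tp b a (N + S k)) k (2 / L * (ep / 2))).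
  rewrite cf_tp in K by auto. destruct (Compare_dec.lt_dec k (N + S k)); [| lia].
  eapply Rle_trans; [apply K |].
  - apply sr_cont; auto.
  - apply tp_cont.
  - intros x _. apply sr_tail; auto. intros; apply HN; lia.
  - right; field; lra.
Qed.
Lemma rep b g : cont1 g -> summ (cf b g) -> forall x, 0 <= x <= L -> g x = sr b (cf b g) x.
Proof.
  intros cg H x Hx. apply Rminus_diag_uniq.
  apply (complete L HL b (fun x => g x - sr b (cf b g) x)); auto.
  - assert (c := sr_cont b _ H). ctn.
  - intros k. rewrite cf_minus by (auto; apply sr_cont; auto).
    rewrite cf_sr; auto; [ring |]. intros ->. apply cf_true0; auto.
Qed.
Lemma rep_tail b g n ep x : cont1 g -> summ (cf b g) ->
  (forall m, sm (fun i => Rabs (cf b g (n + i))) m <= ep) -> 0 <= x <= L ->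
  Rabs (g x - tp b (cf b g) n x) <= 2 / L * ep.
Proof. intros. rewrite (rep b g) at 1 by auto. apply sr_tail; auto. Qed.

(** By parts, the coefficient of [h] is that of [h'] over lam_k up to sign; a product is at most
    half the sum of squares, and Bessel for [h'] and the sum of 1/k^2 bound the two halves. The
    index 0 is kept apart. *)
Lemma C1_sum b (h h' : R -> R) : (forall x, is_derive h x (h' x)) -> cont1 h' ->
  b = false \/ (h 0 = 0 /\ h L = 0) -> forall n, sm (fun k => Rabs (cf b h k)) n <=
    Rabs (cf b h 0) + / 2 * (L * RInt (fun x => h' x ^ 2) 0 L + 2 * / lam 1 ^ 2).
Proof.
  intros D ch B n.
  assert (P1 := lam1_pos L HL).
  assert (K : forall k, Rabs (cf b h (S k)) <= / 2 * (L * (ck (S k) * cf (negb b) h' (S k) ^ 2) + / lam 1 ^ 2 * / (INR k + 1) ^ 2)).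
  { intros k. assert (P := lam_pos L HL (S k) ltac:(lia)).
    assert (E := cf_ibp L HL b h h' (S k) D ch B).
    set (X := cf (negb b) h' (S k)) in *. set (Y := cf b h (S k)) in *.
    assert (EY : Rabs Y = Rabs X * / lam (S k)).
    { rewrite E, !Rabs_mult, (Rabs_right (lam (S k))) by lra.
      replace (Rabs (sg b)) with 1 by (destruct b; simpl; [rewrite Rabs_R1 | rewrite Rabs_left]; lra).
      field. lra. }
    rewrite EY.
    replace (/ lam 1 ^ 2 * / (INR k + 1) ^ 2) with ((/ lam (S k)) ^ 2).
    2:{ rewrite (lam_S L HL (S k)), S_INR. assert (h1 := pos_INR k). field. split; lra. }
    assert (LX : X ^ 2 <= L * (ck (S k) * X ^ 2)).
    { assert (q := ck_bounds L HL (S k)). assert (h2 := pow2_ge_0 X).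
      assert (L * (1 / L) <= L * ck (S k)) by (apply Rmult_le_compat_l; lra).
      replace (L * (1 / L)) with 1 in H by (field; lra). nra. }
    assert (Q := pow2_ge_0 (Rabs X - / lam (S k))).
    assert (Rabs X ^ 2 = X ^ 2) by (rewrite <- !Rsqr_pow2; symmetry; apply Rsqr_abs). nra. }
  assert (Z : 0 <= / 2 * (L * RInt (fun x => h' x ^ 2) 0 L + 2 * / lam 1 ^ 2)).
  { assert (0 <= RInt (fun x => h' x ^ 2) 0 L) by (apply RI_ge0; [ctn | lra | intros; apply pow2_ge_0]).
    assert (0 < / lam 1 ^ 2) by (apply Rinv_0_lt_compat, pow_lt; auto). nra. }
  destruct n; cbn [sm].
  - assert (h1 := Rabs_pos (cf b h 0)). lra.
  - change (sm (fun k => Rabs (cf b h k)) n + Rabs (cf b h n)) with (sm (fun k => Rabs (cf b h k)) (S n)).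
    rewrite sm_head. apply Rplus_le_compat_l.
    eapply Rle_trans; [apply sm_le; intros; apply K |].
    rewrite sm_scal, sm_plus, !sm_scal. apply Rmult_le_compat_l; [lra |].
    apply Rplus_le_compat.
    + apply Rmult_le_compat_l; [lra |].
      assert (q := bessel L HL (negb b) h' (S n) ch). rewrite sm_head in q.
      assert (0 <= ck 0 * cf (negb b) h' 0 ^ 2) by (apply Rmult_le_pos; [left; apply ck_pos; auto | apply pow2_ge_0]). lra.
    + rewrite Rmult_comm. apply Rmult_le_compat_r; [left; apply Rinv_0_lt_compat, pow_lt; auto | apply inv_sq_sum].
Qed.
Lemma C1_summ b (h h' : R -> R) : (forall x, is_derive h x (h' x)) -> cont1 h' ->
  b = false \/ (h 0 = 0 /\ h L = 0) -> summ (cf b h).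
Proof. intros. eapply summ_of_bound. apply (C1_sum b h h'); auto. Qed.

Lemma sq_sum x y : (x + y) ^ 2 <= 2 * x ^ 2 + 2 * y ^ 2.
Proof. assert (h := pow2_ge_0 (x - y)). nra. Qed.

(** A moving average makes [g] differentiable and a rational cutoff makes it vanish at both ends;
    the cutoff differs from 1 only near the ends, at small cost in L2. *)
Lemma C1_approx g ep : cont1 g -> 0 < ep -> exists h h' : R -> R, (forall x, is_derive h x (h' x)) /\ cont1 h' /\
  h 0 = 0 /\ h L = 0 /\ RInt (fun x => (g x - h x) ^ 2) 0 L <= ep.
Proof.
  intros cg Hep.
  destruct (cont1_bound g 0 (L + 1) cg) as [M [HM HB]].
  set (e1 := Rmin 1 (ep / (8 * L))).
  assert (He1 : 0 < e1) by (apply Rmin_pos; [lra | apply Rdiv_lt_0_compat; lra]).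
  assert (He1a : e1 <= 1) by apply Rmin_l.
  assert (He1b : e1 <= ep / (8 * L)) by apply Rmin_r.
  destruct (cont2_unif_mod (fun t _ => g t) 0 (L + 1) 0 0 e1) as [de [Hde HU]]; auto. { ctn. }
  set (et := Rmin 1 (de / 2)).
  assert (Het : 0 < et) by (apply Rmin_pos; lra).
  assert (Heta : et <= 1) by apply Rmin_l. assert (Hetb : et <= de / 2) by apply Rmin_r.
  set (a := Rmin (L / 2) (ep / (16 * (M ^ 2 + 1)))).
  assert (M2 : 0 <= M ^ 2) by apply pow2_ge_0.
  assert (Ha : 0 < a) by (apply Rmin_pos; [lra | apply Rdiv_lt_0_compat; lra]).
  assert (Ha1 : a <= L / 2) by apply Rmin_l.
  assert (Ha2 : a <= ep / (16 * (M ^ 2 + 1))) by apply Rmin_r.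
  assert (HaL : 0 < a * L / 2) by nra.
  (* On [a, L - a] the product x (L - x) is at least a L/2, so the cutoff defect ze / (S^2 + ze)
     integrates there to at most ep / (8 (M^2 + 1)). *)
  set (ze := (a * L / 2) ^ 2 * (ep / (8 * (M ^ 2 + 1) * L))).
  assert (Hze : 0 < ze).
  { unfold ze. apply Rmult_lt_0_compat; [apply pow_lt; auto |]. apply Rdiv_lt_0_compat; auto. nra. }
  set (Ga := fun x => RInt g 0 x).
  assert (DGa : forall x, is_derive Ga x (g x)) by (intros; apply RI_derive; auto).
  set (h0 := fun x => / et * (Ga (x + et) - Ga x)).
  set (h0' := fun x => / et * (g (x + et) - g x)).
  assert (Dh0 : forall x, is_derive h0 x (h0' x)).
  { intros x. unfold h0, h0'. apply (is_derive_scal (fun x => Ga (x + et) - Ga x)).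
    apply (is_derive_minus (fun x => Ga (x + et)) Ga); auto.
    evar_last. { apply (is_derive_comp Ga (fun x => x + et)); [apply DGa | auto_derive; [trivial | reflexivity]]. }
    unfold scal; simpl; unfold mult; simpl. ring. }
  assert (ch0' : cont1 h0') by (unfold h0'; ctn).
  assert (ch0 : cont1 h0) by (apply (cont1_derive _ h0'); auto).
  assert (Eh0 : forall x, h0 x = / et * RInt g x (x + et)).
  { intros x. unfold h0, Ga. rewrite <- (RI_chasles g 0 x (x + et)) by auto. ring. }
  set (S := fun x => x * (L - x)).
  set (ka := fun x => S x ^ 2 / (S x ^ 2 + ze)).
  set (ka' := fun x => 2 * S x * (L - 2 * x) * ze * / (S x ^ 2 + ze) ^ 2).
  assert (Pd : forall x, 0 < S x ^ 2 + ze) by (intros; assert (h := pow2_ge_0 (S x)); lra).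
  assert (Dka : forall x, is_derive ka x (ka' x)).
  { intros x. assert (h := Pd x). unfold ka, ka', S in *. auto_derive; [lra |]. field. lra. }
  assert (cka' : cont1 ka').
  { unfold ka'. intros x. apply c_mult; [unfold S; ctn |].
    apply (continuous_Rinv_comp (fun x => (S x ^ 2 + ze) ^ 2)); [unfold S; ctn |].
    apply Rgt_not_eq, pow_lt, Pd. }
  assert (cka : cont1 ka) by (apply (cont1_derive _ ka'); auto).
  exists (fun x => ka x * h0 x), (fun x => ka' x * h0 x + ka x * h0' x). split; [| split; [| split; [| split]]].
  - intros x. apply (is_derive_mult ka h0); auto. intros; apply Rmult_comm.
  - ctn.
  - unfold ka, S. field. lra.
  - unfold ka, S. field. lra.
  - assert (k01 : forall x, 0 <= 1 - ka x <= 1 /\ 1 - ka x = ze / (S x ^ 2 + ze)).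
    { intros x. assert (h := Pd x). assert (E : 1 - ka x = ze / (S x ^ 2 + ze)) by (unfold ka; field; lra).
      rewrite E. split; [| auto]. split; [apply Rdiv_le_0_compat; lra |].
      apply Rle_div_l; [lra |]. assert (h2 := pow2_ge_0 (S x)); lra. }
    assert (Bh0 : forall x, 0 <= x <= L -> Rabs (h0 x) <= M /\ Rabs (g x - h0 x) <= e1).
    { intros x Hx. assert (ie : 0 < / et) by (apply Rinv_0_lt_compat; auto). split.
      - rewrite Eh0, Rabs_mult, (Rabs_right (/ et)) by lra.
        apply Rle_trans with (/ et * (M * (x + et - x))); [| right; field; lra].
        apply Rmult_le_compat_l; [lra |]. apply RI_abs_ub; auto; [lra |]. intros; apply HB; lra.
      - replace (g x - h0 x) with (- (/ et * RInt (fun y => g y - g x) x (x + et))).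
        2:{ rewrite RI_minus by ctn. rewrite RI_const, Eh0. field. lra. }
        rewrite Rabs_Ropp, Rabs_mult, (Rabs_right (/ et)) by lra.
        apply Rle_trans with (/ et * (e1 * (x + et - x))); [| right; field; lra].
        apply Rmult_le_compat_l; [lra |]. apply RI_abs_ub; [ctn | lra |]. intros y Hy.
        left. apply (HU x 0 y 0); try lra; [rewrite Rabs_right; lra | rewrite Rminus_diag_eq, Rabs_R0; auto]. }
    assert (Ik : RInt (fun x => 1 - ka x) 0 L <= 2 * a + L * (ze / (a * L / 2) ^ 2)).
    { assert (c1k : cont1 (fun x => 1 - ka x)) by ctn.
      rewrite <- (RI_chasles _ 0 a L c1k), <- (RI_chasles _ a (L - a) L c1k).
      assert (I1 : RInt (fun x => 1 - ka x) 0 a <= 1 * (a - 0)) by (apply RI_ub; auto; [lra | intros; apply k01]).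
      assert (I3 : RInt (fun x => 1 - ka x) (L - a) L <= 1 * (L - (L - a))) by (apply RI_ub; auto; [lra | intros; apply k01]).
      assert (I2 : RInt (fun x => 1 - ka x) a (L - a) <= ze / (a * L / 2) ^ 2 * (L - a - a)).
      { apply RI_ub; auto; [lra |]. intros x Hx. rewrite (proj2 (k01 x)).
        assert (a * L / 2 <= S x) by (unfold S; nra).
        apply Rmult_le_compat_l; [lra |]. apply Rinv_le_contravar; [apply pow_lt; auto |].
        assert ((a * L / 2) ^ 2 <= S x ^ 2) by (apply pow_incr; lra). lra. }
      assert (0 <= ze / (a * L / 2) ^ 2) by (apply Rdiv_le_0_compat; [lra | apply pow_lt; auto]). nra. }
    apply Rle_trans with (RInt (fun x => 2 * e1 + 2 * M ^ 2 * (1 - ka x)) 0 L).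
    + apply RI_le; [ctn | ctn | lra |]. intros x Hx.
      destruct (Bh0 x Hx) as [B1 B2]. destruct (k01 x) as [K1 _].
      replace (g x - ka x * h0 x) with ((g x - h0 x) + (1 - ka x) * h0 x) by ring.
      eapply Rle_trans; [apply sq_sum |].
      assert (Q1 : (g x - h0 x) ^ 2 <= e1).
      { rewrite <- Rsqr_pow2, Rsqr_abs, Rsqr_pow2. assert (h := Rabs_pos (g x - h0 x)). nra. }
      assert (Q2 : (h0 x) ^ 2 <= M ^ 2).
      { rewrite <- (Rsqr_pow2 (h0 x)), Rsqr_abs, Rsqr_pow2. apply pow_incr. split; [apply Rabs_pos | auto]. }
      assert (Q3 : ((1 - ka x) * h0 x) ^ 2 <= M ^ 2 * (1 - ka x)).
      { rewrite Rpow_mult_distr. assert ((1 - ka x) ^ 2 <= 1 - ka x) by nra.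
        assert (h := pow2_ge_0 (h0 x)). assert (h2 := pow2_ge_0 (1 - ka x)). nra. }
      lra.
    + rewrite RI_plus by ctn. rewrite RI_const. rewrite RI_scal by ctn.
      assert (E : L * (ze / (a * L / 2) ^ 2) = ep / (8 * (M ^ 2 + 1))).
      { unfold ze. field. repeat split; try lra; nra. }
      rewrite E in Ik.
      assert (T1 : 2 * e1 * (L - 0) <= ep / 4).
      { replace (ep / 4) with (2 * (ep / (8 * L)) * L) by (field; lra). nra. }
      assert (T2 : M ^ 2 * a <= ep / 16).
      { apply Rle_trans with ((M ^ 2 + 1) * (ep / (16 * (M ^ 2 + 1)))); [nra | right; field; lra]. }
      assert (T3 : M ^ 2 * (ep / (8 * (M ^ 2 + 1))) <= ep / 8).
      { apply Rle_trans with ((M ^ 2 + 1) * (ep / (8 * (M ^ 2 + 1)))); [| right; field; lra].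
        apply Rmult_le_compat_r; [apply Rdiv_le_0_compat; lra | lra]. }
      assert (2 * M ^ 2 * RInt (fun x => 1 - ka x) 0 L <= 2 * M ^ 2 * (2 * a + ep / (8 * (M ^ 2 + 1)))) by
        (apply Rmult_le_compat_l; lra).
      lra.
Qed.

(** By minimality [g] may be compared with the partial sums of its C1 approximation, which converge
    uniformly. *)
Lemma l2conv b g ep : cont1 g -> 0 < ep -> exists N, forall n, (N <= n)%nat -> dN b g n <= ep.
Proof.
  intros cg Hep.
  destruct (C1_approx g (ep / 4) cg ltac:(lra)) as [h [h' [D [ch' [h0 [hL HI]]]]]].
  assert (ch : cont1 h) by (apply (cont1_derive _ h'); auto).
  assert (HS := C1_summ b h h' D ch' (or_intror (conj h0 hL))).
  set (de := Rmin 1 (ep / (4 * L))).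
  assert (Hde : 0 < de) by (apply Rmin_pos; [lra | apply Rdiv_lt_0_compat; lra]).
  assert (Hd1 : de <= 1) by apply Rmin_l. assert (Hd2 : de <= ep / (4 * L)) by apply Rmin_r.
  destruct (HS (de * L / 2)) as [N HN]. { assert (0 < de * L) by (apply Rmult_lt_0_compat; auto). lra. }
  exists N. intros n Hn.
  assert (ct := tp_cont L b (cf b h) n).
  eapply Rle_trans; [apply (dN_best L HL b g (cf b h)); auto; intros ->; apply cf_true0; auto |].
  apply Rle_trans with (RInt (fun x => 2 * (g x - h x) ^ 2 + 2 * de) 0 L).
  - apply RI_le; [ctn | ctn | lra |]. intros x Hx.
    replace (g x - tp b (cf b h) n x) with ((g x - h x) + (h x - tp b (cf b h) n x)) by ring.
    eapply Rle_trans; [apply sq_sum |]. apply Rplus_le_compat_l.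
    assert (T := rep_tail b h n (de * L / 2) x ch HS (fun m => HN n Hn m) Hx).
    replace (2 / L * (de * L / 2)) with de in T by (field; lra).
    assert (Q1 : (h x - tp b (cf b h) n x) ^ 2 <= de).
    { rewrite <- Rsqr_pow2, Rsqr_abs, Rsqr_pow2. assert (q := Rabs_pos (h x - tp b (cf b h) n x)). nra. }
    lra.
  - rewrite RI_plus by ctn. rewrite RI_const. rewrite RI_scal by ctn.
    assert (2 * de * (L - 0) <= ep / 2).
    { replace (ep / 2) with (2 * (ep / (4 * L)) * L) by (field; lra). nra. }
    lra.
Qed.
Lemma parseval_le b g B : cont1 g -> (forall N, sm (fun k => ck k * cf b g k ^ 2) N <= B) ->
  RInt (fun x => g x ^ 2) 0 L <= B.
Proof.
  intros cg H. apply le_eps. intros ep Hep. destruct (l2conv b g ep cg Hep) as [N HN].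
  specialize (HN N (le_n _)). unfold dNL in HN. assert (h := H N). lra.
Qed.
(** The error is the scalar product of [g] with the remainder of [f], so Cauchy-Schwarz needs
    approximation of [f] alone. *)
Lemma ip_err b f g n : cont1 f -> cont1 g ->
  (RInt (fun x => f x * g x) 0 L - sm (fun k => ck k * cf b f k * cf b g k) n) ^ 2
    <= dN b f n * RInt (fun x => g x ^ 2) 0 L.
Proof.
  intros cf' cg. assert (ct := tp_cont L b (cf b f) n).
  rewrite <- (ip_tp L b g (cf b f) n cg), <- RI_minus by ctn.
  rewrite (RInt_ext _ (fun x => (f x - tp b (cf b f) n x) * g x)) by (intros; req; ring).
  rewrite (dN_dist L HL b f n cf'). apply RI_cs; [ctn | ctn | lra].
Qed.

(** Compactness in time: one [N] serves a finite net of times, and at a nearby time minimality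
    allows the partial sum of the net point to be reused. *)
Lemma l2unif b f T ep : cont2 f -> 0 <= T -> 0 < ep ->
  exists N, forall n, (N <= n)%nat -> forall t, 0 <= t <= T -> dN b (f t) n <= ep.
Proof.
  intros cf2 HT Hep.
  set (d0 := Rmin 1 (ep / (8 * L))).
  assert (Hd0 : 0 < d0) by (apply Rmin_pos; [lra | apply Rdiv_lt_0_compat; lra]).
  assert (Hd1 : d0 <= 1) by apply Rmin_l. assert (Hd2 : d0 <= ep / (8 * L)) by apply Rmin_r.
  destruct (cont2_unif_mod f 0 T 0 L d0 cf2 Hd0) as [de [Hde HU]].
  destruct (archimed_cor1 (de / (T + 1))) as [M [HM HM0]]; [apply Rdiv_lt_0_compat; lra |].
  assert (HMp : 0 < INR M) by (apply lt_0_INR; lia).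
  (* Common rank for the first net points, by adding the ranks one at a time. *)
  assert (Net : forall j, exists N, forall i, (i <= j)%nat -> forall n, (N <= n)%nat -> dN b (f (INR i * (T / INR M))) n <= ep / 4).
  { induction j as [| j [N IH]].
    - destruct (l2conv b (f (INR 0 * (T / INR M))) (ep / 4)) as [N HN]; [ctn | lra |].
      exists N. intros i Hi. replace i with O by lia. auto.
    - destruct (l2conv b (f (INR (S j) * (T / INR M))) (ep / 4)) as [N' HN']; [ctn | lra |].
      exists (N + N')%nat. intros i Hi n Hn. destruct (Nat.eq_dec i (S j)) as [-> |].
      + apply HN'; lia.
      + apply IH; lia. }
  destruct (Net M) as [N HN]. exists N. intros n Hn t Ht.
  assert (Near : exists i, (i <= M)%nat /\ 0 <= INR i * (T / INR M) <= T /\ Rabs (t - INR i * (T / INR M)) < de).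
  { assert (St : forall j, (j <= M)%nat -> t <= INR j * (T / INR M) ->
       exists i, (i <= M)%nat /\ 0 <= INR i * (T / INR M) <= T /\ Rabs (t - INR i * (T / INR M)) < de).
    { assert (TM : 0 <= T / INR M) by (apply Rdiv_le_0_compat; lra).
      assert (TM2 : T / INR M < de).
      { unfold Rdiv. apply Rle_lt_trans with ((T + 1) * / INR M).
        - apply Rmult_le_compat_r; [left; apply Rinv_0_lt_compat |]; lra.
        - apply (Rmult_lt_compat_l (T + 1)) in HM; [| lra].
          replace ((T + 1) * (de / (T + 1))) with de in HM by (field; lra). auto. }
      assert (Rg : forall i, (i <= M)%nat -> 0 <= INR i * (T / INR M) <= T).
      { intros i Hi. assert (h1 := pos_INR i). assert (h2 : INR i <= INR M) by (apply le_INR; auto).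
        split; [apply Rmult_le_pos; auto |].
        apply Rle_trans with (INR M * (T / INR M)); [apply Rmult_le_compat_r; auto | right; field; lra]. }
      induction j; intros Hj Hle.
      - exists O. repeat split; try apply Rg; try lia. simpl in *. rewrite Rmult_0_l in *.
        replace t with 0 by lra. rewrite Rminus_0_r, Rabs_R0. auto.
      - destruct (Rle_dec t (INR j * (T / INR M))) as [Hc | Hc]; [apply IHj; auto; lia |].
        exists (S j). repeat split; try apply Rg; auto. rewrite S_INR in *.
        rewrite Rabs_left1; nra. }
    apply (St M); auto. replace (INR M * (T / INR M)) with T by (field; lra). lra. }
  destruct Near as [i [Hi [Hr Hd]]]. set (s := INR i * (T / INR M)) in *.
  assert (c1 : cont1 (f t)) by ctn. assert (c2 : cont1 (f s)) by ctn.
  assert (ct := tp_cont L b (cf b (f s)) n).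
  eapply Rle_trans; [apply (dN_best L HL b (f t) (cf b (f s))); auto; intros ->; apply cf_true0; auto |].
  apply Rle_trans with (RInt (fun x => 2 * d0 + 2 * (f s x - tp b (cf b (f s)) n x) ^ 2) 0 L).
  - apply RI_le; [ctn | ctn | lra |]. intros x Hx.
    replace (f t x - tp b (cf b (f s)) n x) with ((f t x - f s x) + (f s x - tp b (cf b (f s)) n x)) by ring.
    eapply Rle_trans; [apply sq_sum |]. apply Rplus_le_compat_r.
    assert (Q := HU s x t x Hr Hx Ht Hx Hd ltac:(rewrite Rminus_diag_eq, Rabs_R0; auto)).
    assert (Q1 : (f t x - f s x) ^ 2 <= d0).
    { rewrite <- Rsqr_pow2, Rsqr_abs, Rsqr_pow2. assert (q := Rabs_pos (f t x - f s x)). nra. }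
    lra.
  - rewrite RI_plus by ctn. rewrite RI_const. rewrite RI_scal by ctn.
    rewrite <- (dN_dist L HL b (f s) n c2). assert (h := HN i Hi n Hn). fold s in h.
    assert (2 * d0 * (L - 0) <= ep / 4).
    { replace (ep / 4) with (2 * (ep / (8 * L)) * L) by (field; lra). nra. }
    lra.
Qed.
Lemma ip_unif b f g T ep : cont2 f -> cont2 g -> 0 <= T -> 0 < ep ->
  exists N, forall n, (N <= n)%nat -> forall t, 0 <= t <= T ->
  Rabs (RInt (fun x => f t x * g t x) 0 L - sm (fun k => ck k * cf b (f t) k * cf b (g t) k) n) <= ep.
Proof.
  intros c1 c2 HT Hep. destruct (cont2_bound g 0 T 0 L c2) as [M [HM HB]].
  destruct (l2unif b f T (ep ^ 2 / (M ^ 2 * L)) c1 HT) as [N HN].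
  { apply Rdiv_lt_0_compat; [apply pow_lt; auto | apply Rmult_lt_0_compat; auto; apply pow_lt; auto]. }
  exists N. intros n Hn t Ht. assert (c1t : cont1 (f t)) by ctn. assert (c2t : cont1 (g t)) by ctn.
  assert (K := ip_err b (f t) (g t) n c1t c2t).
  assert (I : RInt (fun x => g t x ^ 2) 0 L <= M ^ 2 * (L - 0)).
  { apply RI_ub; [ctn | lra |]. intros x Hx. rewrite <- (Rsqr_pow2 (g t x)), Rsqr_abs, Rsqr_pow2.
    apply pow_incr. split; [apply Rabs_pos | apply HB; auto]. }
  assert (h := HN n Hn t Ht). assert (d0 := dN_ge0 L HL b (f t) n c1t).
  assert (M2 : 0 < M ^ 2) by (apply pow_lt; auto).
  assert (K2 : dN b (f t) n * RInt (fun x => g t x ^ 2) 0 L <= ep ^ 2).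
  { apply Rle_trans with (ep ^ 2 / (M ^ 2 * L) * (M ^ 2 * (L - 0))); [| right; field; split; lra].
    apply Rmult_le_compat; auto. apply RI_ge0; [ctn | lra | intros; apply pow2_ge_0]. }
  apply Rsqr_incr_0_var; [| lra]. rewrite <- Rsqr_abs, !Rsqr_pow2. lra.
Qed.
End Series.

(** * The heat equation in Fourier coefficients *)

Ltac pos := match goal with
  | |- 0 < _ * _ => apply Rmult_lt_0_compat; pos
  | |- 0 < _ ^ _ => apply pow_lt; pos
  | |- 0 < Rpower _ _ => apply Rpower_pos
  | |- 0 < exp _ => apply exp_pos
  | |- 0 < / _ => apply Rinv_0_lt_compat; pos
  | |- 0 < _ / _ => apply Rdiv_lt_0_compat; pos
  | |- 0 < sqrt _ => apply sqrt_lt_R0; pos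
  | |- 0 <= _ * _ => apply Rmult_le_pos; pos
  | |- 0 <= _ ^ 2 => apply pow2_ge_0
  | |- 0 <= Rpower _ _ => left; apply Rpower_pos
  | |- 0 <= exp _ => left; apply exp_pos
  | |- 0 <= Rabs _ => apply Rabs_pos
  | |- 0 <= sqrt _ => apply sqrt_pos
  | |- 0 <= INR _ => apply pos_INR
  | |- 0 <= _ / _ => apply Rdiv_le_0_compat; pos
  | |- 0 <= _ ^ _ => apply pow_le; pos
  | |- 0 <= / _ => left; apply Rinv_0_lt_compat; pos
  | |- 0 <= _ + _ => first [lra | apply Rplus_le_le_0_compat; pos]
  | _ => first [assumption | lra]
  end.

Definition clamp (T t : R) : R := Rmax 0 (Rmin t T).
Lemma clamp_in T t : 0 <= T -> 0 <= clamp T t <= T.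
Proof. intros. unfold clamp, Rmax, Rmin. destruct (Rle_dec t T); destruct (Rle_dec 0 _); lra. Qed.
Lemma clamp_id T t : 0 <= t <= T -> clamp T t = t.
Proof. intros. unfold clamp, Rmax, Rmin. destruct (Rle_dec t T); destruct (Rle_dec 0 _); lra. Qed.
Lemma cont1_clamp T : cont1 (clamp T).
Proof. unfold clamp. ctn. Qed.

Lemma variation_of_constants (y r : R -> R) m s t : s <= t -> cont1 r ->
  (forall x, s <= x <= t -> is_derive y x (- m * y x + r x)) ->
  y t = exp (- m * (t - s)) * y s + RInt (fun x => exp (- m * (t - x)) * r x) s t.
Proof.
  intros Hst cr D.
  rewrite (RI_ftc_seg (fun x => exp (- m * (t - x)) * y x)); auto.
  - replace (- m * (t - t)) with 0 by ring. rewrite exp_0. ring.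
  - intros x Hx. evar_last.
    + apply (is_derive_mult (fun x => exp (- m * (t - x))) y).
      * auto_derive; [trivial | reflexivity].
      * apply D; auto.
      * intros; apply Rmult_comm.
    + unfold plus, mult; simpl. unfold mult; simpl. unfold Rminus. ring.
  - intros x Hx. ctn.
Qed.

(** Solution of the scalar equation w_k' = -(nu lam_k^2 + rho) w_k + lam_k phi_k with initial value
    a_k, where phi_k is taken in the opposite parity. The sign is the same in both parities, so the
    source is -phi_x for sines and +phi_x for cosines. *)
Definition wkL (L : R) (b : bool) (nu rho : R) (a : nat -> R) (phi : R -> R -> R) (k : nat) (t : R) : R :=
  exp (- (nu * lamL L k ^ 2 + rho) * t) *
  (a k + lamL L k * RInt (fun s => exp ((nu * lamL L k ^ 2 + rho) * s) * cfL L (negb b) (phi s) k) 0 t).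

(* [w] solves [w_t = nu w_xx - rho w +- phi_x] (Dirichlet for parity [true], zero flux for
   parity [false]) in the sense of Fourier coefficients, with initial coefficients [a]. *)
Definition hs (L : R) (b : bool) (nu rho T : R) (a : nat -> R) (phi w : R -> R -> R) : Prop :=
  cont2 phi /\ cont2 w /\
  (forall t k, 0 <= t <= T -> cfL L b (w t) k = wkL L b nu rho a phi k t) /\
  (forall ep, 0 < ep -> exists N, forall n, (N <= n)%nat -> forall t, 0 <= t <= T ->
     forall m, sm (fun i => Rabs (cfL L b (w t) (n + i))) m <= ep).

Section Heat.
Variables L nu rho T : R.
Hypothesis HL : 0 < L.
Hypothesis Hnu : 0 < nu.
Hypothesis Hrho : 0 <= rho.
Hypothesis HT : 0 < T.
Local Notation lam := (lamL L).
Local Notation e := (ee L).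
Local Notation cf := (cfL L).
Local Notation ck := (ckL L).
Local Notation mu k := (nu * lam k ^ 2 + rho).
Local Notation wk b := (wkL L b nu rho).

Lemma mu_ge0 k : 0 <= mu k.
Proof. assert (h := pow2_ge_0 (lam k)). nra. Qed.
Lemma phik_cont b phi k : cont2 phi -> cont1 (fun s => cf b (phi s) k).
Proof.
  intros c. unfold cfL. assert (ce := e_cont L b k).
  apply (RI_param_cont (fun s x => phi s x * e b k x)). ctn.
Qed.
Lemma wk_derive b a phi k t : cont2 phi ->
  is_derive (wk b a phi k) t (- mu k * wk b a phi k t + lam k * cf (negb b) (phi t) k).
Proof.
  intros c. assert (cp := phik_cont (negb b) phi k c).
  assert (D := RI_derive (fun s => exp (mu k * s) * cf (negb b) (phi s) k) 0 t ltac:(ctn)).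
  unfold wkL.
  evar_last.
  - apply (is_derive_mult (fun t => exp (- mu k * t))
      (fun t => a k + lam k * RInt (fun s => exp (mu k * s) * cf (negb b) (phi s) k) 0 t)).
    + auto_derive; [trivial | reflexivity].
    + apply (is_derive_plus (fun _ => a k)); [apply is_derive_const |].
      apply (is_derive_scal (fun t => RInt (fun s => exp (mu k * s) * cf (negb b) (phi s) k) 0 t)). exact D.
    + intros; apply Rmult_comm.
  - unfold plus, mult, zero; simpl; unfold mult; simpl.
    set (X := RInt (fun s => exp ((nu * (lam k * (lam k * 1)) + rho) * s) * cf (negb b) (phi s) k) 0 t).
    assert (E : exp (- (nu * (lam k * (lam k * 1)) + rho) * t) * exp ((nu * (lam k * (lam k * 1)) + rho) * t) = 1).
    { rewrite <- exp_plus, <- exp_0. f_equal. ring. }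
    set (Y := exp (- (nu * (lam k * (lam k * 1)) + rho) * t)) in *.
    set (Z := exp ((nu * (lam k * (lam k * 1)) + rho) * t)) in *.
    transitivity (- (nu * (lam k * (lam k * 1)) + rho) * (Y * (a k + lam k * X)) + (Y * Z) * (lam k * cf (negb b) (phi t) k)).
    + ring.
    + rewrite E. ring.
Qed.
Lemma wk_cont b a phi k : cont2 phi -> cont1 (wk b a phi k).
Proof. intros c. eapply cont1_derive. intros; apply wk_derive; auto. Qed.
Lemma wk_0 b a phi k : wk b a phi k 0 = a k.
Proof. unfold wkL. rewrite RI_point, Rmult_0_r, exp_0. rg. Qed.
Lemma wk_restart b a phi k s t : cont2 phi -> s <= t ->
  wk b a phi k t = exp (- mu k * (t - s)) * wk b a phi k s
    + lam k * RInt (fun r => exp (- mu k * (t - r)) * cf (negb b) (phi r) k) s t.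
Proof.
  intros c Hst. assert (cp := phik_cont (negb b) phi k c).
  rewrite (variation_of_constants (wk b a phi k) (fun r => lam k * cf (negb b) (phi r) k) (mu k) s t Hst).
  - rewrite <- RI_scal by ctn. f_equal. apply RInt_ext. intros; req; ring.
  - ctn.
  - intros; apply wk_derive; auto.
Qed.
Lemma wk_form b a phi k t : cont2 phi -> 0 <= t ->
  wk b a phi k t = exp (- mu k * t) * a k
    + lam k * RInt (fun r => exp (- mu k * (t - r)) * cf (negb b) (phi r) k) 0 t.
Proof. intros. rewrite (wk_restart b a phi k 0 t), wk_0, Rminus_0_r by auto. auto. Qed.
Lemma wk_true0 a phi t : a O = 0 -> wk true a phi 0 t = 0.
Proof. intros E. unfold wkL. rewrite lam0, E by auto. ring. Qed.

Lemma sqrt_Rpower x y : 0 < x -> sqrt (Rpower x y) = Rpower x (y / 2).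
Proof.
  intros. rewrite <- Rpower_sqrt by apply Rpower_pos. rewrite Rpower_mult. f_equal.
Qed.
Lemma cf_sq_sum b g n m : cont1 g ->
  sm (fun i => cf b g (n + i) ^ 2) m <= L * RInt (fun x => g x ^ 2) 0 L.
Proof.
  intros cg.
  apply Rle_trans with (L * sm (fun k => ck k * cf b g k ^ 2) (n + m)).
  - rewrite sm_split, <- Rmult_1_l, Rmult_plus_distr_l.
    assert (0 <= L * sm (fun k => ck k * cf b g k ^ 2) n).
    { apply Rmult_le_pos; [lra |]. apply sm_ge0. intros; apply Rmult_le_pos; [left; apply ck_pos; auto | apply pow2_ge_0]. }
    rewrite <- (sm_scal L (fun i => ck (n + i) * cf b g (n + i) ^ 2)).
    assert (sm (fun i => cf b g (n + i) ^ 2) m <= sm (fun k => L * (ck (n + k) * cf b g (n + k) ^ 2)) m).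
    { apply sm_le. intros i _. assert (h := ck_bounds L HL (n + i)). assert (h2 := pow2_ge_0 (cf b g (n + i))).
      assert (L * (1 / L) <= L * ck (n + i)) by (apply Rmult_le_compat_l; lra).
      replace (L * (1 / L)) with 1 in H0 by (field; lra). nra. }
    lra.
  - apply Rmult_le_compat_l; [lra |]. apply bessel; auto.
Qed.
(** Cauchy-Schwarz between multiplier and coefficients. With q = j + 5/8, the decay exp(-y) <= C
    y^(-q) at y = 2 nu lam^2 si turns the squared multiplier into lam^(2j - 2q) = lam^(-5/4) times
    si^(-q). The tail n^(-1/4) and si^(-q) then appear under a square root. *)
Lemma ksum (j : nat) : exists C, 0 < C /\ forall b g n m si, cont1 g -> (1 <= n)%nat -> 0 < si ->
  sm (fun i => Rabs (lam (n + i) ^ j * exp (- (nu * lam (n + i) ^ 2) * si) * cf b g (n + i))) m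
   <= C * Rpower (INR n) (- (1 / 8)) * Rpower si (- (INR j / 2 + 5 / 16)) * sqrt (RInt (fun x => g x ^ 2) 0 L).
Proof.
  set (q := INR j + 5 / 8).
  assert (Hq : 0 < q) by (unfold q; assert (h := pos_INR j); lra).
  destruct (Rpower_exp_bound q Hq) as [C0 [HC0 HE]].
  assert (P1 := lam1_pos L HL).
  set (C1 := C0 * Rpower (2 * nu) (- q) * Rpower (lam 1) (- (5 / 4))).
  assert (HC1 : 0 < C1) by (unfold C1; pos).
  exists (sqrt (5 * C1) * sqrt L). split.
  { apply Rmult_lt_0_compat; apply sqrt_lt_R0; lra. }
  intros b g n m si cg Hn Hsi.
  assert (Hn1 : 1 <= INR n) by (apply (le_INR 1); auto).
  eapply Rle_trans; [apply (sm_cs_sqrt (fun i => lam (n + i) ^ j * exp (- (nu * lam (n + i) ^ 2) * si)) (fun i => cf b g (n + i))) |].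
  assert (B2 : sqrt (sm (fun i => cf b g (n + i) ^ 2) m) <= sqrt L * sqrt (RInt (fun x => g x ^ 2) 0 L)).
  { rewrite <- sqrt_mult; [apply sqrt_le_1_alt, cf_sq_sum; auto | lra |].
    apply RI_ge0; [ctn | lra | intros; apply pow2_ge_0]. }
  assert (B1 : sqrt (sm (fun i => (lam (n + i) ^ j * exp (- (nu * lam (n + i) ^ 2) * si)) ^ 2) m)
      <= sqrt (5 * C1) * Rpower (INR n) (- (1/8)) * Rpower si (- (INR j / 2 + 5 / 16))).
  { apply Rle_trans with (sqrt (5 * C1 * Rpower (INR n) (- (1/4)) * Rpower si (- q))).
    - apply sqrt_le_1_alt.
      apply Rle_trans with (C1 * Rpower si (- q) * sm (fun i => qk (n + i)) m).
      + rewrite <- sm_scal. apply sm_le. intros i _.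
        set (k := (n + i)%nat). assert (Hk : 1 <= INR k) by (apply (le_INR 1); unfold k; lia).
        assert (Pk : 0 < lam k) by (apply lam_pos; auto; unfold k; lia).
        rewrite Rpow_mult_distr, <- pow_mult.
        replace (exp (- (nu * lam k ^ 2) * si) ^ 2) with (exp (- (2 * nu * lam k ^ 2 * si))).
        2:{ rewrite <- (Rsqr_pow2 (exp _)). unfold Rsqr. rewrite <- exp_plus. f_equal. ring. }
        assert (Y : 0 < 2 * nu * lam k ^ 2 * si) by pos.
        apply Rle_trans with (lam k ^ (j * 2) * (C0 * Rpower (2 * nu * lam k ^ 2 * si) (- q))).
        { apply Rmult_le_compat_l; [apply pow_le; lra | apply HE; auto]. }
        right.
        rewrite <- (Rpower_pow (j * 2)), mult_INR by auto.
        rewrite <- Rpower_mult_distr; [| pos | auto].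
        rewrite <- Rpower_mult_distr; [| lra | apply pow_lt; auto].
        rewrite <- (Rpower_pow 2) by auto. rewrite Rpower_mult.
        unfold qk, C1. rewrite (lam_S L HL k). rewrite <- !Rpower_mult_distr by lra.
        replace (INR j * INR 2) with (2 * INR j) by (simpl; ring).
        replace (INR 2 * - q) with (- (5/4) - 2 * INR j) by (unfold q; simpl; field).
        replace (Rpower (INR k) (- (5 / 4))) with (Rpower (INR k) (2 * INR j) * Rpower (INR k) (- (5/4) - 2 * INR j)).
        2:{ rewrite <- Rpower_plus. f_equal. ring. }
        replace (Rpower (lam 1) (- (5 / 4))) with (Rpower (lam 1) (2 * INR j) * Rpower (lam 1) (- (5/4) - 2 * INR j)).
        2:{ rewrite <- Rpower_plus. f_equal. ring. }
        ring.
      + replace (5 * C1 * Rpower (INR n) (- (1/4)) * Rpower si (- q)) with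
          (C1 * Rpower si (- q) * (5 * Rpower (INR n) (- (1/4)))) by ring.
        apply Rmult_le_compat_l; [| apply qk_tail; auto].
        apply Rmult_le_pos; [lra | left; apply Rpower_pos].
    - right. rewrite sqrt_mult; [| apply Rmult_le_pos; [lra | left; apply Rpower_pos] | left; apply Rpower_pos].
      rewrite sqrt_mult; [| lra | left; apply Rpower_pos].
      rewrite !sqrt_Rpower by lra. f_equal; [f_equal; f_equal; lra | f_equal; unfold q; field]. }
  apply Rle_trans with ((sqrt (5 * C1) * Rpower (INR n) (- (1/8)) * Rpower si (- (INR j / 2 + 5 / 16)))
      * (sqrt L * sqrt (RInt (fun x => g x ^ 2) 0 L))).
  - apply Rmult_le_compat; auto; apply sqrt_pos.
  - right; ring.
Qed.

Lemma RInt_sq_le (g : R -> R) M : cont1 g -> (forall x, 0 <= x <= L -> Rabs (g x) <= M) ->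
  RInt (fun x => g x ^ 2) 0 L <= M ^ 2 * L.
Proof.
  intros c H. replace (M ^ 2 * L) with (M ^ 2 * (L - 0)) by ring. apply RI_ub; [ctn | lra |].
  intros x Hx. rewrite <- (Rsqr_pow2 (g x)), Rsqr_abs, Rsqr_pow2. apply pow_incr.
  split; [apply Rabs_pos | auto].
Qed.
Lemma sqrt_sq_le (g : R -> R) M : cont1 g -> 0 <= M -> (forall x, 0 <= x <= L -> Rabs (g x) <= M) ->
  sqrt (RInt (fun x => g x ^ 2) 0 L) <= M * sqrt L.
Proof.
  intros c HM H. replace (M * sqrt L) with (sqrt (M ^ 2 * L)).
  - apply sqrt_le_1_alt, RInt_sq_le; auto.
  - rewrite sqrt_mult, sqrt_pow2; auto; [apply pow2_ge_0 | lra].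
Qed.
Lemma exp_le_mono x y : x <= y -> exp x <= exp y.
Proof. intros [H | ->]; [left; apply exp_increasing; auto | lra]. Qed.

(** The Duhamel term with one derivative is singular like (t - s)^(-13/16). A further 1/16 is spent
    on exp(-be (t - s)) <= C (be (t - s))^(-1/16), leaving the integrable power -7/8 and the gain
    be^(-1/16), which becomes the contraction factor. *)
Lemma duh_sum : exists C, 0 < C /\ forall b phi D be n m t, cont2 phi -> 0 <= D -> 0 < be ->
  (forall s x, 0 <= s <= T -> 0 <= x <= L -> Rabs (phi s x) <= D * exp (be * s)) ->
  (1 <= n)%nat -> 0 <= t <= T ->
  sm (fun i => Rabs (lam (n + i) * RInt (fun s => exp (- mu (n + i) * (t - s)) * cf b (phi s) (n + i)) 0 t)) m
   <= C * D * exp (be * t) * Rpower (INR n) (- (1 / 8)) * Rpower be (- (1 / 16)).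
Proof.
  destruct (ksum 1) as [C1 [HC1 K1]].
  destruct (Rpower_exp_bound (1 / 16)) as [C2 [HC2 K2]]; [lra |].
  assert (TP := Rpower_pos (1 / 8) T).
  assert (sL : 0 < sqrt L) by (apply sqrt_lt_R0; auto).
  exists (8 * (C1 * sqrt L * C2) * Rpower T (1 / 8)). split.
  { pos. }
  intros b phi D be n m t cphi HD Hbe HB Hn Ht.
  set (h := fun s => sm (fun i => Rabs (lam (n + i) * exp (- mu (n + i) * (t - s)) * cf b (phi s) (n + i))) m).
  assert (cpk : forall k, cont1 (fun s => cf b (phi s) k)) by (intros; apply phik_cont; auto).
  assert (ch : cont1 h).
  { intros s. unfold h. apply (c_sm (fun i s => Rabs (lam (n + i) * exp (- mu (n + i) * (t - s)) * cf b (phi s) (n + i)))).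
    intros i _. assert (c := cpk (n + i)%nat). ctn. }
  apply Rle_trans with (RInt h 0 t).
  - unfold h. rewrite (RI_sm (fun i s => Rabs (lam (n + i) * exp (- mu (n + i) * (t - s)) * cf b (phi s) (n + i)))).
    2:{ intros i. assert (c := cpk (n + i)%nat). ctn. }
    apply sm_le. intros i _. assert (c := cpk (n + i)%nat).
    rewrite <- RI_scal by ctn.
    rewrite (RInt_ext (fun x => lam (n + i) * (exp (- mu (n + i) * (t - x)) * cf b (phi x) (n + i)))
       (fun s => lam (n + i) * exp (- mu (n + i) * (t - s)) * cf b (phi s) (n + i))) by (intros; req; ring).
    apply RI_abs; [ctn | lra].
  - set (Q := C1 * sqrt L * C2 * D * exp (be * t) * Rpower (INR n) (- (1/8)) * Rpower be (- (1/16))).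
    assert (HQ : 0 <= Q).
    { unfold Q. assert (p1 := Rpower_pos (- (1/8)) (INR n)). assert (p2 := Rpower_pos (- (1/16)) be).
      assert (p3 := exp_pos (be * t)).
      pos. }
    destruct (Req_dec t 0) as [-> | Ht0].
    { rewrite RI_point. assert (p1 := Rpower_pos (- (1/8)) (INR n)). assert (p2 := Rpower_pos (- (1/16)) be).
      assert (p3 := exp_pos (be * 0)). pos. }
    assert (S := RI_singular h t Q (1 / 8) ch (proj1 Ht) ltac:(lra) HQ).
    eapply Rle_trans; [apply S |].
    + intros s Hs.
      assert (cs : cont1 (phi s)) by ctn.
      assert (A1 : h s <= C1 * Rpower (INR n) (- (1/8)) * Rpower (t - s) (- (INR 1 / 2 + 5/16)) * sqrt (RInt (fun x => phi s x ^ 2) 0 L)).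
      { eapply Rle_trans; [| apply (K1 b (phi s) n m (t - s)); auto; lra].
        unfold h. apply sm_le. intros i _. rewrite !Rabs_mult.
        apply Rmult_le_compat_r; [apply Rabs_pos |]. rewrite pow_1. apply Rmult_le_compat_l; [apply Rabs_pos |].
        rewrite !Rabs_right by (left; apply exp_pos). apply exp_le_mono.
        assert (q := Rmult_le_pos rho (t - s) Hrho ltac:(lra)). nra. }
      assert (A2 := sqrt_sq_le (phi s) (D * exp (be * s)) cs ltac:(apply Rmult_le_pos; [auto | left; apply exp_pos])
         (fun x Hx => HB s x ltac:(lra) Hx)).
      assert (A3 : exp (be * s) <= exp (be * t) * (C2 * Rpower be (- (1/16)) * Rpower (t - s) (- (1/16)))).
      { replace (be * s) with (be * t + - (be * (t - s))) by ring. rewrite exp_plus.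
        apply Rmult_le_compat_l; [left; apply exp_pos |].
        rewrite Rmult_assoc, Rpower_mult_distr by lra. apply K2. apply Rmult_lt_0_compat; lra. }
      eapply Rle_trans; [apply A1 |].
      set (P1 := Rpower (INR n) (- (1/8))) in *. assert (p1 : 0 < P1) by apply Rpower_pos.
      set (P2 := Rpower (t - s) (- (INR 1 / 2 + 5/16))) in *. assert (p2 : 0 < P2) by apply Rpower_pos.
      apply Rle_trans with (C1 * P1 * P2 * (D * (exp (be * t) * (C2 * Rpower be (- (1/16)) * Rpower (t - s) (- (1/16)))) * sqrt L)).
      * apply Rmult_le_compat_l; [pos |].
        eapply Rle_trans; [apply A2 |]. apply Rmult_le_compat_r; [lra |]. apply Rmult_le_compat_l; auto.
      * right. unfold Q.
        replace (Rpower (t - s) (1/8 - 1)) with (P2 * Rpower (t - s) (- (1/16))).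
        2:{ unfold P2. rewrite <- Rpower_plus. f_equal. simpl. field. }
        fold P1. ring.
    + apply Rle_trans with (Q / (1 / 8) * Rpower T (1/8)).
      * apply Rmult_le_compat_l; [apply Rdiv_le_0_compat; lra | apply Rpower_le_l; lra].
      * unfold Q. right. field.
Qed.
End Heat.

(** * Solutions with a Lipschitz source *)

Lemma tail_lim8 ep : 0 < ep -> exists n, (1 <= n)%nat /\ forall j, (n <= j)%nat -> Rpower (INR j) (- (1 / 8)) <= ep.
Proof.
  intros He. destruct (tail_lim (ep ^ 2)) as [n [Hn H]]; [pos |]. exists n. split; auto. intros j Hj.
  assert (J : 0 < INR j) by (apply lt_0_INR; lia).
  replace (- (1/8)) with (- (1/4) / 2) by lra. rewrite <- sqrt_Rpower by auto.
  rewrite <- (sqrt_pow2 ep) by lra. apply sqrt_le_1_alt. auto.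
Qed.
Lemma exp_ge1 x : 0 <= x -> 1 <= exp x.
Proof. intros H. assert (h := exp_le_mono 0 x H). rewrite exp_0 in h. auto. Qed.
(** Any prescribed contraction factor is reached by a large enough exponential weight. *)
Lemma Rpower_small et : 0 < et -> exists be, 0 < be /\ Rpower be (- (1 / 16)) = et.
Proof.
  intros H. exists (Rpower (/ et) 16). split; [pos |]. rewrite Rpower_mult.
  replace (16 * - (1 / 16)) with (- (1)) by lra. rewrite Rpower_Ropp, Rpower_1 by pos. apply Rinv_inv.
Qed.

Section Solve.
Variables L nu rho T : R.
Hypothesis HL : 0 < L.
Hypothesis Hnu : 0 < nu.
Hypothesis Hrho : 0 <= rho.
Hypothesis HT : 0 < T.
Local Notation lam := (lamL L).
Local Notation cf := (cfL L).
Local Notation tp := (tpL L).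
Local Notation sr := (srL L).
Local Notation mu k := (nu * lam k ^ 2 + rho).
Local Notation wk b := (wkL L b nu rho).
Local Notation hs b := (hs L b nu rho T).

Lemma exp_mu_le1 k t : 0 <= t -> exp (- mu k * t) <= 1.
Proof.
  intros. rewrite <- exp_0. apply exp_le_mono.
  assert (h := mu_ge0 L nu rho Hnu Hrho k). nra.
Qed.
Lemma wk_zero b a phi t : 0 <= t -> Rabs (wk b a phi 0 t) <= Rabs (a O).
Proof.
  intros Ht. unfold wkL. rewrite lam0 at 2 by auto. rewrite Rmult_0_l, Rplus_0_r, Rabs_mult.
  rewrite (Rabs_right (exp _)) by (left; apply exp_pos).
  assert (h := exp_mu_le1 0 t Ht). assert (h2 := Rabs_pos (a O)). nra.
Qed.
Lemma wk_sum : exists C, 0 < C /\ forall b a phi D be n m t, cont2 phi -> 0 <= D -> 0 < be ->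
  (forall s x, 0 <= s <= T -> 0 <= x <= L -> Rabs (phi s x) <= D * exp (be * s)) ->
  (1 <= n)%nat -> 0 <= t <= T ->
  sm (fun i => Rabs (wk b a phi (n + i) t)) m <= sm (fun i => Rabs (a (n + i)%nat)) m
   + C * D * exp (be * t) * Rpower (INR n) (- (1 / 8)) * Rpower be (- (1 / 16)).
Proof.
  destruct (duh_sum L nu rho T HL Hnu Hrho) as [C [HC K]]. exists C. split; auto.
  intros b a phi D be n m t c HD Hbe HB Hn Ht.
  eapply Rle_trans; [| apply Rplus_le_compat_l; apply (K (negb b) phi D be n m t); auto].
  rewrite <- sm_plus. apply sm_le. intros i _. rewrite (wk_form L nu rho) by (auto; lra).
  eapply Rle_trans; [apply Rabs_triang |]. apply Rplus_le_compat_r. rewrite Rabs_mult.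
  rewrite (Rabs_right (exp _)) by (left; apply exp_pos).
  assert (h := exp_mu_le1 (n + i) t (proj1 Ht)). assert (h2 := Rabs_pos (a (n + i)%nat)). nra.
Qed.
(** The tail estimate starts at index 1. The mode 0 is added by hand: lam_0 = 0, so the source does
    not act on it and it cannot grow. *)
Lemma wk_sum_all : exists C, 0 < C /\ forall b a A phi D be n t, cont2 phi -> 0 <= D -> 0 < be ->
  (forall n, sm (fun k => Rabs (a k)) n <= A) ->
  (forall s x, 0 <= s <= T -> 0 <= x <= L -> Rabs (phi s x) <= D * exp (be * s)) -> 0 <= t <= T ->
  sm (fun k => Rabs (wk b a phi k t)) n <= A + C * D * exp (be * t) * Rpower be (- (1 / 16)).
Proof.
  destruct wk_sum as [C [HC K]]. exists C. split; auto.
  intros b a A phi D be n t c HD Hbe HA HB Ht.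
  assert (Z : 0 <= C * D * exp (be * t) * Rpower be (- (1 / 16))) by pos.
  destruct n.
  - cbn [sm]. assert (h := HA O). simpl in h. lra.
  - rewrite sm_head. assert (K1 := K b a phi D be 1%nat n t c HD Hbe HB (le_n _) Ht).
    simpl Nat.add in K1. simpl INR in K1.
    replace (Rpower 1 (- (1/8))) with 1 in K1 by (unfold Rpower; rewrite ln_1, Rmult_0_r, exp_0; auto).
    assert (h := HA (S n)). rewrite sm_head in h.
    assert (h0 := wk_zero b a phi t (proj1 Ht)). lra.
Qed.
(** Time is clamped so that the series converges uniformly for every real [t] and [sol] is
    continuous on the whole plane. *)
Definition sol (b : bool) (a : nat -> R) (phi : R -> R -> R) (t x : R) : R :=
  sr b (fun k => wk b a phi k (clamp T t)) x.
Lemma wk_tails b a A phi : (forall n, sm (fun k => Rabs (a k)) n <= A) -> cont2 phi ->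
  forall ep, 0 < ep -> exists N, forall n, (N <= n)%nat -> forall t, 0 <= t <= T -> forall m,
    sm (fun i => Rabs (wk b a phi (n + i) t)) m <= ep.
Proof.
  intros HA c ep Hep.
  destruct wk_sum as [C [HC K]].
  destruct (cont2_bound phi 0 T 0 L c) as [D [HD HB]].
  destruct (summ_of_bound a A HA (ep / 2)) as [N1 HN1]; [lra |].
  set (Q := C * D * exp T).
  assert (HQ : 0 < Q) by (unfold Q; pos).
  destruct (tail_lim8 (ep / 2 / Q)) as [N2 [HN2 HT2]]; [pos |].
  exists (N1 + N2)%nat. intros n Hn t Ht m.
  eapply Rle_trans; [apply (K b a phi D 1 n m t); auto; try lra; try lia |].
  - intros s x Hs Hx. assert (h := HB s x Hs Hx).
    assert (1 <= exp (1 * s)) by (apply exp_ge1; lra). nra.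
  - replace (Rpower 1 (- (1 / 16))) with 1 by (unfold Rpower; rewrite ln_1, Rmult_0_r, exp_0; auto).
    assert (h1 := HN1 n ltac:(lia) m). assert (h2 := HT2 n ltac:(lia)).
    assert (h3 : C * D * exp (1 * t) <= Q) by (unfold Q; apply Rmult_le_compat_l; [pos | apply exp_le_mono; lra]).
    assert (p := Rpower_pos (- (1/8)) (INR n)).
    assert (C * D * exp (1 * t) * Rpower (INR n) (- (1 / 8)) <= Q * (ep / 2 / Q)).
    { apply Rmult_le_compat; auto; pos. }
    replace (Q * (ep / 2 / Q)) with (ep / 2) in H by (field; lra). lra.
Qed.
Lemma wk_summ b a A phi t : (forall n, sm (fun k => Rabs (a k)) n <= A) -> cont2 phi -> 0 <= t <= T ->
  summ (fun k => wk b a phi k t).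
Proof.
  intros HA c Ht ep Hep. destruct (wk_tails b a A phi HA c ep Hep) as [N HN].
  exists N. intros n Hn m. apply HN; auto.
Qed.
Lemma sol_hs b a A phi : (forall n, sm (fun k => Rabs (a k)) n <= A) -> (b = true -> a O = 0) ->
  cont2 phi -> hs b a phi (sol b a phi).
Proof.
  intros HA H0 c. assert (HTl := wk_tails b a A phi HA c).
  assert (E : forall t k, 0 <= t <= T -> cf b (sol b a phi t) k = wk b a phi k t).
  { intros t k Ht. unfold sol. rewrite clamp_id by auto. apply (cf_sr L HL).
    - apply (wk_summ b a A); auto.
    - intros ->. apply (wk_true0 L nu rho HL); auto. }
  split; [auto | split; [| split; [exact E |]]].
  - apply (sr_cont2 L HL b (fun t k => wk b a phi k (clamp T t))).
    + intros k. assert (c1 := wk_cont L nu rho b a phi k c). assert (c2 := cont1_clamp T). ctn.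
    + intros ep Hep. destruct (HTl ep Hep) as [N HN]. exists N. intros n Hn t m. apply HN; auto.
      apply clamp_in; lra.
  - intros ep Hep. destruct (HTl ep Hep) as [N HN]. exists N. intros n Hn t Ht m.
    rewrite (sm_ext _ (fun i => Rabs (wk b a phi (n + i) t))) by (intros; rewrite E; auto). apply HN; auto.
Qed.
Lemma sr_dist b a1 a2 B x : summ a1 -> summ a2 -> (forall n, sm (fun k => Rabs (a1 k - a2 k)) n <= B) ->
  Rabs (sr b a1 x - sr b a2 x) <= 2 / L * B.
Proof.
  intros H1 H2 HB.
  assert (L1 := sr_lim L HL b a1 x H1). assert (L2 := sr_lim L HL b a2 x H2).
  assert (L3 : is_lim_seq (fun n => Rabs (tp b a1 n x - tp b a2 n x)) (Rabs (sr b a1 x - sr b a2 x))).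
  { apply (is_lim_seq_abs (fun n => tp b a1 n x - tp b a2 n x) (Finite _)). apply is_lim_seq_minus'; auto. }
  apply (is_lim_seq_le _ (fun _ => 2 / L * B) _ _ ) with (3 := is_lim_seq_const _) in L3; auto.
  intros n.
  assert (K := tp_tail L HL b (fun k => a1 k - a2 k) 0 n x). simpl in K.
  unfold tpL at 2 in K. cbn [sm] in K. rewrite Rminus_0_r in K.
  replace (tp b a1 n x - tp b a2 n x) with (tp b (fun k => a1 k - a2 k) n x).
  - eapply Rle_trans; [apply K |]. apply Rmult_le_compat_l; auto. pos.
  - unfold tpL. rewrite <- sm_minus. apply sm_ext. intros; ring.
Qed.
Lemma sr_zero b x : sr b (fun _ => 0) x = 0.
Proof.
  unfold srL. rewrite (Lim_seq_ext _ (fun _ => 0)); [rewrite Lim_seq_const; auto |].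
  intros n. unfold tpL. rewrite (sm_ext _ (fun _ => 0)), sm_zero by (intros; ring). auto.
Qed.
Lemma summ_zero : summ (fun _ => 0).
Proof. apply (summ_of_bound _ 0). intros n. rewrite (sm_ext _ (fun _ => 0)), sm_zero by (intros; apply Rabs_R0). lra. Qed.
Lemma sr_bound b a B x : summ a -> (forall n, sm (fun k => Rabs (a k)) n <= B) -> Rabs (sr b a x) <= 2 / L * B.
Proof.
  intros H HB. rewrite <- (Rminus_0_r (sr b a x)), <- (sr_zero b x). apply sr_dist; auto.
  - apply summ_zero.
  - intros n. rewrite (sm_ext _ (fun k => Rabs (a k))); auto. intros; rewrite Rminus_0_r; auto.
Qed.
Lemma wk_minus b a phi1 phi2 k t : cont2 phi1 -> cont2 phi2 ->
  wk b a phi1 k t - wk b a phi2 k t = wk b (fun _ => 0) (fun s x => phi1 s x - phi2 s x) k t.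
Proof.
  intros c1 c2. unfold wkL.
  assert (p1 := phik_cont L (negb b) phi1 k c1). assert (p2 := phik_cont L (negb b) phi2 k c2).
  rewrite (RInt_ext (fun s => exp (mu k * s) * cf (negb b) (fun x => phi1 s x - phi2 s x) k)
    (fun s => exp (mu k * s) * cf (negb b) (phi1 s) k - exp (mu k * s) * cf (negb b) (phi2 s) k)).
  - rewrite RI_minus by ctn. ring.
  - intros; req. rewrite cf_minus by ctn. ring.
Qed.
Lemma sol_lip : exists C, 0 < C /\ forall b a A phi1 phi2 D be t x,
  (forall n, sm (fun k => Rabs (a k)) n <= A) -> cont2 phi1 -> cont2 phi2 -> 0 <= D -> 0 < be ->
  (forall s x, 0 <= s <= T -> 0 <= x <= L -> Rabs (phi1 s x - phi2 s x) <= D * exp (be * s)) ->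
  Rabs (sol b a phi1 t x - sol b a phi2 t x) <= C * D * exp (be * clamp T t) * Rpower be (- (1 / 16)).
Proof.
  destruct wk_sum_all as [C [HC K]]. exists (2 / L * C). split; [pos |].
  intros b a A phi1 phi2 D be t x HA c1 c2 HD Hbe HB. unfold sol.
  assert (Hc := clamp_in T t ltac:(lra)).
  replace (2 / L * C * D * exp (be * clamp T t) * Rpower be (- (1 / 16))) with
    (2 / L * (C * D * exp (be * clamp T t) * Rpower be (- (1 / 16)))) by ring.
  apply sr_dist; try (apply (wk_summ b a A); auto).
  intros n.
  assert (K1 := K b (fun _ => 0) 0 (fun s x => phi1 s x - phi2 s x) D be n (clamp T t) ltac:(ctn) HD Hbe).
  rewrite Rplus_0_l in K1.
  rewrite (sm_ext _ (fun k => Rabs (wk b (fun _ => 0) (fun s x => phi1 s x - phi2 s x) k (clamp T t)))).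
  - apply K1; auto. intros j. rewrite (sm_ext _ (fun _ => 0)), sm_zero by (intros; apply Rabs_R0). lra.
  - intros; rewrite wk_minus; auto.
Qed.
Lemma hs_ext b a phi w w' : hs b a phi w -> cont2 w' -> (forall t x, w' t x = w t x) -> hs b a phi w'.
Proof.
  intros [H1 [H2 [H3 H4]]] c E.
  assert (EC : forall t k, cf b (w' t) k = cf b (w t) k) by (intros; apply cf_ext; auto).
  split; [auto | split; [auto | split]].
  - intros. rewrite EC; auto.
  - intros ep Hep. destruct (H4 ep Hep) as [N HN]. exists N. intros n Hn t Ht m.
    rewrite (sm_ext _ (fun i => Rabs (cf b (w t) (n + i)))) by (intros; rewrite EC; auto). auto.
Qed.
(** The unknown enters through the source [Nn w]. In the norm weighted by exp(be t) the solution map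
    contracts by C K be^(-1/16), so a large [be] handles any [T]. *)
Lemma picard b a A Nn K : (forall n, sm (fun k => Rabs (a k)) n <= A) -> (b = true -> a O = 0) ->
  0 <= K -> (forall w, cont2 w -> cont2 (Nn w)) ->
  (forall w1 w2 t x, 0 <= t <= T -> 0 <= x <= L -> Rabs (Nn w1 t x - Nn w2 t x) <= K * Rabs (w1 t x - w2 t x)) ->
  exists w, hs b a (Nn w) w.
Proof.
  intros HA H0 HK HN HLip.
  destruct sol_lip as [C [HC Lp]]. destruct wk_sum_all as [C' [HC' Sm]].
  (* Makes the contraction factor at most 1/2; K + 1 avoids division by zero. *)
  destruct (Rpower_small (/ (2 * C * (K + 1)))) as [be [Hbe Eb]]; [pos |].
  set (Phi := fun (f : R * R -> R) (p : R * R) => sol b a (Nn (fun t x => f (t, x))) (fst p) (snd p)).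
  set (P := fun f : R * R -> R => cont2 (fun t x => f (t, x))).
  assert (wt1 : forall t, 1 <= exp (be * clamp T t)).
  { intros t. apply exp_ge1. assert (h := clamp_in T t ltac:(lra)). apply Rmult_le_pos; lra. }
  assert (P0 : P (fun _ => 0)) by (unfold P; ctn).
  assert (cN0 : cont2 (Nn (fun t x => 0))) by (apply HN; ctn).
  destruct (cont2_bound (Nn (fun t x => 0)) 0 T 0 L cN0) as [D0 [HD0 HB0]].
  destruct (contraction P Phi (fun p => exp (be * clamp T (fst p))) (1 / 2) (exp (be * T)) (fun _ => 0)
     (2 / L * (Rabs A + C' * D0 * exp (be * T) * Rpower be (- (1/16))))) as [f [Pf Ef]].
  - intros [t x]. simpl. split; [apply exp_pos |]. apply exp_le_mono.
    assert (h := clamp_in T t ltac:(lra)). apply Rmult_le_compat_l; lra.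
  - lra.
  - pos.
  - intros f Pf. unfold P, Phi. simpl. apply (sol_hs b a A (Nn (fun t x => f (t, x)))); auto.
  - intros f g D Pf Pg HD HB [t x]. unfold Phi. simpl.
    assert (Q := Lp b a A (Nn (fun t x => f (t, x))) (Nn (fun t x => g (t, x))) (K * D) be t x HA (HN _ Pf) (HN _ Pg)
       ltac:(pos) Hbe).
    eapply Rle_trans; [apply Q |].
    + intros s y Hs Hy. eapply Rle_trans; [apply HLip; auto |].
      assert (h := HB (s, y)). simpl in h. rewrite clamp_id in h by auto.
      rewrite Rmult_assoc. apply Rmult_le_compat_l; auto.
    + rewrite Eb.
      assert (w0 := exp_pos (be * clamp T t)).
      apply Rle_trans with (C * ((K + 1) * D) * exp (be * clamp T t) * / (2 * C * (K + 1))).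
      * apply Rmult_le_compat_r; [pos |]. apply Rmult_le_compat_r; [lra |]. apply Rmult_le_compat_l; [lra |]. nra.
      * right. field. split; lra.
  - intros u f Pu Hu. unfold P. apply cont2_unif. intros ep Hep. destruct (Hu ep Hep) as [N HN'].
    exists (fun t x => u N (t, x)). split; [apply Pu |]. intros t x. rewrite Rabs_minus_sym. apply HN'. lia.
  - auto.
  - intros [t x]. unfold Phi. simpl. rewrite Rminus_0_r. unfold sol.
    assert (Hc := clamp_in T t ltac:(lra)).
    eapply Rle_trans; [apply (sr_bound b _ (A + C' * D0 * exp (be * clamp T t) * Rpower be (- (1 / 16)))) |].
    + apply (wk_summ b a A); auto.
    + intros n. apply (Sm b a A _ D0 be n (clamp T t)); auto; try lra.
      intros s y Hs Hy. assert (h := HB0 s y Hs Hy).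
        assert (1 <= exp (be * s)) by (apply exp_ge1; apply Rmult_le_pos; lra). nra.
    + assert (Z : 0 <= 2 / L * (Rabs A + C' * D0 * exp (be * T) * Rpower be (- (1 / 16)))).
      { pos. }
      apply Rle_trans with (2 / L * (Rabs A + C' * D0 * exp (be * T) * Rpower be (- (1 / 16)))).
      * apply Rmult_le_compat_l; [pos |]. apply Rplus_le_compat; [apply Rle_abs |].
        apply Rmult_le_compat_r; [pos |]. apply Rmult_le_compat_l; [pos |]. apply exp_le_mono.
        apply Rmult_le_compat_l; lra.
      * assert (h := wt1 t). nra.
  - set (w := fun t x => f (t, x)). exists w.
    assert (Hs := sol_hs b a A (Nn w) HA H0 (HN w Pf)).
    apply (hs_ext b a (Nn w) (sol b a (Nn w)) w Hs Pf).
    intros t x. unfold w at 1. rewrite <- (Ef (t, x)). reflexivity.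
Qed.

Lemma hs_rep b a phi w t x : hs b a phi w -> 0 <= t <= T -> 0 <= x <= L -> w t x = sr b (cf b (w t)) x.
Proof.
  intros [_ [c [_ H4]]] Ht Hx. apply rep; auto; [ctn |].
  intros ep Hep. destruct (H4 ep Hep) as [N HN]. exists N. auto.
Qed.
Lemma hs_summ b a phi w t : hs b a phi w -> 0 <= t <= T -> summ (cf b (w t)).
Proof. intros [_ [c [_ H4]]] Ht ep Hep. destruct (H4 ep Hep) as [N HN]. exists N. auto. Qed.
Lemma hs_tp b a phi w ep : hs b a phi w -> 0 < ep -> exists N, forall n, (N <= n)%nat ->
  forall t x, 0 <= t <= T -> 0 <= x <= L -> Rabs (w t x - tp b (cf b (w t)) n x) <= ep.
Proof.
  intros H Hep. assert (H' := H). destruct H' as [_ [c [_ H4]]].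
  destruct (H4 (ep * L / 2)) as [N HN]. { assert (0 < ep * L) by pos. lra. }
  exists N. intros n Hn t x Ht Hx. eapply Rle_trans.
  - apply (rep_tail L HL b (w t) n (ep * L / 2)); auto; [ctn | apply (hs_summ b a phi w); auto].
  - right; field; lra.
Qed.
Lemma sup_bound b A K : 0 <= A -> 0 <= K -> exists M, 0 < M /\ forall a phi w, hs b a phi w ->
  (forall n, sm (fun k => Rabs (a k)) n <= A) ->
  (forall t x, 0 <= t <= T -> 0 <= x <= L -> Rabs (phi t x) <= K * Rabs (w t x)) ->
  (forall t n, 0 <= t <= T -> sm (fun k => Rabs (cf b (w t) k)) n <= M) /\
  forall t x, 0 <= t <= T -> 0 <= x <= L -> Rabs (w t x) <= M.
Proof.
  intros HA HK. destruct wk_sum_all as [C [HC Sm]].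
  destruct (Rpower_small (/ (4 / L * C * (K + 1)))) as [be [Hbe Eb]]; [pos |].
  set (B := 2 / L * A). assert (HB0 : 0 <= B) by (unfold B; pos).
  set (W1 := 2 * B + 1).
  exists ((A + L * W1) * exp (be * T) + W1 * exp (be * T)). split.
  { assert (p := exp_pos (be * T)). assert (0 < L * W1) by (unfold W1; pos). unfold W1 in *. nra. }
  intros a phi w H Ha Hphi. assert (H' := H). destruct H' as [cphi [cw [Hcf Htl]]].
  assert (Step1 : forall W, 0 <= W -> (forall t x, 0 <= t <= T -> 0 <= x <= L -> Rabs (w t x) <= W * exp (be * t)) ->
     forall t n, 0 <= t <= T -> sm (fun k => Rabs (cf b (w t) k)) n <= A + L / 4 * W * exp (be * t)).
  { intros W HW HWb t n Ht.
    rewrite (sm_ext _ (fun k => Rabs (wk b a phi k t))) by (intros; rewrite Hcf; auto).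
    eapply Rle_trans; [apply (Sm b a A phi (K * W) be n t); auto; [pos |] |].
    - intros s y Hs Hy. eapply Rle_trans; [apply Hphi; auto |]. rewrite Rmult_assoc.
      apply Rmult_le_compat_l; auto.
    - apply Rplus_le_compat_l. rewrite Eb.
      apply Rle_trans with (C * ((K + 1) * W) * exp (be * t) * / (4 / L * C * (K + 1))).
      + apply Rmult_le_compat_r; [pos |]. apply Rmult_le_compat_r; [pos |]. apply Rmult_le_compat_l; [lra |]. nra.
      + right. field. repeat split; lra. }
  assert (Step : forall W, 0 <= W -> (forall t x, 0 <= t <= T -> 0 <= x <= L -> Rabs (w t x) <= W * exp (be * t)) ->
     forall t x, 0 <= t <= T -> 0 <= x <= L -> Rabs (w t x) <= (B + W / 2) * exp (be * t)).
  { intros W HW HWb t x Ht Hx. rewrite (hs_rep b a phi w t x) by auto.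
    eapply Rle_trans; [apply (sr_bound b _ (A + L / 4 * W * exp (be * t))) |].
    - apply (hs_summ b a phi w); auto.
    - intros n. apply (Step1 W HW HWb t n Ht).
    - unfold B. assert (1 <= exp (be * t)) by (apply exp_ge1; apply Rmult_le_pos; lra).
      replace (2 / L * (A + L / 4 * W * exp (be * t))) with (2 / L * A + W / 2 * exp (be * t)) by (field; lra).
      assert (0 <= 2 / L * A) by pos. nra. }
  destruct (cont2_bound w 0 T 0 L cw) as [W0 [HW0 HWb]].
  assert (It : forall n t x, 0 <= t <= T -> 0 <= x <= L -> Rabs (w t x) <= (2 * B + W0 * (1/2) ^ n) * exp (be * t)).
  { induction n; intros t x Ht Hx.
    - simpl. assert (h := HWb t x Ht Hx).
      assert (1 <= exp (be * t)) by (apply exp_ge1; apply Rmult_le_pos; lra). nra.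
    - assert (q : 0 <= (1/2) ^ n) by pos.
      assert (S1 := Step (2 * B + W0 * (1/2) ^ n) ltac:(nra) IHn t x Ht Hx).
      replace (2 * B + W0 * (1 / 2) ^ S n) with (B + (2 * B + W0 * (1 / 2) ^ n) / 2) by (simpl; field). auto. }
  destruct (geom_small W0 (1/2) 1) as [N HN]; try lra. specialize (HN N (le_n _)).
  assert (F : forall t x, 0 <= t <= T -> 0 <= x <= L -> Rabs (w t x) <= W1 * exp (be * t)).
  { intros t x Ht Hx. eapply Rle_trans; [apply (It N); auto |]. apply Rmult_le_compat_r; [pos | unfold W1; lra]. }
  assert (W1p : 0 <= W1) by (unfold W1; lra).
  assert (Em : forall t, 0 <= t <= T -> 1 <= exp (be * t) <= exp (be * T)).
  { intros t Ht. split; [apply exp_ge1; apply Rmult_le_pos; lra | apply exp_le_mono; apply Rmult_le_compat_l; lra]. }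
  split.
  - intros t n Ht. eapply Rle_trans; [apply (Step1 W1 W1p F t n Ht) |]. destruct (Em t Ht) as [E1 E2].
    assert (L / 4 * W1 * exp (be * t) <= L * W1 * exp (be * T)).
    { apply Rmult_le_compat; try lra; [pos |]. assert (0 <= L * W1) by pos. lra. }
    assert (0 <= W1 * exp (be * T)) by pos. nra.
  - intros t x Ht Hx. eapply Rle_trans; [apply F; auto |]. destruct (Em t Ht) as [E1 E2].
    assert (W1 * exp (be * t) <= W1 * exp (be * T)) by (apply Rmult_le_compat_l; lra).
    assert (0 <= (A + L * W1) * exp (be * T)). { apply Rmult_le_pos; [| pos]. assert (0 <= L * W1) by pos; lra. }
    lra.
Qed.
End Solve.

(** * Truncations *)

Definition pp (y : R) : R := Rmax 0 y.
Lemma pp_pos y : 0 <= y -> pp y = y.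
Proof. intros. unfold pp. apply Rmax_right; auto. Qed.
Lemma pp_neg y : y <= 0 -> pp y = 0.
Proof. intros. unfold pp. apply Rmax_left; auto. Qed.
Lemma pp_ge0 y : 0 <= pp y.
Proof. apply Rmax_l. Qed.
Lemma cont1_pp : cont1 pp.
Proof. unfold pp. ctn. Qed.
Lemma derive_zero_sq (f : R -> R) : (forall y, Rabs y <= 1 -> Rabs (f y) <= y ^ 2) -> is_derive f 0 0.
Proof.
  intros H. apply is_derive_Reals. intros ep Hep.
  assert (f0 : f 0 = 0).
  { assert (h := H 0 ltac:(rewrite Rabs_R0; lra)). replace (0 ^ 2) with 0 in h by ring.
    apply Rabs_le_between in h. lra. }
  assert (Hm : 0 < Rmin 1 ep) by (apply Rmin_pos; lra).
  exists (mkposreal _ Hm). simpl. intros h Hh Hd.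
  assert (m1 := Rmin_l 1 ep). assert (m2 := Rmin_r 1 ep).
  rewrite Rplus_0_l, f0, !Rminus_0_r. unfold Rdiv. rewrite Rabs_mult, Rabs_inv.
  assert (P := Rabs_pos_lt h Hh). assert (K := H h ltac:(lra)).
  rewrite <- Rsqr_pow2, Rsqr_abs in K. unfold Rsqr in K.
  apply Rle_lt_trans with (Rabs h); [| lra].
  apply (Rmult_le_reg_r (Rabs h)); auto. rewrite Rmult_assoc, Rinv_l by lra. lra.
Qed.
(** Away from 0 the function is locally a power or zero; at 0 it is at most y^2, which forces the
    derivative 0. *)
Lemma pp_pow_derive n y : is_derive (fun y => pp y ^ S (S n)) y (INR (S (S n)) * pp y ^ S n).
Proof.
  destruct (Rtotal_order y 0) as [Hy | [-> | Hy]].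
  - apply (is_derive_ext_loc (fun _ => 0)).
    + exists (mkposreal (- y) ltac:(lra)). intros z Hz. unfold ball in Hz; simpl in Hz.
      unfold AbsRing_ball, abs, minus, plus, opp in Hz; simpl in Hz. apply Rabs_def2 in Hz. simpl in *.
      rewrite pp_neg by lra. ring.
    + rewrite (pp_neg y) by lra. replace (INR (S (S n)) * 0 ^ S n) with 0 by (simpl pow; ring).
      apply (is_derive_const (K := R_AbsRing) (V := R_NormedModule)).
  - rewrite pp_neg by lra. replace (INR (S (S n)) * 0 ^ S n) with 0 by (simpl pow; ring).
    apply derive_zero_sq. intros y Hy.
    assert (h : 0 <= pp y <= 1 /\ pp y <= Rabs y).
    { unfold pp, Rmax. destruct (Rle_dec 0 y); [rewrite Rabs_right in * by lra; lra |].
      assert (q := Rabs_pos y). lra. }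
    rewrite Rabs_right by (apply Rle_ge, pow_le; lra).
    replace (S (S n)) with (n + 2)%nat by lia. rewrite pow_add.
    assert (pp y ^ n <= 1) by (rewrite <- (pow1 n); apply pow_incr; lra).
    assert (0 <= pp y ^ n) by (apply pow_le; lra).
    assert (pp y ^ 2 <= y ^ 2). { rewrite <- (Rsqr_pow2 y), Rsqr_abs, Rsqr_pow2. apply pow_incr; lra. }
    assert (0 <= pp y ^ 2) by apply pow2_ge_0. nra.
  - apply (is_derive_ext_loc (fun y => y ^ S (S n))).
    + exists (mkposreal y Hy). intros z Hz. unfold ball in Hz; simpl in Hz.
      unfold AbsRing_ball, abs, minus, plus, opp in Hz; simpl in Hz. apply Rabs_def2 in Hz. simpl in *.
      rewrite pp_pos by lra. reflexivity.
    + rewrite (pp_pos y) by lra. auto_derive; [trivial |].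
      change (1 * (INR (S (S n)) * y ^ S n) = INR (S (S n)) * y ^ S n). apply Rmult_1_l.
Qed.
(* Truncation of [s y] at level [c], for [s = 1] or [s = -1]. *)
Definition q0 (s c y : R) : R := pp (s * y - c) ^ 3.
Definition q1 (s c y : R) : R := s * (3 * pp (s * y - c) ^ 2).
Definition q2 (s c y : R) : R := s ^ 2 * (6 * pp (s * y - c)).
Lemma q0_derive s c y : is_derive (q0 s c) y (q1 s c y).
Proof.
  unfold q0, q1. evar_last.
  - apply (is_derive_comp (fun z => pp z ^ 3) (fun y => s * y - c)); [apply (pp_pow_derive 1) |].
    auto_derive; [trivial | reflexivity].
  - unfold scal; simpl; unfold mult; simpl. ring.
Qed.
Lemma q1_derive s c y : is_derive (q1 s c) y (q2 s c y).
Proof.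
  unfold q1, q2. evar_last.
  - apply (is_derive_scal (fun y => 3 * pp (s * y - c) ^ 2)).
    apply (is_derive_scal (fun y => pp (s * y - c) ^ 2)).
    apply (is_derive_comp (fun z => pp z ^ 2) (fun y => s * y - c)); [apply (pp_pow_derive 0) |].
    auto_derive; [trivial | reflexivity].
  - unfold scal; simpl; unfold mult; simpl. ring.
Qed.
Lemma q0_ge0 s c y : 0 <= q0 s c y.
Proof. unfold q0. apply pow_le, pp_ge0. Qed.
Lemma q2_ge0 s c y : 0 <= q2 s c y.
Proof. unfold q2. assert (h := pp_ge0 (s * y - c)). assert (h2 := pow2_ge_0 s). nra. Qed.
Lemma q0_cont s c : cont1 (q0 s c).
Proof. apply (cont1_derive _ (q1 s c)). apply q0_derive. Qed.
Lemma q1_cont s c : cont1 (q1 s c).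
Proof. apply (cont1_derive _ (q2 s c)). apply q1_derive. Qed.
Lemma q2_cont s c : cont1 (q2 s c).
Proof. unfold q2. assert (h := cont1_pp). ctn. Qed.
Lemma q0_zero s c y : q0 s c y = 0 -> s * y <= c.
Proof.
  unfold q0. intros H. destruct (Rle_dec (s * y) c); auto. exfalso.
  rewrite pp_pos in H by lra. assert (0 < (s * y - c) ^ 3) by (apply pow_lt; lra). lra.
Qed.
Lemma q0_vanish s c y : s * y <= c -> q0 s c y = 0.
Proof. intros. unfold q0. rewrite pp_neg by lra. ring. Qed.
(** The form in which a source is absorbed by Gronwall: if it vanishes linearly at the truncation
    level, the second derivative times its square is controlled by the cubic truncation itself. The
    cube is used because it is twice continuously differentiable. *)
Lemma q2_control s c y f K : s ^ 2 = 1 -> (c <= s * y -> Rabs f <= K * (s * y - c)) ->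
  q2 s c y * f ^ 2 <= 6 * K ^ 2 * q0 s c y.
Proof.
  intros Hs H. unfold q2, q0. rewrite Hs. destruct (Rle_dec c (s * y)) as [h | h].
  - rewrite pp_pos by lra. specialize (H h). set (d := s * y - c) in *. assert (0 <= d) by (unfold d; lra).
    assert (f ^ 2 <= (K * d) ^ 2).
    { rewrite <- (Rsqr_pow2 f), Rsqr_abs, Rsqr_pow2. apply pow_incr. split; [apply Rabs_pos | auto]. }
    replace (6 * K ^ 2 * d ^ 3) with (6 * d * (K * d) ^ 2) by ring. nra.
  - rewrite pp_neg by lra. ring_simplify. lra.
Qed.
Lemma RI_zero f L : 0 < L -> cont1 f -> (forall x, 0 <= x <= L -> 0 <= f x) -> RInt f 0 L <= 0 ->
  forall x, 0 <= x <= L -> f x = 0.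
Proof.
  intros HL c H0 HI. apply (zero_closure L HL); auto. intros x Hx.
  assert (Z : forall y, 0 <= y <= L -> RInt f 0 y = 0).
  { intros y Hy. assert (E := RI_chasles f 0 y L c).
    assert (0 <= RInt f 0 y) by (apply RI_ge0; auto; [lra | intros; apply H0; lra]).
    assert (0 <= RInt f y L) by (apply RI_ge0; auto; [lra | intros; apply H0; lra]). lra. }
  assert (D := RI_derive f 0 x c).
  assert (D0 : is_derive (fun y => RInt f 0 y) x 0).
  { apply (is_derive_ext_loc (fun _ => 0)).
    - assert (Hm : 0 < Rmin x (L - x)) by (apply Rmin_pos; lra).
      exists (mkposreal _ Hm). intros z Hz. unfold ball in Hz; simpl in Hz.
      unfold AbsRing_ball, abs, minus, plus, opp in Hz; simpl in Hz. apply Rabs_def2 in Hz. simpl in *.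
      assert (m1 := Rmin_l x (L - x)). assert (m2 := Rmin_r x (L - x)).
      symmetry. apply Z. lra.
    - apply (is_derive_const (K := R_AbsRing) (V := R_NormedModule)). }
  rewrite <- (is_derive_unique _ _ _ D), (is_derive_unique _ _ _ D0). auto.
Qed.

(** * Energy estimates and comparison *)

Section Energy.
Variables L nu rho T : R.
Hypothesis HL : 0 < L.
Hypothesis Hnu : 0 < nu.
Hypothesis Hrho : 0 <= rho.
Hypothesis HT : 0 < T.
Local Notation lam := (lamL L).
Local Notation e := (ee L).
Local Notation cf := (cfL L).
Local Notation ck := (ckL L).
Local Notation tp := (tpL L).
Local Notation mu k := (nu * lam k ^ 2 + rho).
Local Notation wk b := (wkL L b nu rho).
Local Notation hs b := (hs L b nu rho T).

(** Cauchy-Schwarz after splitting the exponential into two equal halves; the free factor integrates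
    to at most 1/m, and lam^2/m <= 1/nu compensates the derivative. *)
Lemma duh_sq k g s t : cont1 g -> s <= t ->
  (lam k * RInt (fun r => exp (- mu k * (t - r)) * g r) s t) ^ 2
    <= / nu * RInt (fun r => exp (- mu k * (t - r)) * g r ^ 2) s t.
Proof.
  intros cg Hst.
  assert (I0 : 0 <= RInt (fun r => exp (- mu k * (t - r)) * g r ^ 2) s t).
  { apply RI_ge0; [ctn | auto | intros; pos]. }
  destruct (Nat.eq_dec k 0) as [-> | Hk].
  { apply Rle_trans with 0; [right; rewrite lam0 by auto; ring | apply Rmult_le_pos; [pos | exact I0]]. }
  assert (P := lam_pos L HL k ltac:(lia)).
  set (m := mu k) in *. assert (Hm : nu * lam k ^ 2 <= m) by (unfold m; lra).
  assert (Pm : 0 < nu * lam k ^ 2) by pos.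
  set (h := fun r => exp (- (m / 2) * (t - r))).
  assert (ch : cont1 h) by (unfold h; ctn).
  assert (hh : forall r, h r * h r = exp (- m * (t - r))).
  { intros r. unfold h. rewrite <- exp_plus. f_equal. field. }
  assert (CS := RI_cs h (fun r => h r * g r) s t ch ltac:(ctn) Hst).
  rewrite (RInt_ext (fun x => h x * (h x * g x)) (fun r => exp (- m * (t - r)) * g r)) in CS.
  2:{ intros; req. rewrite <- hh; ring. }
  rewrite (RInt_ext (fun x => (h x * g x) ^ 2) (fun r => exp (- m * (t - r)) * g r ^ 2)) in CS.
  2:{ intros; req. rewrite <- hh; ring. }
  assert (I1 : RInt (fun x => h x ^ 2) s t <= / m).
  { rewrite (RInt_ext _ (fun r => exp (- m * (t - r)))) by (intros; req; rewrite <- hh; ring).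
    rewrite (RI_ftc (fun r => / m * exp (- m * (t - r)))).
    - replace (- m * (t - t)) with 0 by ring. rewrite exp_0.
      assert (0 < / m * exp (- m * (t - s))) by pos. lra.
    - intros x. auto_derive; [trivial |]. unfold Rminus. field. lra.
    - ctn. }
  rewrite Rpow_mult_distr.
  set (X := RInt (fun r => exp (- m * (t - r)) * g r ^ 2) s t) in *.
  apply Rle_trans with (lam k ^ 2 * (/ m * X)).
  - apply Rmult_le_compat_l; [pos |]. eapply Rle_trans; [apply CS |]. apply Rmult_le_compat_r; auto.
  - rewrite <- Rmult_assoc. apply Rmult_le_compat_r; auto.
    apply (Rmult_le_reg_r (m * nu)); [pos |].
    replace (lam k ^ 2 * / m * (m * nu)) with (nu * lam k ^ 2) by (field; lra).
    replace (/ nu * (m * nu)) with m by (field; lra). auto.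
Qed.
(** With equal initial coefficients only the Duhamel term of phi1 - phi2 survives; [duh_sq] is
    summed over the modes between Parseval for the solution and Bessel for the source. *)
Lemma hs_energy b a phi1 w1 phi2 w2 t : hs b a phi1 w1 -> hs b a phi2 w2 -> 0 <= t <= T ->
  RInt (fun x => (w1 t x - w2 t x) ^ 2) 0 L
    <= / nu * RInt (fun s => RInt (fun x => (phi1 s x - phi2 s x) ^ 2) 0 L) 0 t.
Proof.
  intros [c1 [d1 [E1 _]]] [c2 [d2 [E2 _]]] Ht.
  set (psi := fun s x => phi1 s x - phi2 s x). assert (cpsi : cont2 psi) by (unfold psi; ctn).
  apply (parseval_le L HL b (fun x => w1 t x - w2 t x)); [ctn |]. intros N.
  assert (cpk : forall k, cont1 (fun s => cf (negb b) (psi s) k)) by (intros; apply phik_cont; auto).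
  assert (K : forall k, ck k * cf b (fun x => w1 t x - w2 t x) k ^ 2
     <= / nu * RInt (fun s => ck k * cf (negb b) (psi s) k ^ 2) 0 t).
  { intros k. assert (c := cpk k).
    rewrite cf_minus by ctn. rewrite E1, E2 by auto. rewrite (wk_minus L nu rho) by auto.
    rewrite (wk_form L nu rho) by (auto; lra). rewrite Rmult_0_r, Rplus_0_l.
    rewrite RI_scal by ctn.
    assert (Q := duh_sq k (fun s => cf (negb b) (psi s) k) 0 t c (proj1 Ht)).
    assert (C := ck_pos L HL k).
    assert (Q2 : RInt (fun r => exp (- mu k * (t - r)) * cf (negb b) (psi r) k ^ 2) 0 t
      <= RInt (fun r => cf (negb b) (psi r) k ^ 2) 0 t).
    { apply RI_le; [ctn | ctn | lra |]. intros r Hr.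
      assert (h := exp_mu_le1 L nu rho Hnu Hrho k (t - r) ltac:(lra)).
      assert (h2 := pow2_ge_0 (cf (negb b) (psi r) k)). nra. }
    assert (0 < / nu) by pos.
    unfold psi in Q, Q2 |- *.
    set (X := RInt (fun r => exp (- mu k * (t - r)) * cf (negb b) (fun x => phi1 r x - phi2 r x) k ^ 2) 0 t) in *.
    set (Y := RInt (fun r => cf (negb b) (fun x => phi1 r x - phi2 r x) k ^ 2) 0 t) in *.
    assert (/ nu * X <= / nu * Y) by (apply Rmult_le_compat_l; lra).
    replace (/ nu * (ck k * Y)) with (ck k * (/ nu * Y)) by ring.
    apply Rmult_le_compat_l; [lra |]. eapply Rle_trans; [apply Q | auto]. }
  eapply Rle_trans; [apply sm_le; intros; apply K |].
  rewrite sm_scal. rewrite <- (RI_sm (fun k s => ck k * cf (negb b) (psi s) k ^ 2)).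
  2:{ intros k. assert (c := cpk k). ctn. }
  apply Rmult_le_compat_l; [pos |]. apply RI_le; [| | lra |].
  - intros s. apply (c_sm (fun k s => ck k * cf (negb b) (psi s) k ^ 2)). intros k _. assert (c := cpk k). ctn.
  - apply (RI_param_cont (fun s x => (phi1 s x - phi2 s x) ^ 2)). ctn.
  - intros s Hs. apply (bessel L HL (negb b) (psi s)). ctn.
Qed.

Lemma tp_dx b c N x : is_derive (tp b c N) x (tp (negb b) (fun k => sg b * lam k * c k) N x).
Proof.
  unfold tpL. evar_last.
  - apply (sm_derive (fun k x => ck k * c k * e b k x) (fun k x => ck k * c k * (sg b * lam k * e (negb b) k x))).
    intros k _. apply (is_derive_scal (e b k)). apply e_derive.
  - simpl. apply sm_ext. intros; ring.
Qed.
Lemma tp_cont2 b (c : nat -> R -> R) N : (forall k, cont1 (c k)) -> cont2 (fun t x => tp b (fun k => c k t) N x).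
Proof.
  intros H p. unfold tpL. apply (c_sm (fun k (q : R * R) => ck k * c k (fst q) * e b k (snd q))).
  intros k _. assert (h := H k). assert (ce := e_cont L b k). ctn.
Qed.
Lemma tp_bdry c N x : x = 0 \/ x = L -> tp true c N x = 0.
Proof.
  intros H. unfold tpL. rewrite (sm_ext _ (fun _ => 0)), sm_zero; auto.
  intros k _. destruct H as [-> | ->]; [rewrite sin_0' | rewrite sin_L]; auto; ring.
Qed.
(* The estimate is run on partial sums, which are smooth and satisfy the boundary conditions
   exactly; completing the square absorbs the gradient. *)
Lemma truncation_step b a phi (th th1 th2 : R -> R) N t : cont2 phi ->
  (forall y, is_derive th y (th1 y)) -> (forall y, is_derive th1 y (th2 y)) -> cont1 th2 ->
  (forall y, 0 <= th2 y) -> th1 0 = 0 -> (forall y, 0 <= y * th1 y) -> 0 <= t ->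
  RInt (fun x => th (tp b (fun k => wk b a phi k t) N x)) 0 L
   <= RInt (fun x => th (tp b a N x)) 0 L
    + / (4 * nu) * RInt (fun s => RInt (fun x => th2 (tp b (fun k => wk b a phi k s) N x)
          * tp (negb b) (cf (negb b) (phi s)) N x ^ 2) 0 L) 0 t.
Proof.
  intros c D1 D2 c2 P2 Z1 S1 Ht.
  assert (c1 : cont1 th1) by (apply (cont1_derive _ th2); auto).
  assert (c0 : cont1 th) by (apply (cont1_derive _ th1); auto).
  assert (cwk : forall k, cont1 (wk b a phi k)) by (intros; apply wk_cont; auto).
  assert (cpk : forall k, cont1 (fun s => cf (negb b) (phi s) k)) by (intros; apply phik_cont; auto).
  set (P := fun t x => tp b (fun k => wk b a phi k t) N x).
  set (dwk := fun k t => - mu k * wk b a phi k t + lam k * cf (negb b) (phi t) k).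
  assert (cdwk : forall k, cont1 (dwk k)) by (intros k; assert (h1 := cwk k); assert (h2 := cpk k); unfold dwk; ctn).
  set (Pt := fun t x => tp b (fun k => dwk k t) N x).
  set (X := fun t x => tp (negb b) (fun k => sg b * lam k * wk b a phi k t) N x).
  set (F := fun t x => tp (negb b) (fun k => cf (negb b) (phi t) k) N x).
  assert (cP : cont2 P) by (apply tp_cont2; auto).
  assert (cPt : cont2 Pt) by (apply tp_cont2; auto).
  assert (cX : cont2 X).
  { apply (tp_cont2 (negb b) (fun k t => sg b * lam k * wk b a phi k t)). intros k; assert (h1 := cwk k); ctn. }
  assert (cF : cont2 F) by (apply (tp_cont2 (negb b) (fun k t => cf (negb b) (phi t) k)); auto).
  assert (DP : forall t x, is_derive (fun s => P s x) t (Pt t x)).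
  { intros t0 x. unfold P, Pt, tpL. apply (sm_derive (fun k s => ck k * wk b a phi k s * e b k x)
      (fun k s => ck k * dwk k s * e b k x)). intros k _.
    evar_last.
    - apply (is_derive_scal_l (fun s => ck k * wk b a phi k s) t0 (ck k * dwk k t0) (e b k x)).
      apply (is_derive_scal (wk b a phi k)). apply wk_derive; auto.
    - unfold scal; simpl; unfold mult; simpl. ring. }
  (* Flux of the truncated problem, with J_x = P_t + rho P. The boundary terms of the integration by
     parts vanish: for sines through [th1 0 = 0], for cosines because [J] is a sine sum. *)
  set (J := fun t x => nu * X t x - sg b * F t x).
  assert (sb := sg_sq b).
  assert (DJ : forall t x, is_derive (fun y => J t y) x (Pt t x + rho * P t x)).
  { intros t0 x. unfold J. evar_last.
    - apply (is_derive_minus (fun y => nu * X t0 y) (fun y => sg b * F t0 y)).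
      + apply (is_derive_scal (X t0)). apply tp_dx.
      + apply (is_derive_scal (F t0)). apply tp_dx.
    - unfold minus, plus, opp; simpl. rewrite Bool.negb_involutive, sg_neg.
      unfold Pt, P, tpL, dwk. rewrite <- !sm_scal, <- sm_plus.
      match goal with |- sm ?u N + - sm ?v N = _ => transitivity (sm (fun k => u k - v k) N); [rewrite sm_minus; ring |] end.
      apply sm_ext. intros k _.
      transitivity (ck k * (- nu * (sg b * sg b) * lam k ^ 2 * wk b a phi k t0 + (sg b * sg b) * lam k * cf (negb b) (phi t0) k) * e b k x);
        [ring | rewrite sb; ring]. }
  assert (cJ : cont2 J) by (unfold J; ctn).
  set (y := fun t => RInt (fun x => th (P t x)) 0 L).
  set (z := fun s => RInt (fun x => th2 (P s x) * F s x ^ 2) 0 L).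
  assert (cz : cont1 z) by (apply (RI_param_cont (fun s x => th2 (P s x) * F s x ^ 2)); ctn).
  assert (Dy : forall t, is_derive y t (RInt (fun x => th1 (P t x) * Pt t x) 0 L)).
  { intros t0. apply (RI_param_derive (fun t x => th (P t x)) (fun t x => th1 (P t x) * Pt t x)); [ctn | ctn |].
    intros t1 x. evar_last.
    - apply (is_derive_comp th (fun s => P s x)); [apply D1 | apply DP].
    - unfold scal; simpl; unfold mult; simpl. ring. }
  assert (K : forall t, RInt (fun x => th1 (P t x) * Pt t x) 0 L <= / (4 * nu) * z t).
  { intros t0.
    assert (DPx : forall x, is_derive (fun y => th1 (P t0 y)) x (th2 (P t0 x) * X t0 x)).
    { intros x. evar_last.
      - apply (is_derive_comp th1 (P t0)); [apply D2 | apply tp_dx].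
      - unfold scal; simpl; unfold mult; simpl. unfold X. ring. }
    assert (IB := RI_ibp (fun x => th1 (P t0 x)) (fun x => th2 (P t0 x) * X t0 x) (fun x => J t0 x)
       (fun x => Pt t0 x + rho * P t0 x) 0 L DPx ltac:(ctn) (DJ t0) ltac:(ctn)).
    assert (B0 : th1 (P t0 L) * J t0 L = 0 /\ th1 (P t0 0) * J t0 0 = 0).
    { destruct b.
      - unfold P. rewrite !tp_bdry, Z1 by auto. split; ring.
      - unfold J, X, F. simpl negb. rewrite !tp_bdry by auto. split; ring. }
    destruct B0 as [B1 B2]. cbv beta in IB. rewrite B1, B2 in IB.
    unfold z. rewrite <- RI_scal by ctn.
    rewrite (RInt_ext (fun x => th1 (P t0 x) * Pt t0 x)
      (fun x => th1 (P t0 x) * (Pt t0 x + rho * P t0 x) - rho * (P t0 x * th1 (P t0 x)))) by (intros; req; ring).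
    rewrite RI_minus by ctn. rewrite IB.
    assert (I2 : 0 <= RInt (fun x => rho * (P t0 x * th1 (P t0 x))) 0 L).
    { apply RI_ge0; [ctn | lra |]. intros; apply Rmult_le_pos; auto. }
    assert (I3 : - RInt (fun x => / (4 * nu) * (th2 (P t0 x) * F t0 x ^ 2)) 0 L <= RInt (fun x => th2 (P t0 x) * X t0 x * J t0 x) 0 L).
    { apply Rle_trans with (RInt (fun x => (-1) * (/ (4 * nu) * (th2 (P t0 x) * F t0 x ^ 2))) 0 L).
      - rewrite (RI_scal (-1)) by ctn. lra.
      - apply RI_le; [ctn | ctn | lra |]. intros x _. unfold J.
        assert (Q := pow2_ge_0 (2 * nu * X t0 x - sg b * F t0 x)).
        assert (Q1 : 0 <= X t0 x * (nu * X t0 x - sg b * F t0 x) + / (4 * nu) * F t0 x ^ 2).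
        { replace (X t0 x * (nu * X t0 x - sg b * F t0 x) + / (4 * nu) * F t0 x ^ 2) with
            (/ (4 * nu) * ((2 * nu * X t0 x - sg b * F t0 x) ^ 2 + (1 - sg b * sg b) * F t0 x ^ 2)) by (field; lra).
          rewrite sb. apply Rmult_le_pos; [pos | lra]. }
        assert (h := P2 (P t0 x)). nra. }
    lra. }
  assert (Fin : y t - / (4 * nu) * RInt z 0 t <= y 0 - / (4 * nu) * RInt z 0 0).
  { apply (decr_of_derive (fun t => y t - / (4 * nu) * RInt z 0 t)
      (fun t => RInt (fun x => th1 (P t x) * Pt t x) 0 L - / (4 * nu) * z t)); auto.
    - intros s Hs. apply (is_derive_minus y (fun t => / (4 * nu) * RInt z 0 t)); auto.
      apply (is_derive_scal (fun t => RInt z 0 t)). apply RI_derive; auto.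
    - intros s Hs. assert (h := K s). lra. }
  rewrite RI_point in Fin.
  assert (Y0 : y 0 = RInt (fun x => th (tp b a N x)) 0 L).
  { unfold y, P. apply RInt_ext. intros; req. f_equal. unfold tpL. apply sm_ext. intros. rewrite wk_0. auto. }
  rewrite Y0 in Fin.
  match goal with |- ?A <= ?B + ?C => assert (Fin' : A - C <= B - / (4 * nu) * 0) by exact Fin end.
  lra.
Qed.

(** Passage to the limit in [truncation_step], then Gronwall for the integral of th(w). The partial
    sums of [w] converge uniformly, but those of [phi] only in L2, so the two factors of the source
    term are treated separately. *)
Lemma truncation b a phi w (th th1 th2 : R -> R) K : hs b a phi w ->
  (forall y, is_derive th y (th1 y)) -> (forall y, is_derive th1 y (th2 y)) -> cont1 th2 ->
  (forall y, 0 <= th y) -> (forall y, 0 <= th2 y) -> th1 0 = 0 -> (forall y, 0 <= y * th1 y) -> 0 <= K ->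
  (forall t x, 0 <= t <= T -> 0 <= x <= L -> th2 (w t x) * phi t x ^ 2 <= K * th (w t x)) ->
  (forall x, 0 <= x <= L -> th (w 0 x) = 0) ->
  forall t x, 0 <= t <= T -> 0 <= x <= L -> th (w t x) = 0.
Proof.
  intros H D1 D2 c2 P0 P2 Z1 S1 HK HB H0.
  assert (H' := H). destruct H' as [cphi [cw [Ecf _]]].
  assert (c1 : cont1 th1) by (apply (cont1_derive _ th2); auto).
  assert (c0 : cont1 th) by (apply (cont1_derive _ th1); auto).
  destruct (cont2_bound w 0 T 0 L cw) as [M [HM HMb]].
  destruct (cont2_bound phi 0 T 0 L cphi) as [Mf [HMf HMfb]].
  destruct (cont1_bound th2 (- M) M c2) as [M2 [HM2 HM2b]].
  set (y := fun t => RInt (fun x => th (w t x)) 0 L).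
  assert (cy : cont1 y) by (apply (RI_param_cont (fun t x => th (w t x))); ctn).
  assert (y0 : forall t, 0 <= y t) by (intros; apply RI_ge0; [ctn | lra | auto]).
  set (Q := 2 * L + / (4 * nu) * (2 * M2 + Mf ^ 2 * L) * T).
  assert (HQ : 0 < Q) by (unfold Q; assert (0 <= / (4 * nu) * (2 * M2 + Mf ^ 2 * L) * T) by pos; lra).
  assert (Key : forall ep, 0 < ep -> ep <= 1 -> forall t, 0 <= t <= T ->
     y t <= Q * ep + K / (2 * nu) * RInt y 0 t).
  { intros ep Hep Hep1.
    destruct (cont2_unif_mod (fun s _ => th s) (- M - 1) (M + 1) 0 0 ep ltac:(ctn) Hep) as [d0 [Hd0 U0]].
    destruct (cont2_unif_mod (fun s _ => th2 s) (- M - 1) (M + 1) 0 0 ep ltac:(ctn) Hep) as [d2 [Hd2 U2]].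
    set (d := Rmin 1 (Rmin d0 d2) / 2).
    assert (Hd : 0 < d /\ d < 1 /\ d < d0 /\ d < d2).
    { assert (h1 := Rmin_l 1 (Rmin d0 d2)). assert (h2 := Rmin_r 1 (Rmin d0 d2)).
      assert (h3 := Rmin_l d0 d2). assert (h4 := Rmin_r d0 d2).
      assert (0 < Rmin 1 (Rmin d0 d2)) by (repeat apply Rmin_pos; lra). unfold d. lra. }
    destruct (hs_tp L nu rho T HL b a phi w d H) as [N1 HN1]; [lra |].
    destruct (l2unif L HL (negb b) phi T ep cphi ltac:(lra) Hep) as [N2 HN2].
    set (N := (N1 + N2)%nat).
    assert (Cl : forall t x, 0 <= t <= T -> 0 <= x <= L ->
      Rabs (th (tp b (fun k => wk b a phi k t) N x) - th (w t x)) <= ep /\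
      Rabs (th2 (tp b (fun k => wk b a phi k t) N x) - th2 (w t x)) <= ep).
    { intros t x Ht Hx.
      assert (h := HN1 N ltac:(unfold N; lia) t x Ht Hx).
      replace (tp b (cf b (w t)) N x) with (tp b (fun k => wk b a phi k t) N x) in h.
      2:{ unfold tpL. apply sm_ext. intros. rewrite Ecf; auto. }
      set (Y := tp b (fun k => wk b a phi k t) N x) in *.
      assert (hb := HMb t x Ht Hx). apply Rabs_le_between in hb. apply Rabs_le_between in h.
      assert (z0 : Rabs (0 - 0) < d0 /\ Rabs (0 - 0) < d2) by (rewrite Rminus_0_r, Rabs_R0; lra).
      assert (hY : Rabs (Y - w t x) < d0 /\ Rabs (Y - w t x) < d2) by (split; apply Rabs_def1; lra).
      split; left; [apply (U0 (w t x) 0 Y 0) | apply (U2 (w t x) 0 Y 0)]; lra. }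
    intros t Ht.
    assert (St := truncation_step b a phi th th1 th2 N t cphi D1 D2 c2 P2 Z1 S1 (proj1 Ht)).
    assert (ctpN : forall c, cont1 (tp b c N)) by (intros; apply tp_cont).
    assert (cpk : forall k, cont1 (fun s => cf (negb b) (phi s) k)) by (intros; apply phik_cont; auto).
    assert (cwk : forall k, cont1 (wk b a phi k)) by (intros; apply wk_cont; auto).
    assert (cP2 : cont2 (fun t x => tp b (fun k => wk b a phi k t) N x)) by (apply tp_cont2; auto).
    assert (cF2 : cont2 (fun t x => tp (negb b) (fun k => cf (negb b) (phi t) k) N x))
      by (apply (tp_cont2 (negb b) (fun k t => cf (negb b) (phi t) k)); auto).
    assert (A1 : y t - ep * L <= RInt (fun x => th (tp b (fun k => wk b a phi k t) N x)) 0 L).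
    { unfold y. replace (ep * L) with (ep * (L - 0)) by ring. rewrite <- (RI_const ep 0 L), <- RI_minus by ctn.
      assert (ct := ctpN (fun k => wk b a phi k t)).
      apply RI_le; [ctn | ctn | lra |]. intros x Hx. destruct (Cl t x Ht Hx) as [h _].
      apply Rabs_le_between in h. lra. }
    assert (A2 : RInt (fun x => th (tp b a N x)) 0 L <= ep * L).
    { assert (ct := ctpN a). replace (ep * L) with (ep * (L - 0)) by ring. apply RI_ub; [ctn | lra |].
      intros x Hx. destruct (Cl 0 x ltac:(lra) Hx) as [h _].
      replace (tp b (fun k => wk b a phi k 0) N x) with (tp b a N x) in h.
      - rewrite H0 in h by auto. apply Rabs_le_between in h. lra.
      - unfold tpL. apply sm_ext. intros. rewrite wk_0. auto. }
    assert (A3 : forall s, 0 <= s <= T -> RInt (fun x => th2 (tp b (fun k => wk b a phi k s) N x)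
          * tp (negb b) (cf (negb b) (phi s)) N x ^ 2) 0 L <= 2 * K * y s + (2 * M2 + Mf ^ 2 * L) * ep).
    { intros s Hs.
      assert (ct1 := ctpN (fun k => wk b a phi k s)). assert (ct2 := tp_cont L (negb b) (cf (negb b) (phi s)) N).
      assert (cs : cont1 (phi s)) by ctn.
      assert (dd := HN2 N ltac:(unfold N; lia) s Hs). rewrite dN_dist in dd by auto.
      assert (bb : RInt (fun x => tp (negb b) (cf (negb b) (phi s)) N x ^ 2) 0 L <= Mf ^ 2 * L).
      { rewrite tp_sq; auto; [| intros E; rewrite E; apply cf_true0; auto].
        eapply Rle_trans; [apply bessel; auto |]. apply RInt_sq_le; auto. }
      (* The partial sum [F] of [phi] is compared through F^2 <= 2 phi^2 + 2 (phi - F)^2; this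
         factor 2 turns the constant 1/(4 nu) into K/(2 nu). *)
      apply Rle_trans with (RInt (fun x => 2 * (th2 (w s x) * phi s x ^ 2)
         + (2 * M2 * (phi s x - tp (negb b) (cf (negb b) (phi s)) N x) ^ 2
         + ep * tp (negb b) (cf (negb b) (phi s)) N x ^ 2)) 0 L).
      - apply RI_le; [ctn | ctn | lra |]. intros x Hx.
        destruct (Cl s x Hs Hx) as [_ h]. apply Rabs_le_between in h.
        set (F := tp (negb b) (cf (negb b) (phi s)) N x).
        set (Y := th2 (tp b (fun k => wk b a phi k s) N x)) in *.
        assert (hb := HMb s x Hs Hx). apply Rabs_le_between in hb.
        assert (hm := HM2b (w s x) ltac:(lra)). apply Rabs_le_between in hm.
        assert (h0 := P2 (w s x)).
        assert (F2 : F ^ 2 <= 2 * phi s x ^ 2 + 2 * (phi s x - F) ^ 2).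
        { assert (q := pow2_ge_0 (2 * phi s x - F)). nra. }
        assert (Fp := pow2_ge_0 F). assert (Dp := pow2_ge_0 (phi s x - F)).
        assert (Y * F ^ 2 <= (th2 (w s x) + ep) * F ^ 2) by (apply Rmult_le_compat_r; lra).
        assert (th2 (w s x) * F ^ 2 <= th2 (w s x) * (2 * phi s x ^ 2 + 2 * (phi s x - F) ^ 2)) by (apply Rmult_le_compat_l; lra).
        assert (th2 (w s x) * (phi s x - F) ^ 2 <= M2 * (phi s x - F) ^ 2) by (apply Rmult_le_compat_r; lra).
        lra.
      - rewrite RI_plus by ctn. rewrite RI_plus by ctn. rewrite !RI_scal by ctn.
        assert (I1 : RInt (fun x => th2 (w s x) * phi s x ^ 2) 0 L <= K * y s).
        { unfold y. rewrite <- RI_scal by ctn. apply RI_le; [ctn | ctn | lra |]. auto. }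
        assert (2 * M2 * RInt (fun x => (phi s x - tp (negb b) (cf (negb b) (phi s)) N x) ^ 2) 0 L <= 2 * M2 * ep)
          by (apply Rmult_le_compat_l; lra).
        assert (ep * RInt (fun x => tp (negb b) (cf (negb b) (phi s)) N x ^ 2) 0 L <= ep * (Mf ^ 2 * L))
          by (apply Rmult_le_compat_l; lra).
        lra. }
    assert (A4 : RInt (fun s => RInt (fun x => th2 (tp b (fun k => wk b a phi k s) N x)
          * tp (negb b) (cf (negb b) (phi s)) N x ^ 2) 0 L) 0 t
          <= 2 * K * RInt y 0 t + (2 * M2 + Mf ^ 2 * L) * ep * t).
    { apply Rle_trans with (RInt (fun s => 2 * K * y s + (2 * M2 + Mf ^ 2 * L) * ep) 0 t).
      - apply RI_le; [| ctn | lra |].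
        + apply (RI_param_cont (fun s x => th2 (tp b (fun k => wk b a phi k s) N x)
            * tp (negb b) (cf (negb b) (phi s)) N x ^ 2)).
          intros p. apply c_mult.
          * apply (c_cont1 th2 (fun q : R * R => tp b (fun k => wk b a phi k (fst q)) N (snd q))); auto.
          * apply c_pow. apply cF2.
        + intros s Hs. apply A3. lra.
      - rewrite RI_plus by ctn. rewrite RI_const. rewrite RI_scal by ctn. lra. }
    assert (n4 : 0 < / (4 * nu)) by pos.
    assert (A5 : / (4 * nu) * RInt (fun s => RInt (fun x => th2 (tp b (fun k => wk b a phi k s) N x)
          * tp (negb b) (cf (negb b) (phi s)) N x ^ 2) 0 L) 0 t <=
       / (4 * nu) * (2 * K * RInt y 0 t + (2 * M2 + Mf ^ 2 * L) * ep * t)) by (apply Rmult_le_compat_l; lra).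
    assert (E1 : / (4 * nu) * (2 * K * RInt y 0 t) = K / (2 * nu) * RInt y 0 t) by (field; lra).
    assert (E2 : / (4 * nu) * ((2 * M2 + Mf ^ 2 * L) * ep * t) <= / (4 * nu) * ((2 * M2 + Mf ^ 2 * L) * ep * T)).
    { apply Rmult_le_compat_l; [lra |]. apply Rmult_le_compat_l; [pos | lra]. }
    unfold Q. lra. }
  assert (Y0 : forall t, 0 <= t <= T -> y t <= 0).
  { intros t Ht. apply le_eps. intros ep Hep. rewrite Rplus_0_l.
    set (C := K / (2 * nu)). assert (HC : 0 <= C) by (unfold C; pos).
    assert (Pe := exp_pos (C * t)).
    set (d := Rmin 1 (ep / (Q * exp (C * t)))).
    assert (Hd : 0 < d) by (apply Rmin_pos; [lra | pos]).
    assert (d1 : d <= 1) by apply Rmin_l. assert (d2 : d <= ep / (Q * exp (C * t))) by apply Rmin_r.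
    assert (G := gronwall y (Q * d) C T cy HC (Key d Hd d1) t Ht).
    eapply Rle_trans; [apply G |].
    apply Rle_trans with (Q * (ep / (Q * exp (C * t))) * exp (C * t)).
    - apply Rmult_le_compat_r; [lra |]. apply Rmult_le_compat_l; lra.
    - right; field. split; lra. }
  intros t x Ht Hx. apply (RI_zero (fun x => th (w t x)) L); auto; [ctn | apply Y0; auto].
Qed.
End Energy.

(** * Hoelder continuity in time *)

Lemma Rpower_le_1p m q : 0 < m -> 0 < q <= 1 -> Rpower m q <= 1 + m.
Proof.
  intros Hm Hq. destruct (Rle_dec 1 m).
  - apply Rle_trans with (Rpower m 1); [apply Rle_Rpower; lra |]. rewrite Rpower_1; lra.
  - assert (Rpower m q <= Rpower 1 q) by (apply Rpower_le_l; lra).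
    assert (Rpower 1 q = 1) by (unfold Rpower; rewrite ln_1, Rmult_0_r, exp_0; auto). lra.
Qed.
Lemma one_minus_exp y : 0 <= y -> 0 <= 1 - exp (- y) <= y /\ 1 - exp (- y) <= 1.
Proof.
  intros H. assert (h := exp_ineq1_le (- y)). assert (h2 := exp_pos (- y)).
  assert (h3 := exp_le_mono (- y) 0 ltac:(lra)). rewrite exp_0 in h3. lra.
Qed.
(** Interpolation between the bound 1 for large [y] and y^2 for small [y]. *)
Lemma one_minus_exp_sq y : 0 < y -> (1 - exp (- y)) ^ 2 <= Rpower y (3 / 4).
Proof.
  intros Hy. destruct (one_minus_exp y) as [h1 h2]; [lra |].
  destruct (Rle_dec 1 y).
  - assert (1 <= Rpower y (3/4)).
    { rewrite <- (Rpower_O y) by lra. apply Rle_Rpower; lra. }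
    nra.
  - apply Rle_trans with (y ^ 2); [apply pow_incr; lra |].
    rewrite <- (Rpower_pow 2) by auto. replace (INR 2) with (3/4 + 5/4) by (simpl; lra).
    rewrite Rpower_plus. assert (Rpower y (5/4) <= Rpower 1 (5/4)) by (apply Rpower_le_l; lra).
    assert (Rpower 1 (5/4) = 1) by (unfold Rpower; rewrite ln_1, Rmult_0_r, exp_0; auto).
    assert (p := Rpower_pos (3/4) y). nra.
Qed.

Section Holder.
Variables L nu rho T : R.
Hypothesis HL : 0 < L.
Hypothesis Hnu : 0 < nu.
Hypothesis Hrho : 0 <= rho.
Hypothesis HT : 0 < T.
Local Notation lam := (lamL L).
Local Notation cf := (cfL L).
Local Notation ck := (ckL L).
Local Notation mu k := (nu * lam k ^ 2 + rho).
Local Notation wk b := (wkL L b nu rho).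
Local Notation hs b := (hs L b nu rho T).

Lemma exp_gap_sq k h : 0 < h -> (1 - exp (- mu k * h)) ^ 2 <= (1 + mu k) * Rpower h (3 / 4).
Proof.
  intros Hh. assert (m0 := mu_ge0 L nu rho Hnu Hrho k).
  replace (- mu k * h) with (- (mu k * h)) by ring.
  destruct (Req_dec (mu k) 0) as [E | E].
  - rewrite E, Rmult_0_l, Ropp_0, exp_0, Rminus_diag_eq by auto.
    assert (p := Rpower_pos (3/4) h). simpl. lra.
  - assert (mp : 0 < mu k) by lra.
    eapply Rle_trans; [apply one_minus_exp_sq; pos |].
    rewrite <- Rpower_mult_distr by lra. apply Rmult_le_compat_r; [pos |]. apply Rpower_le_1p; lra.
Qed.
(** Restarting at [s] splits the increment into the decay of the initial part, the decay of the
    earlier Duhamel term, and the new Duhamel term. The second is critical: (mu h)^(3/4) is paid by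
    exp(-mu (s - r)) <= C (mu (s - r))^(-3/4), integrable as 3/4 < 1. The later flux estimate asks
    for more than 5/8 here. *)
Lemma l2holder b A2 D : 0 <= A2 -> 0 <= D -> exists H, 0 < H /\ forall a phi w, hs b a phi w ->
  (forall N, sm (fun k => (1 + lam k ^ 2) * a k ^ 2) N <= A2) ->
  (forall t x, 0 <= t <= T -> 0 <= x <= L -> Rabs (phi t x) <= D) ->
  forall s t, 0 <= s -> s < t -> t <= T ->
  RInt (fun x => (w t x - w s x) ^ 2) 0 L <= H * Rpower (t - s) (3 / 4).
Proof.
  intros HA HD.
  destruct (Rpower_exp_bound (3 / 4)) as [C0 [HC0 KE]]; [lra |].
  set (Ha := 4 * (2 / L) * ((1 + rho + nu) * A2)).
  set (Hb := 4 * / nu * (C0 * (D ^ 2 * L) / (1 / 4) * Rpower T (1 / 4))).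
  set (Hc := 2 * / nu * (D ^ 2 * L) * Rpower T (1 / 4)).
  assert (Pa : 0 <= Ha) by (unfold Ha; pos).
  assert (Pb : 0 <= Hb) by (unfold Hb; pos).
  assert (Pc : 0 <= Hc) by (unfold Hc; pos).
  exists (Ha + Hb + Hc + 1). split; [lra |].
  intros a phi w [cphi [cw [Ecf _]]] HAb HDb s t Hs Hst HtT.
  set (h := t - s). assert (Hh : 0 < h) by (unfold h; lra).
  assert (ph := Rpower_pos (3/4) h).
  assert (cpk : forall k, cont1 (fun s => cf (negb b) (phi s) k)) by (intros; apply phik_cont; auto).
  set (f := fun k r => cf (negb b) (phi r) k).
  assert (cfk : forall k, cont1 (f k)) by auto.
  assert (Bes : forall r N, 0 <= r <= T -> sm (fun k => ck k * f k r ^ 2) N <= D ^ 2 * L).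
  { intros r N Hr. eapply Rle_trans; [apply (bessel L HL (negb b) (phi r)); ctn |].
    apply RInt_sq_le; auto. ctn. }
  (* At k = 0 the Duhamel term vanishes and mu_0 may be 0, where a real power is meaningless; hence
     the default 0. *)
  set (g := fun k => match k with O => 0 | S _ => Rpower (mu k) (3/4) end).
  assert (g0 : forall k, 0 <= g k) by (intros [|k]; unfold g; [lra | pos]).
  assert (K : forall k, ck k * (wk b a phi k t - wk b a phi k s) ^ 2 <=
     Rpower h (3/4) * (4 * (2 / L) * ((1 + rho + nu) * ((1 + lam k ^ 2) * a k ^ 2)))
     + (Rpower h (3/4) * (4 * / nu)) * RInt (fun r => g k * (ck k * (exp (- mu k * (s - r)) * f k r ^ 2))) 0 s
     + (2 * / nu) * RInt (fun r => ck k * f k r ^ 2) s t).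
  { intros k. assert (c := cfk k). assert (Ck := ck_pos L HL k). assert (Ck2 := ck_bounds L HL k).
    set (I := lam k * RInt (fun r => exp (- mu k * (s - r)) * f k r) 0 s).
    set (Y := lam k * RInt (fun r => exp (- mu k * (t - r)) * f k r) s t).
    assert (E1 : wk b a phi k s = exp (- mu k * s) * a k + I) by (apply wk_form; auto).
    assert (E2 : wk b a phi k t = exp (- mu k * h) * wk b a phi k s + Y) by (apply wk_restart; auto; lra).
    assert (G := exp_gap_sq k h Hh). set (d := 1 - exp (- mu k * h)) in *.
    assert (E3 : wk b a phi k t - wk b a phi k s = (- d * (exp (- mu k * s) * a k) - d * I) + Y).
    { rewrite E2, E1. unfold d. ring. }
    rewrite E3.
    assert (e1 := exp_mu_le1 L nu rho Hnu Hrho k s Hs). assert (e0 := exp_pos (- mu k * s)).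
    assert (Q : ((- d * (exp (- mu k * s) * a k) - d * I) + Y) ^ 2 <= 4 * (d ^ 2 * a k ^ 2) + 4 * (d ^ 2 * I ^ 2) + 2 * Y ^ 2).
    { eapply Rle_trans; [apply sq_sum |].
      assert (q1 := sq_sum (- d * (exp (- mu k * s) * a k)) (- (d * I))).
      assert (q2 : (- d * (exp (- mu k * s) * a k)) ^ 2 <= d ^ 2 * a k ^ 2).
      { replace ((- d * (exp (- mu k * s) * a k)) ^ 2) with (exp (- mu k * s) ^ 2 * (d ^ 2 * a k ^ 2)) by ring.
        assert (exp (- mu k * s) ^ 2 <= 1) by (rewrite <- (pow1 2); apply pow_incr; lra).
        assert (0 <= d ^ 2 * a k ^ 2) by pos. nra. }
      replace (- d * (exp (- mu k * s) * a k) - d * I) with (- d * (exp (- mu k * s) * a k) + - (d * I)) by ring.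
      replace ((- (d * I)) ^ 2) with (d ^ 2 * I ^ 2) in q1 by ring. lra. }
    assert (T1 : ck k * (4 * (d ^ 2 * a k ^ 2)) <= Rpower h (3/4) * (4 * (2 / L) * ((1 + rho + nu) * ((1 + lam k ^ 2) * a k ^ 2)))).
    { assert (q1 : d ^ 2 * a k ^ 2 <= (1 + rho + nu) * (1 + lam k ^ 2) * Rpower h (3/4) * a k ^ 2).
      { apply Rmult_le_compat_r; [pos |]. eapply Rle_trans; [apply G |]. apply Rmult_le_compat_r; [lra |].
        assert (l2 := pow2_ge_0 (lam k)). nra. }
      assert (q0 : 0 <= d ^ 2 * a k ^ 2) by pos.
      apply Rle_trans with (2 / L * (4 * ((1 + rho + nu) * (1 + lam k ^ 2) * Rpower h (3/4) * a k ^ 2))); [| right; ring].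
      apply Rmult_le_compat; lra. }
    assert (T2 : ck k * (4 * (d ^ 2 * I ^ 2)) <= (Rpower h (3/4) * (4 * / nu)) * RInt (fun r => g k * (ck k * (exp (- mu k * (s - r)) * f k r ^ 2))) 0 s).
    { rewrite RI_scal by ctn. rewrite RI_scal by ctn.
      destruct k as [| k'].
      - unfold I. rewrite (lam0 L) at 1 by auto. unfold g. right. ring.
      - assert (DS := duh_sq L nu rho HL Hnu Hrho (S k') (f (S k')) 0 s c Hs). fold I in DS.
        assert (d2 : d ^ 2 <= g (S k') * Rpower h (3/4)).
        { unfold g. rewrite Rpower_mult_distr; [| | auto].
          - unfold d. replace (- mu (S k') * h) with (- (mu (S k') * h)) by ring. apply one_minus_exp_sq.
            assert (P := lam_pos L HL (S k') ltac:(lia)). assert (0 < nu * lam (S k') ^ 2) by pos. apply Rmult_lt_0_compat; lra.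
          - assert (P := lam_pos L HL (S k') ltac:(lia)). assert (0 < nu * lam (S k') ^ 2) by pos. lra. }
        set (X := RInt (fun r => exp (- mu (S k') * (s - r)) * f (S k') r ^ 2) 0 s) in *.
        assert (q : d ^ 2 * I ^ 2 <= g (S k') * Rpower h (3/4) * (/ nu * X)) by (apply Rmult_le_compat; auto; pos).
        assert (ck (S k') * (4 * (d ^ 2 * I ^ 2)) <= ck (S k') * (4 * (g (S k') * Rpower h (3/4) * (/ nu * X)))) by
          (apply Rmult_le_compat_l; lra).
        eapply Rle_trans; [apply H |]. right; ring. }
    assert (T3 : ck k * (2 * Y ^ 2) <= (2 * / nu) * RInt (fun r => ck k * f k r ^ 2) s t).
    { rewrite RI_scal by ctn.
      assert (DS := duh_sq L nu rho HL Hnu Hrho k (f k) s t c ltac:(lra)). fold Y in DS.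
      assert (q : RInt (fun r => exp (- mu k * (t - r)) * f k r ^ 2) s t <= RInt (fun r => f k r ^ 2) s t).
      { apply RI_le; [ctn | ctn | lra |]. intros r Hr.
        assert (q := exp_mu_le1 L nu rho Hnu Hrho k (t - r) ltac:(lra)). assert (q2 := pow2_ge_0 (f k r)). nra. }
      assert (q2 : Y ^ 2 <= / nu * RInt (fun r => f k r ^ 2) s t).
      { eapply Rle_trans; [apply DS |]. apply Rmult_le_compat_l; [pos | auto]. }
      apply Rle_trans with (ck k * (2 * (/ nu * RInt (fun r => f k r ^ 2) s t))); [| right; ring].
      apply Rmult_le_compat_l; lra. }
    apply Rle_trans with (ck k * (4 * (d ^ 2 * a k ^ 2) + 4 * (d ^ 2 * I ^ 2) + 2 * Y ^ 2));
      [apply Rmult_le_compat_l; lra | lra]. }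
  apply Rle_trans with ((Ha + Hb + Hc) * Rpower h (3/4)); [| fold h; lra].
  apply (parseval_le L HL b (fun x => w t x - w s x)); [ctn |]. intros N.
  rewrite (sm_ext _ (fun k => ck k * (wk b a phi k t - wk b a phi k s) ^ 2)).
  2:{ intros. rewrite cf_minus by ctn. rewrite !Ecf by lra. auto. }
  eapply Rle_trans; [apply sm_le; intros; apply K |].
  rewrite !sm_plus, !sm_scal.
  rewrite <- (RI_sm (fun k r => g k * (ck k * (exp (- mu k * (s - r)) * f k r ^ 2)))).
  2:{ intros k. assert (c := cfk k). ctn. }
  rewrite <- (RI_sm (fun k r => ck k * f k r ^ 2)).
  2:{ intros k. assert (c := cfk k). ctn. }
  assert (S1 : Rpower h (3/4) * (4 * (2 / L) * ((1 + rho + nu) * sm (fun k => (1 + lam k ^ 2) * a k ^ 2) N)) <= Ha * Rpower h (3/4)).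
  { rewrite (Rmult_comm Ha). apply Rmult_le_compat_l; [lra |]. unfold Ha. apply Rmult_le_compat_l; [pos |].
    apply Rmult_le_compat_l; [pos | auto]. }
  set (hh := fun r => sm (fun k => g k * (ck k * (exp (- mu k * (s - r)) * f k r ^ 2))) N).
  assert (chh : cont1 hh).
  { intros r. unfold hh. apply (c_sm (fun k r => g k * (ck k * (exp (- mu k * (s - r)) * f k r ^ 2)))). intros k _.
    assert (c := cfk k). ctn. }
  assert (S2 : RInt hh 0 s <= C0 * (D ^ 2 * L) / (1 / 4) * Rpower T (1 / 4)).
  { destruct (Req_dec s 0) as [-> | Hs0].
    - rewrite RI_point. pos.
    - eapply Rle_trans; [apply (RI_singular hh s (C0 * (D ^ 2 * L)) (1/4)); auto; [lra | pos |] |].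
      + intros r Hr. unfold hh.
        apply Rle_trans with (sm (fun k => (C0 * Rpower (s - r) (1/4 - 1)) * (ck k * f k r ^ 2)) N).
        * apply sm_le. intros k _. assert (Ck := ck_pos L HL k).
          replace (g k * (ck k * (exp (- mu k * (s - r)) * f k r ^ 2))) with
            ((g k * exp (- mu k * (s - r))) * (ck k * f k r ^ 2)) by ring.
          apply Rmult_le_compat_r; [pos |].
          destruct k as [| k']; [unfold g; assert (0 <= C0 * Rpower (s - r) (1/4 - 1)) by pos; lra |].
          assert (P := lam_pos L HL (S k') ltac:(lia)). assert (P2 : 0 < nu * lam (S k') ^ 2) by pos.
          assert (mp : 0 < mu (S k')) by lra.
          replace (- mu (S k') * (s - r)) with (- (mu (S k') * (s - r))) by ring.
          unfold g. eapply Rle_trans; [apply Rmult_le_compat_l; [pos |]; apply KE; apply Rmult_lt_0_compat; lra |].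
          rewrite <- Rpower_mult_distr by lra.
          replace (Rpower (mu (S k')) (3/4) * (C0 * (Rpower (mu (S k')) (- (3/4)) * Rpower (s - r) (- (3/4))))) with
            ((Rpower (mu (S k')) (3/4) * Rpower (mu (S k')) (- (3/4))) * (C0 * Rpower (s - r) (- (3/4)))) by ring.
          rewrite <- Rpower_plus. replace (3/4 + - (3/4)) with 0 by lra. rewrite Rpower_O by auto.
          replace (1/4 - 1) with (- (3/4)) by lra. lra.
        * rewrite sm_scal. assert (q := Bes r N ltac:(lra)).
          apply Rle_trans with (C0 * Rpower (s - r) (1/4 - 1) * (D ^ 2 * L)); [apply Rmult_le_compat_l; [pos | auto] | right; ring].
      + apply Rmult_le_compat_l; [pos |]. apply Rpower_le_l; lra. }
  assert (S3 : RInt (fun r => sm (fun k => ck k * f k r ^ 2) N) s t <= D ^ 2 * L * h).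
  { apply RI_ub; [| lra |].
    - intros r. apply (c_sm (fun k r => ck k * f k r ^ 2)). intros k _. assert (c := cfk k). ctn.
    - intros r Hr. apply Bes. lra. }
  assert (S4 : h <= Rpower T (1/4) * Rpower h (3/4)).
  { rewrite <- (Rpower_1 h) at 1 by auto. replace 1 with (1/4 + 3/4) at 1 by lra. rewrite Rpower_plus.
    apply Rmult_le_compat_r; [lra |]. apply Rpower_le_l; unfold h; lra. }
  assert (S5 : Rpower h (3/4) * (4 * / nu) * RInt hh 0 s <= Hb * Rpower h (3/4)).
  { unfold Hb. apply Rle_trans with (Rpower h (3/4) * (4 * / nu) * (C0 * (D ^ 2 * L) / (1 / 4) * Rpower T (1 / 4)));
      [apply Rmult_le_compat_l; [pos | auto] | right; ring]. }
  assert (S6 : 2 * / nu * RInt (fun r => sm (fun k => ck k * f k r ^ 2) N) s t <= Hc * Rpower h (3/4)).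
  { unfold Hc. apply Rle_trans with (2 * / nu * (D ^ 2 * L * (Rpower T (1/4) * Rpower h (3/4)))).
    - apply Rmult_le_compat_l; [pos |]. eapply Rle_trans; [apply S3 |]. apply Rmult_le_compat_l; [pos | auto].
    - right; ring. }
  fold hh. lra.
Qed.
End Holder.

(** * Energy balance *)

Lemma clamp_lip T x y : 0 <= T -> Rabs (clamp T x - clamp T y) <= Rabs (x - y).
Proof.
  intros HT. unfold clamp, Rmax, Rmin, Rabs.
  destruct (Rle_dec x T); destruct (Rle_dec y T);
  repeat match goal with |- context [Rle_dec ?a ?b] => destruct (Rle_dec a b) end;
  repeat match goal with |- context [Rcase_abs ?a] => destruct (Rcase_abs a) end; lra.
Qed.
(** Continuous extension from the closed rectangle to the plane, by projecting both variables. *)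
Definition ext (T L : R) (f : R -> R -> R) (t x : R) : R := f (clamp T t) (clamp L x).
Lemma ext_cont T L f : 0 <= T -> 0 <= L -> cont_on (rect T L) f -> cont2 (ext T L f).
Proof.
  intros HT HL H. apply cont2_eps. intros t x ep Hep.
  assert (Hin : rect T L (clamp T t, clamp L x)) by (split; simpl; apply clamp_in; auto).
  assert (K := H _ Hin).
  apply (proj1 (filterlim_locally _ _)) with (eps := mkposreal ep Hep) in K.
  destruct K as [[d Hd] K]. exists d. split; auto. intros s y Hs Hy.
  left. apply (K (clamp T s, clamp L y)).
  - split; simpl; [apply (Rle_lt_trans _ (Rabs (s - t))); [apply clamp_lip; auto | auto]
      | apply (Rle_lt_trans _ (Rabs (y - x))); [apply clamp_lip; auto | auto]].
  - split; simpl; apply clamp_in; auto.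
Qed.
Lemma locally_in (a b x : R) (P : R -> Prop) : a < x < b -> (forall y, a < y < b -> P y) -> locally x P.
Proof.
  intros Hx H. assert (Hm : 0 < Rmin (x - a) (b - x)) by (apply Rmin_pos; lra).
  exists (mkposreal _ Hm). intros y Hy. unfold ball in Hy; simpl in Hy.
  unfold AbsRing_ball, abs, minus, plus, opp in Hy; simpl in Hy. apply Rabs_def2 in Hy. simpl in Hy.
  assert (m1 := Rmin_l (x - a) (b - x)). assert (m2 := Rmin_r (x - a) (b - x)). apply H. lra.
Qed.
Lemma derive_ext_in (f g : R -> R) (a b x l : R) : a < x < b -> (forall y, a < y < b -> f y = g y) ->
  is_derive f x l -> is_derive g x l.
Proof.
  intros Hx E D. apply (is_derive_ext_loc f); auto. apply (locally_in a b); auto.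
Qed.
Lemma within_interior (f : R -> R) (l x L : R) : 0 < x < L -> deriv_within (Icc 0 L) f l x -> is_derive f x l.
Proof.
  intros Hx dx. unfold deriv_within in dx. apply is_derive_Reals. intros e He.
  apply (proj1 (filterlim_locally _ _)) with (eps := mkposreal e He) in dx.
  destruct dx as [[de Hde] K].
  assert (Hm : 0 < Rmin de (Rmin x (L - x))) by (repeat apply Rmin_pos; lra).
  exists (mkposreal _ Hm). simpl. intros h Hh Hb.
  assert (m1 := Rmin_l de (Rmin x (L - x))). assert (m2 := Rmin_r de (Rmin x (L - x))).
  assert (m3 := Rmin_l x (L - x)). assert (m4 := Rmin_r x (L - x)).
  assert (Hb' := Rabs_def2 _ _ Hb).
  assert (Q := K (x + h)).
  replace (x + h - x) with h in Q by ring. apply Q.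
  - unfold ball; simpl. unfold AbsRing_ball, abs, minus, plus, opp; simpl.
    replace (x + h + - x) with h by ring. lra.
  - unfold Icc. split; lra.
Qed.
Lemma interior_pt (T L : R) (f : R -> R -> R) t x : cont_on (orect T L) f -> 0 < t < T -> 0 < x < L -> continuity_2d_pt f t x.
Proof.
  intros c Ht Hx. apply continuity_2d_pt_filterlim.
  intros P HP. assert (K := c (t, x) (conj Ht Hx) P HP).
  unfold filtermap, within in *. simpl in *. destruct K as [[d Hd] K].
  assert (Hm : 0 < Rmin d (Rmin (Rmin t (T - t)) (Rmin x (L - x)))) by (repeat apply Rmin_pos; lra).
  exists (mkposreal _ Hm). intros [s y] [Hb1 Hb2]. simpl in *.
  assert (q1 := Rmin_l d (Rmin (Rmin t (T - t)) (Rmin x (L - x)))).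
  assert (q2 := Rmin_r d (Rmin (Rmin t (T - t)) (Rmin x (L - x)))).
  assert (q3 := Rmin_l (Rmin t (T - t)) (Rmin x (L - x))). assert (q4 := Rmin_r (Rmin t (T - t)) (Rmin x (L - x))).
  assert (m3 := Rmin_l t (T - t)). assert (m4 := Rmin_r t (T - t)).
  assert (m5 := Rmin_l x (L - x)). assert (m6 := Rmin_r x (L - x)).
  unfold ball in Hb1, Hb2; simpl in Hb1, Hb2; unfold AbsRing_ball, abs, minus, plus, opp in Hb1, Hb2; simpl in Hb1, Hb2.
  assert (h1 := Rabs_def2 _ _ Hb1). assert (h2 := Rabs_def2 _ _ Hb2).
  apply (K (s, y)).
  - split; simpl; unfold ball; simpl; unfold AbsRing_ball, abs, minus, plus, opp; simpl; lra.
  - split; simpl; lra.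
Qed.
Lemma RInt_plus_seg (f g : R -> R) a b : a <= b -> (forall x, a <= x <= b -> continuous f x) ->
  (forall x, a <= x <= b -> continuous g x) -> RInt (fun x => f x + g x) a b = RInt f a b + RInt g a b.
Proof.
  intros Hab cf cg. apply (RInt_plus f g);
  apply (ex_RInt_continuous (V := R_CompleteNormedModule)); rewrite Rmin_left, Rmax_right by lra; auto.
Qed.

(* Integrating over [[d, L - d]] only and letting [d] tend to [0] avoids any control of
   [qt] at the boundary. *)
Lemma energy_balance T L (q J S qt : R -> R -> R) : 0 < T -> 0 < L -> cont2 q -> cont2 J -> cont2 S ->
  (forall t x, 0 < t < T -> 0 < x < L -> is_derive (fun s => q s x) t (qt t x)) ->
  (forall t x, 0 < t < T -> 0 < x < L -> is_derive (fun y => J t y) x (qt t x - S t x)) ->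
  (forall t x, 0 < t < T -> 0 < x < L -> continuity_2d_pt qt t x) ->
  (forall t, 0 <= t <= T -> J t 0 = 0 /\ J t L = 0) ->
  forall t, 0 <= t <= T -> RInt (q t) 0 L = RInt (q 0) 0 L + RInt (fun s => RInt (S s) 0 L) 0 t.
Proof.
  intros HT HL cq cJ cS Dq DJ cqt BJ.
  assert (csl : forall t x, 0 < t < T -> 0 < x < L -> continuous (qt t) x).
  { intros t x Ht Hx. assert (h := proj1 (continuity_2d_pt_filterlim qt t x) (cqt t x Ht Hx)).
    apply (continuous_comp_2 (fun _ => t) (fun y => y) qt); [apply c_const | apply continuous_id |].
    exact h. }
  assert (D : forall d t, 0 < d < L / 2 -> 0 < t < T ->
     is_derive (fun t => RInt (q t) d (L - d)) t (J t (L - d) - J t d + RInt (S t) d (L - d))).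
  { intros d t Hd Ht.
    replace (J t (L - d) - J t d + RInt (S t) d (L - d)) with (RInt (fun x => Derive (fun u => q u x) t) d (L - d)).
    - apply (is_derive_RInt_param q).
      + apply (locally_in 0 T); auto. intros s Hs x. rewrite Rmin_left, Rmax_right by lra. intros Hx.
        exists (qt s x). apply Dq; lra.
      + intros x. rewrite Rmin_left, Rmax_right by lra. intros Hx.
        apply continuity_2d_pt_ext_loc with qt; [| apply cqt; lra].
        assert (Hm : 0 < Rmin (Rmin t (T - t)) (Rmin x (L - x))) by (repeat apply Rmin_pos; lra).
        exists (mkposreal _ Hm). simpl. intros u v Hu Hv.
        assert (m1 := Rmin_l (Rmin t (T - t)) (Rmin x (L - x))). assert (m2 := Rmin_r (Rmin t (T - t)) (Rmin x (L - x))).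
        assert (m3 := Rmin_l t (T - t)). assert (m4 := Rmin_r t (T - t)).
        assert (m5 := Rmin_l x (L - x)). assert (m6 := Rmin_r x (L - x)).
        assert (Hu' := Rabs_def2 _ _ Hu). assert (Hv' := Rabs_def2 _ _ Hv).
        symmetry. apply is_derive_unique, Dq; lra.
      + apply filter_forall. intros s. apply exR. ctn.
    - rewrite (RI_ext _ (fun x => (qt t x - S t x) + S t x)); [| lra |].
      + rewrite RInt_plus_seg; [| lra | |].
        * rewrite (RI_ftc_seg (J t)); auto; [lra | |].
          -- intros x Hx. apply DJ; lra.
          -- intros x Hx. apply c_minus; [apply csl; lra | ctn].
        * intros x Hx. apply c_minus; [apply csl; lra | ctn].
        * intros x Hx. ctn.
      + intros x Hx. transitivity (qt t x); [apply is_derive_unique, Dq; lra | ring]. }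
  set (Z := fun t => RInt (q t) 0 L - RInt (fun s => RInt (S s) 0 L) 0 t).
  assert (cSS : cont1 (fun s => RInt (S s) 0 L)) by (apply (RI_param_cont S); auto).
  assert (cZ : cont1 Z).
  { unfold Z. assert (h1 := RI_param_cont q 0 L cq). assert (h2 := RI_cont (fun s => RInt (S s) 0 L) 0 cSS). ctn. }
  (* On [d, L - d] the balance is exact. Removing the two strips costs at most 2 M d per integral,
     and [J] near the ends is small by uniform continuity; constancy then extends to t = 0 and t = T
     by continuity of [Z]. *)
  assert (Zc : forall t1 t2, 0 < t1 -> t1 <= t2 -> t2 < T -> Z t2 = Z t1).
  { intros t1 t2 H1 H12 H2. apply eq_eps. intros ep Hep.
    destruct (cont2_bound q 0 T 0 L cq) as [Mq [HMq Bq]].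
    destruct (cont2_bound S 0 T 0 L cS) as [Ms [HMs Bs]].
    set (e1 := ep / (4 * T)). assert (He1 : 0 < e1) by (unfold e1; pos).
    destruct (cont2_unif_mod J 0 T 0 L e1 cJ He1) as [de [Hde UJ]].
    set (d := Rmin (Rmin (L / 4) (de / 2)) (ep / (8 * (Mq + Ms * T) + 1))).
    assert (P1 : 0 < Mq + Ms * T) by (assert (0 < Ms * T) by pos; lra).
    assert (Hd : 0 < d /\ d <= L / 4 /\ d <= de / 2 /\ d <= ep / (8 * (Mq + Ms * T) + 1)).
    { assert (h1 := Rmin_l (Rmin (L / 4) (de / 2)) (ep / (8 * (Mq + Ms * T) + 1))).
      assert (h2 := Rmin_r (Rmin (L / 4) (de / 2)) (ep / (8 * (Mq + Ms * T) + 1))).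
      assert (h3 := Rmin_l (L / 4) (de / 2)). assert (h4 := Rmin_r (L / 4) (de / 2)).
      assert (0 < d) by (unfold d; repeat apply Rmin_pos; try lra; apply Rdiv_lt_0_compat; lra).
      unfold d in *. lra. }
    set (g := fun s => J s (L - d) - J s d + RInt (S s) d (L - d)).
    assert (cg : cont1 g).
    { unfold g. assert (h := RI_param_cont S d (L - d) cS). ctn. }
    assert (E : RInt g t1 t2 = RInt (q t2) d (L - d) - RInt (q t1) d (L - d)).
    { apply (RI_ftc_seg (fun t => RInt (q t) d (L - d))); auto. intros t Ht. apply D; lra. }
    assert (Cut : forall f M, cont1 f -> (forall x, 0 <= x <= L -> Rabs (f x) <= M) ->
        Rabs (RInt f 0 L - RInt f d (L - d)) <= 2 * M * d).
    { intros f M cf HM.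
      assert (c1 := RI_chasles f 0 d L cf). assert (c2 := RI_chasles f d (L - d) L cf).
      replace (RInt f 0 L - RInt f d (L - d)) with (RInt f 0 d + RInt f (L - d) L) by lra.
      eapply Rle_trans; [apply Rabs_triang |].
      assert (Rabs (RInt f 0 d) <= M * (d - 0)) by (apply RI_abs_ub; auto; [lra | intros; apply HM; lra]).
      assert (Rabs (RInt f (L - d) L) <= M * (L - (L - d))) by (apply RI_abs_ub; auto; [lra | intros; apply HM; lra]).
      lra. }
    assert (Q1 := Cut (q t1) Mq ltac:(ctn) (fun x Hx => Bq t1 x ltac:(lra) Hx)).
    assert (Q2 := Cut (q t2) Mq ltac:(ctn) (fun x Hx => Bq t2 x ltac:(lra) Hx)).
    assert (Q3 : Rabs (RInt (fun s => RInt (S s) 0 L - g s) t1 t2) <= (2 * e1 + 2 * Ms * d) * (t2 - t1)).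
    { apply RI_abs_ub; [ctn | auto |]. intros s Hs. unfold g.
      assert (q3 := Cut (S s) Ms ltac:(ctn) (fun x Hx => Bs s x ltac:(lra) Hx)).
      destruct (BJ s ltac:(lra)) as [b0 bL].
      assert (j1 := UJ s L s (L - d) ltac:(lra) ltac:(lra) ltac:(lra) ltac:(lra)
        ltac:(rewrite Rminus_diag_eq, Rabs_R0; auto) ltac:(rewrite Rabs_left; lra)).
      assert (j2 := UJ s 0 s d ltac:(lra) ltac:(lra) ltac:(lra) ltac:(lra)
        ltac:(rewrite Rminus_diag_eq, Rabs_R0; auto) ltac:(rewrite Rabs_right; lra)).
      rewrite bL in j1. rewrite b0 in j2.
      apply Rabs_def2 in j1. apply Rabs_def2 in j2. apply Rabs_le_between in q3. apply Rabs_le. lra. }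
    rewrite RI_minus in Q3 by auto. rewrite E in Q3.
    assert (E3 := RI_chasles (fun s => RInt (S s) 0 L) 0 t1 t2 cSS).
    unfold Z.
    apply Rabs_le_between in Q1. apply Rabs_le_between in Q2. apply Rabs_le_between in Q3.
    assert (B1 : (2 * e1 + 2 * Ms * d) * (t2 - t1) <= (2 * e1 + 2 * Ms * d) * T).
    { apply Rmult_le_compat_l; [| lra]. assert (0 < Ms * d) by (apply Rmult_lt_0_compat; lra). lra. }
    assert (B2 : 2 * e1 * T = ep / 2) by (unfold e1; field; lra).
    assert (B3 : d * (8 * (Mq + Ms * T) + 1) <= ep).
    { destruct Hd as [_ [_ [_ h]]]. apply (Rmult_le_compat_r (8 * (Mq + Ms * T) + 1)) in h; [| lra].
      replace (ep / (8 * (Mq + Ms * T) + 1) * (8 * (Mq + Ms * T) + 1)) with ep in h by (field; lra). auto. }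
    assert (B4 : 0 <= d * (Ms * T)) by (destruct Hd; pos).
    assert (B5 : 0 < d) by apply Hd.
    clearbody d e1. apply Rabs_le. lra. }
  intros t Ht.
  assert (ZT : forall s, 0 <= s <= T -> Z s - Z (T / 2) = 0).
  { apply (zero_closure T HT (fun s => Z s - Z (T / 2))); [ctn |]. intros s Hs.
    destruct (Rle_dec s (T / 2)) as [h | h].
    - rewrite (Zc s (T / 2)); lra.
    - rewrite (Zc (T / 2) s); lra. }
  assert (z1 := ZT t Ht). assert (z2 := ZT 0 ltac:(lra)). unfold Z in z1, z2. rewrite RI_point in z2. lra.
Qed.

(** * Uniqueness *)

Definition Pfun (b c L : R) (V M : R -> R -> R) (t : R) : R := b + c * RInt (fun y => V t y * M t y) 0 L.
Definition GfL (b c L : R) (V M : R -> R -> R) (t x : R) : R := / 2 * (Pfun b c L V M t - V t x).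

(** A classical solution extended continuously to the plane, with [V] and [N] standing for u_x and
    m_x. Second derivatives are eliminated: [s_vx] is the Hamilton-Jacobi equation solved for u_xx,
    and [s_fx] is the Fokker-Planck equation as the statement that the flux has derivative [mt].
    This is the shape consumed by [energy_balance]. *)
Record solution (nu r T L b c : R) (uT m0 : R -> R) (U V M N ut mt : R -> R -> R) : Prop := {
  s_cU : cont2 U; s_cV : cont2 V; s_cM : cont2 M; s_cN : cont2 N;
  s_ut : forall t x, 0 < t < T -> 0 < x < L -> is_derive (fun s => U s x) t (ut t x);
  s_ux : forall t x, 0 < t < T -> 0 < x < L -> is_derive (fun y => U t y) x (V t x);
  s_vx : forall t x, 0 < t < T -> 0 < x < L ->
    is_derive (fun y => V t y) x (/ nu * (- ut t x + r * U t x - GfL b c L V M t x ^ 2));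
  s_mt : forall t x, 0 < t < T -> 0 < x < L -> is_derive (fun s => M s x) t (mt t x);
  s_mx : forall t x, 0 < t < T -> 0 < x < L -> is_derive (fun y => M t y) x (N t x);
  s_fx : forall t x, 0 < t < T -> 0 < x < L ->
    is_derive (fun y => nu * N t y + GfL b c L V M t y * M t y) x (mt t x);
  s_cut : forall t x, 0 < t < T -> 0 < x < L -> continuity_2d_pt ut t x;
  s_cmt : forall t x, 0 < t < T -> 0 < x < L -> continuity_2d_pt mt t x;
  s_bv : forall t x, 0 <= t <= T -> x = 0 \/ x = L -> V t x = 0;
  s_bm : forall t x, 0 <= t <= T -> x = 0 \/ x = L -> nu * N t x + GfL b c L V M t x * M t x = 0;
  s_im : forall x, 0 <= x <= L -> M 0 x = m0 x;
  s_fu : forall x, 0 <= x <= L -> U T x = uT x }.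

Lemma classical_unpack sigma r T L eps uT m0 u m : 0 < sigma -> 0 < T -> 0 < L ->
  classical_solution sigma r T L eps uT m0 u m -> exists U V M N ut mt,
  solution (sigma ^ 2 / 2) r T L (bcoef eps) (ccoef eps) uT m0 U V M N ut mt /\
  forall t x, 0 <= t <= T -> 0 <= x <= L -> U t x = u t x /\ M t x = m t x.
Proof.
  intros Hs HT HL [ux [mx [ut [uxx [mt [mxx [c1 [c2 [c3 [c4 [c5 [c6 [c7 [c8 [D1 [D2 [E1 [E2 [I1 [B1 B2]]]]]]]]]]]]]]]]]]]].
  set (X := ext T L).
  assert (XE : forall f t x, 0 <= t <= T -> 0 <= x <= L -> X f t x = f t x).
  { intros f t x Ht Hx. unfold X, ext. rewrite !clamp_id by auto. auto. }
  assert (GE : forall t x, 0 <= t <= T -> 0 <= x <= L ->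
     GfL (bcoef eps) (ccoef eps) L (X ux) (X m) t x = Gfun eps L ux m t x).
  { intros t x Ht Hx. unfold GfL, Pfun, Gfun. rewrite XE by auto. f_equal. f_equal. f_equal. f_equal.
    apply RI_ext; [lra |]. intros y Hy. rewrite !XE by auto. auto. }
  assert (nu0 : 0 < sigma ^ 2 / 2) by pos.
  exists (X u), (X ux), (X m), (X mx), ut, mt. split.
  - constructor.
    + apply ext_cont; auto; lra.
    + apply ext_cont; auto; lra.
    + apply ext_cont; auto; lra.
    + apply ext_cont; auto; lra.
    + intros t x Ht Hx. apply (derive_ext_in (fun s => u s x) _ 0 T); auto.
      * intros s Hs'. rewrite XE by lra. auto.
      * apply D2; auto.
    + intros t x Ht Hx. apply (derive_ext_in (u t) _ 0 L); auto.
      * intros s Hs'. rewrite XE by lra. auto.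
      * rewrite XE by lra. destruct (D1 t ltac:(lra)) as [d _]. assert (dx := d x ltac:(unfold Icc; lra)).
        apply (within_interior _ _ _ L); auto.
    + intros t x Ht Hx. apply (derive_ext_in (ux t) _ 0 L); auto.
      * intros s Hs'. rewrite XE by lra. auto.
      * rewrite GE, XE by lra.
        replace (/ (sigma ^ 2 / 2) * (- ut t x + r * u t x - Gfun eps L ux m t x ^ 2)) with (uxx t x).
        -- apply D2; auto.
        -- assert (E := E1 t x Ht Hx).
           replace (- ut t x + r * u t x - Gfun eps L ux m t x ^ 2) with (sigma ^ 2 / 2 * uxx t x) by lra.
           field. apply Rgt_not_eq; auto.
    + intros t x Ht Hx. apply (derive_ext_in (fun s => m s x) _ 0 T); auto.
      * intros s Hs'. rewrite XE by lra. auto.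
      * apply D2; auto.
    + intros t x Ht Hx. apply (derive_ext_in (m t) _ 0 L); auto.
      * intros s Hs'. rewrite XE by lra. auto.
      * rewrite XE by lra. destruct (D1 t ltac:(lra)) as [_ d]. assert (dx := d x ltac:(unfold Icc; lra)).
        apply (within_interior _ _ _ L); auto.
    + intros t x Ht Hx.
      apply (derive_ext_in (fun y => sigma ^ 2 / 2 * mx t y + Gfun eps L ux m t y * m t y) _ 0 L); auto.
      * intros y Hy. rewrite GE, !XE by lra. auto.
      * destruct (E2 t x Ht Hx) as [g [Dg Eg]].
        replace (mt t x) with (sigma ^ 2 / 2 * mxx t x + g) by lra.
        apply (is_derive_plus (fun y => sigma ^ 2 / 2 * mx t y)); auto.
        apply (is_derive_scal (mx t)). apply D2; auto.
    + intros t x Ht Hx. apply (interior_pt T L); auto.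
    + intros t x Ht Hx. apply (interior_pt T L); auto.
    + intros t x Ht Hx. rewrite XE by (destruct Hx; subst; lra). destruct (B1 t Ht). destruct Hx; subst; auto.
    + intros t x Ht Hx. assert (0 <= x <= L) by (destruct Hx; subst; lra).
      rewrite GE, !XE by auto. apply B2; auto.
    + intros x Hx. rewrite XE by lra. apply I1; auto.
    + intros x Hx. rewrite XE by lra. apply I1; auto.
  - intros t x Ht Hx. rewrite !XE by auto. auto.
Qed.

Section Uniq.
Variables nu r T L b c : R.
Variables uT m0 : R -> R.
Hypothesis Hnu : 0 < nu.
Hypothesis HT : 0 < T.
Hypothesis HL : 0 < L.
Hypothesis Hb : 0 < b.
Hypothesis Hc : 0 < c.
Hypothesis Hbc : b + c = 1.
Hypothesis Hm0 : forall x, 0 <= x <= L -> 0 <= m0 x.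
Hypothesis Hmass : RInt m0 0 L = 1.
Local Notation solution := (solution nu r T L b c uT m0).
Local Notation Gf := (GfL b c L).
Local Notation Pf := (Pfun b c L).

Lemma Pf_cont V M : cont2 V -> cont2 M -> cont1 (Pf V M).
Proof.
  intros. unfold Pfun. assert (h := RI_param_cont (fun t y => V t y * M t y) 0 L ltac:(ctn)). ctn.
Qed.
Lemma Gf_cont V M : cont2 V -> cont2 M -> cont2 (Gf V M).
Proof. intros. unfold GfL. assert (h := Pf_cont V M H H0). ctn. Qed.
Lemma c2d_mult f g t x : cont2 f -> continuity_2d_pt g t x -> continuity_2d_pt (fun t x => f t x * g t x) t x.
Proof. intros. apply continuity_2d_pt_mult; auto. apply cont2_pt; auto. Qed.

(** Energy balance for q = M with the total flux as [J] and no source; the zero-flux condition is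
    exactly what is asked of [J]. *)
Lemma s_mass U V M N ut mt : solution U V M N ut mt -> forall t, 0 <= t <= T -> RInt (M t) 0 L = 1.
Proof.
  intros S t Ht. destruct S as [cU cV cM cN Dt Dx Dv Dm Dn Df c1 c2 bv bm im fu].
  assert (cG := Gf_cont V M cV cM).
  assert (E := energy_balance T L M (fun t y => nu * N t y + Gf V M t y * M t y) (fun _ _ => 0) mt HT HL cM
    ltac:(ctn) ltac:(ctn) Dm).
  rewrite E; auto.
  - rewrite (RI_ext (fun s => RInt (fun _ => 0) 0 L) (fun _ => 0)), RI_const by
      (try lra; intros; rewrite RI_const; apply Rmult_0_l).
    rewrite (RI_ext (M 0) m0) by (auto; lra). rewrite Hmass. rg.
  - intros s x Hs Hx. rewrite Rminus_0_r. auto.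
Qed.
(** Stampacchia truncation of the negative part, done directly on the classical solution: |G M| <= B
    |M| vanishes linearly at level 0, the square is completed in [N], and Gronwall concludes. *)
Lemma s_nonneg U V M N ut mt : solution U V M N ut mt ->
  forall t x, 0 <= t <= T -> 0 <= x <= L -> 0 <= M t x.
Proof.
  intros S t x Ht Hx. destruct S as [cU cV cM cN Dt Dx Dv Dm Dn Df c1 c2 bv bm im fu].
  assert (cG := Gf_cont V M cV cM).
  assert (k0 := q0_cont (-1) 0). assert (k1 := q1_cont (-1) 0). assert (k2 := q2_cont (-1) 0).
  set (Fl := fun t y => nu * N t y + Gf V M t y * M t y). assert (cFl : cont2 Fl) by (unfold Fl; ctn).
  set (S := fun t x => - (q2 (-1) 0 (M t x) * N t x * Fl t x)). assert (cS : cont2 S) by (unfold S; ctn).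
  destruct (cont2_bound (Gf V M) 0 T 0 L cG) as [B [HB Bb]].
  set (y := fun t => RInt (fun x => q0 (-1) 0 (M t x)) 0 L).
  assert (cy : cont1 y) by (apply (RI_param_cont (fun t x => q0 (-1) 0 (M t x))); ctn).
  set (K := / (4 * nu) * (6 * B ^ 2)).
  assert (HK : 0 <= K) by (unfold K; pos).
  assert (E : forall t, 0 <= t <= T -> y t <= 0 + K * RInt y 0 t).
  { intros s Hs.
    assert (E := energy_balance T L (fun t x => q0 (-1) 0 (M t x)) (fun t x => q1 (-1) 0 (M t x) * Fl t x) S
      (fun t x => q1 (-1) 0 (M t x) * mt t x) HT HL ltac:(ctn) ltac:(ctn) cS).
    unfold y at 1. rewrite E; auto; clear E.
    - rewrite (RI_ext (fun x => q0 (-1) 0 (M 0 x)) (fun _ => 0)), RI_const; [| lra |].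
      2:{ intros z Hz. apply q0_vanish. rewrite im by auto. assert (h := Hm0 z Hz). lra. }
      rewrite Rmult_0_l. apply Rplus_le_compat_l. rewrite <- RI_scal by auto.
      apply RI_le; [apply (RI_param_cont S); auto | ctn | lra |].
      intros s' Hs'. unfold y. rewrite <- RI_scal by ctn. apply RI_le; [ctn | ctn | lra |]. intros z Hz.
      assert (P2 := q2_ge0 (-1) 0 (M s' z)).
      assert (C := q2_control (-1) 0 (M s' z) (Gf V M s' z * M s' z) B ltac:(ring)).
      assert (C' : q2 (-1) 0 (M s' z) * (Gf V M s' z * M s' z) ^ 2 <= 6 * B ^ 2 * q0 (-1) 0 (M s' z)).
      { apply C. intros h. rewrite Rabs_mult. assert (g := Bb s' z ltac:(lra) Hz).
        rewrite (Rabs_left1 (M s' z)) by lra. assert (g0 := Rabs_pos (Gf V M s' z)). nra. }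
      set (g := Gf V M s' z * M s' z) in *. unfold S, Fl. fold g.
      assert (Q := pow2_ge_0 (2 * nu * N s' z + g)).
      assert (Q1 : - (N s' z * (nu * N s' z + g)) <= / (4 * nu) * g ^ 2).
      { apply (Rmult_le_reg_l (4 * nu)); [lra |].
        replace (4 * nu * (/ (4 * nu) * g ^ 2)) with (g ^ 2) by (field; lra). nra. }
      unfold K. replace (/ (4 * nu) * (6 * B ^ 2) * q0 (-1) 0 (M s' z)) with (/ (4 * nu) * (6 * B ^ 2 * q0 (-1) 0 (M s' z))) by ring.
      apply Rle_trans with (/ (4 * nu) * (q2 (-1) 0 (M s' z) * g ^ 2)).
      + replace (- (q2 (-1) 0 (M s' z) * N s' z * (nu * N s' z + g))) with
          (q2 (-1) 0 (M s' z) * (- (N s' z * (nu * N s' z + g)))) by ring.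
        replace (/ (4 * nu) * (q2 (-1) 0 (M s' z) * g ^ 2)) with (q2 (-1) 0 (M s' z) * (/ (4 * nu) * g ^ 2)) by ring.
        apply Rmult_le_compat_l; auto.
      + apply Rmult_le_compat_l; [pos | auto].
    - intros s' z Hs' Hz. evar_last.
      + apply (is_derive_comp (q0 (-1) 0) (fun s => M s z)); [apply q0_derive | apply Dm; auto].
      + unfold scal; simpl; unfold mult; simpl. ring.
    - intros s' z Hs' Hz. evar_last.
      + apply (is_derive_mult (fun z => q1 (-1) 0 (M s' z)) (Fl s')).
        * apply (is_derive_comp (q1 (-1) 0) (M s')); [apply q1_derive | apply Dn; auto].
        * apply Df; auto.
        * intros; apply Rmult_comm.
      + unfold plus, mult, scal; simpl; unfold mult; simpl. unfold S. ring.
    - intros s' z Hs' Hz. apply (c2d_mult (fun t x => q1 (-1) 0 (M t x))); [ctn | auto].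
    - intros s' Hs'. unfold Fl. rewrite !bm by auto. split; ring. }
  assert (Y := gronwall y 0 K T cy HK E t Ht). rewrite Rmult_0_l in Y.
  assert (Z := RI_zero (fun x => q0 (-1) 0 (M t x)) L HL ltac:(ctn) (fun x _ => q0_ge0 _ _ _) Y x Hx).
  apply q0_zero in Z. lra.
Qed.

Lemma zero_ends f : cont1 f -> (forall t, 0 < t < T -> f t = 0) -> forall t, 0 <= t <= T -> f t = 0.
Proof. intros. apply (zero_closure T HT); auto. Qed.

(** Testing the difference of the [u] equations with M - M', and of the [m] equations with U - U',
    removes the second-order terms and determines [P]. With P = P' the equation of U - U' closes on
    itself backward from [T], then that of M - M' forward from 0. *)
Lemma s_unique U V M N ut mt U' V' M' N' ut' mt' :
  solution U V M N ut mt -> solution U' V' M' N' ut' mt' ->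
  forall t x, 0 <= t <= T -> 0 <= x <= L -> U' t x = U t x /\ M' t x = M t x.
Proof.
  intros S S'.
  assert (ms := s_mass _ _ _ _ _ _ S). assert (ms' := s_mass _ _ _ _ _ _ S').
  assert (nn := s_nonneg _ _ _ _ _ _ S). assert (nn' := s_nonneg _ _ _ _ _ _ S').
  destruct S as [cU cV cM cN Dt Dx Dv Dm Dn Df c1 c2 bv bm im fu].
  destruct S' as [cU' cV' cM' cN' Dt' Dx' Dv' Dm' Dn' Df' c1' c2' bv' bm' im' fu'].
  assert (cG := Gf_cont V M cV cM). assert (cG' := Gf_cont V' M' cV' cM').
  assert (cP := Pf_cont V M cV cM). assert (cP' := Pf_cont V' M' cV' cM').
  set (G := Gf V M) in *. set (G' := Gf V' M') in *. set (P := Pf V M) in *. set (P' := Pf V' M') in *.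
  assert (EV : forall t x, V t x = P t - 2 * G t x) by (intros; unfold G, GfL; fold P; field).
  assert (EV' : forall t x, V' t x = P' t - 2 * G' t x) by (intros; unfold G', GfL; fold P'; field).
  set (w := fun t x => U t x - U' t x). assert (cw : cont2 w) by (unfold w; ctn).
  set (k := fun t x => M t x - M' t x). assert (ckk : cont2 k) by (unfold k; ctn).
  assert (Dw : forall t x, 0 < t < T -> 0 < x < L -> is_derive (fun s => w s x) t (ut t x - ut' t x)).
  { intros t x Ht Hx. apply (is_derive_minus (fun s => U s x) (fun s => U' s x)); auto. }
  assert (Dk : forall t x, 0 < t < T -> 0 < x < L -> is_derive (fun s => k s x) t (mt t x - mt' t x)).
  { intros t x Ht Hx. apply (is_derive_minus (fun s => M s x) (fun s => M' s x)); auto. }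
  assert (Dwx : forall t x, 0 < t < T -> 0 < x < L -> is_derive (fun y => w t y) x (V t x - V' t x)).
  { intros t x Ht Hx. apply (is_derive_minus (U t) (U' t)); auto. }
  assert (Dkx : forall t x, 0 < t < T -> 0 < x < L -> is_derive (fun y => k t y) x (N t x - N' t x)).
  { intros t x Ht Hx. apply (is_derive_minus (M t) (M' t)); auto. }
  set (dF := fun t y => (nu * N t y + G t y * M t y) - (nu * N' t y + G' t y * M' t y)).
  assert (cdF : cont2 dF) by (unfold dF; ctn).
  assert (DdF : forall t x, 0 < t < T -> 0 < x < L -> is_derive (fun y => dF t y) x (mt t x - mt' t x)).
  { intros t x Ht Hx. apply (is_derive_minus (fun y => nu * N t y + G t y * M t y) (fun y => nu * N' t y + G' t y * M' t y)).
    - apply Df; auto.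
    - apply Df'; auto. }
  assert (DdV : forall t x, 0 < t < T -> 0 < x < L -> is_derive (fun y => V t y - V' t y) x
     (/ nu * (- (ut t x - ut' t x) + r * w t x - (G t x ^ 2 - G' t x ^ 2)))).
  { intros t x Ht Hx. evar_last.
    - apply (is_derive_minus (V t) (V' t)); [apply Dv | apply Dv']; auto.
    - unfold minus, plus, opp; simpl. fold G G'. unfold w. field. lra. }
  assert (dVb : forall t x, 0 <= t <= T -> x = 0 \/ x = L -> V t x - V' t x = 0) by
    (intros; rewrite bv, bv' by auto; ring).
  assert (dFb : forall t x, 0 <= t <= T -> x = 0 \/ x = L -> dF t x = 0).
  { intros t x Ht Hx. unfold dF, G, G'. rewrite bm, bm' by auto. ring. }
  assert (cd : forall t x, 0 < t < T -> 0 < x < L -> continuity_2d_pt (fun t x => ut t x - ut' t x) t x).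
  { intros t x Ht Hx. apply continuity_2d_pt_minus; auto. }
  assert (cd' : forall t x, 0 < t < T -> 0 < x < L -> continuity_2d_pt (fun t x => mt t x - mt' t x) t x).
  { intros t x Ht Hx. apply continuity_2d_pt_minus; auto. }
  assert (w_T : forall x, 0 <= x <= L -> w T x = 0) by (intros; unfold w; rewrite fu, fu' by auto; ring).
  assert (k_0 : forall x, 0 <= x <= L -> k 0 x = 0) by (intros; unfold k; rewrite im, im' by auto; ring).
  assert (dP : forall t, 0 <= t <= T -> P t - P' t = 0).
  { set (S := fun t x => r * (w t x * k t x) - (G t x ^ 2 - G' t x ^ 2) * k t x - (V t x - V' t x) * (G t x * M t x - G' t x * M' t x)).
    assert (cS : cont2 S) by (unfold S; ctn).
    assert (E := energy_balance T L (fun t x => w t x * k t x) (fun t x => - nu * ((V t x - V' t x) * k t x) + w t x * dF t x) S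
      (fun t x => (ut t x - ut' t x) * k t x + w t x * (mt t x - mt' t x)) HT HL ltac:(ctn) ltac:(ctn) cS).
    assert (E' : forall t, 0 <= t <= T -> RInt (fun x => w t x * k t x) 0 L = RInt (fun s => RInt (S s) 0 L) 0 t).
    { intros t Ht. rewrite E; auto; clear E.
      - rewrite (RI_ext (fun x => w 0 x * k 0 x) (fun _ => 0)), RI_const by (try lra; intros; rewrite k_0 by auto; ring).
        rg.
      - intros s x Hs Hx. apply (is_derive_mult (fun s => w s x) (fun s => k s x)); auto. intros; apply Rmult_comm.
      - intros s x Hs Hx. evar_last.
        + apply (is_derive_plus (fun x => - nu * ((V s x - V' s x) * k s x)) (fun x => w s x * dF s x)).
          * apply (is_derive_scal (fun x => (V s x - V' s x) * k s x)).
            apply (is_derive_mult (fun x => V s x - V' s x) (fun x => k s x)); auto. intros; apply Rmult_comm.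
          * apply (is_derive_mult (fun x => w s x) (fun x => dF s x)); auto. intros; apply Rmult_comm.
        + unfold plus, mult; simpl; unfold mult; simpl. unfold S, dF. field. lra.
      - intros s x Hs Hx. apply continuity_2d_pt_plus.
        + apply continuity_2d_pt_mult; [apply cd; auto | apply cont2_pt; auto].
        + apply c2d_mult; auto.
      - intros s Hs. rewrite !dVb, !dFb by auto. split; ring. }
    set (sS := fun s => RInt (S s) 0 L). assert (csS : cont1 sS) by (apply (RI_param_cont S); auto).
    (* Since both masses are 1 and int V M = (P - b)/c, the terms in P - P' add up to this
       coefficient times (P - P')^2; it is positive because c < 1. *)
    set (ka := / 2 * (/ c - 1)).
    assert (Hka : 0 < ka).
    { unfold ka. assert (1 < / c) by (rewrite <- Rinv_1 at 1; apply Rinv_lt_contravar; lra). lra. }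
    set (h := fun t => sS t - r * RInt sS 0 t).
    assert (ch : cont1 h) by (unfold h; assert (q := RI_cont sS 0 csS); ctn).
    assert (Hh : forall t, 0 <= t <= T -> ka * (P t - P' t) ^ 2 <= h t).
    { intros t Ht. unfold h. unfold sS at 2. rewrite <- (E' t Ht). unfold sS, S.
      (* Substituting V = P - 2 G turns the quadratic Hamiltonian terms into (M + M') (G - G')^2 >=
         0; this is the monotonicity of the game. *)
      rewrite (RInt_ext _ (fun x => r * (w t x * k t x) + ((M t x + M' t x) * (G t x - G' t x) ^ 2
          + (- (P t - P' t)) * (G t x * M t x - G' t x * M' t x)))).
      2:{ intros; req. rewrite EV, EV'. unfold k. ring. }
      rewrite RI_plus by ctn. rewrite RI_plus by ctn. rewrite (RI_scal r) by ctn. rewrite (RI_scal (- (P t - P' t))) by ctn.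
      rewrite RI_minus by ctn.
      assert (I0 : 0 <= RInt (fun x => (M t x + M' t x) * (G t x - G' t x) ^ 2) 0 L).
      { apply RI_ge0; [ctn | lra |]. intros x Hx. assert (h1 := nn t x Ht Hx). assert (h2 := nn' t x Ht Hx).
        apply Rmult_le_pos; [lra | pos]. }
      assert (GI : forall V M, cont2 V -> cont2 M -> RInt (M t) 0 L = 1 ->
         RInt (fun x => Gf V M t x * M t x) 0 L = / 2 * (Pf V M t - (Pf V M t - b) / c)).
      { clear - HL Hc. intros V M cV cM E. unfold GfL.
        rewrite (RInt_ext _ (fun x => / 2 * Pf V M t * M t x - / 2 * (V t x * M t x))) by (intros; req; ring).
        rewrite RI_minus by ctn. rewrite !RI_scal by ctn. rewrite E.
        replace (RInt (fun x => V t x * M t x) 0 L) with ((Pf V M t - b) / c) by (unfold Pfun; field; lra). rg. }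
      assert (g1 := GI V M cV cM (ms t Ht)). assert (g2 := GI V' M' cV' cM' (ms' t Ht)).
      fold G P in g1. fold G' P' in g2. unfold G, G' in *. rewrite g1, g2.
      fold G G' in I0 |- *.
      set (I := RInt (fun x => (M t x + M' t x) * (G t x - G' t x) ^ 2) 0 L) in *.
      set (I2 := RInt (fun x => w t x * k t x) 0 L).
      unfold ka.
      replace (r * I2 + (I + - (P t - P' t) * (/ 2 * (P t - (P t - b) / c) - / 2 * (P' t - (P' t - b) / c))) - r * I2)
        with (I + / 2 * (/ c - 1) * (P t - P' t) ^ 2) by (field; lra). lra. }
    set (g := fun t => exp (- r * t) * h t). assert (cg : cont1 g) by (unfold g; ctn).
    assert (g0 : forall t, 0 <= t <= T -> 0 <= g t).
    { intros t Ht. unfold g. apply Rmult_le_pos; [pos |]. assert (q := Hh t Ht).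
      assert (0 <= ka * (P t - P' t) ^ 2) by pos. lra. }
    (* [g] is the time derivative of exp(-r t) int w k, whose boundary values vanish: [w] is zero at
       [T] and [k] at 0. *)
    assert (Ig : RInt g 0 T <= 0).
    { rewrite (RI_ftc (fun t => exp (- r * t) * RInt sS 0 t) g); auto.
      - unfold sS at 1. rewrite <- (E' T) by lra.
        rewrite (RI_ext (fun x => w T x * k T x) (fun _ => 0)), RI_const by (try lra; intros; rewrite w_T by auto; ring).
        rewrite RI_point. right. ring.
      - intros t. evar_last.
        + apply (is_derive_mult (fun t => exp (- r * t)) (fun t => RInt sS 0 t)).
          * auto_derive; [trivial | reflexivity].
          * apply RI_derive; auto.
          * intros; apply Rmult_comm.
        + unfold plus, mult; simpl; unfold mult; simpl. unfold g, h. ring. }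
    intros t Ht. assert (Z := RI_zero g T HT cg g0 Ig t Ht).
    unfold g in Z. apply Rmult_integral in Z. destruct Z as [Z | Z]; [assert (q := exp_pos (- r * t)); lra |].
    assert (q := Hh t Ht). rewrite Z in q.
    assert (q2 := pow2_ge_0 (P t - P' t)).
    assert (q3 : (P t - P' t) ^ 2 <= 0). { apply (Rmult_le_reg_l ka); auto. lra. }
    apply Rsqr_0_uniq. rewrite Rsqr_pow2. lra. }
  assert (w0 : forall t x, 0 <= t <= T -> 0 <= x <= L -> w t x = 0).
  { set (S := fun t x => 2 * nu * (V t x - V' t x) ^ 2 + 2 * r * w t x ^ 2 - 2 * w t x * (G t x ^ 2 - G' t x ^ 2)).
    assert (cS : cont2 S) by (unfold S; ctn).
    assert (E := energy_balance T L (fun t x => w t x ^ 2) (fun t x => - (2 * nu) * (w t x * (V t x - V' t x))) S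
      (fun t x => 2 * w t x * (ut t x - ut' t x)) HT HL ltac:(ctn) ltac:(ctn) cS).
    set (y := fun t => RInt (fun x => w t x ^ 2) 0 L).
    set (sS := fun s => RInt (S s) 0 L). assert (csS : cont1 sS) by (apply (RI_param_cont S); auto).
    assert (E' : forall t, 0 <= t <= T -> y t = y 0 + RInt sS 0 t).
    { intros t Ht. apply E; auto; clear E.
      - intros s x Hs Hx. evar_last.
        + apply (is_derive_pow (fun s => w s x) 2 s (ut s x - ut' s x)). auto.
        + simpl. ring.
      - intros s x Hs Hx. evar_last.
        + apply (is_derive_scal (fun x => w s x * (V s x - V' s x))).
          apply (is_derive_mult (fun x => w s x) (fun x => V s x - V' s x)); auto. intros; apply Rmult_comm.
        + unfold plus, mult; simpl; unfold mult; simpl. unfold S. field. lra.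
      - intros s x Hs Hx. apply (c2d_mult (fun t x => 2 * w t x)); [ctn | auto].
      - intros s Hs. rewrite !dVb by auto. split; ring. }
    destruct (cont2_bound (fun t x => G t x + G' t x) 0 T 0 L ltac:(ctn)) as [B [HB Bb]].
    set (K := B ^ 2 / (8 * nu) + 2 * Rabs r). assert (HK : 0 <= K) by (unfold K; pos).
    (* With P = P' the difference G^2 - G'^2 is -(1/2) (V - V') (G + G'), so completing the square
       in V - V' leaves only the integral of w^2. A lower bound is wanted because Gronwall runs
       backward from y(T) = 0. *)
    assert (Sb : forall t, 0 <= t <= T -> - K * y t <= sS t).
    { intros t Ht. unfold y. rewrite <- RI_scal by ctn. apply RI_le; [ctn | ctn | lra |]. intros x Hx.
      unfold S. assert (dp := dP t Ht).
      assert (eV : V t x - V' t x = - 2 * (G t x - G' t x)) by (rewrite EV, EV'; lra).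
      set (v := V t x - V' t x) in *.
      replace (G t x ^ 2 - G' t x ^ 2) with (- / 2 * v * (G t x + G' t x)) by (rewrite eV; field).
      assert (Bx := Bb t x Ht Hx). set (g := G t x + G' t x) in *. set (ww := w t x).
      assert (g2 : g ^ 2 <= B ^ 2).
      { rewrite <- (Rsqr_pow2 g), Rsqr_abs, Rsqr_pow2. apply pow_incr. split; [apply Rabs_pos | auto]. }
      assert (Q : 0 <= 2 * nu * v ^ 2 + ww * g * v + B ^ 2 / (8 * nu) * ww ^ 2).
      { replace (2 * nu * v ^ 2 + ww * g * v + B ^ 2 / (8 * nu) * ww ^ 2) with
          (2 * nu * (v + ww * g / (4 * nu)) ^ 2 + / (8 * nu) * (ww ^ 2 * (B ^ 2 - g ^ 2))) by (field; lra).
        apply Rplus_le_le_0_compat; [pos |]. apply Rmult_le_pos; [pos |]. apply Rmult_le_pos; [pos | lra]. }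
      assert (rr : - Rabs r <= r) by (assert (q := Rle_abs (- r)); rewrite Rabs_Ropp in q; lra).
      assert (w2 := pow2_ge_0 ww).
      assert (- (2 * Rabs r) * ww ^ 2 <= 2 * r * ww ^ 2) by (apply Rmult_le_compat_r; lra).
      unfold K. lra. }
    assert (y0 : forall t, 0 <= y t) by (intros; apply RI_ge0; [ctn | lra | intros; pos]).
    assert (yT : y T = 0).
    { unfold y. rewrite (RI_ext _ (fun _ => 0)), RI_const by (try lra; intros; rewrite w_T by auto; ring). apply Rmult_0_l. }
    assert (Y : forall t, 0 <= t <= T -> y t <= 0).
    { intros t Ht.
      assert (Dc : - (exp (K * T) * (y 0 + RInt sS 0 T)) <= - (exp (K * t) * (y 0 + RInt sS 0 t))).
      { apply (decr_of_derive (fun t => - (exp (K * t) * (y 0 + RInt sS 0 t)))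
          (fun t => - (exp (K * t) * (K * (y 0 + RInt sS 0 t) + sS t)))); [lra | |].
        - intros s Hs. apply (is_derive_opp (fun t => exp (K * t) * (y 0 + RInt sS 0 t))). evar_last.
          + apply (is_derive_mult (fun t => exp (K * t)) (fun t => y 0 + RInt sS 0 t)).
            * auto_derive; [trivial | reflexivity].
            * apply (is_derive_plus (fun _ => y 0)); [apply is_derive_const | apply RI_derive; auto].
            * intros; apply Rmult_comm.
          + unfold plus, mult, zero; simpl; unfold mult; simpl. ring.
        - intros s Hs. rewrite <- E' by lra. assert (q := Sb s ltac:(lra)).
          assert (0 <= exp (K * s) * (K * y s + sS s)) by (apply Rmult_le_pos; [pos | lra]). lra. }
      rewrite <- !E' in Dc by lra. rewrite yT in Dc. assert (q := exp_pos (K * t)). assert (q2 := y0 t). nra. }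
    intros t x Ht Hx.
    assert (Z := RI_zero (fun x => w t x ^ 2) L HL ltac:(ctn) (fun x _ => pow2_ge_0 _) (Y t Ht) x Hx).
    apply Rsqr_0_uniq. rewrite Rsqr_pow2. auto. }
  (* Differentiation of w = 0 inside the rectangle, then closure in [x] and in [t]. *)
  assert (v0 : forall t x, 0 <= t <= T -> 0 <= x <= L -> V t x - V' t x = 0).
  { intros t x Ht Hx.
    apply (zero_ends (fun t => V t x - V' t x)); [ctn | | auto]. intros s Hs.
    apply (zero_closure L HL (fun x => V s x - V' s x)); [ctn | | auto]. intros z Hz.
    assert (D0 : is_derive (fun y => w s y) z 0).
    { apply (derive_ext_in (fun _ => 0) _ 0 L); auto.
      - intros y Hy. symmetry. apply w0; lra.
      - apply (is_derive_const (K := R_AbsRing) (V := R_NormedModule)). }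
    rewrite <- (is_derive_unique _ _ _ (Dwx s z Hs Hz)), (is_derive_unique _ _ _ D0). auto. }
  assert (k0 : forall t x, 0 <= t <= T -> 0 <= x <= L -> k t x = 0).
  { set (S := fun t x => - 2 * (N t x - N' t x) * dF t x). assert (cS : cont2 S) by (unfold S; ctn).
    assert (E := energy_balance T L (fun t x => k t x ^ 2) (fun t x => 2 * (k t x * dF t x)) S
      (fun t x => 2 * k t x * (mt t x - mt' t x)) HT HL ltac:(ctn) ltac:(ctn) cS).
    set (y := fun t => RInt (fun x => k t x ^ 2) 0 L).
    assert (cy : cont1 y) by (apply (RI_param_cont (fun t x => k t x ^ 2)); ctn).
    assert (E' : forall t, 0 <= t <= T -> y t = y 0 + RInt (fun s => RInt (S s) 0 L) 0 t).
    { intros t Ht. apply E; auto; clear E.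
      - intros s x Hs Hx. evar_last.
        + apply (is_derive_pow (fun s => k s x) 2 s (mt s x - mt' s x)). auto.
        + simpl. ring.
      - intros s x Hs Hx. evar_last.
        + apply (is_derive_scal (fun x => k s x * dF s x)).
          apply (is_derive_mult (fun x => k s x) (fun x => dF s x)); auto. intros; apply Rmult_comm.
        + unfold plus, mult; simpl; unfold mult; simpl. unfold S. ring.
      - intros s x Hs Hx. apply (c2d_mult (fun t x => 2 * k t x)); [ctn | auto].
      - intros s Hs. rewrite !dFb by auto. split; ring. }
    destruct (cont2_bound G 0 T 0 L cG) as [B [HB Bb]].
    assert (HK : 0 <= B ^ 2 / (2 * nu)) by pos.
    assert (Y : forall t, 0 <= t <= T -> y t <= 0 + B ^ 2 / (2 * nu) * RInt y 0 t).
    { intros t Ht. rewrite E' by auto.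
      assert (y00 : y 0 = 0).
      { unfold y. rewrite (RI_ext _ (fun _ => 0)), RI_const by (try lra; intros; rewrite k_0 by auto; ring). apply Rmult_0_l. }
      rewrite y00. apply Rplus_le_compat_l. rewrite <- RI_scal by auto.
      apply RI_le; [apply (RI_param_cont S); auto | ctn | lra |]. intros s Hs.
      unfold y. rewrite <- RI_scal by ctn. apply RI_le; [ctn | ctn | lra |]. intros x Hx.
      unfold S, dF. assert (dp := dP s ltac:(lra)). assert (v00 := v0 s x ltac:(lra) Hx).
      assert (eG : G' s x = G s x) by (rewrite EV, EV' in v00; lra). rewrite eG.
      set (n := N s x - N' s x). set (kk := k s x).
      replace (nu * N s x + G s x * M s x - (nu * N' s x + G s x * M' s x)) with (nu * n + G s x * kk) by (unfold n, kk, k; ring).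
      assert (g2 : G s x ^ 2 <= B ^ 2).
      { rewrite <- (Rsqr_pow2 (G s x)), Rsqr_abs, Rsqr_pow2. apply pow_incr. split; [apply Rabs_pos | apply Bb; auto; lra]. }
      assert (Q : 0 <= 2 * n * (nu * n + G s x * kk) + B ^ 2 / (2 * nu) * kk ^ 2).
      { replace (2 * n * (nu * n + G s x * kk) + B ^ 2 / (2 * nu) * kk ^ 2) with
          (2 * nu * (n + G s x * kk / (2 * nu)) ^ 2 + / (2 * nu) * (kk ^ 2 * (B ^ 2 - G s x ^ 2))) by (field; lra).
        apply Rplus_le_le_0_compat; [pos |]. apply Rmult_le_pos; [pos |]. apply Rmult_le_pos; [pos | lra]. }
      lra. }
    intros t x Ht Hx. assert (Z := gronwall y 0 _ T cy HK Y t Ht). rewrite Rmult_0_l in Z.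
    assert (Z' := RI_zero (fun x => k t x ^ 2) L HL ltac:(ctn) (fun x _ => pow2_ge_0 _) Z x Hx).
    apply Rsqr_0_uniq. rewrite Rsqr_pow2. auto. }
  intros t x Ht Hx. assert (h1 := w0 t x Ht Hx). assert (h2 := k0 t x Ht Hx). unfold w, k in *. lra.
Qed.
End Uniq.

(** * The coupled problem for given p and its fixed point *)

Definition clip (K y : R) : R := Rmax (- K) (Rmin y K).
Lemma clip_bound K y : 0 <= K -> Rabs (clip K y) <= K.
Proof. intros. apply Rabs_le. unfold clip, Rmax, Rmin. destruct (Rle_dec y K); destruct (Rle_dec (- K) _); lra. Qed.
Lemma clip_id K y : Rabs y <= K -> clip K y = y.
Proof.
  intros H. apply Rabs_le_between in H. unfold clip, Rmax, Rmin.
  destruct (Rle_dec y K); destruct (Rle_dec (- K) _); lra.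
Qed.
Lemma clip_hi K y : 0 <= K -> K <= y -> clip K y = K.
Proof. intros. unfold clip, Rmax, Rmin. destruct (Rle_dec y K); destruct (Rle_dec (- K) _); lra. Qed.
Lemma clip_lo K y : 0 <= K -> y <= - K -> clip K y = - K.
Proof. intros. unfold clip, Rmax, Rmin. destruct (Rle_dec y K); destruct (Rle_dec (- K) _); lra. Qed.
Lemma clip_lip K y z : 0 <= K -> Rabs (clip K y - clip K z) <= Rabs (y - z).
Proof.
  intros. unfold clip, Rmax, Rmin, Rabs.
  destruct (Rle_dec y K); destruct (Rle_dec z K);
  repeat match goal with |- context [Rle_dec ?a ?b] => destruct (Rle_dec a b) end;
  repeat match goal with |- context [Rcase_abs ?a] => destruct (Rcase_abs a) end; lra.
Qed.
Lemma cont1_clip K : cont1 (clip K).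
Proof. unfold clip. ctn. Qed.
(** For |y| <= K this is p^2/4 - G^2 with G = (p - y)/2: the Hamiltonian up to sign and a term
    constant in [x]. Clipping the square makes it globally Lipschitz in [y]. *)
Definition Fq (K p y : R) : R := / 2 * p * y - / 4 * clip K y ^ 2.
Lemma Fq_lip K p y z : 0 <= K -> Rabs (Fq K p y - Fq K p z) <= (/ 2 * (Rabs p + K)) * Rabs (y - z).
Proof.
  intros HK. unfold Fq.
  assert (h1 := clip_lip K y z HK). assert (h2 := clip_bound K y HK). assert (h3 := clip_bound K z HK).
  replace (/ 2 * p * y - / 4 * clip K y ^ 2 - (/ 2 * p * z - / 4 * clip K z ^ 2)) with
    (/ 2 * p * (y - z) - / 4 * ((clip K y + clip K z) * (clip K y - clip K z))) by ring.
  eapply Rle_trans; [apply Rabs_triang |]. rewrite Rabs_Ropp, !Rabs_mult.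
  rewrite (Rabs_right (/ 2)), (Rabs_right (/ 4)) by lra.
  assert (h4 : Rabs (clip K y + clip K z) <= 2 * K) by (eapply Rle_trans; [apply Rabs_triang | lra]).
  assert (h5 := Rabs_pos (clip K y + clip K z)). assert (h6 := Rabs_pos (clip K y - clip K z)).
  assert (Rabs (clip K y + clip K z) * Rabs (clip K y - clip K z) <= 2 * K * Rabs (y - z)) by (apply Rmult_le_compat; auto).
  lra.
Qed.
Lemma RI_rev f T : cont1 f -> RInt (fun s => f (T - s)) 0 T = RInt f 0 T.
Proof.
  intros c. rewrite (RI_ftc (fun s => - RInt f 0 (T - s))).
  - replace (T - T) with 0 by ring. rewrite Rminus_0_r, RI_point. rg.
  - intros x. evar_last.
    + apply (is_derive_opp (fun s => RInt f 0 (T - s))).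
      apply (is_derive_comp (fun y => RInt f 0 y) (fun s => T - s)); [apply RI_derive; auto | auto_derive; [trivial | reflexivity]].
    + unfold opp, scal; simpl; unfold mult; simpl. ring.
  - ctn.
Qed.
Lemma sq_le_of_abs x y : 0 <= y -> Rabs x <= y -> x ^ 2 <= y ^ 2.
Proof. intros. rewrite <- (Rsqr_pow2 x), Rsqr_abs, Rsqr_pow2. apply pow_incr. split; [apply Rabs_pos | auto]. Qed.

Section Coupled.
Variables L nu r T K0 : R.
Variables v0 m0 v0' m0' : R -> R.
Hypothesis HL : 0 < L.
Hypothesis Hnu : 0 < nu.
Hypothesis Hr : 0 <= r.
Hypothesis HT : 0 < T.
Hypothesis HK0 : 0 <= K0.
Hypothesis Dv0 : forall x, is_derive v0 x (v0' x).
Hypothesis cv0' : cont1 v0'.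
Hypothesis v0_0 : v0 0 = 0.
Hypothesis v0_L : v0 L = 0.
Hypothesis v0_b : forall x, 0 <= x <= L -> Rabs (v0 x) <= K0.
Hypothesis Dm0 : forall x, is_derive m0 x (m0' x).
Hypothesis cm0' : cont1 m0'.
Hypothesis m0_pos : forall x, 0 <= x <= L -> 0 <= m0 x.
Hypothesis m0_mass : RInt m0 0 L = 1.
Local Notation lam := (lamL L).
Local Notation cf := (cfL L).
Local Notation ck := (ckL L).

Definition vsrc (p : R -> R) (v : R -> R -> R) (s x : R) : R := Fq K0 (p (T - s)) (v s x).
Definition msrc (p : R -> R) (v m : R -> R -> R) (t x : R) : R :=
  / 2 * (p t - clip K0 (v (T - t) x)) * m t x.
(* [v] runs backwards: [v s] is the slope [u_x] at time [T - s]. *)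
Definition coupled (p : R -> R) (v m : R -> R -> R) : Prop :=
  hs L true nu r T (cf true v0) (vsrc p v) v /\ hs L false nu 0 T (cf false m0) (msrc p v m) m.
Definition Vf (v m : R -> R -> R) (t : R) : R := RInt (fun x => v (T - t) x * m t x) 0 L.

(** * Solvability and a priori bounds for a given p *)

Lemma cv0 : cont1 v0. Proof. apply (cont1_derive _ v0'); auto. Qed.
Lemma cm0 : cont1 m0. Proof. apply (cont1_derive _ m0'); auto. Qed.
Lemma data_sum : exists A, 0 <= A /\ (forall n, sm (fun k => Rabs (cf true v0 k)) n <= A)
   /\ (forall n, sm (fun k => Rabs (cf false m0 k)) n <= A).
Proof.
  assert (S1 := C1_sum L HL true v0 v0' Dv0 cv0' (or_intror (conj v0_0 v0_L))).
  assert (S2 := C1_sum L HL false m0 m0' Dm0 cm0' (or_introl eq_refl)).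
  eexists (Rmax _ _). split; [| split; intros n; [eapply Rle_trans; [apply S1 | apply Rmax_l] | eapply Rle_trans; [apply S2 | apply Rmax_r]]].
  eapply Rle_trans; [apply (S1 O) | apply Rmax_l].
Qed.
Lemma vsrc_cont p v : cont1 p -> cont2 v -> cont2 (vsrc p v).
Proof. intros. unfold vsrc, Fq. assert (h := cont1_clip K0). ctn. Qed.
Lemma msrc_cont p v m : cont1 p -> cont2 v -> cont2 m -> cont2 (msrc p v m).
Proof. intros. unfold msrc. assert (h := cont1_clip K0). ctn. Qed.

(** For given [p] the system is triangular: [v] solves a Lipschitz problem without [m], and the
    equation of [m] is then linear with bounded drift. *)
Lemma coupled_exists p P : cont1 p -> 0 <= P -> (forall t, Rabs (p t) <= P) -> exists v m, coupled p v m.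
Proof.
  intros cp HP Hp. destruct data_sum as [A [HA [A1 A2]]].
  destruct (picard L nu r T HL Hnu Hr HT true (cf true v0) A (vsrc p) (/ 2 * (P + K0))) as [v Hv]; auto.
  - intros _. apply cf_true0; auto.
  - pos.
  - intros; apply vsrc_cont; auto.
  - intros w1 w2 t x Ht Hx. unfold vsrc. eapply Rle_trans; [apply Fq_lip; auto |].
    apply Rmult_le_compat_r; [pos |]. assert (h := Hp (T - t)). lra.
  - assert (cv : cont2 v) by apply Hv.
    destruct (picard L nu 0 T HL Hnu (Rle_refl 0) HT false (cf false m0) A (msrc p v) (/ 2 * (P + K0))) as [m Hm]; auto.
    + discriminate.
    + pos.
    + intros; apply msrc_cont; auto.
    + intros w1 w2 t x Ht Hx. unfold msrc.
      replace (/ 2 * (p t - clip K0 (v (T - t) x)) * w1 t x - / 2 * (p t - clip K0 (v (T - t) x)) * w2 t x) with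
        (/ 2 * (p t - clip K0 (v (T - t) x)) * (w1 t x - w2 t x)) by ring.
      rewrite Rabs_mult. apply Rmult_le_compat_r; [pos |]. rewrite Rabs_mult, (Rabs_right (/ 2)) by lra.
      apply Rmult_le_compat_l; [lra |]. eapply Rle_trans; [apply Rabs_triang |]. rewrite Rabs_Ropp.
      assert (h1 := Hp t). assert (h2 := clip_bound K0 (v (T - t) x) HK0). lra.
    + exists v, m. split; auto.
Qed.

Lemma hs_init b rho f phi w : cont1 f -> hs L b nu rho T (cf b f) phi w ->
  forall x, 0 <= x <= L -> w 0 x = f x.
Proof.
  intros c [c1 [c2 [E _]]] x Hx. apply Rminus_diag_uniq.
  apply (complete L HL b (fun x => w 0 x - f x)); auto; [ctn |].
  intros k. rewrite cf_minus by ctn. rewrite E, wk_0 by lra. ring.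
Qed.
(* A source constant in [x] does not contribute: its cosine coefficients vanish for [k >= 1]. *)
Lemma hs_shift rho a phi w ka : cont1 ka -> hs L true nu rho T a phi w ->
  hs L true nu rho T a (fun s x => phi s x - ka s) w.
Proof.
  intros ck [c1 [c2 [E H]]]. split; [ctn | split; [auto | split; [| auto]]].
  intros t k Ht. rewrite E by auto. unfold wkL. simpl negb. f_equal. f_equal.
  destruct k as [| k]; [rewrite lam0 by auto; rg |]. f_equal. apply RInt_ext. intros s _. req. f_equal.
  rewrite cf_minus by ctn.
  assert (Z : cf false (fun _ => ka s) (S k) = 0).
  { unfold cfL. assert (ce := e_cont L false (S k)).
    rewrite (RInt_ext _ (fun x => ka s * (ee L false 0 x * ee L false (S k) x))).
    - rewrite RI_scal by (assert (ce0 := e_cont L false 0); ctn). rewrite orth by (auto; lia). ring.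
    - intros; req. rewrite e_false0; auto. ring. }
  rewrite Z. ring.
Qed.

Section Fixed_p.
Variables (p : R -> R) (P : R) (v m : R -> R -> R).
Hypothesis cp : cont1 p.
Hypothesis HP : 0 <= P.
Hypothesis Hp : forall t, Rabs (p t) <= P.
Hypothesis HC : coupled p v m.

Lemma v_cont : cont2 v. Proof. apply HC. Qed.
Lemma m_cont : cont2 m. Proof. apply HC. Qed.
(** Truncation at the levels K0 and -K0. The source itself does not vanish there, but by [hs_shift]
    its value at the level may be subtracted, since that value depends on time only. *)
Lemma v_bound s x : 0 <= s <= T -> 0 <= x <= L -> Rabs (v s x) <= K0.
Proof.
  intros Hs Hx. destruct HC as [Hv _]. assert (cv := v_cont).
  assert (init := hs_init true r v0 _ v cv0 Hv).
  assert (Side : forall sg, sg ^ 2 = 1 -> sg * v s x <= K0).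
  { intros sg Hsg.
    (* Beyond the level the clip is constant, so the shifted source is p (v - sg K0)/2 and vanishes
       linearly, as [q2_control] requires. *)
    set (ka := fun s => Fq K0 (p (T - s)) (sg * K0)).
    assert (cka : cont1 ka) by (unfold ka, Fq; ctn).
    assert (Hv' := hs_shift r _ _ v ka cka Hv).
    apply q0_zero.
    apply (truncation L nu r T HL Hnu Hr HT true _ _ v (q0 sg K0) (q1 sg K0) (q2 sg K0) (6 * (P / 2) ^ 2) Hv'); auto.
    - intros; apply q0_derive.
    - intros; apply q1_derive.
    - apply q2_cont.
    - intros; apply q0_ge0.
    - intros; apply q2_ge0.
    - unfold q1. rewrite Rmult_0_r, pp_neg by lra. ring.
    - intros y. unfold q1. destruct (Rle_dec (sg * y) K0).
      + rewrite pp_neg by lra. right; ring.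
      + assert (q := pow2_ge_0 (pp (sg * y - K0))).
        replace (y * (sg * (3 * pp (sg * y - K0) ^ 2))) with (3 * (sg * y) * pp (sg * y - K0) ^ 2) by ring.
        apply Rmult_le_pos; lra.
    - pos.
    - intros s' y Hs' Hy. apply q2_control; auto. intros h.
      assert (E : vsrc p v s' y - ka s' = / 2 * p (T - s') * (v s' y - sg * K0)).
      { unfold vsrc, ka, Fq.
        assert (E1 : clip K0 (v s' y) = clip K0 (sg * K0)).
        { assert (S12 : sg = 1 \/ sg = -1).
          { assert (q : (sg - 1) * (sg + 1) = 0) by (ring_simplify; lra).
            apply Rmult_integral in q. destruct q; [left | right]; lra. }
          destruct S12 as [-> | ->].
          - rewrite !clip_hi by lra. auto.
          - rewrite !clip_lo by lra. auto. }
        rewrite E1. ring. }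
      rewrite E, !Rabs_mult, (Rabs_right (/ 2)) by lra.
      assert (E2 : Rabs (v s' y - sg * K0) = sg * v s' y - K0).
      { replace (v s' y - sg * K0) with (sg * (sg * v s' y - K0)).
        - rewrite Rabs_mult, (Rabs_right (sg * v s' y - K0)) by lra.
          replace (Rabs sg) with 1; [ring |].
          apply Rsqr_inj; [lra | apply Rabs_pos |]. rewrite <- Rsqr_abs, !Rsqr_pow2. lra.
        - replace (sg * (sg * v s' y - K0)) with (sg ^ 2 * v s' y - sg * K0) by ring. rewrite Hsg. ring. }
      rewrite E2. assert (q := Hp (T - s')). apply Rmult_le_compat_r; lra.
    - intros y Hy. apply q0_vanish. rewrite init by auto. assert (q := v0_b y Hy). apply Rabs_le_between in q.
      assert (S12 : sg = 1 \/ sg = -1).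
      { assert (q' : (sg - 1) * (sg + 1) = 0) by (ring_simplify; lra).
        apply Rmult_integral in q'. destruct q'; [left | right]; lra. }
      destruct S12 as [-> | ->]; lra. }
  assert (h1 := Side 1 ltac:(ring)). assert (h2 := Side (-1) ltac:(ring)). apply Rabs_le. lra.
Qed.
Lemma gm_bound t x : Rabs (/ 2 * (p t - clip K0 (v (T - t) x))) <= / 2 * (P + K0).
Proof.
  rewrite Rabs_mult, (Rabs_right (/ 2)) by lra. apply Rmult_le_compat_l; [lra |].
  eapply Rle_trans; [apply Rabs_triang |]. rewrite Rabs_Ropp.
  assert (h1 := Hp t). assert (h2 := clip_bound K0 (v (T - t) x) HK0). lra.
Qed.
Lemma msrc_le t x : Rabs (msrc p v m t x) <= / 2 * (P + K0) * Rabs (m t x).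
Proof. unfold msrc. rewrite Rabs_mult. apply Rmult_le_compat_r; [pos | apply gm_bound]. Qed.
Lemma m_nonneg t x : 0 <= t <= T -> 0 <= x <= L -> 0 <= m t x.
Proof.
  intros Ht Hx. destruct HC as [_ Hm].
  assert (init := hs_init false 0 m0 _ m cm0 Hm).
  assert (Z : q0 (-1) 0 (m t x) = 0).
  { apply (truncation L nu 0 T HL Hnu (Rle_refl 0) HT false _ _ m (q0 (-1) 0) (q1 (-1) 0) (q2 (-1) 0) (6 * (/ 2 * (P + K0)) ^ 2) Hm); auto.
    - intros; apply q0_derive.
    - intros; apply q1_derive.
    - apply q2_cont.
    - intros; apply q0_ge0.
    - intros; apply q2_ge0.
    - unfold q1. rewrite Rmult_0_r, pp_neg by lra. ring.
    - intros y. unfold q1. destruct (Rle_dec 0 y).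
      + rewrite pp_neg by lra. right; ring.
      + assert (q := pow2_ge_0 (pp (-1 * y - 0))).
        replace (y * (-1 * (3 * pp (-1 * y - 0) ^ 2))) with (3 * (- y) * pp (-1 * y - 0) ^ 2) by ring.
        apply Rmult_le_pos; lra.
    - pos.
    - intros s y Hs Hy. apply q2_control; [ring |]. intros h.
      eapply Rle_trans; [apply msrc_le |]. rewrite (Rabs_left1 (m s y)) by lra. right; ring.
    - intros y Hy. apply q0_vanish. rewrite init by auto. assert (q := m0_pos y Hy). lra. }
  apply q0_zero in Z. lra.
Qed.
(** The mass is the cosine coefficient of index 0, which neither decays nor feels the source because
    lam_0 = 0 and rho = 0. *)
Lemma m_mass t : 0 <= t <= T -> RInt (m t) 0 L = 1.
Proof.
  intros Ht. destruct HC as [_ [_ [_ [E _]]]].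
  assert (h := E t O Ht). unfold wkL in h.
  rewrite lam0 in h by auto. rewrite Rmult_0_l, Rplus_0_r in h.
  replace (- (nu * 0 ^ 2) * t) with 0 in h by ring. rewrite exp_0, Rmult_1_l, Rplus_0_r in h.
  assert (E0 : forall f : R -> R, cf false f 0 = RInt f 0 L).
  { intros f. unfold cfL. apply RInt_ext. intros; req. rewrite e_false0; auto. ring. }
  rewrite !E0 in h. rewrite h. auto.
Qed.
(** An average of [v] against the probability density [m]. It keeps b + c V in the range |p| <= b +
    c K0, whatever the bound assumed on [p]. *)
Lemma Vf_bound t : 0 <= t <= T -> Rabs (Vf v m t) <= K0.
Proof.
  intros Ht. assert (cv := v_cont). assert (cm := m_cont). unfold Vf.
  eapply Rle_trans; [apply RI_abs; [ctn | lra] |].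
  apply Rle_trans with (RInt (fun x => K0 * m t x) 0 L).
  - apply RI_le; [ctn | ctn | lra |]. intros x Hx. rewrite Rabs_mult, (Rabs_right (m t x)) by (apply Rle_ge, m_nonneg; auto).
    apply Rmult_le_compat_r; [apply m_nonneg; auto | apply v_bound; auto; lra].
  - rewrite RI_scal by ctn. rewrite m_mass by auto. lra.
Qed.
Lemma Vf_cont : cont1 (Vf v m).
Proof.
  assert (cv := v_cont). assert (cm := m_cont). unfold Vf.
  apply (RI_param_cont (fun t x => v (T - t) x * m t x)). ctn.
Qed.
End Fixed_p.

Lemma m_sup P : 0 <= P -> exists M, 0 < M /\ forall p v m, cont1 p -> (forall t, Rabs (p t) <= P) -> coupled p v m ->
  (forall t n, 0 <= t <= T -> sm (fun k => Rabs (cf false (m t) k)) n <= M) /\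
  forall t x, 0 <= t <= T -> 0 <= x <= L -> Rabs (m t x) <= M.
Proof.
  intros HP. destruct data_sum as [A [HA [_ A2]]].
  destruct (sup_bound L nu 0 T HL Hnu (Rle_refl 0) false A (/ 2 * (P + K0)) HA ltac:(pos)) as [M [HM B]].
  exists M. split; auto. intros p v m cp Hp HC. apply (B _ _ m (proj2 HC) A2).
  intros; apply msrc_le; auto.
Qed.

(** Energy estimates with Gronwall, for [v] and then for [m]. The conclusion goes from L2 in time to
    a pointwise bound, which later lifts the convergence of the iteration from L2 to uniform. *)
Lemma Vf_lipschitz P : 0 <= P -> exists K, 0 < K /\ forall p1 v1 m1 p2 v2 m2,
  cont1 p1 -> (forall t, Rabs (p1 t) <= P) -> coupled p1 v1 m1 ->
  cont1 p2 -> (forall t, Rabs (p2 t) <= P) -> coupled p2 v2 m2 ->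
  forall t, 0 <= t <= T -> (Vf v1 m1 t - Vf v2 m2 t) ^ 2 <= K * RInt (fun s => (p1 s - p2 s) ^ 2) 0 T.
Proof.
  intros HP. destruct (m_sup P HP) as [M [HM Ms]].
  set (B := / 2 * (P + K0)). assert (HB : 0 <= B) by (unfold B; pos).
  (* C1 and C3 are the Gronwall rates for [v] and [m]; C2 and C4, multiplied by the squared distance
     of the parameters, bound the squared L2 distances of the two [v] and the two [m]. *)
  set (C1 := / nu * (/ 2 * K0 ^ 2 * L + 2 * B ^ 2)). assert (HC1 : 0 <= C1) by (unfold C1; pos).
  set (C2 := C1 * exp (C1 * T)). assert (HC2 : 0 <= C2) by (unfold C2; pos).
  set (C3 := / nu * (2 * B ^ 2 + M ^ 2 * L + M ^ 2 * C2)). assert (HC3 : 0 <= C3) by (unfold C3; pos).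
  set (C4 := C3 * exp (C3 * T) * (1 + T)). assert (HC4 : 0 <= C4) by (unfold C4; pos).
  exists (2 * (C2 * (M ^ 2 * L)) + 2 * (C4 * (K0 ^ 2 * L)) + 1). split.
  { assert (0 <= 2 * (C2 * (M ^ 2 * L)) + 2 * (C4 * (K0 ^ 2 * L))) by pos. lra. }
  intros p1 v1 m1 p2 v2 m2 cp1 Hp1 H1 cp2 Hp2 H2.
  assert (cv1 := v_cont p1 v1 m1 H1). assert (cv2 := v_cont p2 v2 m2 H2).
  assert (cm1 := m_cont p1 v1 m1 H1). assert (cm2 := m_cont p2 v2 m2 H2).
  assert (bv1 : forall s x, 0 <= s <= T -> 0 <= x <= L -> Rabs (v1 s x) <= K0) by (intros; eapply (v_bound p1 P v1 m1); eauto).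
  assert (bv2 : forall s x, 0 <= s <= T -> 0 <= x <= L -> Rabs (v2 s x) <= K0) by (intros; eapply (v_bound p2 P v2 m2); eauto).
  assert (bm1 := proj2 (Ms p1 v1 m1 cp1 Hp1 H1)). assert (bm2 := proj2 (Ms p2 v2 m2 cp2 Hp2 H2)).
  set (D := RInt (fun s => (p1 s - p2 s) ^ 2) 0 T).
  assert (HD : 0 <= D) by (apply RI_ge0; [ctn | lra | intros; pos]).
  assert (Dt : forall f t, cont1 f -> (forall s, 0 <= f s) -> 0 <= t <= T -> RInt f 0 t <= RInt f 0 T).
  { intros f t c Hf Ht. rewrite <- (RI_chasles f 0 t T c).
    assert (0 <= RInt f t T) by (apply RI_ge0; auto; lra). lra. }
  set (yv := fun s => RInt (fun x => (v1 s x - v2 s x) ^ 2) 0 L).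
  assert (cyv : cont1 yv) by (apply (RI_param_cont (fun s x => (v1 s x - v2 s x) ^ 2)); ctn).
  assert (yv0 : forall s, 0 <= yv s) by (intros; apply RI_ge0; [ctn | lra | intros; pos]).
  assert (Yv : forall s, 0 <= s <= T -> yv s <= C2 * D).
  { intros s Hs.
    assert (G := gronwall_src yv (fun s => (p1 (T - s) - p2 (T - s)) ^ 2) C1 T cyv ltac:(ctn) HC1 ltac:(intros; cbv beta; pos)).
    eapply Rle_trans; [apply G; auto |].
    - intros s' Hs'. unfold yv at 1.
      eapply Rle_trans; [apply (hs_energy L nu r T HL Hnu Hr true _ _ v1 _ v2 s' (proj1 H1) (proj1 H2) Hs') |].
      assert (cs1 := vsrc_cont p1 v1 cp1 cv1). assert (cs2 := vsrc_cont p2 v2 cp2 cv2).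
      apply Rle_trans with (/ nu * RInt (fun s => (/ 2 * K0 ^ 2 * L + 2 * B ^ 2) * (yv s + (p1 (T - s) - p2 (T - s)) ^ 2)) 0 s').
      + apply Rmult_le_compat_l; [pos |]. apply RI_le; [| ctn | lra |].
        * apply (RI_param_cont (fun s x => (vsrc p1 v1 s x - vsrc p2 v2 s x) ^ 2)). ctn.
        * intros q Hq.
          apply Rle_trans with (RInt (fun x => / 2 * K0 ^ 2 * (p1 (T - q) - p2 (T - q)) ^ 2 + 2 * B ^ 2 * (v1 q x - v2 q x) ^ 2) 0 L).
          -- apply RI_le; [ctn | ctn | lra |]. intros x Hx.
             set (dl := p1 (T - q) - p2 (T - q)). set (w := v1 q x - v2 q x).
             assert (E : vsrc p1 v1 q x - vsrc p2 v2 q x = (Fq K0 (p1 (T - q)) (v1 q x) - Fq K0 (p1 (T - q)) (v2 q x)) + / 2 * dl * v2 q x)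
               by (unfold vsrc, Fq, dl; ring).
             rewrite E. eapply Rle_trans; [apply sq_sum |].
             assert (a1 := Fq_lip K0 (p1 (T - q)) (v1 q x) (v2 q x) HK0). fold w in a1.
             assert (a2 : Rabs (Fq K0 (p1 (T - q)) (v1 q x) - Fq K0 (p1 (T - q)) (v2 q x)) <= B * Rabs w).
             { eapply Rle_trans; [apply a1 |]. apply Rmult_le_compat_r; [pos |]. unfold B. assert (h := Hp1 (T - q)). lra. }
             apply sq_le_of_abs in a2; [| pos].
             rewrite Rpow_mult_distr in a2. rewrite <- (Rsqr_pow2 (Rabs w)), <- Rsqr_abs, Rsqr_pow2 in a2.
             assert (a3 : v2 q x ^ 2 <= K0 ^ 2) by (apply sq_le_of_abs; auto; apply bv2; lra).
             assert (a4 := pow2_ge_0 dl). nra.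
          -- rewrite RI_plus by ctn. rewrite RI_const. rewrite RI_scal by ctn. fold (yv q).
             assert (h := yv0 q). set (d2 := (p1 (T - q) - p2 (T - q)) ^ 2). assert (d20 : 0 <= d2) by (unfold d2; pos).
             assert (0 <= / 2 * K0 ^ 2 * L * yv q) by pos. assert (0 <= 2 * B ^ 2 * d2) by pos. lra.
      + rewrite RI_scal by ctn. unfold C1. right; ring.
    - fold C2. apply Rmult_le_compat_l; auto. unfold D.
      rewrite <- (RI_rev (fun s => (p1 s - p2 s) ^ 2) T) by ctn.
      apply (Dt (fun s => (p1 (T - s) - p2 (T - s)) ^ 2)); [ctn | intros; pos | auto]. }
  set (ym := fun s => RInt (fun x => (m1 s x - m2 s x) ^ 2) 0 L).
  assert (cym : cont1 ym) by (apply (RI_param_cont (fun s x => (m1 s x - m2 s x) ^ 2)); ctn).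
  assert (ym0 : forall s, 0 <= ym s) by (intros; apply RI_ge0; [ctn | lra | intros; pos]).
  assert (Ym : forall s, 0 <= s <= T -> ym s <= C4 * D).
  { intros s Hs.
    assert (G := gronwall_src ym (fun s => (p1 s - p2 s) ^ 2 + D) C3 T cym ltac:(ctn) HC3 ltac:(intros; cbv beta; pos)).
    eapply Rle_trans; [apply G; auto |].
    - intros s' Hs'. unfold ym at 1.
      eapply Rle_trans; [apply (hs_energy L nu 0 T HL Hnu (Rle_refl 0) false _ _ m1 _ m2 s' (proj2 H1) (proj2 H2) Hs') |].
      assert (cs1 := msrc_cont p1 v1 m1 cp1 cv1 cm1). assert (cs2 := msrc_cont p2 v2 m2 cp2 cv2 cm2).
      apply Rle_trans with (/ nu * RInt (fun s => (2 * B ^ 2 + M ^ 2 * L + M ^ 2 * C2) * (ym s + ((p1 s - p2 s) ^ 2 + D))) 0 s').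
      + apply Rmult_le_compat_l; [pos |]. apply RI_le; [| ctn | lra |].
        * apply (RI_param_cont (fun s x => (msrc p1 v1 m1 s x - msrc p2 v2 m2 s x) ^ 2)). ctn.
        * intros q Hq.
          apply Rle_trans with (RInt (fun x => 2 * B ^ 2 * (m1 q x - m2 q x) ^ 2 + (M ^ 2 * (p1 q - p2 q) ^ 2 + M ^ 2 * (v1 (T - q) x - v2 (T - q) x) ^ 2)) 0 L).
          -- apply RI_le; [ctn | ctn | lra |]. intros x Hx.
             set (dl := p1 q - p2 q). set (w := v1 (T - q) x - v2 (T - q) x). set (k := m1 q x - m2 q x).
             assert (E : msrc p1 v1 m1 q x - msrc p2 v2 m2 q x = (/ 2 * (p1 q - clip K0 (v1 (T - q) x))) * k
                + / 2 * (dl - (clip K0 (v1 (T - q) x) - clip K0 (v2 (T - q) x))) * m2 q x)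
               by (unfold msrc, dl, k; ring).
             rewrite E. eapply Rle_trans; [apply sq_sum |].
             assert (a1 := gm_bound p1 P v1 Hp1 q x). fold B in a1. apply sq_le_of_abs in a1; auto.
             set (g := / 2 * (p1 q - clip K0 (v1 (T - q) x))) in *.
             assert (a2 := clip_lip K0 (v1 (T - q) x) (v2 (T - q) x) HK0). fold w in a2.
             apply sq_le_of_abs in a2; [| pos]. rewrite <- (Rsqr_pow2 (Rabs w)), <- Rsqr_abs, Rsqr_pow2 in a2.
             set (cw := clip K0 (v1 (T - q) x) - clip K0 (v2 (T - q) x)) in *.
             assert (a3 : m2 q x ^ 2 <= M ^ 2) by (apply sq_le_of_abs; [lra | apply bm2; auto; lra]).
             assert (a4 := pow2_ge_0 k).
             assert (a5 : (g * k) ^ 2 <= B ^ 2 * k ^ 2) by (rewrite Rpow_mult_distr; apply Rmult_le_compat_r; auto).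
             assert (a6 : (dl - cw) ^ 2 <= 2 * dl ^ 2 + 2 * w ^ 2).
             { assert (q1 := sq_sum dl (- cw)). replace ((- cw) ^ 2) with (cw ^ 2) in q1 by ring.
               replace (dl + - cw) with (dl - cw) in q1 by ring. lra. }
             assert (a7 : (/ 2 * (dl - cw) * m2 q x) ^ 2 <= / 4 * (2 * dl ^ 2 + 2 * w ^ 2) * M ^ 2).
             { replace ((/ 2 * (dl - cw) * m2 q x) ^ 2) with (/ 4 * (dl - cw) ^ 2 * m2 q x ^ 2) by field.
               apply Rmult_le_compat; try pos. }
             lra.
          -- rewrite RI_plus by ctn. rewrite RI_plus by ctn. rewrite RI_const. rewrite !RI_scal by ctn.
             fold (ym q). fold (yv (T - q)).
             assert (h := ym0 q). assert (h2 := Yv (T - q) ltac:(lra)).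
             set (d2 := (p1 q - p2 q) ^ 2). assert (d20 : 0 <= d2) by (unfold d2; pos).
             assert (M ^ 2 * yv (T - q) <= M ^ 2 * (C2 * D)) by (apply Rmult_le_compat_l; [pos | auto]).
             assert (0 <= (M ^ 2 * L + M ^ 2 * C2) * ym q) by pos.
             assert (0 <= (2 * B ^ 2 + M ^ 2 * C2) * d2) by pos.
             assert (0 <= (2 * B ^ 2 + M ^ 2 * L) * D) by pos. lra.
      + rewrite RI_scal by ctn. unfold C3. right; ring.
    - unfold C4. rewrite (Rmult_assoc (C3 * exp (C3 * T))). apply Rmult_le_compat_l; [pos |].
      rewrite RI_plus by ctn. rewrite RI_const.
      assert (h := Dt (fun s => (p1 s - p2 s) ^ 2) s ltac:(ctn) ltac:(intros; cbv beta; pos) Hs). fold D in h.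
      assert (D * (s - 0) <= D * T) by (apply Rmult_le_compat_l; lra). lra. }
  intros t Ht.
  assert (E : Vf v1 m1 t - Vf v2 m2 t = RInt (fun x => (v1 (T - t) x - v2 (T - t) x) * m1 t x) 0 L
     + RInt (fun x => v2 (T - t) x * (m1 t x - m2 t x)) 0 L).
  { unfold Vf. rewrite <- RI_minus by ctn. rewrite <- RI_plus by ctn. apply RInt_ext. intros; req; ring. }
  rewrite E. eapply Rle_trans; [apply sq_sum |].
  assert (Q1 := RI_cs (fun x => v1 (T - t) x - v2 (T - t) x) (m1 t) 0 L ltac:(ctn) ltac:(ctn) ltac:(lra)).
  assert (Q2 := RI_cs (v2 (T - t)) (fun x => m1 t x - m2 t x) 0 L ltac:(ctn) ltac:(ctn) ltac:(lra)).
  fold (yv (T - t)) in Q1. fold (ym t) in Q2.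
  assert (R1 : RInt (fun x => m1 t x ^ 2) 0 L <= M ^ 2 * L) by (apply RInt_sq_le; auto; ctn).
  assert (R2 : RInt (fun x => v2 (T - t) x ^ 2) 0 L <= K0 ^ 2 * L) by (apply RInt_sq_le; auto; [ctn | intros; apply bv2; auto; lra]).
  assert (h1 := Yv (T - t) ltac:(lra)). assert (h2 := Ym t Ht).
  assert (P1 : yv (T - t) * RInt (fun x => m1 t x ^ 2) 0 L <= C2 * D * (M ^ 2 * L)).
  { apply Rmult_le_compat; auto. apply RI_ge0; [ctn | lra | intros; pos]. }
  assert (P2 : RInt (fun x => v2 (T - t) x ^ 2) 0 L * ym t <= K0 ^ 2 * L * (C4 * D)).
  { apply Rmult_le_compat; auto. apply RI_ge0; [ctn | lra | intros; pos]. }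
  cbv beta in Q1, Q2. fold (yv (T - t)) in Q1. fold (ym t) in Q2. fold D.
  eapply Rle_trans; [apply Rplus_le_compat; (apply Rmult_le_compat_l; [lra |]); [apply (Rle_trans _ _ _ Q1 P1) | apply (Rle_trans _ _ _ Q2 P2)] |]. lra.
Qed.

(** Duality mode by mode, as the solutions are known so far only through their coefficients. For the
    differences, exp(-r t) a_k(T - t) b_k(t) vanishes at both ends of [0,T], because [v] is
    prescribed at [T] and [m] at 0. *)
Lemma Vf_monotone P p1 v1 m1 p2 v2 m2 : 0 <= P ->
  cont1 p1 -> (forall t, Rabs (p1 t) <= P) -> coupled p1 v1 m1 ->
  cont1 p2 -> (forall t, Rabs (p2 t) <= P) -> coupled p2 v2 m2 ->
  RInt (fun t => exp (- r * t) * ((p1 t - p2 t) * (Vf v1 m1 t - Vf v2 m2 t))) 0 T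
    <= RInt (fun t => exp (- r * t) * (p1 t - p2 t) ^ 2) 0 T.
Proof.
  intros HP cp1 Hp1 H1 cp2 Hp2 H2.
  assert (cv1 := v_cont p1 v1 m1 H1). assert (cv2 := v_cont p2 v2 m2 H2).
  assert (cm1 := m_cont p1 v1 m1 H1). assert (cm2 := m_cont p2 v2 m2 H2).
  assert (cV1 := Vf_cont p1 v1 m1 H1). assert (cV2 := Vf_cont p2 v2 m2 H2).
  assert (bv1 : forall s x, 0 <= s <= T -> 0 <= x <= L -> Rabs (v1 s x) <= K0) by (intros; eapply (v_bound p1 P v1 m1); eauto).
  assert (bv2 : forall s x, 0 <= s <= T -> 0 <= x <= L -> Rabs (v2 s x) <= K0) by (intros; eapply (v_bound p2 P v2 m2); eauto).
  assert (nn1 : forall s x, 0 <= s <= T -> 0 <= x <= L -> 0 <= m1 s x) by (intros; eapply (m_nonneg p1 P v1 m1); eauto).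
  assert (nn2 : forall s x, 0 <= s <= T -> 0 <= x <= L -> 0 <= m2 s x) by (intros; eapply (m_nonneg p2 P v2 m2); eauto).
  assert (ms1 : forall s, 0 <= s <= T -> RInt (m1 s) 0 L = 1) by (intros; eapply (m_mass p1 v1 m1); eauto).
  assert (ms2 : forall s, 0 <= s <= T -> RInt (m2 s) 0 L = 1) by (intros; eapply (m_mass p2 v2 m2); eauto).
  assert (cs1 := vsrc_cont p1 v1 cp1 cv1). assert (cs2 := vsrc_cont p2 v2 cp2 cv2).
  assert (cg1 := msrc_cont p1 v1 m1 cp1 cv1 cm1). assert (cg2 := msrc_cont p2 v2 m2 cp2 cv2 cm2).
  set (dF := fun s x => vsrc p1 v1 s x - vsrc p2 v2 s x). assert (cdF : cont2 dF) by (unfold dF; ctn).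
  set (dg := fun t x => msrc p1 v1 m1 t x - msrc p2 v2 m2 t x). assert (cdg : cont2 dg) by (unfold dg; ctn).
  set (dm := fun t x => m1 t x - m2 t x). assert (cdm : cont2 dm) by (unfold dm; ctn).
  set (dv := fun t x => v1 (T - t) x - v2 (T - t) x). assert (cdv : cont2 dv) by (unfold dv; ctn).
  set (dFr := fun t x => dF (T - t) x). assert (cdFr : cont2 dFr) by (unfold dFr; ctn).
  set (ak := wkL L true nu r (fun _ => 0) dF). set (bk := wkL L false nu 0 (fun _ => 0) dg).
  assert (cak : forall k, cont1 (ak k)) by (intros; apply wk_cont; auto).
  assert (cbk : forall k, cont1 (bk k)) by (intros; apply wk_cont; auto).
  assert (Ea : forall t k, 0 <= t <= T -> cf true (dv t) k = ak k (T - t)).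
  { intros t k Ht. unfold dv. rewrite cf_minus by ctn.
    rewrite (proj1 (proj2 (proj2 (proj1 H1)))), (proj1 (proj2 (proj2 (proj1 H2)))) by lra.
    apply wk_minus; auto. }
  assert (Eb : forall t k, 0 <= t <= T -> cf false (dm t) k = bk k t).
  { intros t k Ht. unfold dm. rewrite cf_minus by ctn.
    rewrite (proj1 (proj2 (proj2 (proj2 H1)))), (proj1 (proj2 (proj2 (proj2 H2)))) by lra.
    apply wk_minus; auto. }
  assert (cfF : forall k, cont1 (fun t => cf false (dFr t) k)) by (intros; apply phik_cont; auto).
  assert (cfg : forall k, cont1 (fun t => cf true (dg t) k)) by (intros; apply phik_cont; auto).
  (* In the derivative of that product the terms nu lam^2 cancel, and the weight exp(-r t) cancels
     the discount; what is left is lam_k times a difference of source terms, hence the division by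
     lam_k. *)
  assert (K : forall k, RInt (fun t => exp (- r * t) * (ck k * cf false (dFr t) k * bk k t - ck k * ak k (T - t) * cf true (dg t) k)) 0 T = 0).
  { intros k. assert (c1 := cak k). assert (c2 := cbk k). assert (c3 := cfF k). assert (c4 := cfg k).
    destruct k as [| k].
    - rewrite (RInt_ext _ (fun _ => 0)); [rewrite RI_const; apply Rmult_0_l |].
      intros t _. req. unfold ak, bk, wkL. rewrite lam0 by auto. ring.
    - assert (P0 := lam_pos L HL (S k) ltac:(lia)).
      rewrite (RI_ftc (fun t => - (ck (S k) / lam (S k)) * (exp (- r * t) * (ak (S k) (T - t) * bk (S k) t)))).
      + assert (b0 : bk (S k) 0 = 0) by apply wk_0.
        assert (a0 : ak (S k) (T - T) = 0) by (rewrite Rminus_diag_eq by auto; apply wk_0).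
        rewrite b0, a0. rg.
      + intros t. evar_last.
        * apply (is_derive_scal (fun t => exp (- r * t) * (ak (S k) (T - t) * bk (S k) t))).
          apply (is_derive_mult (fun t => exp (- r * t)) (fun t => ak (S k) (T - t) * bk (S k) t)).
          -- auto_derive; [trivial | reflexivity].
          -- apply (is_derive_mult (fun t => ak (S k) (T - t)) (bk (S k))).
             ++ apply (is_derive_comp (ak (S k)) (fun t => T - t)); [apply wk_derive; auto | auto_derive; [trivial | reflexivity]].
             ++ apply wk_derive; auto.
             ++ intros; apply Rmult_comm.
          -- intros; apply Rmult_comm.
        * unfold plus, mult, scal; simpl; unfold mult; simpl. unfold dFr. fold ak bk.
          change (cf false (fun x : R => dF (T - t) x) (S k)) with (cf false (dF (T - t)) (S k)). fd. lra.
      + ctn. }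
  set (H := fun t => RInt (fun x => dFr t x * dm t x) 0 L - RInt (fun x => dv t x * dg t x) 0 L).
  assert (cH : cont1 H).
  { unfold H. assert (h1 := RI_param_cont (fun t x => dFr t x * dm t x) 0 L ltac:(ctn)).
    assert (h2 := RI_param_cont (fun t x => dv t x * dg t x) 0 L ltac:(ctn)). ctn. }
  (* Summation over the modes: the scalar products in [H] are uniform limits in [t] of their
     truncated Parseval sums. *)
  assert (Z : RInt (fun t => exp (- r * t) * H t) 0 T = 0).
  { apply eq_eps. intros ep Hep. rewrite Rminus_0_r.
    destruct (ip_unif L HL false dFr dm T (ep / (2 * T)) cdFr cdm ltac:(lra) ltac:(pos)) as [N1 HN1].
    destruct (ip_unif L HL true dv dg T (ep / (2 * T)) cdv cdg ltac:(lra) ltac:(pos)) as [N2 HN2].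
    set (N := (N1 + N2)%nat).
    set (h := fun t => sm (fun k => exp (- r * t) * (ck k * cf false (dFr t) k * bk k t - ck k * ak k (T - t) * cf true (dg t) k)) N).
    assert (ch : cont1 h).
    { intros t. unfold h. apply (c_sm (fun k t => exp (- r * t) * (ck k * cf false (dFr t) k * bk k t - ck k * ak k (T - t) * cf true (dg t) k))).
      intros k _. assert (c1 := cak k). assert (c2 := cbk k). assert (c3 := cfF k). assert (c4 := cfg k). ctn. }
    assert (Ih : RInt h 0 T = 0).
    { unfold h. rewrite (RI_sm (fun k t => exp (- r * t) * (ck k * cf false (dFr t) k * bk k t - ck k * ak k (T - t) * cf true (dg t) k))).
      - rewrite (sm_ext _ (fun _ => 0)), sm_zero by (intros; apply K). auto.
      - intros k. assert (c1 := cak k). assert (c2 := cbk k). assert (c3 := cfF k). assert (c4 := cfg k). ctn. }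
    replace (RInt (fun t => exp (- r * t) * H t) 0 T) with (RInt (fun t => exp (- r * t) * H t - h t) 0 T)
      by (rewrite RI_minus by ctn; rewrite Ih; apply Rminus_0_r).
    replace ep with ((ep / T) * (T - 0)) by (field; lra).
    apply RI_abs_ub; [ctn | lra |]. intros t Ht.
    assert (q1 := HN1 N ltac:(unfold N; lia) t Ht). assert (q2 := HN2 N ltac:(unfold N; lia) t Ht).
    rewrite (sm_ext _ (fun k => ck k * cf false (dFr t) k * bk k t)) in q1 by (intros; rewrite Eb; auto).
    rewrite (sm_ext _ (fun k => ck k * ak k (T - t) * cf true (dg t) k)) in q2 by (intros; rewrite Ea; auto).
    unfold h. rewrite sm_scal, sm_minus. unfold H.
    match goal with |- Rabs (?e * (?A - ?B) - ?e * (?C - ?D)) <= _ => replace (e * (A - B) - e * (C - D)) with (e * ((A - C) - (B - D))) by ring end.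
    rewrite Rabs_mult, (Rabs_right (exp _)) by (left; apply exp_pos).
    assert (e1 : exp (- r * t) <= 1).
    { assert (q := exp_le_mono (- r * t) 0). rewrite exp_0 in q. apply q. assert (0 <= r * t) by (apply Rmult_le_pos; lra). lra. }
    assert (e0 := exp_pos (- r * t)).
    match goal with |- ?e * Rabs (?X - ?Y) <= _ => assert (q3 : Rabs (X - Y) <= ep / T) end.
    { eapply Rle_trans; [apply Rabs_triang |]. rewrite Rabs_Ropp.
      replace (ep / T) with (ep / (2 * T) + ep / (2 * T)) by (field; lra). lra. }
    match goal with |- ?e * ?X <= _ => assert (q4 : 0 <= X) by apply Rabs_pos; nra end. }
  set (dl := fun t => p1 t - p2 t).
  set (W := fun t => RInt (fun x => (m1 t x + m2 t x) * (/ 2 * (p1 t - v1 (T - t) x) - / 2 * (p2 t - v2 (T - t) x)) ^ 2) 0 L).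
  assert (cW : cont1 W).
  { apply (RI_param_cont (fun t x => (m1 t x + m2 t x) * (/ 2 * (p1 t - v1 (T - t) x) - / 2 * (p2 t - v2 (T - t) x)) ^ 2)). ctn. }
  (* Pointwise algebra plus unit mass: [W] collects the nonnegative square terms, and the integrals
     of the two densities against functions of time alone are known. *)
  assert (EH : forall t, 0 <= t <= T -> H t = W t - / 2 * (dl t * (dl t - (Vf v1 m1 t - Vf v2 m2 t)))).
  { intros t Ht. unfold H. rewrite <- RI_minus by ctn.
    rewrite (RI_ext _ (fun x => (m1 t x + m2 t x) * (/ 2 * (p1 t - v1 (T - t) x) - / 2 * (p2 t - v2 (T - t) x)) ^ 2
      + ((/ 4 * (p1 t ^ 2 - p2 t ^ 2) - / 2 * dl t * p1 t) * m1 t x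
      + ((/ 2 * dl t * p2 t - / 4 * (p1 t ^ 2 - p2 t ^ 2)) * m2 t x
      + (/ 2 * dl t) * (v1 (T - t) x * m1 t x - v2 (T - t) x * m2 t x))))); [| lra |].
    - rewrite RI_plus by ctn. rewrite RI_plus by ctn. rewrite RI_plus by ctn. rewrite !RI_scal by ctn.
      rewrite RI_minus by ctn. rewrite ms1, ms2 by auto. fold (W t). fold (Vf v1 m1 t). fold (Vf v2 m2 t).
      unfold dl. req. field.
    - intros x Hx. unfold dFr, dF, dm, dv, dg, vsrc, msrc, Fq, dl.
      replace (T - (T - t)) with t by ring. rewrite !clip_id by (first [apply bv1 | apply bv2]; auto; lra). field. }
  rewrite (RI_ext _ (fun t => exp (- r * t) * W t - / 2 * (exp (- r * t) * dl t ^ 2)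
     + / 2 * (exp (- r * t) * (dl t * (Vf v1 m1 t - Vf v2 m2 t))))) in Z; [| lra |].
  2:{ intros t Ht. rewrite EH by auto. ring. }
  assert (cdl : cont1 dl) by (unfold dl; ctn).
  rewrite RI_plus in Z by ctn. rewrite RI_minus in Z by ctn.
  rewrite !(RI_scal (/ 2)) in Z by ctn.
  assert (W0 : 0 <= RInt (fun t => exp (- r * t) * W t) 0 T).
  { apply RI_ge0; [ctn | lra |]. intros t Ht. apply Rmult_le_pos; [pos |]. apply RI_ge0; [ctn | lra |].
    intros x Hx. assert (h1 := nn1 t x Ht Hx). assert (h2 := nn2 t x Ht Hx). apply Rmult_le_pos; [lra | pos]. }
  fold dl. unfold dl in *. lra.
Qed.

(** The damped iteration contracts in an L2 norm weighted by exp(-r t). This is not yet continuity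
    of the limit, so a second recursion carries the convergence over to the sup norm. *)
Lemma fixed_point b c : 0 < b -> 0 < c -> b + c = 1 -> exists p v m, cont1 p /\
  (forall t, Rabs (p t) <= b + c * K0) /\ coupled p v m /\
  forall t, 0 <= t <= T -> p t = b + c * Vf v m t.
Proof.
  intros Hb Hc Hbc. set (P := b + c * K0).
  assert (HP : 0 <= P) by (unfold P; pos).
  destruct (Vf_lipschitz P HP) as [K [HK Lp]].
  (* A coupled pair is selected by choice for each [p]; the Lipschitz and monotonicity bounds hold
     between any two coupled pairs, so an arbitrary selection serves. The inhabitant is a
     default. *)
  set (vm := fun p => epsilon (inhabits ((fun _ _ : R => 0), (fun _ _ : R => 0)))
      (fun q : (R -> R -> R) * (R -> R -> R) => coupled p (fst q) (snd q))).
  set (Vp := fun p => Vf (fst (vm p)) (snd (vm p))).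
  set (Q := fun p => cont1 p /\ (forall t, Rabs (p t) <= P) /\ (forall t, p t = p (clamp T t))).
  assert (HQc : forall p, Q p -> coupled p (fst (vm p)) (snd (vm p))).
  { intros p [cp [Hp _]]. unfold vm. apply epsilon_spec.
    destruct (coupled_exists p P cp HP Hp) as [v [m HC]]. exists (v, m). auto. }
  assert (Vb : forall p, Q p -> forall t, 0 <= t <= T -> Rabs (Vp p t) <= K0).
  { intros p HQ t Ht. assert (HC := HQc p HQ). destruct HQ as [cp [Hp _]]. unfold Vp. eapply (Vf_bound p P); eauto. }
  assert (Vc : forall p, Q p -> cont1 (Vp p)).
  { intros p HQ. assert (HC := HQc p HQ). unfold Vp. eapply (Vf_cont p); eauto. }
  set (E := exp (r * T)). assert (HE : 0 < E) by (unfold E; pos).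
  (* The squared distance carries the weight of the duality inequality, so that [Vf_monotone]
     applies without loss. *)
  set (Rr := fun p q : R -> R => RInt (fun t => exp (- r * t) * (p t - q t) ^ 2) 0 T).
  assert (Rr0 : forall p q, cont1 p -> cont1 q -> 0 <= Rr p q).
  { intros p q cp cq. apply RI_ge0; [ctn | lra | intros; pos]. }
  set (K2 := K * E). assert (HK2 : 0 < K2) by (unfold K2; pos).
  assert (V2 : forall p q, Q p -> Q q -> forall t, 0 <= t <= T -> (Vp p t - Vp q t) ^ 2 <= K2 * Rr p q).
  { intros p q Hp Hq t Ht. assert (HC := HQc p Hp). assert (HC' := HQc q Hq).
    destruct Hp as [cp [bp _]]. destruct Hq as [cq [bq _]].
    eapply Rle_trans; [apply (Lp p _ _ q _ _ cp bp HC cq bq HC' t Ht) |].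
    unfold K2. rewrite Rmult_assoc. apply Rmult_le_compat_l; [lra |]. unfold Rr. rewrite <- RI_scal by ctn.
    apply RI_le; [ctn | ctn | lra |]. intros s Hs. rewrite <- Rmult_assoc. unfold E. rewrite <- exp_plus.
    assert (1 <= exp (r * T + - r * s)) by (apply exp_ge1; assert (0 <= r * (T - s)) by (apply Rmult_le_pos; lra); lra).
    assert (q2 := pow2_ge_0 (p s - q s)). nra. }
  set (K1 := K2 * T). assert (HK1 : 0 < K1) by (unfold K1; pos).
  (* Chosen so that ta (c^2 K1) = b - ta; the rate (1 - ta)^2 + 2 (1 - ta) ta c + ta^2 c^2 K1 is
     then 1 - ta b - 2 ta^2 c <= 1 - ta b. *)
  set (ta := b / (1 + c ^ 2 * K1)).
  assert (Hd : 0 < c ^ 2 * K1) by pos.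
  assert (Hta : 0 < ta) by (unfold ta; pos).
  assert (Eta : ta * (1 + c ^ 2 * K1) = b) by (unfold ta; field; lra).
  assert (Hta1 : ta <= b) by (assert (0 < ta * (c ^ 2 * K1)) by pos; lra).
  assert (Hta2 : ta < 1) by lra.
  set (nx := fun (p : R -> R) t => (1 - ta) * p t + ta * (b + c * Vp p (clamp T t))).
  assert (Qn : forall p, Q p -> Q (nx p)).
  { intros p HQ. assert (cV := Vc p HQ). assert (bV := Vb p HQ). destruct HQ as [cp [bp ep]].
    assert (cc := cont1_clamp T). unfold nx. split; [ctn | split].
    - intros t. assert (h1 := bp t). assert (h2 := bV (clamp T t) (clamp_in T t ltac:(lra))).
      apply Rabs_le_between in h1. apply Rabs_le_between in h2. apply Rabs_le. unfold P in *.
      assert (0 <= (1 - ta) * (b + c * K0 - p t)) by (apply Rmult_le_pos; lra).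
      assert (0 <= (1 - ta) * (b + c * K0 + p t)) by (apply Rmult_le_pos; lra).
      assert (0 <= ta * (c * (K0 - Vp p (clamp T t)))) by (apply Rmult_le_pos; [lra | apply Rmult_le_pos; lra]).
      assert (0 <= ta * (c * (K0 + Vp p (clamp T t)))) by (apply Rmult_le_pos; [lra | apply Rmult_le_pos; lra]).
      assert (0 < ta * b) by pos. lra.
    - intros t. rewrite (ep t). rewrite (clamp_id T (clamp T t)) by (apply clamp_in; lra). auto. }
  set (u := fix u n := match n with O => (fun _ : R => b) | S n => nx (u n) end).
  assert (Qu : forall n, Q (u n)).
  { induction n; [| apply Qn; auto]. simpl. split; [ctn | split; auto].
    intros t. rewrite Rabs_right by lra. unfold P. assert (0 <= c * K0) by pos. lra. }
  set (qq := 1 - ta * b).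
  assert (tb : 0 < ta * b) by pos. assert (tb1 : ta * b < 1) by nra.
  assert (An : forall n, Rr (u (S n)) (u (S (S n))) <= qq * Rr (u n) (u (S n))).
  { intros n. set (p := u n). assert (Hp : Q p) by apply Qu. assert (Hq : Q (nx p)) by (apply Qn; auto).
    change (u (S n)) with (nx p). change (u (S (S n))) with (nx (nx p)). set (q := nx p) in *.
    assert (cVp := Vc p Hp). assert (cVq := Vc q Hq).
    assert (HC := HQc p Hp). assert (HC' := HQc q Hq). assert (v2 := V2 p q Hp Hq).
    assert (Hp' := Hp). assert (Hq' := Hq). destruct Hp' as [cp [bp _]]. destruct Hq' as [cq [bq _]].
    assert (Mo := Vf_monotone P p _ _ q _ _ HP cp bp HC cq bq HC'). fold (Vp p) in Mo. fold (Vp q) in Mo.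
    set (I1 := RInt (fun t => exp (- r * t) * ((p t - q t) * (Vp p t - Vp q t))) 0 T) in *.
    fold (Rr p q) in Mo.
    assert (I2 : RInt (fun t => exp (- r * t) * (Vp p t - Vp q t) ^ 2) 0 T <= K1 * Rr p q).
    { replace (K1 * Rr p q) with (K2 * Rr p q * (T - 0)) by (unfold K1; ring). apply RI_ub; [ctn | lra |].
      intros t Ht. assert (h := v2 t Ht).
      assert (e1 : exp (- r * t) <= 1).
      { assert (z := exp_le_mono (- r * t) 0). rewrite exp_0 in z. apply z. assert (0 <= r * t) by (apply Rmult_le_pos; lra). lra. }
      assert (e0 := exp_pos (- r * t)). assert (z := pow2_ge_0 (Vp p t - Vp q t)). nra. }
    assert (Ex : Rr q (nx q) = (1 - ta) ^ 2 * Rr p q + (2 * (1 - ta) * ta * c * I1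
        + ta ^ 2 * c ^ 2 * RInt (fun t => exp (- r * t) * (Vp p t - Vp q t) ^ 2) 0 T)).
    { unfold Rr, I1. rewrite <- !RI_scal by ctn. rewrite <- RI_plus by ctn. rewrite <- RI_plus by ctn.
      apply RI_ext; [lra |]. intros t Ht. unfold nx at 1. unfold q at 1, nx at 1. rewrite clamp_id by auto. ring. }
    rewrite Ex. assert (R0 := Rr0 p q cp cq). set (A := Rr p q) in *.
    assert (t1 : 2 * (1 - ta) * ta * c * I1 <= 2 * (1 - ta) * ta * c * A) by (apply Rmult_le_compat_l; [pos | auto]).
    assert (t2 : ta ^ 2 * c ^ 2 * RInt (fun t => exp (- r * t) * (Vp p t - Vp q t) ^ 2) 0 T <= ta ^ 2 * c ^ 2 * (K1 * A))
      by (apply Rmult_le_compat_l; [pos | auto]).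
    assert (t3 : (1 - ta) ^ 2 + 2 * (1 - ta) * ta * c + ta ^ 2 * c ^ 2 * K1 <= qq).
    { unfold qq. replace (ta ^ 2 * c ^ 2 * K1) with (ta * (ta * (c ^ 2 * K1))) by ring.
      replace (ta * (c ^ 2 * K1)) with (b - ta) by lra. replace c with (1 - b) by lra. nra. }
    apply Rle_trans with (((1 - ta) ^ 2 + 2 * (1 - ta) * ta * c + ta ^ 2 * c ^ 2 * K1) * A); [lra |].
    apply Rmult_le_compat_r; auto. }
  set (A0 := Rr (u O) (u 1%nat)).
  assert (HA0 : 0 <= A0) by (apply Rr0; apply Qu).
  assert (An' : forall n, Rr (u n) (u (S n)) <= A0 * qq ^ n).
  { induction n; [simpl pow; fold A0; lra |]. eapply Rle_trans; [apply An |]. simpl pow.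
    replace (A0 * (qq * qq ^ n)) with (qq * (A0 * qq ^ n)) by ring. apply Rmult_le_compat_l; [unfold qq; lra | auto]. }
  (* The sup distance obeys d_(n+1) <= (1 - ta) d_n + ta c |V_(n+1) - V_n|, and the last term decays
     like sqrt(qq)^n by [V2]. A rate of at least 1 - ta/2 leaves room ta/2 for it, which explains
     the factor 2 in [S]. *)
  set (th := Rmax (sqrt qq) (1 - ta / 2)).
  assert (th1 : sqrt qq <= th) by apply Rmax_l. assert (th2 : 1 - ta / 2 <= th) by apply Rmax_r.
  assert (sq0 := sqrt_pos qq).
  assert (sq1 : sqrt qq < 1) by (rewrite <- sqrt_1; apply sqrt_lt_1; unfold qq; lra).
  assert (th3 : 0 <= th < 1) by (split; [lra | unfold th; apply Rmax_lub_lt; lra]).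
  assert (cd : cont1 (fun t => u 1%nat t - u O t)) by (destruct (Qu 1%nat) as [c1 _]; destruct (Qu O) as [c0 _]; ctn).
  destruct (cont1_bound _ 0 T cd) as [S0 [HS0 BS0]].
  set (S := S0 + 2 * c * sqrt (K2 * A0)).
  assert (HS : 0 <= S) by (unfold S; pos).
  assert (Sup : forall n t, Rabs (u (Datatypes.S n) t - u n t) <= S * th ^ n).
  { induction n; intros t.
    - destruct (Qu 1%nat) as [_ [_ e1]]. destruct (Qu O) as [_ [_ e0]]. rewrite e1, e0. simpl pow.
      assert (h := BS0 (clamp T t) (clamp_in T t ltac:(lra))). assert (0 <= 2 * c * sqrt (K2 * A0)) by pos. unfold S. lra.
    - assert (Hc' := clamp_in T t ltac:(lra)).
      replace (u (Datatypes.S (Datatypes.S n)) t - u (Datatypes.S n) t) with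
        ((1 - ta) * (u (Datatypes.S n) t - u n t) + ta * (c * (Vp (u (Datatypes.S n)) (clamp T t) - Vp (u n) (clamp T t))))
        by (simpl; unfold nx; ring).
      assert (v2 := V2 (u n) (u (Datatypes.S n)) (Qu _) (Qu _) (clamp T t) Hc').
      assert (v3 : Rabs (Vp (u (Datatypes.S n)) (clamp T t) - Vp (u n) (clamp T t)) <= sqrt (K2 * A0) * th ^ n).
      { rewrite Rabs_minus_sym. rewrite <- sqrt_Rsqr_abs, Rsqr_pow2.
        apply Rle_trans with (sqrt (K2 * A0 * qq ^ n)).
        - apply sqrt_le_1_alt. eapply Rle_trans; [apply v2 |]. rewrite Rmult_assoc. apply Rmult_le_compat_l; [lra | auto].
        - rewrite sqrt_mult; [| pos | apply pow_le; unfold qq; lra]. apply Rmult_le_compat_l; [pos |].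
          replace (sqrt (qq ^ n)) with (sqrt qq ^ n).
          + apply pow_incr. lra.
          + symmetry. apply sqrt_lem_1; [apply pow_le; unfold qq; lra | apply pow_le; lra |].
            rewrite <- Rpow_mult_distr, sqrt_sqrt; auto. unfold qq; lra. }
      assert (h := IHn t). assert (pn : 0 <= th ^ n) by (apply pow_le; lra).
      eapply Rle_trans; [apply Rabs_triang |]. rewrite !Rabs_mult, (Rabs_right (1 - ta)), (Rabs_right ta), (Rabs_right c) by lra.
      apply Rle_trans with ((1 - ta) * (S * th ^ n) + ta * (c * (sqrt (K2 * A0) * th ^ n))).
      + apply Rplus_le_compat; [apply Rmult_le_compat_l; lra |]. apply Rmult_le_compat_l; [lra |]. apply Rmult_le_compat_l; lra.
      + assert (s1 : 2 * (c * sqrt (K2 * A0)) <= S) by (unfold S; lra).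
        assert (s2 : ta * (c * (sqrt (K2 * A0) * th ^ n)) <= ta / 2 * (S * th ^ n)).
        { replace (ta * (c * (sqrt (K2 * A0) * th ^ n))) with (ta / 2 * ((2 * (c * sqrt (K2 * A0))) * th ^ n)) by field.
          apply Rmult_le_compat_l; [lra |]. apply Rmult_le_compat_r; auto. }
        simpl pow. assert (0 <= S * th ^ n) by pos.
        assert ((1 - ta / 2) * (S * th ^ n) <= th * (S * th ^ n)) by (apply Rmult_le_compat_r; auto). lra. }
  destruct (limit_geom u S th th3 HS Sup) as [f Hf].
  assert (small : forall e, 0 < e -> exists N, forall t, Rabs (u N t - f t) <= e /\ Rabs (u (Datatypes.S N) t - f t) <= e).
  { intros e He. destruct (geom_small (S / (1 - th)) th e th3 He) as [N HN]. exists N. intros t.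
    split; eapply Rle_trans; try apply Hf; apply HN; lia. }
  assert (Qf : Q f).
  { split; [| split].
    - apply (cont1_slice (fun _ x => f x) 0). apply cont2_unif. intros e He. destruct (small e He) as [N HN].
      exists (fun _ x => u N x). split; [destruct (Qu N) as [cN _]; ctn |]. intros t x. rewrite Rabs_minus_sym. apply HN.
    - intros t. apply le_eps. intros e He. destruct (small e He) as [N HN]. destruct (HN t) as [h _].
      destruct (Qu N) as [_ [bN _]]. assert (h2 := bN t).
      assert (h3 := Rabs_triang (u N t) (- (u N t - f t))). rewrite Rabs_Ropp in h3.
      replace (u N t + - (u N t - f t)) with (f t) in h3 by ring. lra.
    - intros t. apply eq_eps. intros e He. destruct (small (e / 2)) as [N HN]; [lra |].
      destruct (HN t) as [h1 _]. destruct (HN (clamp T t)) as [h2 _]. destruct (Qu N) as [_ [_ eN]]. rewrite (eN t) in h1.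
      assert (h3 := Rabs_triang (- (u N (clamp T t) - f t)) (u N (clamp T t) - f (clamp T t))). rewrite Rabs_Ropp in h3.
      replace (- (u N (clamp T t) - f t) + (u N (clamp T t) - f (clamp T t))) with (f t - f (clamp T t)) in h3 by ring. lra. }
  exists f, (fst (vm f)), (snd (vm f)). split; [apply Qf | split; [apply Qf | split; [apply HQc; auto |]]].
  intros t Ht. fold (Vp f).
  (* The iteration passes to the limit because [Vp] is continuous from L2 in time to pointwise
     values; dividing by [ta] gives the fixed-point equation. *)
  assert (Fx : ta * (f t - (b + c * Vp f t)) = 0).
  { apply eq_eps. intros e He. rewrite Rminus_0_r.
    set (d := Rmin 1 (Rmin (e / 4) (e ^ 2 / (16 * (K2 * T + 1))))).
    assert (P1 : 0 < K2 * T) by pos.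
    assert (Hd0 : 0 < d) by (unfold d; repeat apply Rmin_pos; try lra; pos).
    assert (d1 : d <= 1) by apply Rmin_l.
    assert (d2 : d <= e / 4) by (eapply Rle_trans; [apply Rmin_r | apply Rmin_l]).
    assert (d3 : d <= e ^ 2 / (16 * (K2 * T + 1))) by (eapply Rle_trans; [apply Rmin_r | apply Rmin_r]).
    destruct (small d Hd0) as [N HN]. destruct (HN t) as [h1 h2].
    assert (v2 := V2 (u N) f (Qu N) Qf t Ht).
    assert (RB : Rr (u N) f <= d * T).
    { unfold Rr. replace (d * T) with (d * (T - 0)) by ring. destruct (Qu N) as [cN _]. destruct Qf as [cF _].
      apply RI_ub; [ctn | lra |]. intros s Hs.
      assert (e1 : exp (- r * s) <= 1).
      { assert (z := exp_le_mono (- r * s) 0). rewrite exp_0 in z. apply z. assert (0 <= r * s) by (apply Rmult_le_pos; lra). lra. }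
      assert (e0 := exp_pos (- r * s)). destruct (HN s) as [z _]. apply sq_le_of_abs in z; [| lra].
      assert (z2 := pow2_ge_0 (u N s - f s)). assert (d ^ 2 <= d) by nra. nra. }
    assert (v3 : Rabs (Vp (u N) t - Vp f t) <= e / 4).
    { apply Rsqr_incr_0_var; [| lra]. rewrite <- Rsqr_abs, !Rsqr_pow2. eapply Rle_trans; [apply v2 |].
      apply Rle_trans with (K2 * (d * T)); [apply Rmult_le_compat_l; lra |].
      replace (K2 * (d * T)) with (d * (K2 * T)) by ring.
      apply Rle_trans with (e ^ 2 / (16 * (K2 * T + 1)) * (K2 * T + 1)); [apply Rmult_le_compat; lra |].
      right. field. lra. }
    assert (Eu : u (Datatypes.S N) t = (1 - ta) * u N t + ta * (b + c * Vp (u N) t)).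
    { simpl. unfold nx. rewrite clamp_id by auto. auto. }
    replace (ta * (f t - (b + c * Vp f t))) with
      (- (u (Datatypes.S N) t - f t) + (1 - ta) * (u N t - f t) + (ta * c) * (Vp (u N) t - Vp f t)) by (rewrite Eu; ring).
    eapply Rle_trans; [apply Rabs_triang |]. eapply Rle_trans; [apply Rplus_le_compat_r; apply Rabs_triang |].
    rewrite (Rabs_mult (1 - ta)), (Rabs_mult (ta * c)), !Rabs_Ropp, (Rabs_right (1 - ta)), (Rabs_right (ta * c)) by (try lra; apply Rle_ge; pos).
    assert (a1 := Rabs_pos (u N t - f t)). assert (a2 := Rabs_pos (Vp (u N) t - Vp f t)).
    assert ((1 - ta) * Rabs (u N t - f t) <= Rabs (u N t - f t)) by nra.
    assert (ta * c <= 1) by nra.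
    assert (ta * c * Rabs (Vp (u N) t - Vp f t) <= Rabs (Vp (u N) t - Vp f t)) by nra. lra. }
  apply Rmult_integral in Fx. destruct Fx; lra.
Qed.
End Coupled.

(** * Flux regularity *)

Lemma RI_shift f s0 t : cont1 f -> RInt (fun s => f (s0 + s)) 0 t = RInt f s0 (s0 + t).
Proof.
  intros c. rewrite (RI_ftc (fun s => RInt f s0 (s0 + s))).
  - rewrite Rplus_0_r, RI_point. rg.
  - intros x. evar_last.
    + apply (is_derive_comp (fun y => RInt f s0 y) (fun s => s0 + s)); [apply RI_derive; auto | auto_derive; [trivial | reflexivity]].
    + unfold scal; simpl; unfold mult; simpl. ring.
  - ctn.
Qed.
(** Semigroup property: the solution seen from time [s0] starts from its own coefficients there. It
    gives local regularity without assumptions on the original datum. *)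
Lemma hs_restart L b nu rho T a phi w s0 : hs L b nu rho T a phi w -> 0 <= s0 <= T ->
  hs L b nu rho (T - s0) (cfL L b (w s0)) (fun s => phi (s0 + s)) (fun s => w (s0 + s)).
Proof.
  intros [c1 [c2 [E Tl]]] Hs. split; [ctn | split; [ctn | split]].
  - intros t k Ht. rewrite E by lra. rewrite (wk_restart L nu rho b a phi k s0) by (auto; lra).
    assert (c3 : cont2 (fun s => phi (s0 + s))) by ctn.
    rewrite (wk_form L nu rho b (cfL L b (w s0)) (fun s => phi (s0 + s))) by (auto; lra). rewrite E by lra.
    replace (s0 + t - s0) with t by ring. f_equal. f_equal.
    assert (c4 := phik_cont L (negb b) phi k c1).
    rewrite <- (RI_shift (fun r => exp (- (nu * lamL L k ^ 2 + rho) * (s0 + t - r)) * cfL L (negb b) (phi r) k)) by ctn.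
    apply RInt_ext. intros r _. req. replace (s0 + t - (s0 + r)) with (t - r) by ring. auto.
  - intros ep Hep. destruct (Tl ep Hep) as [N HN]. exists N. intros n Hn t Ht m. apply HN; auto; lra.
Qed.

Section Flux.
Variables L nu rho T : R.
Variable b : bool.
Variable a : nat -> R.
Variables phi w : R -> R -> R.
Hypothesis HL : 0 < L.
Hypothesis Hnu : 0 < nu.
Hypothesis Hrho : 0 <= rho.
Hypothesis HT : 0 < T.
Hypothesis H : hs L b nu rho T a phi w.
Local Notation lam := (lamL L).
Local Notation cf := (cfL L).
Local Notation ck := (ckL L).
Local Notation mu k := (nu * lamL L k ^ 2 + rho).
Local Notation nu' := (nu + rho / lamL L 1 ^ 2).

(* [lam k * fl k] is the time derivative of the [k]-th coefficient of [w]; used for [k >= 1] only. *)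
Definition fl (k : nat) (t : R) : R := cf (negb b) (phi t) k - (nu * lam k + rho / lam k) * cf b (w t) k.

Lemma cphi : cont2 phi. Proof. apply H. Qed.
Lemma cw : cont2 w. Proof. apply H. Qed.
Lemma fl_cont k : cont1 (fl k).
Proof.
  assert (c1 := phik_cont L (negb b) phi k cphi). assert (c2 := phik_cont L b w k cw). unfold fl. ctn.
Qed.
Lemma mu_le k : (1 <= k)%nat -> mu k <= nu' * lam k ^ 2.
Proof.
  intros Hk. assert (p1 := lam1_pos L HL). assert (pk := lam_pos L HL k Hk).
  assert (q : lam 1 <= lam k).
  { rewrite (lam_S L HL k). assert (1 <= INR k) by (apply (le_INR 1); auto). nra. }
  assert (q2 : lam 1 ^ 2 <= lam k ^ 2) by (apply pow_incr; lra).
  assert (rho <= rho / lam 1 ^ 2 * lam k ^ 2); [| lra].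
  replace rho with (rho / lam 1 ^ 2 * lam 1 ^ 2) at 1 by (field; lra).
  apply Rmult_le_compat_l; auto. pos.
Qed.
(** Variation of constants with phi(t) added and subtracted: mu times the integral of exp(-mu (t -
    s)) is 1 - exp(-mu t), so the stationary part cancels and only increments of [phi] remain, whose
    Hoelder decay tames the factor [mu]. *)
Lemma fl_form k t : (1 <= k)%nat -> 0 <= t <= T ->
  fl k t = exp (- mu k * t) * fl k 0 + exp (- mu k * t) * (cf (negb b) (phi t) k - cf (negb b) (phi 0) k)
   + mu k * RInt (fun s => exp (- mu k * (t - s)) * (cf (negb b) (phi t) k - cf (negb b) (phi s) k)) 0 t.
Proof.
  intros Hk Ht. assert (pk := lam_pos L HL k Hk). destruct H as [c1 [c2 [E _]]].
  assert (c3 := phik_cont L (negb b) phi k c1).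
  assert (Hmu : 0 < mu k) by (assert (0 < nu * lam k ^ 2) by pos; lra).
  unfold fl. rewrite !E by lra. rewrite wk_0. rewrite wk_form by (auto; lra).
  rewrite (RInt_ext (fun s => exp (- mu k * (t - s)) * (cf (negb b) (phi t) k - cf (negb b) (phi s) k))
    (fun s => cf (negb b) (phi t) k * exp (- mu k * (t - s)) - exp (- mu k * (t - s)) * cf (negb b) (phi s) k)) by (intros; req; ring).
  rewrite RI_minus by ctn. rewrite RI_scal by ctn.
  assert (I1 : RInt (fun s => exp (- mu k * (t - s))) 0 t = / mu k * (1 - exp (- mu k * t))).
  { rewrite (RI_ftc (fun s => / mu k * exp (- mu k * (t - s)))).
    - replace (- mu k * (t - t)) with 0 by ring. rewrite exp_0, Rminus_0_r. rg.
    - intros x. auto_derive; [trivial |]. change (lam k * (lam k * 1)) with (lam k ^ 2). change (t + - x) with (t - x). fd. lra.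
    - ctn. }
  rewrite I1. set (I := RInt _ 0 t). set (f := cf (negb b) (phi t) k). set (f0 := cf (negb b) (phi 0) k).
  set (ex := exp (- mu k * t)). field. split; lra.
Qed.

Definition l2mod (al Hc : R) : Prop := forall s t, 0 <= s -> s < t -> t <= T ->
  RInt (fun x => (phi t x - phi s x) ^ 2) 0 L <= Hc * Rpower (t - s) (2 * al).

(** The initial flux is subtracted because its summability depends on the datum. The factor [mu]
    counts as two more derivatives, and [ksum] with j + 2 combined with the Hoelder gain gives the
    singularity (t - s)^(th - 1). *)
Lemma flux_core j al Hc : INR j / 2 + 5 / 16 < al -> 0 <= Hc -> l2mod al Hc ->
  exists C, 0 <= C /\ forall n m t, (1 <= n)%nat -> 0 <= t <= T ->
   sm (fun i => Rabs (lam (n + i) ^ j * (fl (n + i) t - exp (- mu (n + i) * t) * fl (n + i) 0))) m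
     <= C * Rpower (INR n) (- (1 / 8)).
Proof.
  intros Hal HHc Hm. assert (c1 := cphi).
  destruct (ksum L nu HL Hnu j) as [C1 [HC1 K1]]. destruct (ksum L nu HL Hnu (j + 2)) as [C2 [HC2 K2]].
  (* The margin that makes the singular integral converge. *)
  set (th := al - (INR j / 2 + 5 / 16)). assert (Hth : 0 < th) by (unfold th; lra).
  assert (P1 := lam1_pos L HL). assert (Hnu' : 0 < nu') by (assert (0 <= rho / lam 1 ^ 2) by pos; lra).
  exists (C1 * sqrt Hc * Rpower T th + nu' * (C2 * sqrt Hc) / th * Rpower T th). split; [pos |].
  intros n m t Hn Ht. assert (Pn := Rpower_pos (- (1 / 8)) (INR n)).
  destruct (Req_dec t 0) as [-> | Ht0].
  { rewrite (sm_ext _ (fun _ => 0)); [rewrite sm_zero; pos |]. intros i _.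
    rewrite Rmult_0_r, exp_0, Rmult_1_l, Rminus_diag_eq, Rmult_0_r by auto. apply Rabs_R0. }
  assert (gn : forall s, 0 <= s -> s < t -> sqrt (RInt (fun x => (phi t x - phi s x) ^ 2) 0 L) <= sqrt Hc * Rpower (t - s) al).
  { intros s h0 h1. eapply Rle_trans; [apply sqrt_le_1_alt, Hm; auto; lra |].
    rewrite sqrt_mult by pos. rewrite sqrt_Rpower by lra. right. f_equal. f_equal. field. }
  assert (cfd : forall s k, cf (negb b) (phi t) k - cf (negb b) (phi s) k = cf (negb b) (fun x => phi t x - phi s x) k)
    by (intros; rewrite cf_minus by ctn; auto).
  assert (eb : forall k q, 0 <= q -> exp (- mu k * q) <= exp (- (nu * lam k ^ 2) * q)).
  { intros k q Hq. apply exp_le_mono. assert (z := Rmult_le_pos rho q Hrho Hq). nra. }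
  assert (cpk : forall k, cont1 (fun s => cf (negb b) (phi s) k)) by (intros; apply phik_cont; auto).
  set (h := fun s => sm (fun i => nu' * Rabs (lam (n + i) ^ (j + 2) * exp (- (nu * lam (n + i) ^ 2) * (t - s)) *
       (cf (negb b) (phi t) (n + i) - cf (negb b) (phi s) (n + i)))) m).
  assert (ch0 : forall i, cont1 (fun s => nu' * Rabs (lam (n + i) ^ (j + 2) * exp (- (nu * lam (n + i) ^ 2) * (t - s)) *
       (cf (negb b) (phi t) (n + i) - cf (negb b) (phi s) (n + i))))) by (intros i; assert (c := cpk (n + i)%nat); ctn).
  assert (ch : cont1 h).
  { intros s. unfold h. apply (c_sm (fun i s => nu' * Rabs (lam (n + i) ^ (j + 2) * exp (- (nu * lam (n + i) ^ 2) * (t - s)) *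
       (cf (negb b) (phi t) (n + i) - cf (negb b) (phi s) (n + i))))). intros i _. apply ch0. }
  assert (A : sm (fun i => Rabs (lam (n + i) ^ j * exp (- (nu * lam (n + i) ^ 2) * t) * (cf (negb b) (phi t) (n + i) - cf (negb b) (phi 0) (n + i)))) m
     <= C1 * sqrt Hc * Rpower T th * Rpower (INR n) (- (1 / 8))).
  { rewrite (sm_ext _ (fun i => Rabs (lam (n + i) ^ j * exp (- (nu * lam (n + i) ^ 2) * t) * cf (negb b) (fun x => phi t x - phi 0 x) (n + i))))
      by (intros; rewrite cfd; auto).
    eapply Rle_trans; [apply K1; auto; [ctn | lra] |].
    assert (g0 := gn 0 ltac:(lra) ltac:(lra)). rewrite Rminus_0_r in g0.
    assert (p := Rpower_pos (- (INR j / 2 + 5 / 16)) t).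
    apply Rle_trans with (C1 * Rpower (INR n) (- (1 / 8)) * Rpower t (- (INR j / 2 + 5 / 16)) * (sqrt Hc * Rpower t al)).
    { apply Rmult_le_compat_l; [pos | auto]. }
    replace (C1 * Rpower (INR n) (- (1 / 8)) * Rpower t (- (INR j / 2 + 5 / 16)) * (sqrt Hc * Rpower t al)) with
      (C1 * Rpower (INR n) (- (1 / 8)) * sqrt Hc * Rpower t th).
    2:{ unfold th. replace (al - (INR j / 2 + 5 / 16)) with (- (INR j / 2 + 5 / 16) + al) by ring. rewrite Rpower_plus. ring. }
    replace (C1 * sqrt Hc * Rpower T th * Rpower (INR n) (- (1 / 8))) with (C1 * Rpower (INR n) (- (1 / 8)) * sqrt Hc * Rpower T th) by ring.
    apply Rmult_le_compat_l; [pos |]. apply Rpower_le_l; lra. }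
  assert (B : RInt h 0 t <= nu' * (C2 * sqrt Hc) / th * Rpower T th * Rpower (INR n) (- (1 / 8))).
  { set (Q := nu' * (C2 * sqrt Hc) * Rpower (INR n) (- (1 / 8))). assert (HQ : 0 <= Q) by (unfold Q; pos).
    eapply Rle_trans; [apply (RI_singular h t Q th ch (proj1 Ht) Hth HQ) |].
    - intros s Hs. unfold h. rewrite sm_scal.
      rewrite (sm_ext _ (fun i => Rabs (lam (n + i) ^ (j + 2) * exp (- (nu * lam (n + i) ^ 2) * (t - s)) * cf (negb b) (fun x => phi t x - phi s x) (n + i))))
        by (intros; rewrite cfd; auto).
      assert (k2 := K2 (negb b) (fun x => phi t x - phi s x) n m (t - s) ltac:(ctn) Hn ltac:(lra)).
      assert (g0 := gn s ltac:(lra) ltac:(lra)).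
      assert (p := Rpower_pos (- (INR (j + 2) / 2 + 5 / 16)) (t - s)).
      apply Rle_trans with (nu' * (C2 * Rpower (INR n) (- (1 / 8)) * Rpower (t - s) (- (INR (j + 2) / 2 + 5 / 16)) * (sqrt Hc * Rpower (t - s) al))).
      + apply Rmult_le_compat_l; [lra |]. eapply Rle_trans; [apply k2 |]. apply Rmult_le_compat_l; [pos | auto].
      + right. unfold Q. replace (th - 1) with (- (INR (j + 2) / 2 + 5 / 16) + al) by (unfold th; rewrite plus_INR; simpl; field).
        rewrite Rpower_plus. ring.
    - unfold Q. apply Rle_trans with (nu' * (C2 * sqrt Hc) * Rpower (INR n) (- (1 / 8)) / th * Rpower T th).
      + apply Rmult_le_compat_l; [pos | apply Rpower_le_l; lra].
      + right. field. lra. }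
  apply Rle_trans with (sm (fun i => Rabs (lam (n + i) ^ j * exp (- (nu * lam (n + i) ^ 2) * t) * (cf (negb b) (phi t) (n + i) - cf (negb b) (phi 0) (n + i)))) m + RInt h 0 t); [| lra].
  unfold h. rewrite (RI_sm (fun i s => nu' * Rabs (lam (n + i) ^ (j + 2) * exp (- (nu * lam (n + i) ^ 2) * (t - s)) *
       (cf (negb b) (phi t) (n + i) - cf (negb b) (phi s) (n + i))))) by auto.
  rewrite <- sm_plus. apply sm_le. intros i _. set (k := (n + i)%nat). assert (Hk : (1 <= k)%nat) by (unfold k; lia).
  assert (c := cpk k). assert (lk := lam_ge0 L HL k).
  rewrite (fl_form k t Hk Ht).
  replace (lam k ^ j * (exp (- mu k * t) * fl k 0 + exp (- mu k * t) * (cf (negb b) (phi t) k - cf (negb b) (phi 0) k) +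
     mu k * RInt (fun s => exp (- mu k * (t - s)) * (cf (negb b) (phi t) k - cf (negb b) (phi s) k)) 0 t - exp (- mu k * t) * fl k 0))
   with (lam k ^ j * exp (- mu k * t) * (cf (negb b) (phi t) k - cf (negb b) (phi 0) k)
     + lam k ^ j * mu k * RInt (fun s => exp (- mu k * (t - s)) * (cf (negb b) (phi t) k - cf (negb b) (phi s) k)) 0 t) by ring.
  eapply Rle_trans; [apply Rabs_triang |]. apply Rplus_le_compat.
  - rewrite !Rabs_mult. apply Rmult_le_compat_r; [pos |]. apply Rmult_le_compat_l; [pos |].
    rewrite !Rabs_right by (left; apply exp_pos). apply eb. lra.
  - rewrite <- RI_scal by ctn. eapply Rle_trans; [apply RI_abs; [ctn | lra] |].
    apply RI_le; [ctn | apply ch0 | lra |]. intros s Hs. rewrite !Rabs_mult.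
    assert (m0 := mu_ge0 L nu rho Hnu Hrho k).
    rewrite (Rabs_right (mu k)), !(Rabs_right (exp _)) by (try (left; apply exp_pos); lra).
    assert (e1 := eb k (t - s) ltac:(lra)). assert (e0 := exp_pos (- mu k * (t - s))).
    rewrite !(Rabs_right (lam k ^ _)) by (apply Rle_ge; pos).
    replace (nu' * (lam k ^ (j + 2) * exp (- (nu * lam k ^ 2) * (t - s)) * Rabs (cf (negb b) (phi t) k - cf (negb b) (phi s) k)))
      with (lam k ^ j * (nu' * lam k ^ 2) * (exp (- (nu * lam k ^ 2) * (t - s)) * Rabs (cf (negb b) (phi t) k - cf (negb b) (phi s) k)))
      by (rewrite pow_add; ring).
    assert (ml := mu_le k Hk).
    apply Rmult_le_compat; try pos.
    + apply Rmult_le_compat_l; [pos | auto].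
    + apply Rmult_le_compat_r; [pos | auto].
Qed.

(** For t >= s1 the initial flux is damped by exp(-nu lam^2 s1), so [ksum] at time [s1] bounds it
    for any continuous initial function, at a constant that blows up as [s1] tends to 0. *)
Lemma flux_tail j al Hc s1 : 0 < s1 -> INR j / 2 + 5 / 16 < al -> 0 <= Hc -> l2mod al Hc ->
  exists C, 0 <= C /\ forall n m t, (1 <= n)%nat -> s1 <= t <= T ->
   sm (fun i => Rabs (lam (n + i) ^ j * fl (n + i) t)) m <= C * Rpower (INR n) (- (1 / 8)).
Proof.
  intros Hs1 Hal HHc Hm. assert (c1 := cphi). assert (c2 := cw).
  destruct (flux_core j al Hc Hal HHc Hm) as [C0 [HC0 K0]].
  destruct (ksum L nu HL Hnu j) as [C1 [HC1 K1]]. destruct (ksum L nu HL Hnu (j + 1)) as [C2 [HC2 K2]].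
  assert (P1 := lam1_pos L HL). assert (Hnu' : 0 < nu') by (assert (0 <= rho / lam 1 ^ 2) by pos; lra).
  set (D1 := C1 * Rpower s1 (- (INR j / 2 + 5 / 16)) * sqrt (RInt (fun x => phi 0 x ^ 2) 0 L)).
  set (D2 := C2 * Rpower s1 (- (INR (j + 1) / 2 + 5 / 16)) * sqrt (RInt (fun x => w 0 x ^ 2) 0 L)).
  exists (C0 + (D1 + nu' * D2)). assert (0 <= D1) by (unfold D1; pos). assert (0 <= D2) by (unfold D2; pos).
  split; [pos |]. intros n m t Hn Ht.
  assert (k0 := K0 n m t Hn ltac:(lra)).
  assert (k1 := K1 (negb b) (phi 0) n m s1 ltac:(ctn) Hn Hs1).
  assert (k2 := K2 b (w 0) n m s1 ltac:(ctn) Hn Hs1).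
  apply Rle_trans with (sm (fun i => Rabs (lam (n + i) ^ j * (fl (n + i) t - exp (- mu (n + i) * t) * fl (n + i) 0))
     + (Rabs (lam (n + i) ^ j * exp (- (nu * lam (n + i) ^ 2) * s1) * cf (negb b) (phi 0) (n + i))
     + nu' * Rabs (lam (n + i) ^ (j + 1) * exp (- (nu * lam (n + i) ^ 2) * s1) * cf b (w 0) (n + i)))) m).
  - apply sm_le. intros i _. set (k := (n + i)%nat). assert (Hk : (1 <= k)%nat) by (unfold k; lia).
    assert (lk := lam_pos L HL k Hk).
    replace (lam k ^ j * fl k t) with (lam k ^ j * (fl k t - exp (- mu k * t) * fl k 0) + lam k ^ j * exp (- mu k * t) * fl k 0) by ring.
    eapply Rle_trans; [apply Rabs_triang |]. apply Rplus_le_compat_l.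
    assert (e1 : exp (- mu k * t) <= exp (- (nu * lam k ^ 2) * s1)).
    { apply exp_le_mono. assert (z := Rmult_le_pos rho t Hrho ltac:(lra)).
      assert (0 <= nu * lam k ^ 2 * (t - s1)) by (apply Rmult_le_pos; [pos | lra]). lra. }
    assert (e0 := exp_pos (- mu k * t)).
    rewrite !Rabs_mult, (Rabs_right (exp (- mu k * t))), (Rabs_right (exp (- (nu * lam k ^ 2) * s1))) by (left; apply exp_pos).
    rewrite !(Rabs_right (lam k ^ _)) by (apply Rle_ge; pos).
    assert (f1 : Rabs (fl k 0) <= Rabs (cf (negb b) (phi 0) k) + nu' * lam k * Rabs (cf b (w 0) k)).
    { unfold fl. eapply Rle_trans; [apply Rabs_triang |]. rewrite Rabs_Ropp, Rabs_mult. apply Rplus_le_compat_l.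
      apply Rmult_le_compat_r; [pos |]. assert (0 <= rho / lam k) by pos.
      rewrite Rabs_right by (apply Rle_ge; pos).
      assert (ml := mu_le k Hk). apply Rmult_le_reg_r with (lam k); auto.
      replace ((nu * lam k + rho / lam k) * lam k) with (mu k) by (field; lra). lra. }
    apply Rle_trans with (lam k ^ j * exp (- (nu * lam k ^ 2) * s1) * (Rabs (cf (negb b) (phi 0) k) + nu' * lam k * Rabs (cf b (w 0) k))).
    + apply Rmult_le_compat; try pos. apply Rmult_le_compat_l; [pos | auto].
    + right. rewrite pow_add. ring.
  - rewrite !sm_plus, sm_scal.
    replace ((C0 + (D1 + nu' * D2)) * Rpower (INR n) (- (1 / 8))) with (C0 * Rpower (INR n) (- (1 / 8))
      + (D1 * Rpower (INR n) (- (1 / 8)) + nu' * (D2 * Rpower (INR n) (- (1 / 8))))) by ring.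
    apply Rplus_le_compat; [auto |]. apply Rplus_le_compat.
    + eapply Rle_trans; [apply k1 |]. unfold D1. right; ring.
    + apply Rmult_le_compat_l; [lra |]. eapply Rle_trans; [apply k2 |]. unfold D2. right; ring.
Qed.

Definition tails (f : nat -> R -> R) : Prop := forall ep, 0 < ep -> exists N, forall n, (N <= n)%nat ->
  forall t, 0 <= t <= T -> forall m, sm (fun i => Rabs (f (n + i)%nat t)) m <= ep.
Lemma tails_pow (f : nat -> R -> R) C : 0 <= C ->
  (forall n m t, (1 <= n)%nat -> 0 <= t <= T -> sm (fun i => Rabs (f (n + i)%nat t)) m <= C * Rpower (INR n) (- (1 / 8))) -> tails f.
Proof.
  intros HC K ep Hep. destruct (tail_lim8 (ep / (C + 1))) as [N [HN B]]; [pos |].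
  exists N. intros n Hn t Ht m. eapply Rle_trans; [apply K; auto; lia |].
  assert (q := B n Hn). assert (p := Rpower_pos (- (1 / 8)) (INR n)).
  apply Rle_trans with ((C + 1) * (ep / (C + 1))); [apply Rmult_le_compat; lra |]. right. field. lra.
Qed.

(** Coefficients of the spatial flux, phi - nu w_x for sines and phi + nu w_x for cosines. Unlike
    [fl] it omits the zero-order part rho/lam_k w_k, which is summable anyway. *)
Definition fl2 (k : nat) (t : R) : R := cf (negb b) (phi t) k - nu * lam k * cf b (w t) k.
Lemma fl2_cont k : cont1 (fl2 k).
Proof.
  assert (c1 := phik_cont L (negb b) phi k cphi). assert (c2 := phik_cont L b w k cw). unfold fl2. ctn.
Qed.
Lemma fl2_tails : tails fl -> tails fl2.
Proof.
  intros Tf ep Hep. destruct H as [_ [_ [_ Tw]]]. assert (P1 := lam1_pos L HL).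
  assert (q0 : 0 <= rho / lam 1) by pos.
  destruct (Tf (ep / 2)) as [N1 H1]; [lra |]. destruct (Tw (ep / 2 / (rho / lam 1 + 1))) as [N2 H2]; [pos |].
  exists (S (N1 + N2)). intros n Hn t Ht m.
  assert (h1 := H1 n ltac:(lia) t Ht m). assert (h2 := H2 n ltac:(lia) t Ht m).
  apply Rle_trans with (sm (fun i => Rabs (fl (n + i) t) + rho / lam 1 * Rabs (cf b (w t) (n + i))) m).
  - apply sm_le. intros i _. set (k := (n + i)%nat). assert (Hk : (1 <= k)%nat) by (unfold k; lia).
    assert (lk := lam_pos L HL k Hk).
    replace (fl2 k t) with (fl k t + rho / lam k * cf b (w t) k) by (unfold fl, fl2; ring).
    eapply Rle_trans; [apply Rabs_triang |]. apply Rplus_le_compat_l. rewrite Rabs_mult.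
    apply Rmult_le_compat_r; [pos |]. rewrite Rabs_right by (apply Rle_ge; pos).
    apply Rmult_le_compat_l; auto. apply Rinv_le_contravar; auto.
    rewrite (lam_S L HL k). assert (1 <= INR k) by (apply (le_INR 1); auto). nra.
  - rewrite sm_plus, sm_scal.
    assert (h3 : rho / lam 1 * sm (fun k => Rabs (cf b (w t) (n + k))) m <= (rho / lam 1 + 1) * (ep / 2 / (rho / lam 1 + 1))).
    { apply Rmult_le_compat; auto; [apply sm_ge0; intros; pos | lra]. }
    replace ((rho / lam 1 + 1) * (ep / 2 / (rho / lam 1 + 1))) with (ep / 2) in h3 by (field; lra). lra.
Qed.
Lemma tails_fun b' (f : nat -> R -> R) : (forall k, cont1 (f k)) -> (b' = true -> forall t, f O t = 0) -> tails f ->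
  exists F, cont2 F /\ (forall t k, 0 <= t <= T -> cf b' (F t) k = f k t) /\ (b' = true -> forall t, F t 0 = 0 /\ F t L = 0).
Proof.
  intros cf' f0 Tf.
  set (A := fun t k => f k (clamp T t)).
  assert (Ct := fun t => clamp_in T t ltac:(lra)). assert (cc := cont1_clamp T).
  assert (Sm : forall t, summ (A t)).
  { intros t e He. destruct (Tf e He) as [N HN]. exists N. intros n Hn m. apply HN; auto. }
  exists (fun t x => srL L b' (A t) x). split; [| split].
  - apply sr_cont2; auto.
    + intros k. unfold A. assert (c := cf' k). ctn.
    + intros e He. destruct (Tf e He) as [N HN]. exists N. intros n Hn t m. apply HN; auto.
  - intros t k Ht. rewrite cf_sr; auto.
    + unfold A. rewrite clamp_id; auto.
    + intros E. apply f0; auto.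
  - intros E t. subst b'.
    assert (Z : forall x, (forall k, ee L true k x = 0) -> srL L true (A t) x = 0).
    { intros x Hx. unfold srL. rewrite (Lim_seq_ext _ (fun _ => 0)); [rewrite Lim_seq_const; auto |].
      intros N. unfold tpL. rewrite (sm_ext _ (fun _ => 0)), sm_zero by (intros; rewrite Hx; ring). auto. }
    split; apply Z; intros k; [apply sin_0' | apply sin_L; auto].
Qed.

Lemma prim_coef b' g k : cont1 g -> (b' = true -> cf false g 0 = 0) ->
  cf (negb b') g k = sg b' * lam k * cf b' (fun x => RInt g 0 x) k.
Proof.
  intros c g0. apply (cf_ibp L HL b' (fun x => RInt g 0 x) g k); auto.
  - intros x. apply RI_derive; auto.
  - destruct b'; [right | left; auto]. split; [apply RI_point |].
    transitivity (cf false g 0); [| apply g0; auto].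
    unfold cfL. apply RInt_ext. intros; req. rewrite e_false0; auto. ring.
Qed.

(** The flux is defined by its series, and the primitive of phi - F is compared with +-nu w
    coefficient by coefficient. The integral identity obtained yields the space derivative up to the
    boundary; for cosines [F] is a sine series, which is the zero-flux condition. *)
Lemma flux_space : tails fl -> exists F, cont2 F /\
  (forall t k, 0 <= t <= T -> cf (negb b) (F t) k = fl2 k t) /\
  (b = false -> forall t, F t 0 = 0 /\ F t L = 0) /\
  forall t x, 0 <= t <= T -> 0 <= x <= L ->
    sg b * nu * (w t x - w t 0) = RInt (fun y => phi t y - F t y) 0 x.
Proof.
  intros Tf. assert (c1 := cphi). assert (c2 := cw).
  destruct (tails_fun (negb b) fl2 fl2_cont) as [F [cF [EF BF]]].
  { intros E t. unfold fl2. rewrite E, cf_true0, lam0 by auto. ring. }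
  { apply fl2_tails; auto. }
  exists F. split; [auto | split; [auto | split]].
  { intros E. apply BF. rewrite E. auto. }
  intros t x Ht Hx. set (g := fun y => phi t y - F t y). assert (cg : cont1 g) by (unfold g; ctn).
  assert (Eg : forall k, cf (negb b) g k = nu * lam k * cf b (w t) k).
  { intros k. unfold g. rewrite cf_minus by ctn. rewrite EF by auto. unfold fl2. ring. }
  assert (cQ : cont1 (fun x => RInt g 0 x)) by (apply RI_cont; auto).
  assert (g0 : b = true -> cf false g 0 = 0).
  { intros E. assert (z := Eg O). rewrite E in z. simpl negb in z. rewrite z, lam0 by auto. ring. }
  assert (EQ : forall k, (1 <= k)%nat -> cf b (fun x => RInt g 0 x) k = sg b * nu * cf b (w t) k).
  { intros k Hk. assert (z := prim_coef b g k cg g0). rewrite Eg in z. assert (lk := lam_pos L HL k Hk).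
    assert (s2 : sg b * sg b = 1) by (destruct b; simpl; ring).
    apply Rmult_eq_reg_l with (sg b * lam k); [| destruct b; simpl; lra]. rewrite <- z.
    replace (sg b * lam k * (sg b * nu * cf b (w t) k)) with ((sg b * sg b) * (nu * lam k * cf b (w t) k)) by ring. rewrite s2. ring. }
  set (d := fun x => sg b * nu * w t x - RInt g 0 x). assert (cd : cont1 d) by (unfold d; ctn).
  set (d0 := / L * cf false d 0).
  assert (Ed : forall k, (1 <= k)%nat -> cf b d k = 0).
  { intros k Hk. unfold d. rewrite cf_minus by ctn. rewrite (cf_scal L b (sg b * nu)) by ctn. rewrite EQ by auto. ring. }
  (* All coefficients of [d] of index k >= 1 vanish. There is no sine mode 0, so [d] is zero in that
     parity; in the cosine parity it equals its mean [d0]. *)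
  assert (Dc : exists q, forall x, 0 <= x <= L -> d x = q).
  { destruct (Bool.bool_dec b true) as [Eb | Eb].
    - exists 0. apply (complete L HL b d cd). intros [| k]; [rewrite Eb; apply cf_true0; auto | apply Ed; lia].
    - assert (Eb' : b = false) by (destruct b; congruence). exists d0. intros y Hy. apply Rminus_diag_uniq.
      apply (complete L HL false (fun x => d x - d0)); [ctn | | auto]. intros k. rewrite cf_minus by ctn.
      assert (K1 : cf false (fun _ => d0) k = d0 * cf false (fun x => ee L false 0 x) k).
      { rewrite <- cf_scal by (apply e_cont). apply cf_ext; auto. intros; rewrite e_false0; auto. ring. }
      rewrite K1. unfold cfL at 2. destruct k as [| k].
      + rewrite (RInt_ext _ (fun _ => 1)) by (intros; req; rewrite e_false0; auto; ring).
        rewrite RI_const. unfold d0. req. field. lra.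
      + rewrite orth by (auto; lia). rewrite <- Eb', Ed by lia. ring. }
  destruct Dc as [q Hq]. assert (q1 := Hq x Hx). assert (q2 := Hq 0 ltac:(lra)). unfold d in q1, q2.
  rewrite RI_point in q2. fold g. lra.
Qed.

Lemma coef_derive k t : 0 <= t <= T -> is_derive (wkL L b nu rho a phi k) t (lam k * cf (negb b) (phi t) k - mu k * cf b (w t) k).
Proof.
  intros Ht. destruct H as [c1 [c2 [E _]]]. evar_last; [apply wk_derive; auto |]. rewrite E by auto. req. ring.
Qed.
Lemma coef_diff k s t : 0 <= s -> s <= t -> t <= T ->
  cf b (w t) k - cf b (w s) k = RInt (fun q => lam k * cf (negb b) (phi q) k - mu k * cf b (w q) k) s t.
Proof.
  intros. assert (c1 := phik_cont L (negb b) phi k cphi). assert (c2 := phik_cont L b w k cw).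
  rewrite (RI_ftc_seg (wkL L b nu rho a phi k)); auto.
  - destruct H as [_ [_ [E _]]]. rewrite !E by lra. auto.
  - intros; apply coef_derive; lra.
  - intros x _. ctn.
Qed.
(** [Z] has the time derivatives of the coefficients as coefficients. The increment identity holds
    in every mode, with the time integral exchanged by Fubini, and completeness makes it
    pointwise. *)
Lemma flux_time : tails (fun k t => lam k * fl k t) -> exists Z, cont2 Z /\
  (forall t k, 0 <= t <= T -> cf b (Z t) k = lam k * cf (negb b) (phi t) k - mu k * cf b (w t) k) /\
  forall s t x, 0 <= s -> s <= t -> t <= T -> 0 <= x <= L -> w t x - w s x = RInt (fun q => Z q x) s t.
Proof.
  intros Tz. assert (c1 := cphi). assert (c2 := cw).
  destruct (tails_fun b (fun k t => lam k * cf (negb b) (phi t) k - mu k * cf b (w t) k)) as [Z [cZ [EZ _]]].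
  { intros k. assert (q1 := phik_cont L (negb b) phi k c1). assert (q2 := phik_cont L b w k c2). ctn. }
  { intros E t. rewrite E, cf_true0, lam0 by auto. ring. }
  { intros ep Hep. destruct (Tz ep Hep) as [N HN]. exists (S N). intros n Hn t Ht m.
    rewrite (sm_ext _ (fun i => Rabs (lam (n + i) * fl (n + i) t))); [apply HN; auto; lia |].
    intros i _. f_equal. unfold fl. assert (lk := lam_pos L HL (n + i) ltac:(lia)). field. lra. }
  exists Z. split; [auto | split; [auto |]]. intros s t x Hs Hst Ht Hx. apply Rminus_diag_uniq.
  assert (cI : cont1 (fun x => RInt (fun q => Z q x) s t)) by (apply (RI_param_cont (fun x q => Z q x)); ctn).
  apply (complete L HL b (fun x => w t x - w s x - RInt (fun q => Z q x) s t)); [ctn | | auto].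
  intros k. rewrite (cf_minus L b (fun x => w t x - w s x)) by ctn. rewrite cf_minus by ctn.
  rewrite coef_diff by auto. apply Rminus_diag_eq.
  assert (ce := e_cont L b k).
  assert (EI : cf b (fun x => RInt (fun q => Z q x) s t) k = RInt (fun q => cf b (Z q) k) s t).
  { unfold cfL. transitivity (RInt (fun x => RInt (fun q => Z q x * ee L b k x) s t) 0 L).
    - apply RInt_ext. intros y _. req. rewrite (RInt_ext (fun q => Z q y * ee L b k y) (fun q => ee L b k y * Z q y)) by (intros; req; ring).
      rewrite RI_scal by ctn. apply Rmult_comm.
    - symmetry. apply (RI_fubini (fun q x => Z q x * ee L b k x)). ctn. }
  rewrite EI. apply RI_ext; auto. intros q Hq. rewrite EZ by lra. auto.
Qed.

Hypothesis zero_mode : b = true \/ rho = 0.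
Lemma zero_coef s t : 0 <= s -> s <= t -> t <= T -> cf b (w t) 0 = cf b (w s) 0.
Proof.
  intros. apply Rminus_diag_uniq. rewrite coef_diff by auto.
  rewrite (RInt_ext _ (fun _ => 0)); [rewrite RI_const; req; ring |]. intros q _. req. rewrite lam0 by auto.
  destruct zero_mode as [-> | ->]; [rewrite cf_true0 by auto; ring | ring].
Qed.
Lemma fl_diff S s t m : (forall t n, 0 <= t <= T -> sm (fun i => Rabs (fl (1 + i) t)) n <= S) ->
  0 <= s -> s <= t -> t <= T ->
  sm (fun i => Rabs ((cf b (w t) (1 + i) - cf b (w s) (1 + i)) / lam (1 + i))) m <= S * (t - s).
Proof.
  intros HS Hs Hst Ht.
  assert (cfl : forall i, cont1 (fun q => Rabs (fl (1 + i) q))) by (intros i; assert (c := fl_cont (1 + i)); ctn).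
  apply Rle_trans with (RInt (fun q => sm (fun i => Rabs (fl (1 + i) q)) m) s t).
  - rewrite (RI_sm (fun i q => Rabs (fl (1 + i) q))) by auto. apply sm_le. intros i _. assert (c := fl_cont (1 + i)).
    assert (lk := lam_pos L HL (1 + i) ltac:(lia)).
    rewrite coef_diff by auto.
    rewrite (RInt_ext _ (fun q => lam (1 + i) * fl (1 + i) q)) by (intros; req; unfold fl; field; lra).
    rewrite RI_scal by ctn. unfold Rdiv. rewrite (Rmult_comm (lam (1 + i))), Rmult_assoc, Rinv_r, Rmult_1_r by lra.
    apply RI_abs; auto.
  - apply RI_ub; auto; [| intros; apply HS; lra]. intros q. apply (c_sm (fun i q => Rabs (fl (1 + i) q))). intros i _. apply cfl.
Qed.
(** The space primitive has the coefficients w_k/lam_k up to sign, whose time derivatives are the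
    summable [fl]. One antiderivative thus gains Lipschitz continuity in time before [w] itself is
    known to have it. Comparing the points [x] and 0 doubles 2/L. *)
Lemma prim_lip S s t x : (forall t n, 0 <= t <= T -> sm (fun i => Rabs (fl (1 + i) t)) n <= S) ->
  0 <= s -> s <= t -> t <= T -> 0 <= x <= L ->
  Rabs (RInt (fun y => w t y - w s y) 0 x) <= 4 / L * (S * (t - s)).
Proof.
  intros HS Hs Hst Ht Hx. assert (c2 := cw).
  set (g := fun y => w t y - w s y). assert (cg : cont1 g) by (unfold g; ctn).
  set (Q := (fun x => RInt g 0 x) : R -> R). assert (cQ : cont1 Q) by (apply RI_cont; auto).
  assert (Eg : forall k, cf b g k = cf b (w t) k - cf b (w s) k) by (intros; unfold g; rewrite cf_minus by ctn; auto).
  assert (PQ : forall k, cf b g k = sg (negb b) * lam k * cf (negb b) Q k).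
  { intros k. assert (z := prim_coef (negb b) g k cg). rewrite Bool.negb_involutive in z. apply z.
    intros E. assert (Eb : b = false) by (destruct b; auto; discriminate). rewrite <- Eb, Eg, (zero_coef s t) by auto. ring. }
  assert (B : forall m, sm (fun i => Rabs (cf (negb b) Q (1 + i))) m <= S * (t - s)).
  { intros m. eapply Rle_trans; [| apply (fl_diff S s t m HS Hs Hst Ht)]. right. apply sm_ext. intros i _.
    assert (lk := lam_pos L HL (1 + i) ltac:(lia)). rewrite <- Eg, PQ.
    replace (sg (negb b) * lam (1 + i) * cf (negb b) Q (1 + i) / lam (1 + i)) with (sg (negb b) * cf (negb b) Q (1 + i)) by (field; lra).
    rewrite Rabs_mult. replace (Rabs (sg (negb b))) with 1; [ring |]. destruct b; simpl; rewrite ?Rabs_Ropp, ?Rabs_R1; auto.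
    unfold Rabs; destruct Rcase_abs; lra. }
  assert (Sm : summ (cf (negb b) Q)).
  { apply (summ_of_bound _ (Rabs (cf (negb b) Q 0) + S * (t - s))). intros n.
    assert (0 <= S * (t - s)) by (apply (B O)).
    destruct n as [| n]; [cbn [sm]; assert (z := Rabs_pos (cf (negb b) Q 0)); lra |]. rewrite sm_head.
    apply Rplus_le_compat_l. apply (B n). }
  assert (R1 := rep_tail L HL (negb b) Q 1 (S * (t - s)) x cQ Sm B Hx).
  assert (R0 := rep_tail L HL (negb b) Q 1 (S * (t - s)) 0 cQ Sm B ltac:(lra)).
  (* The term of index 0 is constant in [x], so this uncontrolled mode cancels against the value at
     0. *)
  assert (Et : tpL L (negb b) (cf (negb b) Q) 1 x = tpL L (negb b) (cf (negb b) Q) 1 0).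
  { unfold tpL. cbn [sm]. f_equal. f_equal. destruct b; simpl negb; [rewrite !e_false0 | rewrite !e_true0]; auto. }
  rewrite Et in R1. assert (Q0 : Q 0 = 0) by apply RI_point. rewrite Q0 in R0. fold (Q x).
  set (z := tpL L (negb b) (cf (negb b) Q) 1 0) in *.
  assert (z3 := Rabs_triang (Q x - z) (- (0 - z))). rewrite Rabs_Ropp in z3.
  replace (Q x - z + - (0 - z)) with (Q x) in z3 by ring. lra.
Qed.

(* Energy estimate for [t (w (t + h) - w t)]: the weight [t] removes the need for a smooth initial datum. *)
Lemma l2lip K S : 0 <= K -> (forall t n, 0 <= t <= T -> sm (fun i => Rabs (fl (1 + i) t)) n <= S) ->
  (forall s t, 0 <= s -> s < t -> t <= T ->
    RInt (fun x => (phi t x - phi s x) ^ 2) 0 L <= K * (RInt (fun x => (w t x - w s x) ^ 2) 0 L + (t - s) ^ 2)) ->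
  exists C, 0 <= C /\ forall s t, 0 <= s -> s < t -> t <= T ->
    s ^ 2 * RInt (fun x => (w t x - w s x) ^ 2) 0 L <= C * (t - s) ^ 2.
Proof.
  intros HK HS HKw. assert (c1 := cphi). assert (c2 := cw).
  assert (S0 : 0 <= S) by (apply (HS 0 O); lra).
  set (C1 := / nu * (2 * K)). assert (HC1 : 0 <= C1) by (unfold C1; pos).
  set (C0 := / nu * (2 * K + 1)). assert (HC0 : 0 < C0) by (unfold C0; pos).
  set (D := T ^ 2 + 4 / L * S ^ 2). assert (HD : 0 <= D) by (unfold D; pos).
  exists (C0 * exp (C0 * T) * (D * T)). split; [pos |].
  intros s t Hs Hst Ht. set (h := t - s). assert (Hh : 0 < h) by (unfold h; lra).
  set (T1 := T - h). assert (HT1 : 0 <= s <= T1) by (unfold T1, h; lra).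
  set (y := fun q => q ^ 2 * RInt (fun x => (w (q + h) x - w q x) ^ 2) 0 L).
  assert (cy : cont1 y).
  { assert (z := RI_param_cont (fun q x => (w (q + h) x - w q x) ^ 2) 0 L ltac:(ctn)). unfold y. ctn. }
  replace t with (s + h) by (unfold h; ring). replace (s + h - s) with h by ring. fold (y s).
  assert (cdp : cont1 (fun q => RInt (fun x => (phi (q + h) x - phi q x) ^ 2) 0 L))
    by (apply (RI_param_cont (fun q x => (phi (q + h) x - phi q x) ^ 2)); ctn).
  assert (E1 : forall q, 0 <= q <= T1 -> y q <= / nu * RInt (fun r => 2 * r ^ 2 * RInt (fun x => (phi (r + h) x - phi r x) ^ 2) 0 L + 4 / L * (S * h) ^ 2) 0 q).
  { intros q Hq.
    set (df := fun r k => cf (negb b) (phi (r + h)) k - cf (negb b) (phi r) k).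
    set (dw := fun r k => cf b (w (r + h)) k - cf b (w r) k).
    assert (cdf : forall k, cont1 (fun r => df r k)).
    { intros k. assert (z := phik_cont L (negb b) phi k c1). assert (z2 := phik_cont L (negb b) (fun r => phi (r + h)) k ltac:(ctn)).
      cbv beta in z2. unfold df. ctn. }
    assert (cdw : forall k, cont1 (fun r => dw r k)).
    { intros k. assert (z := phik_cont L b w k c2). assert (z2 := phik_cont L b (fun r => w (r + h)) k ltac:(ctn)).
      cbv beta in z2. unfold dw. ctn. }
    unfold y.
    assert (PV : RInt (fun x => (q * (w (q + h) x - w q x)) ^ 2) 0 L <=
       / nu * RInt (fun r => 2 * r ^ 2 * RInt (fun x => (phi (r + h) x - phi r x) ^ 2) 0 L + 4 / L * (S * h) ^ 2) 0 q).
    { apply (parseval_le L HL b (fun x => q * (w (q + h) x - w q x))); [ctn |]. intros N.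
      assert (Kk : forall k, ck k * cf b (fun x => q * (w (q + h) x - w q x)) k ^ 2
        <= / nu * RInt (fun r => 2 * r ^ 2 * (ck k * df r k ^ 2) + 2 * (ck k * (dw r k / lam k) ^ 2)) 0 q).
      { intros k. assert (z1 := cdf k). assert (z2 := cdw k). assert (C := ck_pos L HL k).
        rewrite cf_scal by ctn. rewrite cf_minus by ctn. fold (dw q k).
        destruct k as [| k].
        { unfold dw at 1. rewrite (zero_coef q (q + h)) by (unfold T1 in Hq; lra).
          rewrite Rminus_diag_eq, Rmult_0_r, pow_i, Rmult_0_r by (auto; lia).
          apply Rmult_le_pos; [pos |]. apply RI_ge0; [ctn | lra |]. intros. pos. }
        set (k' := Datatypes.S k) in *. assert (lk := lam_pos L HL k' ltac:(unfold k'; lia)).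
        set (wk := wkL L b nu rho a phi k').
        destruct H as [_ [_ [E _]]].
        (* Differentiating the weight produces the extra source [dw], rewritten as lam times dw/lam;
           this quotient is of size S h by [fl_diff]. *)
        assert (V : q * dw q k' = lam k' * RInt (fun r => exp (- mu k' * (q - r)) * (r * df r k' + dw r k' / lam k')) 0 q).
        { assert (V := variation_of_constants (fun r => r * (wk (r + h) - wk r)) (fun r => lam k' * (r * df r k' + dw r k' / lam k')) (mu k') 0 q (proj1 Hq) ltac:(ctn)).
          cbv beta in V. unfold dw at 1. rewrite !E by (unfold T1 in Hq; lra). fold wk. rewrite V.
          - rewrite Rmult_0_l, Rmult_0_r, Rplus_0_l. rewrite <- RI_scal by ctn. apply RInt_ext. intros; req; ring.
          - intros r Hr. evar_last.
            + apply (is_derive_mult (fun r => r) (fun r => wk (r + h) - wk r)); [apply is_derive_id | | intros; apply Rmult_comm].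
              apply (is_derive_minus (fun r => wk (r + h)) wk).
              * apply (is_derive_comp wk (fun r => r + h)); [apply coef_derive; unfold T1 in Hq; lra | auto_derive; [trivial | reflexivity]].
              * apply coef_derive; unfold T1 in Hq; lra.
            + unfold minus, plus, opp, scal, mult, one; simpl; unfold mult; simpl. unfold df, dw, wk.
              rewrite <- !E by (unfold T1 in Hq; lra). req. field. lra. }
        rewrite V.
        assert (Q := duh_sq L nu rho HL Hnu Hrho k' (fun r => r * df r k' + dw r k' / lam k') 0 q ltac:(ctn) (proj1 Hq)). cbv beta in Q.
        apply Rle_trans with (ck k' * (/ nu * RInt (fun r => 2 * r ^ 2 * df r k' ^ 2 + 2 * (dw r k' / lam k') ^ 2) 0 q)).
        - apply Rmult_le_compat_l; [lra |]. eapply Rle_trans; [apply Q |]. apply Rmult_le_compat_l; [pos |].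
          apply RI_le; [ctn | ctn | lra |]. intros r Hr.
          assert (e1 := exp_mu_le1 L nu rho Hnu Hrho k' (q - r) ltac:(lra)).
          assert (q2 := pow2_ge_0 (r * df r k' + dw r k' / lam k')).
          apply Rle_trans with ((r * df r k' + dw r k' / lam k') ^ 2); [nra |].
          eapply Rle_trans; [apply sq_sum |]. right; ring.
        - right. rewrite <- Rmult_assoc, (Rmult_comm (ck k')), Rmult_assoc. f_equal. rewrite <- RI_scal by ctn.
          apply RInt_ext. intros; req; ring. }
      eapply Rle_trans; [apply sm_le; intros; apply Kk |]. rewrite sm_scal.
      apply Rmult_le_compat_l; [pos |].
      assert (ckk : forall k, cont1 (fun r => 2 * r ^ 2 * (ck k * df r k ^ 2) + 2 * (ck k * (dw r k / lam k) ^ 2)))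
        by (intros k; assert (z1 := cdf k); assert (z2 := cdw k); ctn).
      rewrite <- (RI_sm (fun k r => 2 * r ^ 2 * (ck k * df r k ^ 2) + 2 * (ck k * (dw r k / lam k) ^ 2))) by auto.
      apply RI_le; [| ctn | lra |].
      - intros r. apply (c_sm (fun k r => 2 * r ^ 2 * (ck k * df r k ^ 2) + 2 * (ck k * (dw r k / lam k) ^ 2))). intros k _. apply ckk.
      - intros r Hr. rewrite sm_plus, !sm_scal. apply Rplus_le_compat.
        + apply Rmult_le_compat_l; [pos |].
          eapply Rle_trans; [| apply (bessel L HL (negb b) (fun x => phi (r + h) x - phi r x) N); ctn].
          right. apply sm_ext. intros k _. unfold df. rewrite cf_minus by ctn. auto.
        + assert (FD : forall m, sm (fun i => Rabs (dw r (1 + i)%nat / lam (1 + i))) m <= S * h).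
          { intros m. eapply Rle_trans; [apply (fl_diff S r (r + h) m HS); unfold T1 in Hq; lra |]. right; ring. }
          (* Each term is bounded by the absolute sum, so the square sum is at most the square of
             that sum. *)
          assert (SQ : forall m, sm (fun i => (dw r (1 + i)%nat / lam (1 + i)) ^ 2) m <= (S * h) ^ 2).
          { intros m. apply Rle_trans with (sm (fun i => (S * h) * Rabs (dw r (1 + i)%nat / lam (1 + i))) m).
            - apply sm_le. intros i Hi. rewrite <- Rsqr_pow2, Rsqr_abs. unfold Rsqr. apply Rmult_le_compat_r; [pos |].
              eapply Rle_trans; [| apply (FD (Datatypes.S i))]. cbn [sm].
              assert (0 <= sm (fun i => Rabs (dw r (1 + i)%nat / lam (1 + i))) i) by (apply sm_ge0; intros; pos). lra.
            - rewrite sm_scal. assert (z := FD m). assert (0 <= S * h) by pos. nra. }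
          apply Rle_trans with (2 * (2 / L * (S * h) ^ 2)); [| right; field; lra].
          apply Rmult_le_compat_l; [lra |].
          destruct N as [| N]; [cbn [sm]; pos |]. rewrite sm_head.
          unfold dw at 1. rewrite (zero_coef r (r + h)) by (unfold T1 in Hq; lra).
          replace ((cf b (w r) 0 - cf b (w r) 0) / lam 0) with 0 by (unfold Rdiv; ring).
          rewrite pow_i, Rmult_0_r, Rplus_0_l by lia.
          apply Rle_trans with (2 / L * sm (fun i => (dw r (1 + i)%nat / lam (1 + i)) ^ 2) N).
          * rewrite <- sm_scal. apply sm_le. intros i _. apply Rmult_le_compat_r; [pos | apply ck_bounds; auto].
          * apply Rmult_le_compat_l; [pos | apply SQ]. }
    eapply Rle_trans; [| apply PV]. right. rewrite <- RI_scal by ctn. apply RInt_ext. intros; req; ring. }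
  assert (G := gronwall_src y (fun _ => D * h ^ 2) C0 T1 cy ltac:(ctn) ltac:(lra) ltac:(intros; cbv beta; pos)).
  eapply Rle_trans; [apply G; auto |].
  - intros q Hq. eapply Rle_trans; [apply E1; auto |]. unfold C0. rewrite Rmult_assoc. apply Rmult_le_compat_l; [pos |].
    rewrite <- RI_scal by ctn. apply RI_le; [ctn | ctn | lra |]. intros r Hr.
    assert (k1 := HKw r (r + h) ltac:(lra) ltac:(lra) ltac:(unfold T1 in Hq; lra)). replace (r + h - r) with h in k1 by ring.
    set (A := RInt (fun x => (phi (r + h) x - phi r x) ^ 2) 0 L) in *.
    assert (k2 : 2 * r ^ 2 * A <= 2 * K * (y r + T ^ 2 * h ^ 2)).
    { apply Rle_trans with (2 * r ^ 2 * (K * (RInt (fun x => (w (r + h) x - w r x) ^ 2) 0 L + h ^ 2))).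
      - apply Rmult_le_compat_l; [pos | auto].
      - replace (2 * r ^ 2 * (K * (RInt (fun x => (w (r + h) x - w r x) ^ 2) 0 L + h ^ 2))) with (2 * K * (y r + r ^ 2 * h ^ 2)) by (unfold y; req; ring).
        apply Rmult_le_compat_l; [pos |]. apply Rplus_le_compat_l. apply Rmult_le_compat_r; [pos |].
        apply pow_incr. unfold T1 in Hq; lra. }
    assert (y0 : 0 <= y r) by (unfold y; apply Rmult_le_pos; [pos | apply RI_ge0; [ctn | lra | intros; pos]]).
    assert (k3 : 0 <= (2 * K) * (4 / L * S ^ 2 * h ^ 2)) by pos.
    assert (k4 : 0 <= T ^ 2 * h ^ 2) by pos. unfold D.
    replace (4 / L * (S * h) ^ 2) with (4 / L * S ^ 2 * h ^ 2) by ring. lra.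
  - rewrite RI_const. replace (C0 * exp (C0 * T) * (D * T) * h ^ 2) with (C0 * exp (C0 * T) * (D * h ^ 2 * T)) by ring.
    apply Rmult_le_compat; [pos | apply Rmult_le_pos; [pos | lra] | |].
    + apply Rmult_le_compat_l; [lra |]. apply exp_le_mono. apply Rmult_le_compat_l; [lra |]. unfold T1; lra.
    + apply Rmult_le_compat_l; [pos |]. unfold T1 in HT1; lra.
Qed.
End Flux.

(** * Regularity of the fixed point *)

Lemma hs_window L b nu rho T a phi w s0 s1 : hs L b nu rho T a phi w -> 0 <= s0 -> s0 <= s1 -> s1 <= T ->
  hs L b nu rho (s1 - s0) (cfL L b (w s0)) (fun s => phi (s0 + s)) (fun s => w (s0 + s)).
Proof.
  intros H H0 H1 H2. destruct (hs_restart L b nu rho T a phi w s0 H ltac:(lra)) as [c1 [c2 [E Tl]]].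
  split; [auto | split; [auto | split]].
  - intros t k Ht. apply E. lra.
  - intros ep Hep. destruct (Tl ep Hep) as [N HN]. exists N. intros n Hn t Ht m. apply HN; auto; lra.
Qed.
(** Integration by parts moves the smallness to the primitive of [g]; this is how Lipschitz control
    of primitives in time is tested against functions with bounded slope. *)
Lemma weak_lip L g psi psi' psi0 Bq D : 0 < L -> cont1 g -> cont1 psi' ->
  (forall x, 0 <= x <= L -> Rabs (RInt g 0 x) <= Bq) -> (forall x, 0 <= x <= L -> Rabs (psi' x) <= D) ->
  (forall x, 0 <= x <= L -> psi x = psi0 + RInt psi' 0 x) ->
  Rabs (RInt (fun x => g x * psi x) 0 L) <= Bq * (Rabs (psi L) + D * L).
Proof.
  intros HL cg cp HB HD E.
  set (Q := (fun x => RInt g 0 x) : R -> R). assert (cQ : cont1 Q) by (apply RI_cont; auto).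
  set (F := (fun x => psi0 + RInt psi' 0 x) : R -> R).
  assert (dF : forall x, is_derive F x (psi' x)).
  { intros x. evar_last; [apply (is_derive_plus (fun _ => psi0) (fun x => RInt psi' 0 x)); [apply is_derive_const | apply RI_derive; auto] |].
    unfold plus, zero; simpl. ring. }
  assert (I := RI_ibp F psi' Q g 0 L dF cp (fun x => RI_derive g 0 x cg) cg).
  rewrite (RI_ext _ (fun x => F x * g x)); [| lra | intros x Hx; rewrite E by auto; unfold F; ring].
  rewrite I. assert (Q0 : Q 0 = 0) by apply RI_point. rewrite Q0, Rmult_0_r, Rminus_0_r.
  assert (b0 : 0 <= Bq) by (eapply Rle_trans; [apply Rabs_pos | apply (HB 0); lra]).
  assert (R1 : Rabs (RInt (fun x => psi' x * Q x) 0 L) <= D * Bq * (L - 0)).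
  { apply RI_abs_ub; [ctn | lra |]. intros x Hx. rewrite Rabs_mult. apply Rmult_le_compat; try apply Rabs_pos; auto. }
  assert (R2 : Rabs (F L * Q L) <= Rabs (psi L) * Bq).
  { rewrite (E L) by lra. fold (F L). rewrite Rabs_mult. apply Rmult_le_compat_l; [apply Rabs_pos | apply HB; lra]. }
  eapply Rle_trans; [apply Rabs_triang |]. rewrite Rabs_Ropp. lra.
Qed.

Section Windows.
Variables L nu rho T : R.
Variable b : bool.
Variable a : nat -> R.
Variables phi w : R -> R -> R.
Hypothesis HL : 0 < L.
Hypothesis Hnu : 0 < nu.
Hypothesis Hrho : 0 <= rho.
Hypothesis HT : 0 < T.
Hypothesis H : hs L b nu rho T a phi w.
Local Notation lam := (lamL L).
Local Notation cf := (cfL L).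
Local Notation flw := (fl L nu rho b phi w).

(** The layer from [s0] to [s1] is spent on damping the initial flux; a Lipschitz source has
    exponent 1 > 1/2 + 5/16, so one power of lam is summable on [s1,s2]. *)
Lemma time_window s0 s1 s2 K : 0 <= s0 -> s0 < s1 -> s1 < s2 -> s2 <= T -> 0 <= K ->
  (forall s t, s0 <= s -> s < t -> t <= s2 -> RInt (fun x => (phi t x - phi s x) ^ 2) 0 L <= K * (t - s) ^ 2) ->
  exists Z, cont2 Z /\
  (forall t k, s1 <= t <= s2 -> cf b (Z t) k = lam k * cf (negb b) (phi t) k - (nu * lam k ^ 2 + rho) * cf b (w t) k) /\
  forall s t x, s1 <= s -> s <= t -> t <= s2 -> 0 <= x <= L -> w t x - w s x = RInt (fun q => Z q x) s t.
Proof.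
  intros h0 h1 h2 h3 HK Lp.
  assert (H0 := hs_window L b nu rho T a phi w s0 s2 H h0 ltac:(lra) h3).
  assert (H1 := hs_window L b nu rho T a phi w s1 s2 H ltac:(lra) ltac:(lra) h3).
  destruct (flux_tail L nu rho (s2 - s0) b _ _ _ HL Hnu Hrho ltac:(lra) H0 1 1 K (s1 - s0)) as [C [HC TC]]; auto; try lra.
  { simpl. lra. }
  { intros s t k0 k1 k2. eapply Rle_trans; [apply (Lp (s0 + s) (s0 + t)); lra |].
    replace (2 * 1) with (INR 2) by (simpl; ring). rewrite Rpower_pow by lra. right. f_equal. f_equal. ring. }
  destruct (flux_time L nu rho (s2 - s1) b _ _ _ HL ltac:(lra) H1) as [Z [cZ [EZ DZ]]].
  { apply (tails_pow (s2 - s1) _ C HC). intros n m t Hn Ht. eapply Rle_trans; [| apply (TC n m (s1 - s0 + t) Hn); lra].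
    right. apply sm_ext. intros i _. rewrite pow_1. unfold fl. replace (s0 + (s1 - s0 + t)) with (s1 + t) by ring. auto. }
  exists (fun t => Z (t - s1)). split; [ctn | split].
  - intros t k Ht. rewrite EZ by lra. replace (s1 + (t - s1)) with t by ring. auto.
  - intros s t x k1 k2 k3 Hx. assert (D := DZ (s - s1) (t - s1) x ltac:(lra) ltac:(lra) ltac:(lra) Hx).
    replace (s1 + (t - s1)) with t in D by ring. replace (s1 + (s - s1)) with s in D by ring. rewrite D.
    assert (cz : cont1 (fun q => Z q x)) by ctn.
    rewrite <- (RI_chasles (fun q => Z q x) (s - s1) 0 (t - s1)) by auto.
    rewrite <- (RI_chasles (fun q => Z (q - s1) x) s s1 t) by ctn.
    assert (Sh : forall u, RInt (fun q => Z (q - s1) x) s1 u = RInt (fun q => Z q x) 0 (u - s1)).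
    { intros u. assert (z := RI_shift (fun q => Z (q - s1) x) s1 (u - s1) ltac:(ctn)). cbv beta in z.
      replace (s1 + (u - s1)) with u in z by ring. rewrite <- z. apply RInt_ext. intros; req.
      match goal with |- Z ?p x = Z ?q x => replace p with q by ring end. auto. }
    assert (Sw : forall f p q, cont1 f -> RInt f p q = - RInt f q p).
    { intros f p q c. assert (z := RI_chasles f p q p c). rewrite RI_point in z. lra. }
    rewrite Sh, (Sw (fun q => Z q x) (s - s1) 0), (Sw (fun q => Z (q - s1) x) s s1), Sh by ctn. auto.
Qed.

Lemma space_window Hc s1 : 0 < s1 -> s1 < T -> 0 <= Hc -> l2mod L T phi (3 / 8) Hc ->
  (exists S, forall t n, s1 <= t <= T -> sm (fun i => Rabs (flw (1 + i) t)) n <= S) /\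
  exists F, cont2 F /\ (b = false -> forall t, F t 0 = 0 /\ F t L = 0) /\
  (forall t x, s1 <= t <= T -> 0 <= x <= L ->
    sg b * nu * (w t x - w t 0) = RInt (fun y => phi t y - F t y) 0 x).
Proof.
  intros h0 h1 HHc Hm.
  destruct (flux_tail L nu rho T b a phi w HL Hnu Hrho HT H 0 (3 / 8) Hc s1) as [C [HC TC]]; auto; [simpl; lra |].
  split.
  - exists (C * Rpower (INR 1) (- (1 / 8))). intros t n Ht. eapply Rle_trans; [| apply (TC 1%nat n t); auto].
    right. apply sm_ext. intros i _. simpl pow. rewrite Rmult_1_l. auto.
  - assert (H1 := hs_window L b nu rho T a phi w s1 T H ltac:(lra) ltac:(lra) ltac:(lra)).
    destruct (flux_space L nu rho (T - s1) b _ _ _ HL Hrho ltac:(lra) H1) as [F [cF [EF [BF DF]]]].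
    { apply (tails_pow (T - s1) _ C HC). intros n m t Hn Ht. eapply Rle_trans; [| apply (TC n m (s1 + t) Hn); lra].
      right. apply sm_ext. intros i _. simpl pow. rewrite Rmult_1_l. auto. }
    exists (fun t => F (t - s1)). split; [ctn | split; [auto |]].
    intros t x Ht Hx. assert (D := DF (t - s1) x ltac:(lra) Hx). replace (s1 + (t - s1)) with t in D by ring. auto.
Qed.

(** The weight of [l2lip], counted from [s0], is at least (s1 - s0)^2 after [s1] and is divided
    out. *)
Lemma lip_window s0 s1 s2 K S : 0 <= s0 -> s0 < s1 -> s1 <= s2 -> s2 <= T -> 0 <= K -> b = true \/ rho = 0 ->
  (forall t n, s0 <= t <= s2 -> sm (fun i => Rabs (flw (1 + i) t)) n <= S) ->
  (forall s t, s0 <= s -> s < t -> t <= s2 ->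
    RInt (fun x => (phi t x - phi s x) ^ 2) 0 L <= K * (RInt (fun x => (w t x - w s x) ^ 2) 0 L + (t - s) ^ 2)) ->
  exists C, 0 <= C /\ forall s t, s1 <= s -> s < t -> t <= s2 -> RInt (fun x => (w t x - w s x) ^ 2) 0 L <= C * (t - s) ^ 2.
Proof.
  intros h0 h1 h2 h3 HK zm HS Lp.
  assert (H0 := hs_window L b nu rho T a phi w s0 s2 H h0 ltac:(lra) h3).
  destruct (l2lip L nu rho (s2 - s0) b _ _ _ HL Hnu Hrho ltac:(lra) H0 zm K S HK) as [C [HC D]].
  { intros t n Ht. apply (HS (s0 + t) n). lra. }
  { intros s t k0 k1 k2. assert (z := Lp (s0 + s) (s0 + t) ltac:(lra) ltac:(lra) ltac:(lra)).
    replace (s0 + t - (s0 + s)) with (t - s) in z by ring. auto. }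
  exists (C / (s1 - s0) ^ 2). assert (p0 : 0 < (s1 - s0) ^ 2) by (apply pow_lt; lra). split; [pos |].
  intros s t k1 k2 k3. assert (cw := cw L nu rho T b a phi w H).
  assert (z := D (s - s0) (t - s0) ltac:(lra) ltac:(lra) ltac:(lra)). cbv beta in z.
  replace (s0 + (t - s0)) with t in z by ring. replace (s0 + (s - s0)) with s in z by ring.
  replace (t - s0 - (s - s0)) with (t - s) in z by ring.
  assert (I0 : 0 <= RInt (fun x => (w t x - w s x) ^ 2) 0 L) by (apply RI_ge0; [ctn | lra | intros; pos]).
  set (I := RInt (fun x => (w t x - w s x) ^ 2) 0 L) in *.
  assert (q : (s1 - s0) ^ 2 <= (s - s0) ^ 2) by (apply pow_incr; lra).
  apply Rmult_le_reg_l with ((s1 - s0) ^ 2); auto.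
  apply Rle_trans with (C * (t - s) ^ 2); [| right; field; lra]. eapply Rle_trans; [| apply z]. apply Rmult_le_compat_r; auto.
Qed.
End Windows.

Lemma data_h1 L b h h' : 0 < L -> (forall x, is_derive h x (h' x)) -> cont1 h' -> b = false \/ h 0 = 0 /\ h L = 0 ->
  exists A, 0 <= A /\ forall N, sm (fun k => (1 + lamL L k ^ 2) * cfL L b h k ^ 2) N <= A.
Proof.
  intros HL D c bc. assert (ch : cont1 h) by (apply (cont1_derive _ h'); auto).
  exists (L * RInt (fun x => h x ^ 2) 0 L + L * RInt (fun x => h' x ^ 2) 0 L). split.
  { apply Rplus_le_le_0_compat; apply Rmult_le_pos; try lra; apply RI_ge0; try lra; try ctn; intros; pos. }
  intros N. assert (q1 := cf_sq_sum L HL b h 0 N ch). assert (q2 := cf_sq_sum L HL (negb b) h' 0 N c).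
  eapply Rle_trans; [| apply Rplus_le_compat; [apply q1 | apply q2]]. rewrite <- sm_plus. right. apply sm_ext. intros k _.
  change (0 + k)%nat with k. rewrite (cf_ibp L HL b h h' k D c bc).
  assert (s2 : sg b * sg b = 1) by (destruct b; simpl; ring).
  replace ((sg b * lamL L k * cfL L b h k) ^ 2) with ((sg b * sg b) * (lamL L k ^ 2 * cfL L b h k ^ 2)) by ring. rewrite s2. ring.
Qed.

Lemma cf_false0 L g : cfL L false g 0 = RInt g 0 L.
Proof. unfold cfL. apply RInt_ext. intros; req. unfold ee, lamL. simpl. replace (0 * PI / L * x) with 0 by (unfold Rdiv; ring). rewrite cos_0. ring. Qed.
Lemma cf_const L q k : 0 < L -> cfL L false (fun _ => q) (S k) = 0.
Proof.
  intros HL. assert (ce := e_cont L false 0).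
  transitivity (cfL L false (fun x => q * ee L false 0 x) (S k)); [apply cf_ext; auto; intros; rewrite e_false0; auto; ring |].
  rewrite cf_scal by ctn. unfold cfL. rewrite orth by (auto; lia). ring.
Qed.
Lemma derive_of_increment (f z : R -> R) a0 a1 t : a0 < t < a1 -> cont1 z ->
  (forall s t, a0 <= s -> s <= t -> t <= a1 -> f t - f s = RInt z s t) -> is_derive f t (z t).
Proof.
  intros Ht cz E. apply (derive_ext_in (fun y => f a0 + RInt z a0 y) f a0 a1); auto.
  - intros y Hy. rewrite <- (E a0 y) by lra. ring.
  - evar_last; [apply (is_derive_plus (fun _ => f a0) (fun y => RInt z a0 y)); [apply is_derive_const | apply RI_derive; auto] |].
    unfold plus, zero; simpl. ring.
Qed.

(** The antiderivative of [g] with zero mean on [0,L]; it inverts differentiation on all cosine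
    modes k >= 1. *)
Definition pm (L : R) (g : R -> R) (x : R) : R := RInt g 0 x - / L * RInt (fun y => RInt g 0 y) 0 L.
Lemma pm_cont2 L f : cont2 f -> cont2 (fun s x => pm L (f s) x).
Proof.
  intros c. unfold pm. assert (c1 := RI_param_cont2 f 0 c).
  assert (c2 := RI_param_cont (fun s x => RInt (fun y => f s y) 0 x) 0 L c1).
  change (cont2 (fun s x => RInt (fun y => f s y) 0 x - / L * RInt (fun y => RInt (fun z => f s z) 0 y) 0 L)).
  set (g := fun s x => RInt (fun y => f s y) 0 x) in *. set (h := fun s => RInt (fun x => g s x) 0 L) in *.
  change (cont2 (fun s x => g s x - / L * h s)). ctn.
Qed.
Lemma pm_derive L g x : cont1 g -> is_derive (pm L g) x (g x).
Proof.
  intros c. evar_last; [apply (is_derive_minus (fun x => RInt g 0 x) (fun _ => / L * RInt (fun y => RInt g 0 y) 0 L)); [apply RI_derive; auto | apply is_derive_const] |].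
  unfold minus, plus, opp, zero; simpl. ring.
Qed.
Lemma pm_cont L g : cont1 g -> cont1 (pm L g).
Proof. intros c. apply (cont1_derive _ g). intros; apply pm_derive; auto. Qed.
Lemma pm_mean L g : 0 < L -> cont1 g -> RInt (pm L g) 0 L = 0.
Proof.
  intros HL c. unfold pm. assert (cQ := RI_cont g 0 c). rewrite RI_minus by ctn. rewrite RI_const.
  pose (I := (RInt (fun y => RInt g 0 y) 0 L) : R). change (I - / L * I * (L - 0) = 0). clearbody I. field. lra.
Qed.
Lemma pm_coef L g k : 0 < L -> cont1 g -> cfL L true g (S k) = - lamL L (S k) * cfL L false (pm L g) (S k).
Proof.
  intros HL c. assert (cQ := RI_cont g 0 c).
  assert (E := prim_coef L HL false g (S k) c ltac:(discriminate)). simpl negb in E. simpl sg in E.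
  unfold pm. rewrite (cf_minus L false (fun x => RInt g 0 x)) by ctn. rewrite cf_const by auto. rewrite E. ring.
Qed.
Lemma pm_increment L f Z s t x : 0 < L -> cont2 f -> cont2 Z -> s <= t -> 0 <= x <= L ->
  (forall y, 0 <= y <= L -> f t y - f s y = RInt (fun q => Z q y) s t) ->
  pm L (f t) x - pm L (f s) x = RInt (fun q => pm L (Z q) x) s t.
Proof.
  intros HL cf cZ Hst Hx E.
  assert (A : forall y, 0 <= y <= L -> RInt (f t) 0 y - RInt (f s) 0 y = RInt (fun q => RInt (Z q) 0 y) s t).
  { intros y Hy. rewrite <- RI_minus by ctn. rewrite (RI_ext _ (fun z => RInt (fun q => Z q z) s t)) by (try lra; intros; apply E; lra).
    symmetry. apply (RI_fubini (fun q z => Z q z)). ctn. }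
  assert (cW := RI_param_cont2 Z 0 cZ). assert (c1 : cont1 (fun y => RInt (f t) 0 y)) by (apply RI_cont; ctn).
  assert (c2 : cont1 (fun y => RInt (f s) 0 y)) by (apply RI_cont; ctn).
  set (W := (fun q y => RInt (fun z => Z q z) 0 y) : R -> R -> R) in *.
  assert (B : RInt (fun y => RInt (f t) 0 y) 0 L - RInt (fun y => RInt (f s) 0 y) 0 L = RInt (fun q => RInt (W q) 0 L) s t).
  { rewrite <- RI_minus by ctn. rewrite (RI_ext _ (fun y => RInt (fun q => W q y) s t)); [| lra | intros y Hy; rewrite A by auto; auto].
    symmetry. apply (RI_fubini W). auto. }
  assert (cM : cont1 (fun q => RInt (W q) 0 L)) by (apply (RI_param_cont W); auto).
  unfold pm. change (fun q => RInt (Z q) 0 x - / L * RInt (fun y => RInt (Z q) 0 y) 0 L) with (fun q => W q x - / L * RInt (W q) 0 L).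
  rewrite RI_minus by ctn. rewrite RI_scal by ctn. rewrite <- B.
  assert (a := A x Hx). change (fun q => RInt (Z q) 0 x) with (fun q => W q x) in a. rewrite <- a. req. ring.
Qed.

Section Regular.
Variables L nu r T K0 : R.
Variables v0 m0 v0' m0' m0'' : R -> R.
Hypothesis HL : 0 < L.
Hypothesis Hnu : 0 < nu.
Hypothesis Hr : 0 <= r.
Hypothesis HT : 0 < T.
Hypothesis HK0 : 0 <= K0.
Hypothesis Dv0 : forall x, is_derive v0 x (v0' x).
Hypothesis cv0' : cont1 v0'.
Hypothesis v0_0 : v0 0 = 0.
Hypothesis v0_L : v0 L = 0.
Hypothesis v0_b : forall x, 0 <= x <= L -> Rabs (v0 x) <= K0.
Hypothesis Dm0 : forall x, is_derive m0 x (m0' x).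
Hypothesis Dm0' : forall x, is_derive m0' x (m0'' x).
Hypothesis cm0'' : cont1 m0''.
Hypothesis m0_0 : m0 0 = 0.
Hypothesis m0_L : m0 L = 0.
Hypothesis m0'_0 : m0' 0 = 0.
Hypothesis m0'_L : m0' L = 0.
Hypothesis m0_pos : forall x, 0 <= x <= L -> 0 <= m0 x.
Hypothesis m0_mass : RInt m0 0 L = 1.
Variables (b c P : R) (p : R -> R) (v m : R -> R -> R).
Hypothesis HP : 0 <= P.
Hypothesis cp : cont1 p.
Hypothesis Hp : forall t, Rabs (p t) <= P.
Hypothesis HC : coupled L nu r T K0 v0 m0 p v m.
Hypothesis Hfix : forall t, 0 <= t <= T -> p t = b + c * Vf L T v m t.
Local Notation lam := (lamL L).
Local Notation cf := (cfL L).
Local Notation vs := (vsrc T K0 p v).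
Local Notation ms := (msrc T K0 p v m).
Local Notation nsq f := (RInt (fun x => f x ^ 2) 0 L).

(** * Time increments of p and of the two sources *)

Lemma cm0'1 : cont1 m0'. Proof. apply (cont1_derive _ m0''); auto. Qed.
Lemma cv : cont2 v. Proof. apply HC. Qed.
Lemma cm : cont2 m. Proof. apply HC. Qed.
Lemma cvs : cont2 vs. Proof. apply HC. Qed.
Lemma cms : cont2 ms. Proof. apply HC. Qed.
Lemma vb s x : 0 <= s <= T -> 0 <= x <= L -> Rabs (v s x) <= K0.
Proof. intros. assert (c1 := cm0'1). eapply (v_bound L nu r T K0 v0 m0 v0' HL Hnu Hr HT HK0 Dv0 v0_b p P v m); eauto. Qed.
Lemma mb : exists M, 0 < M /\ forall t x, 0 <= t <= T -> 0 <= x <= L -> Rabs (m t x) <= M.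
Proof.
  destruct (cont2_bound m 0 T 0 L cm) as [M [HM B]]. exists M. split; auto.
Qed.

(** The fixed-point equation expresses [p] through int v m; each increment is paired with a bounded
    factor by Cauchy-Schwarz, so [p] inherits the time regularity of [v] and [m] in L2. *)
Lemma p_inc : exists C, 0 <= C /\ forall s t, 0 <= s <= T -> 0 <= t <= T ->
  (p t - p s) ^ 2 <= C * (nsq (fun x => v (T - t) x - v (T - s) x) + nsq (fun x => m t x - m s x)).
Proof.
  destruct mb as [M [HM bM]]. assert (c1 := cv). assert (c2 := cm).
  exists (2 * c ^ 2 * (M ^ 2 * L + K0 ^ 2 * L)). split; [pos |]. intros s t Hs Ht.
  rewrite !Hfix by auto.
  replace (b + c * Vf L T v m t - (b + c * Vf L T v m s)) with (c * (Vf L T v m t - Vf L T v m s)) by ring.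
  assert (E : Vf L T v m t - Vf L T v m s = RInt (fun x => (v (T - t) x - v (T - s) x) * m t x) 0 L + RInt (fun x => v (T - s) x * (m t x - m s x)) 0 L).
  { unfold Vf. rewrite <- RI_minus by ctn. rewrite <- RI_plus by ctn. apply RInt_ext. intros; req; ring. }
  rewrite E, Rpow_mult_distr.
  assert (Q1 := RI_cs (fun x => v (T - t) x - v (T - s) x) (m t) 0 L ltac:(ctn) ltac:(ctn) ltac:(lra)).
  assert (Q2 := RI_cs (v (T - s)) (fun x => m t x - m s x) 0 L ltac:(ctn) ltac:(ctn) ltac:(lra)). cbv beta in Q1, Q2.
  assert (R1 : RInt (fun x => m t x ^ 2) 0 L <= M ^ 2 * L) by (apply RInt_sq_le; auto; ctn).
  assert (R2 : RInt (fun x => v (T - s) x ^ 2) 0 L <= K0 ^ 2 * L) by (apply RInt_sq_le; auto; [ctn | intros; apply vb; auto; lra]).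
  set (A := nsq (fun x => v (T - t) x - v (T - s) x)) in *. set (B := nsq (fun x => m t x - m s x)) in *.
  assert (A0 : 0 <= A) by (apply RI_ge0; [ctn | lra | intros; pos]). assert (B0 : 0 <= B) by (apply RI_ge0; [ctn | lra | intros; pos]).
  assert (P1 : A * RInt (fun x => m t x ^ 2) 0 L <= A * (M ^ 2 * L)) by (apply Rmult_le_compat_l; auto).
  assert (P2 : RInt (fun x => v (T - s) x ^ 2) 0 L * B <= K0 ^ 2 * L * B) by (apply Rmult_le_compat_r; auto).
  assert (c20 := pow2_ge_0 c).
  replace (2 * c ^ 2 * (M ^ 2 * L + K0 ^ 2 * L) * (A + B)) with (c ^ 2 * (2 * (M ^ 2 * L + K0 ^ 2 * L) * (A + B))) by ring.
  apply Rmult_le_compat_l; auto. eapply Rle_trans; [apply sq_sum |].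
  eapply Rle_trans; [apply Rplus_le_compat; (apply Rmult_le_compat_l; [lra |]); [apply (Rle_trans _ _ _ Q1 P1) | apply (Rle_trans _ _ _ Q2 P2)] |].
  assert (0 <= K0 ^ 2 * L * A) by pos. assert (0 <= M ^ 2 * L * B) by pos. lra.
Qed.
Lemma vs_inc : exists C, 0 <= C /\ forall s t, 0 <= s <= T -> 0 <= t <= T ->
  nsq (fun x => vs t x - vs s x) <= C * (nsq (fun x => v t x - v s x) + (p (T - t) - p (T - s)) ^ 2).
Proof.
  assert (c1 := cv). assert (c2 := cvs).
  set (B := / 2 * (P + K0)). assert (HB : 0 <= B) by (unfold B; pos).
  exists (2 * B ^ 2 + / 2 * K0 ^ 2 * L). split; [pos |]. intros s t Hs Ht.
  apply Rle_trans with (RInt (fun x => 2 * B ^ 2 * (v t x - v s x) ^ 2 + / 2 * K0 ^ 2 * (p (T - t) - p (T - s)) ^ 2) 0 L).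
  - apply RI_le; [ctn | ctn | lra |]. intros x Hx.
    set (dl := p (T - t) - p (T - s)). set (y := v t x - v s x).
    assert (E : vs t x - vs s x = (Fq K0 (p (T - t)) (v t x) - Fq K0 (p (T - t)) (v s x)) + / 2 * dl * v s x) by (unfold vsrc, Fq, dl; ring).
    rewrite E. eapply Rle_trans; [apply sq_sum |].
    assert (a1 := Fq_lip K0 (p (T - t)) (v t x) (v s x) HK0). fold y in a1.
    assert (a2 : Rabs (Fq K0 (p (T - t)) (v t x) - Fq K0 (p (T - t)) (v s x)) <= B * Rabs y).
    { eapply Rle_trans; [apply a1 |]. apply Rmult_le_compat_r; [pos |]. unfold B. assert (h := Hp (T - t)). lra. }
    apply sq_le_of_abs in a2; [| pos].
    rewrite Rpow_mult_distr in a2. rewrite <- (Rsqr_pow2 (Rabs y)), <- Rsqr_abs, Rsqr_pow2 in a2.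
    assert (a3 : v s x ^ 2 <= K0 ^ 2) by (apply sq_le_of_abs; auto; apply vb; auto).
    assert (a4 := pow2_ge_0 dl).
    assert (a5 : (/ 2 * dl * v s x) ^ 2 <= / 4 * (dl ^ 2 * K0 ^ 2)).
    { replace ((/ 2 * dl * v s x) ^ 2) with (/ 4 * (dl ^ 2 * v s x ^ 2)) by field.
      apply Rmult_le_compat_l; [lra |]. apply Rmult_le_compat_l; auto. }
    lra.
  - rewrite RI_plus by ctn. rewrite RI_const. rewrite RI_scal by ctn.
    assert (I0 : 0 <= nsq (fun x => v t x - v s x)) by (apply RI_ge0; [ctn | lra | intros; pos]).
    set (I := nsq (fun x => v t x - v s x)) in *. set (d2 := (p (T - t) - p (T - s)) ^ 2). assert (0 <= d2) by (unfold d2; pos).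
    assert (0 <= / 2 * K0 ^ 2 * L * I) by pos. assert (0 <= 2 * B ^ 2 * d2) by pos. lra.
Qed.
Lemma ms_inc : exists C, 0 <= C /\ forall s t, 0 <= s <= T -> 0 <= t <= T ->
  nsq (fun x => ms t x - ms s x) <= C * (nsq (fun x => m t x - m s x) + (nsq (fun x => v (T - t) x - v (T - s) x) + (p t - p s) ^ 2)).
Proof.
  assert (c1 := cv). assert (c2 := cm). assert (c3 := cms). destruct mb as [M [HM bM]].
  set (B := / 2 * (P + K0)). assert (HB : 0 <= B) by (unfold B; pos).
  exists (2 * B ^ 2 + M ^ 2 + M ^ 2 * L). split; [pos |]. intros s t Hs Ht.
  apply Rle_trans with (RInt (fun x => 2 * B ^ 2 * (m t x - m s x) ^ 2 + (M ^ 2 * (p t - p s) ^ 2 + M ^ 2 * (v (T - t) x - v (T - s) x) ^ 2)) 0 L).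
  - apply RI_le; [ctn | ctn | lra |]. intros x Hx.
    set (dl := p t - p s). set (y := v (T - t) x - v (T - s) x). set (k := m t x - m s x).
    assert (E : ms t x - ms s x = (/ 2 * (p t - clip K0 (v (T - t) x))) * k
       + / 2 * (dl - (clip K0 (v (T - t) x) - clip K0 (v (T - s) x))) * m s x) by (unfold msrc, dl, k; ring).
    rewrite E. eapply Rle_trans; [apply sq_sum |].
    assert (a1 : Rabs (/ 2 * (p t - clip K0 (v (T - t) x))) <= B) by (eapply (gm_bound T K0); eauto).
    apply sq_le_of_abs in a1; auto. set (g := / 2 * (p t - clip K0 (v (T - t) x))) in *.
    assert (a2 := clip_lip K0 (v (T - t) x) (v (T - s) x) HK0). fold y in a2.
    apply sq_le_of_abs in a2; [| pos]. rewrite <- (Rsqr_pow2 (Rabs y)), <- Rsqr_abs, Rsqr_pow2 in a2.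
    set (cw := clip K0 (v (T - t) x) - clip K0 (v (T - s) x)) in *.
    assert (a3 : m s x ^ 2 <= M ^ 2) by (apply sq_le_of_abs; [lra | apply bM; auto]).
    assert (a4 := pow2_ge_0 k).
    assert (a5 : (g * k) ^ 2 <= B ^ 2 * k ^ 2) by (rewrite Rpow_mult_distr; apply Rmult_le_compat_r; auto).
    assert (a6 : (dl - cw) ^ 2 <= 2 * dl ^ 2 + 2 * y ^ 2).
    { assert (q1 := sq_sum dl (- cw)). replace ((- cw) ^ 2) with (cw ^ 2) in q1 by ring.
      replace (dl + - cw) with (dl - cw) in q1 by ring. lra. }
    assert (a7 : (/ 2 * (dl - cw) * m s x) ^ 2 <= / 4 * (2 * dl ^ 2 + 2 * y ^ 2) * M ^ 2).
    { replace ((/ 2 * (dl - cw) * m s x) ^ 2) with (/ 4 * (dl - cw) ^ 2 * m s x ^ 2) by field.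
      apply Rmult_le_compat; try pos. }
    lra.
  - rewrite RI_plus by ctn. rewrite RI_plus by ctn. rewrite RI_const. rewrite !RI_scal by ctn.
    assert (I0 : 0 <= nsq (fun x => m t x - m s x)) by (apply RI_ge0; [ctn | lra | intros; pos]).
    assert (J0 : 0 <= nsq (fun x => v (T - t) x - v (T - s) x)) by (apply RI_ge0; [ctn | lra | intros; pos]).
    set (I := nsq (fun x => m t x - m s x)) in *. set (J := nsq (fun x => v (T - t) x - v (T - s) x)) in *.
    set (d2 := (p t - p s) ^ 2). assert (0 <= d2) by (unfold d2; pos).
    assert (0 <= (M ^ 2 + M ^ 2 * L) * I) by pos. assert (0 <= (2 * B ^ 2 + M ^ 2) * d2) by pos.
    assert (0 <= (2 * B ^ 2 + M ^ 2 * L) * J) by pos. lra.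
Qed.
Lemma nsq_sym (f : R -> R -> R) s t : nsq (fun x => f t x - f s x) = nsq (fun x => f s x - f t x).
Proof. apply RInt_ext. intros; req; ring. Qed.

Lemma holder : exists H, 0 <= H /\ forall s t, 0 <= s -> s < t -> t <= T ->
  nsq (fun x => v t x - v s x) <= H * Rpower (t - s) (3 / 4) /\ nsq (fun x => m t x - m s x) <= H * Rpower (t - s) (3 / 4).
Proof.
  destruct (data_h1 L true v0 v0' HL Dv0 cv0' (or_intror (conj v0_0 v0_L))) as [A1 [HA1 S1]].
  destruct (data_h1 L false m0 m0' HL Dm0 cm0'1 (or_introl eq_refl)) as [A2 [HA2 S2]].
  destruct (cont2_bound vs 0 T 0 L cvs) as [D1 [HD1 B1]]. destruct (cont2_bound ms 0 T 0 L cms) as [D2 [HD2 B2]].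
  destruct (l2holder L nu r T HL Hnu Hr true A1 D1 HA1 ltac:(lra)) as [H1 [HH1 E1]].
  destruct (l2holder L nu 0 T HL Hnu (Rle_refl 0) false A2 D2 HA2 ltac:(lra)) as [H2 [HH2 E2]].
  exists (H1 + H2). split; [lra |]. intros s t h0 h1 h2.
  assert (q1 := E1 _ _ v (proj1 HC) S1 B1 s t h0 h1 h2). assert (q2 := E2 _ _ m (proj2 HC) S2 B2 s t h0 h1 h2).
  assert (z := Rpower_pos (3 / 4) (t - s)). cbv beta. split; nra.
Qed.
Lemma p_holder : exists H, 0 <= H /\ forall s t, 0 <= s -> s < t -> t <= T -> (p t - p s) ^ 2 <= H * Rpower (t - s) (3 / 4).
Proof.
  destruct holder as [H [HH E]]. destruct p_inc as [C [HC' I]]. exists (C * (H + H)). split; [pos |].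
  intros s t h0 h1 h2. eapply Rle_trans; [apply I; lra |]. rewrite Rmult_assoc. apply Rmult_le_compat_l; auto.
  destruct (E s t h0 h1 h2) as [_ e2]. destruct (E (T - t) (T - s) ltac:(lra) ltac:(lra) ltac:(lra)) as [e1 _].
  replace (T - s - (T - t)) with (t - s) in e1 by ring. rewrite (nsq_sym v). lra.
Qed.
(** The exponent 3/4 of the squared norms passes from [v] and [m] to [p], and from all three to the
    sources. *)
Lemma src_holder : exists H, 0 <= H /\ l2mod L T vs (3 / 8) H /\ l2mod L T ms (3 / 8) H.
Proof.
  destruct holder as [H [HH E]]. destruct p_holder as [H2 [HH2 E2]]. destruct vs_inc as [C1 [HC1 I1]]. destruct ms_inc as [C2 [HC2 I2]].
  exists (C1 * (H + H2) + C2 * (H + (H + H2))). split; [pos |]. split; intros s t h0 h1 h2; replace (2 * (3 / 8)) with (3 / 4) by field.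
  - destruct (E s t h0 h1 h2) as [e1 _]. assert (e2 := E2 (T - t) (T - s) ltac:(lra) ltac:(lra) ltac:(lra)).
    replace (T - s - (T - t)) with (t - s) in e2 by ring. assert (i := I1 s t ltac:(lra) ltac:(lra)). cbv beta in *.
    assert (z := Rpower_pos (3 / 4) (t - s)). eapply Rle_trans; [apply i |].
    replace ((p (T - t) - p (T - s)) ^ 2) with ((p (T - s) - p (T - t)) ^ 2) by ring.
    apply Rle_trans with (C1 * ((H + H2) * Rpower (t - s) (3 / 4))); [apply Rmult_le_compat_l; lra |].
    assert (0 <= C2 * (H + (H + H2)) * Rpower (t - s) (3 / 4)) by pos. lra.
  - destruct (E s t h0 h1 h2) as [_ e1]. assert (e2 := E2 s t h0 h1 h2).
    destruct (E (T - t) (T - s) ltac:(lra) ltac:(lra) ltac:(lra)) as [e3 _].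
    replace (T - s - (T - t)) with (t - s) in e3 by ring. assert (i := I2 s t ltac:(lra) ltac:(lra)).
    rewrite (nsq_sym (fun t => v (T - t))) in i. cbv beta in *.
    assert (z := Rpower_pos (3 / 4) (t - s)). eapply Rle_trans; [apply i |].
    apply Rle_trans with (C2 * ((H + (H + H2)) * Rpower (t - s) (3 / 4))); [apply Rmult_le_compat_l; lra |].
    assert (0 <= C1 * (H + H2) * Rpower (t - s) (3 / 4)) by pos. lra.
Qed.
Lemma hs_bdry : forall s, 0 <= s <= T -> v s 0 = 0 /\ v s L = 0.
Proof.
  intros s Hs. destruct HC as [Hv _].
  assert (Z : forall x, 0 <= x <= L -> (forall k, ee L true k x = 0) -> v s x = 0).
  { intros x Hx Hk. rewrite (hs_rep L nu r T HL true _ _ v s x Hv Hs Hx).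
    unfold srL. rewrite (Lim_seq_ext _ (fun _ => 0)); [rewrite Lim_seq_const; auto |].
    intros N. unfold tpL. rewrite (sm_ext _ (fun _ => 0)), sm_zero by (intros; rewrite Hk; ring). auto. }
  split; apply Z; try lra; intros k; [apply sin_0' | apply sin_L; auto].
Qed.
(** Stated away from backward time 0, where only a continuous [v0'] is available for the initial
    flux. In forward time this leaves out a neighbourhood of [T]. *)
Lemma v_slope s1 : 0 < s1 -> s1 < T ->
  (exists S, forall t n, s1 <= t <= T -> sm (fun i => Rabs (fl L nu r true vs v (1 + i) t)) n <= S) /\
  exists vx, cont2 vx /\ forall s x, s1 <= s <= T -> 0 <= x <= L -> v s x = RInt (vx s) 0 x.
Proof.
  intros h0 h1. destruct src_holder as [H [HH [M1 _]]]. assert (c1 := cvs).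
  destruct (space_window L nu r T true _ vs v HL Hnu Hr HT (proj1 HC) H s1 h0 h1 HH M1) as [S [F [cF [_ E]]]].
  split; auto. exists (fun s y => / nu * (vs s y - F s y)). split; [ctn |]. intros s x Hs Hx.
  assert (e := E s x Hs Hx). destruct (hs_bdry s ltac:(lra)) as [e0 _]. rewrite e0 in e. rewrite RI_scal by ctn.
  rewrite <- e. simpl sg. field. lra.
Qed.

(* Both [m0'] and [m0] vanish at the end points, so the flux at time [0] is a [C1] function vanishing there. *)
Lemma m_flux_init : summ (fun k => fl L nu 0 false ms m (S k) 0).
Proof.
  (* The drift of [m] at time 0 involves [v] at backward time [T], far from its initial layer; hence
     the drift has a continuous slope there. *)
  destruct (v_slope (T / 2) ltac:(lra) ltac:(lra)) as [_ [vx [cvx E]]]. assert (c1 := cm0'1).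
  assert (c2 : cont1 m0) by (apply (cont1_derive _ m0'); auto). assert (c3 := cm). assert (c4 := cms).
  set (Vx := (fun x => RInt (vx T) 0 x) : R -> R). assert (cVx : cont1 Vx) by (apply RI_cont; ctn).
  set (h := fun x => / 2 * (p 0 - Vx x) * m0 x + nu * m0' x).
  set (h' := fun x => / 2 * (- vx T x) * m0 x + / 2 * (p 0 - Vx x) * m0' x + nu * m0'' x).
  assert (Dh : forall x, is_derive h x (h' x)).
  { intros x. evar_last.
    - apply (is_derive_plus (fun x => / 2 * (p 0 - Vx x) * m0 x) (fun x => nu * m0' x)).
      + apply (is_derive_mult (fun x => / 2 * (p 0 - Vx x)) m0); [| apply Dm0 | intros; apply Rmult_comm].
        apply (is_derive_scal (fun x => p 0 - Vx x)).
        apply (is_derive_minus (fun _ => p 0) Vx); [apply is_derive_const | apply (RI_derive (vx T)); ctn].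
      + apply (is_derive_scal m0'). apply Dm0'.
    - unfold h', plus, minus, opp, scal, zero, mult; simpl; unfold mult, plus, opp; simpl. ring. }
  assert (ch' : cont1 h') by (unfold h'; ctn).
  assert (S1 := C1_summ L HL true h h' Dh ch').
  assert (S2 : summ (cf true h)).
  { apply S1. right. unfold h. rewrite m0_0, m0_L, m0'_0, m0'_L. split; ring. }
  assert (Ek : forall k, fl L nu 0 false ms m (S k) 0 = cf true h (S k)).
  { intros k. unfold fl. simpl negb. assert (lk := lam_pos L HL (S k) ltac:(lia)).
    replace (nu * lam (S k) + 0 / lam (S k)) with (nu * lam (S k)) by (field; lra).
    assert (init := hs_init L nu T HL HT false 0 m0 _ m c2 (proj2 HC)).
    rewrite (cf_ext L HL false (m 0) m0 (S k) init).
    assert (I := cf_ibp L HL false m0 m0' (S k) Dm0 c1 (or_introl eq_refl)). simpl in I.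
    unfold h. rewrite (cf_plus L true (fun x => / 2 * (p 0 - Vx x) * m0 x) (fun x => nu * m0' x)) by ctn.
    rewrite (cf_scal L true nu m0') by ctn. simpl negb in I. rewrite I.
    rewrite (cf_ext L HL true (ms 0) (fun x => / 2 * (p 0 - Vx x) * m0 x)).
    - ring.
    - intros x Hx. unfold msrc. rewrite Rminus_0_r, clip_id by (apply vb; lra). rewrite (E T x) by lra. rewrite init by auto. auto. }
  intros e He. destruct (S2 e He) as [N HN]. exists N. intros n Hn q.
  rewrite (sm_ext _ (fun i => Rabs (cf true h (S n + i)))); [apply HN; lia |]. intros i _. rewrite Ek. auto.
Qed.
(** The core estimate controls the flux minus its damped initial value, and the initial flux is
    summable by the boundary conditions on the datum. This reaches t = 0, which the continuity of
    m_x on the closed rectangle requires. *)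
Lemma m_tails : tails T (fl L nu 0 false ms m).
Proof.
  destruct src_holder as [H [HH [_ M2]]].
  destruct (flux_core L nu 0 T false _ ms m HL Hnu (Rle_refl 0) HT (proj2 HC) 0 (3 / 8) H ltac:(simpl; lra) HH M2) as [C [HC' K]].
  assert (T1 := tails_pow T (fun k t => fl L nu 0 false ms m k t - exp (- (nu * lam k ^ 2 + 0) * t) * fl L nu 0 false ms m k 0) C HC').
  assert (T2 : tails T (fun k t => fl L nu 0 false ms m k t - exp (- (nu * lam k ^ 2 + 0) * t) * fl L nu 0 false ms m k 0)).
  { apply T1. intros n q t Hn Ht. eapply Rle_trans; [| apply (K n q t Hn Ht)]. right. apply sm_ext. intros i _. simpl pow. rewrite Rmult_1_l. auto. }
  intros ep Hep. destruct (T2 (ep / 2)) as [N1 H1]; [lra |]. destruct (m_flux_init (ep / 2)) as [N2 H2]; [lra |].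
  exists (S (N1 + N2)). intros n Hn t Ht q. destruct n as [| n]; [lia |].
  assert (h1 := H1 (S n) ltac:(lia) t Ht q). assert (h2 := H2 n ltac:(lia) q).
  replace ep with (ep / 2 + ep / 2) by field. eapply Rle_trans; [| apply Rplus_le_compat; [apply h1 | apply h2]].
  rewrite <- sm_plus. apply sm_le. intros i _. change (S (n + i)) with (S n + i)%nat. set (k := (S n + i)%nat).
  replace (fl L nu 0 false ms m k t) with ((fl L nu 0 false ms m k t - exp (- (nu * lam k ^ 2 + 0) * t) * fl L nu 0 false ms m k 0)
     + exp (- (nu * lam k ^ 2 + 0) * t) * fl L nu 0 false ms m k 0) at 1 by ring.
  eapply Rle_trans; [apply Rabs_triang |]. apply Rplus_le_compat_l. rewrite Rabs_mult, (Rabs_right (exp _)) by (left; apply exp_pos).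
  assert (e1 := exp_mu_le1 L nu 0 Hnu (Rle_refl 0) k t (proj1 Ht)). assert (z := Rabs_pos (fl L nu 0 false ms m k 0)). nra.
Qed.
Lemma m_slope : exists F, cont2 F /\ (forall t k, 0 <= t <= T -> cf true (F t) k = fl2 L nu false ms m k t) /\
  (forall t, F t 0 = 0 /\ F t L = 0) /\
  forall t x, 0 <= t <= T -> 0 <= x <= L -> m t x = m t 0 + RInt (fun y => / nu * (F t y - ms t y)) 0 x.
Proof.
  assert (c1 := cms). assert (Tm := m_tails).
  destruct (flux_space L nu 0 T false _ ms m HL (Rle_refl 0) HT (proj2 HC) Tm) as [F [cF [EF [BF DF]]]].
  exists F. split; [auto | split; [auto | split; [auto |]]]. intros t x Ht Hx. assert (e := DF t x Ht Hx). simpl sg in e.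
  rewrite RI_scal by ctn. rewrite RI_minus by ctn. rewrite RI_minus in e by ctn.
  assert (e' : RInt (F t) 0 x - RInt (ms t) 0 x = nu * (m t x - m t 0)) by lra. rewrite e'. field. lra.
Qed.
(** The uniform tail bound covers large indices; the finitely many others are continuous in time,
    hence bounded. *)
Lemma m_fl_sum : exists S, forall t n, 0 <= t <= T -> sm (fun i => Rabs (fl L nu 0 false ms m (1 + i) t)) n <= S.
Proof.
  destruct (m_tails 1 ltac:(lra)) as [N HN].
  assert (B : forall k, exists M, 0 <= M /\ forall t, 0 <= t <= T -> Rabs (fl L nu 0 false ms m k t) <= M).
  { intros k. destruct (cont1_bound (fl L nu 0 false ms m k) 0 T) as [M [HM BM]]; [eapply fl_cont; apply (proj2 HC) |].
    exists M. split; [lra | auto]. }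
  assert (B2 : forall n, exists M, forall t, 0 <= t <= T -> sm (fun i => Rabs (fl L nu 0 false ms m i t)) n <= M).
  { induction n as [| n [M IH]]; [exists 0; intros; cbn [sm]; lra |]. destruct (B n) as [M2 [_ h]]. exists (M + M2).
    intros t Ht. cbn [sm]. assert (h1 := IH t Ht). assert (h2 := h t Ht). lra. }
  destruct (B2 (S N)) as [M HM]. exists (M + 1). intros t n Ht.
  assert (h := HM t Ht). assert (h2 := HN (S N) ltac:(lia) t Ht n). rewrite sm_head in h.
  assert (z := Rabs_pos (fl L nu 0 false ms m 0 t)).
  apply Rle_trans with (sm (fun i => Rabs (fl L nu 0 false ms m (1 + i) t)) (N + n)).
  { apply sm_mono; [intros; apply Rabs_pos | lia]. }
  rewrite sm_split. apply Rplus_le_compat; [| eapply Rle_trans; [| apply h2]; right; apply sm_ext; intros; auto].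
  simpl in h |- *. lra.
Qed.

(** In the increment of int v m each difference in time enters through its space primitive,
    Lipschitz by [prim_lip], tested by [weak_lip] against the other factor, whose slope is
    bounded. *)
Lemma p_lip d : 0 < d -> 2 * d < T -> exists C, 0 <= C /\ forall s t, d <= s -> s <= t -> t <= T - d -> Rabs (p t - p s) <= C * (t - s).
Proof.
  intros Hd HdT. assert (c1 := cv). assert (c2 := cm).
  destruct (v_slope d Hd ltac:(lra)) as [[Sv HSv] [vx [cvx Ev]]]. destruct m_slope as [F [cF [_ [_ Em]]]]. assert (c3 := cms).
  destruct m_fl_sum as [Sm HSm]. destruct mb as [M [HM bM]].
  set (mx := fun t y => / nu * (F t y - ms t y)). assert (cmx : cont2 mx) by (unfold mx; ctn).
  destruct (cont2_bound vx 0 T 0 L cvx) as [D1 [HD1 B1]]. destruct (cont2_bound mx 0 T 0 L cmx) as [D2 [HD2 B2]].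
  assert (Sv0 : 0 <= Sv) by (apply (HSv T O); lra). assert (Sm0 : 0 <= Sm) by (apply (HSm T O); lra).
  exists (Rabs c * (4 / L * Sv * (M + D2 * L) + 4 / L * Sm * (D1 * L))). split; [pos |]. intros s t h0 h1 h2.
  rewrite !Hfix by lra.
  replace (b + c * Vf L T v m t - (b + c * Vf L T v m s)) with (c * (Vf L T v m t - Vf L T v m s)) by ring.
  assert (E : Vf L T v m t - Vf L T v m s = - RInt (fun x => (v (T - s) x - v (T - t) x) * m t x) 0 L + RInt (fun x => (m t x - m s x) * v (T - s) x) 0 L).
  { unfold Vf. rewrite <- RI_minus by ctn. replace (- RInt (fun x => (v (T - s) x - v (T - t) x) * m t x) 0 L) with ((-1) * RInt (fun x => (v (T - s) x - v (T - t) x) * m t x) 0 L) by (req; ring).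
    rewrite <- RI_scal by ctn. rewrite <- RI_plus by ctn. apply RInt_ext. intros; req; ring. }
  rewrite E, Rabs_mult, Rmult_assoc. apply Rmult_le_compat_l; [pos |]. eapply Rle_trans; [apply Rabs_triang |]. rewrite Rabs_Ropp.
  assert (Q1 : Rabs (RInt (fun x => (v (T - s) x - v (T - t) x) * m t x) 0 L) <= 4 / L * (Sv * (t - s)) * (Rabs (m t L) + D2 * L)).
  { apply (weak_lip L (fun x => v (T - s) x - v (T - t) x) (m t) (mx t) (m t 0)); [auto | ctn | ctn | | |].
    - intros x Hx. assert (Hw := hs_window L true nu r T _ vs v d T (proj1 HC) ltac:(lra) ltac:(lra) ltac:(lra)).
      assert (z := prim_lip L nu r (T - d) true _ _ _ HL ltac:(lra) Hw (or_introl eq_refl) Sv (T - t - d) (T - s - d) x).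
      cbv beta in z. replace (d + (T - t - d)) with (T - t) in z by ring. replace (d + (T - s - d)) with (T - s) in z by ring.
      replace (T - s - d - (T - t - d)) with (t - s) in z by ring. apply z; try lra.
      intros q n Hq. apply (HSv (d + q) n). lra.
    - intros x Hx. apply B2; lra.
    - intros x Hx. apply Em; lra. }
  assert (Q2 : Rabs (RInt (fun x => (m t x - m s x) * v (T - s) x) 0 L) <= 4 / L * (Sm * (t - s)) * (Rabs (v (T - s) L) + D1 * L)).
  { apply (weak_lip L (fun x => m t x - m s x) (v (T - s)) (vx (T - s)) 0); [auto | ctn | ctn | | |].
    - intros x Hx. apply (prim_lip L nu 0 T false _ ms m HL (Rle_refl 0) (proj2 HC) (or_intror eq_refl) Sm s t x); auto; lra.
    - intros x Hx. apply B1; lra.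
    - intros x Hx. rewrite Rplus_0_l. apply Ev; lra. }
  destruct (hs_bdry (T - s) ltac:(lra)) as [_ z]. rewrite z, Rabs_R0 in Q2.
  assert (zm := bM t L ltac:(lra) ltac:(lra)).
  assert (z2 : 4 / L * (Sv * (t - s)) * (Rabs (m t L) + D2 * L) <= 4 / L * (Sv * (t - s)) * (M + D2 * L)).
  { apply Rmult_le_compat_l; [| lra]. apply Rmult_le_pos; [pos | apply Rmult_le_pos; lra]. }
  lra.
Qed.

Lemma sq_lip x C h : 0 <= C -> 0 <= h -> Rabs x <= C * h -> x ^ 2 <= C ^ 2 * h ^ 2.
Proof. intros. rewrite <- Rpow_mult_distr. apply sq_le_of_abs; auto. pos. Qed.

(** Lipschitz [p] bounds the increments of the source of [v] by those of [v], so [lip_window] and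
    then [time_window] apply; the Lipschitz constant of [v] then does the same for [m]. Every step
    gives up a layer of width [d], and [v] is read at reversed times, whence 3 d at both ends. *)
Lemma interior d : 0 < d -> 6 * d < T ->
  exists Zv Zm, cont2 Zv /\ cont2 Zm /\
  (forall s k, 3 * d <= s <= T - 3 * d -> cf true (Zv s) k = lam k * cf false (vs s) k - (nu * lam k ^ 2 + r) * cf true (v s) k) /\
  (forall s t x, 3 * d <= s -> s <= t -> t <= T - 3 * d -> 0 <= x <= L -> v t x - v s x = RInt (fun q => Zv q x) s t) /\
  (forall t k, 3 * d <= t <= T - 3 * d -> cf false (Zm t) k = lam k * cf true (ms t) k - nu * lam k ^ 2 * cf false (m t) k) /\
  (forall s t x, 3 * d <= s -> s <= t -> t <= T - 3 * d -> 0 <= x <= L -> m t x - m s x = RInt (fun q => Zm q x) s t).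
Proof.
  intros Hd HdT. destruct (p_lip d Hd ltac:(lra)) as [Cp [HCp Lp]].
  destruct vs_inc as [C1 [HC1 I1]]. destruct ms_inc as [C2 [HC2 I2]].
  destruct (v_slope d Hd ltac:(lra)) as [[Sv HSv] _]. destruct m_fl_sum as [Sm HSm].
  assert (Lp2 : forall s t, d <= s -> s <= t -> t <= T - d -> (p t - p s) ^ 2 <= Cp ^ 2 * (t - s) ^ 2).
  { intros. apply sq_lip; auto; lra. }
  assert (V1 : forall s t, d <= s -> s < t -> t <= T - d ->
    nsq (fun x => vs t x - vs s x) <= C1 * (1 + Cp ^ 2) * (nsq (fun x => v t x - v s x) + (t - s) ^ 2)).
  { intros s t h0 h1 h2. eapply Rle_trans; [apply (I1 s t); lra |]. rewrite Rmult_assoc. apply Rmult_le_compat_l; auto.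
    assert (z := Lp2 (T - t) (T - s) ltac:(lra) ltac:(lra) ltac:(lra)).
    replace (T - s - (T - t)) with (t - s) in z by ring.
    replace ((p (T - t) - p (T - s)) ^ 2) with ((p (T - s) - p (T - t)) ^ 2) by ring.
    assert (c1 := cv).
    assert (I0 : 0 <= nsq (fun x => v t x - v s x)) by (apply RI_ge0; [ctn | lra | intros; pos]).
    set (I := nsq (fun x => v t x - v s x)) in *. assert (0 <= Cp ^ 2 * I) by pos. assert (0 <= (t - s) ^ 2) by pos. lra. }
  destruct (lip_window L nu r T true _ vs v HL Hnu Hr (proj1 HC) d (2 * d) (T - d) (C1 * (1 + Cp ^ 2)) Sv) as [Kv [HKv Lv]]; auto; try lra.
  { pos. } { intros t n Ht. apply HSv; lra. }
  destruct (time_window L nu r T true _ vs v HL Hnu Hr (proj1 HC) (2 * d) (3 * d) (T - d) (C1 * (1 + Cp ^ 2) * (Kv + 1))) as [Zv [cZv [EZv DZv]]]; auto; try lra.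
  { pos. }
  { intros s t h0 h1 h2. eapply Rle_trans; [apply V1; lra |]. rewrite (Rmult_assoc (C1 * (1 + Cp ^ 2))).
    apply Rmult_le_compat_l; [pos |]. assert (z := Lv s t ltac:(lra) h1 h2). cbv beta in z. lra. }
  assert (M1 : forall s t, d <= s -> s < t -> t <= T - 2 * d ->
    nsq (fun x => ms t x - ms s x) <= C2 * (1 + (Kv + Cp ^ 2)) * (nsq (fun x => m t x - m s x) + (t - s) ^ 2)).
  { intros s t h0 h1 h2. eapply Rle_trans; [apply (I2 s t); lra |]. rewrite Rmult_assoc. apply Rmult_le_compat_l; auto.
    assert (z := Lp2 s t ltac:(lra) ltac:(lra) ltac:(lra)).
    assert (z2 := Lv (T - t) (T - s) ltac:(lra) ltac:(lra) ltac:(lra)).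
    replace (T - s - (T - t)) with (t - s) in z2 by ring. rewrite (nsq_sym (fun t => v (T - t))). cbv beta in *.
    assert (c1 := cm).
    assert (I0 : 0 <= nsq (fun x => m t x - m s x)) by (apply RI_ge0; [ctn | lra | intros; pos]).
    set (I := nsq (fun x => m t x - m s x)) in *. assert (0 <= (Kv + Cp ^ 2) * I) by pos. assert (0 <= (t - s) ^ 2) by pos. lra. }
  destruct (lip_window L nu 0 T false _ ms m HL Hnu (Rle_refl 0) (proj2 HC) d (2 * d) (T - 2 * d) (C2 * (1 + (Kv + Cp ^ 2))) Sm) as [Km [HKm Lm]]; auto; try lra.
  { pos. } { intros t n Ht. apply HSm; lra. }
  destruct (time_window L nu 0 T false _ ms m HL Hnu (Rle_refl 0) (proj2 HC) (2 * d) (3 * d) (T - 2 * d) (C2 * (1 + (Kv + Cp ^ 2)) * (Km + 1))) as [Zm [cZm [EZm DZm]]]; auto; try lra.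
  { pos. }
  { intros s t h0 h1 h2. eapply Rle_trans; [apply M1; lra |]. rewrite (Rmult_assoc (C2 * (1 + (Kv + Cp ^ 2)))).
    apply Rmult_le_compat_l; [pos |]. assert (z := Lm s t ltac:(lra) h1 h2). cbv beta in z. lra. }
  exists Zv, Zm. split; [auto | split; [auto | split; [| split; [| split]]]].
  - intros s k Hs. apply EZv; lra.
  - intros; apply DZv; lra.
  - intros t k Ht. rewrite EZm by lra. simpl negb. rewrite Rplus_0_r. auto.
  - intros; apply DZm; lra.
Qed.

(** * Reconstruction of u from its slope *)

Variable uT : R -> R.
Hypothesis DuT : forall x, is_derive uT x (v0 x).
Definition Gs (s x : R) : R := / 2 * (p (T - s) - v s x).
Definition G2 (s : R) : R := RInt (fun x => Gs s x ^ 2) 0 L.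
(** The integral of [u] over [0,L] at backward time [s]: integrating the equation removes u_xx by
    the Neumann condition and leaves ub' = -r ub + G2. *)
Definition ub (s : R) : R := exp (- r * s) * (RInt uT 0 L + RInt (fun q => exp (r * q) * G2 q) 0 s).
(* The mean of [u] solves an ODE and the rest of [u] is the mean-free antiderivative of the slope. *)
Definition us (s x : R) : R := / L * ub s + pm L (v s) x.

Lemma cGs : cont2 Gs. Proof. assert (c1 := cv). unfold Gs. ctn. Qed.
Lemma cG2 : cont1 G2.
Proof. assert (c1 := cGs). unfold G2. apply (RI_param_cont (fun s x => Gs s x ^ 2)). ctn. Qed.
Lemma ub_derive s : is_derive ub s (- r * ub s + G2 s).
Proof.
  assert (c1 := cG2). unfold ub. evar_last.
  - apply (is_derive_mult (fun s => exp (- r * s)) (fun s => RInt uT 0 L + RInt (fun q => exp (r * q) * G2 q) 0 s)).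
    + auto_derive; [trivial | reflexivity].
    + apply (is_derive_plus (fun _ => RInt uT 0 L) (fun s => RInt (fun q => exp (r * q) * G2 q) 0 s)); [apply is_derive_const |].
      apply (RI_derive (fun q => exp (r * q) * G2 q)). ctn.
    + intros; apply Rmult_comm.
  - unfold plus, zero, mult; simpl.
    assert (E : exp (- r * s) * exp (r * s) = 1) by (rewrite <- exp_plus; replace (- r * s + r * s) with 0 by ring; apply exp_0).
    set (I := RInt (fun q => exp (r * q) * G2 q) 0 s). req.
    replace (exp (- r * s) * (0 + exp (r * s) * G2 s)) with ((exp (- r * s) * exp (r * s)) * G2 s) by ring. rewrite E. ring.
Qed.
Lemma cub : cont1 ub. Proof. apply (cont1_derive _ (fun s => - r * ub s + G2 s)). apply ub_derive. Qed.
Lemma cus : cont2 us.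
Proof. assert (c1 := cub). assert (c2 := pm_cont2 L v cv). unfold us. ctn. Qed.
Lemma us_x s x : is_derive (us s) x (v s x).
Proof.
  assert (c1 := cv). evar_last; [apply (is_derive_plus (fun _ => / L * ub s) (pm L (v s))); [apply is_derive_const | apply pm_derive; ctn] |].
  unfold plus, zero; simpl. ring.
Qed.
Lemma us_0 x : 0 <= x <= L -> us 0 x = uT x.
Proof.
  intros Hx. assert (cv0 : cont1 v0) by (apply (cont1_derive _ v0'); auto). assert (cuT : cont1 uT) by (apply (cont1_derive _ v0); auto).
  assert (init := hs_init L nu T HL HT true r v0 _ v cv0 (proj1 HC)).
  assert (A : forall y, 0 <= y <= L -> RInt (v 0) 0 y = uT y - uT 0).
  { intros y Hy. rewrite (RI_ext _ v0) by (try lra; intros; apply init; lra). apply RI_ftc; auto. }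
  unfold us, ub, pm. rewrite Rmult_0_r, exp_0, RI_point, A by auto.
  rewrite (RI_ext (fun y => RInt (v 0) 0 y) (fun y => uT y - uT 0)) by (auto; lra).
  rewrite RI_minus by ctn. rewrite RI_const. req. field. lra.
Qed.

(** The residual of the equation of [u] has no cosine coefficients: mode 0 is the equation of [ub],
    and for k >= 1 multiplication by lam_k gives the sine coefficients of the equation of [v].
    Completeness makes it vanish pointwise. *)
Lemma slope_identity s Zv vx : 0 <= s <= T -> cont1 Zv -> cont1 vx ->
  (forall k, cf true Zv k = lam k * cf false (vs s) k - (nu * lam k ^ 2 + r) * cf true (v s) k) ->
  (forall x, 0 <= x <= L -> v s x = RInt vx 0 x) ->
  forall x, 0 <= x <= L -> / L * (- r * ub s + G2 s) + pm L Zv x - nu * vx x + r * us s x - Gs s x ^ 2 = 0.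
Proof.
  intros Hs cZ cvx EZ Ev. assert (c1 := cv). assert (c2 := cvs). assert (c3 := cGs). assert (c4 := cus).
  assert (cpz := pm_cont L Zv cZ). assert (cpv : cont1 (pm L (v s))) by (apply pm_cont; ctn).
  set (k0 := / L * (- r * ub s + G2 s)).
  apply (complete L HL false (fun x => k0 + pm L Zv x - nu * vx x + r * us s x - Gs s x ^ 2)); [ctn |].
  (* The mean of the slope of [v] vanishes because [v] is zero at both ends. *)
  assert (vx0 : cf false vx 0 = 0).
  { rewrite cf_false0, <- Ev by lra. apply hs_bdry; auto. }
  intros k.
  rewrite (cf_minus L false (fun x => k0 + pm L Zv x - nu * vx x + r * us s x) (fun x => Gs s x ^ 2)) by ctn.
  rewrite (cf_plus L false (fun x => k0 + pm L Zv x - nu * vx x) (fun x => r * us s x)) by ctn.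
  rewrite (cf_minus L false (fun x => k0 + pm L Zv x) (fun x => nu * vx x)) by ctn.
  rewrite (cf_plus L false (fun _ => k0) (pm L Zv)) by ctn.
  rewrite (cf_scal L false nu vx), (cf_scal L false r (us s)) by ctn.
  unfold us. rewrite (cf_plus L false (fun _ => / L * ub s) (pm L (v s))) by ctn.
  destruct k as [| k].
  - rewrite vx0, !cf_false0, !pm_mean, !RI_const by (auto; ctn). fold (G2 s). unfold k0. req. field. lra.
  - rewrite !cf_const by auto.
    assert (e1 := pm_coef L Zv k HL cZ). assert (e2 := pm_coef L (v s) k HL ltac:(ctn)).
    assert (e3 := prim_coef L HL true vx (S k) cvx (fun _ => vx0)). simpl negb in e3. simpl sg in e3.
    rewrite <- (cf_ext L HL true (v s) (fun x => RInt vx 0 x) (S k) Ev) in e3.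
    assert (e4 : cf false (fun x => Gs s x ^ 2) (S k) = - cf false (vs s) (S k)).
    { rewrite (cf_ext L HL false (fun x => Gs s x ^ 2) (fun x => / 4 * p (T - s) ^ 2 - vs s x)).
      - rewrite (cf_minus L false (fun _ => / 4 * p (T - s) ^ 2)) by ctn. rewrite cf_const by auto. ring.
      - intros x Hx. unfold Gs, vsrc, Fq. rewrite clip_id by (apply vb; auto). field. }
    rewrite e4, e3. rewrite (EZ (S k)) in e1. assert (lk := lam_pos L HL (S k) ltac:(lia)).
    set (a := cf false (pm L Zv) (S k)) in *. set (y := cf false (pm L (v s)) (S k)) in *.
    set (f := cf false (vs s) (S k)) in *. set (q := cf true (v s) (S k)) in *. set (l := lam (S k)) in *.
    apply Rmult_eq_reg_l with l; [| lra]. rewrite e2 in *.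
    replace (l * (0 + a - nu * (1 * l * (- l * y)) + r * (0 + y) - - f)) with (- (- l * a) + nu * l ^ 2 * (l * y) + r * (l * y) + l * f) by ring.
    rewrite <- e1. ring.
Qed.

Lemma local_reg F t0 : cont2 F -> (forall t k, 0 <= t <= T -> cf true (F t) k = fl2 L nu false ms m k t) ->
  (forall t x, 0 <= t <= T -> 0 <= x <= L -> m t x = m t 0 + RInt (fun y => / nu * (F t y - ms t y)) 0 x) -> 0 < t0 < T ->
  exists a0 a1 Ut Uxx Mt Mxx, (a0 < t0 < a1) /\ cont2 Ut /\ cont2 Uxx /\ cont2 Mt /\ cont2 Mxx /\
  forall t x, a0 < t < a1 -> 0 < x < L ->
   is_derive (fun q => us (T - q) x) t (Ut t x) /\ is_derive (fun y => v (T - t) y) x (Uxx t x) /\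
   is_derive (fun q => m q x) t (Mt t x) /\ is_derive (fun y => / nu * (F t y - ms t y)) x (Mxx t x) /\
   Ut t x + nu * Uxx t x - r * us (T - t) x + Gs (T - t) x ^ 2 = 0 /\
   is_derive (fun y => Gs (T - t) y * m t y) x (Mt t x - nu * Mxx t x).
Proof.
  intros cF EF Em Ht0. set (d := Rmin t0 (T - t0) / 8).
  assert (d1 := Rmin_l t0 (T - t0)). assert (d2 := Rmin_r t0 (T - t0)).
  assert (Hd : 0 < d) by (unfold d; apply Rdiv_lt_0_compat; [apply Rmin_pos; lra | lra]).
  assert (d3 : 8 * d <= t0 /\ 8 * d <= T - t0) by (unfold d; lra).
  destruct (interior d Hd ltac:(lra)) as [Zv [Zm [cZv [cZm [EZv [DZv [EZm DZm]]]]]]].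
  destruct (v_slope (3 * d) ltac:(lra) ltac:(lra)) as [_ [vx [cvx Ev]]].
  assert (c1 := cv). assert (c2 := cm). assert (c3 := cms). assert (c4 := cGs). assert (c5 := cub). assert (c6 := cG2).
  assert (cpz := pm_cont2 L Zv cZv).
  set (uss := fun s x => / L * (- r * ub s + G2 s) + pm L (Zv s) x).
  assert (cuss : cont2 uss) by (unfold uss; ctn).
  set (gx := fun t x => / 2 * (- vx (T - t) x) * m t x + Gs (T - t) x * (/ nu * (F t x - ms t x))).
  assert (cgx : cont2 gx) by (unfold gx; ctn).
  (* The Fokker-Planck equation in integrated form: the flux is the space primitive of m_t. It makes
     [F], hence m_x, differentiable in [x]. *)
  assert (DF : forall t x, 3 * d <= t <= T - 3 * d -> 0 <= x <= L -> F t x = RInt (Zm t) 0 x).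
  { intros t x Ht Hx. assert (cz : cont1 (Zm t)) by ctn. assert (cQ := RI_cont (Zm t) 0 cz). apply Rminus_diag_uniq.
    apply (complete L HL true (fun x => F t x - RInt (Zm t) 0 x)); [ctn | | auto]. intros k. rewrite cf_minus by ctn.
    destruct k as [| k]; [rewrite !cf_true0 by auto; ring |].
    assert (z0 : cf false (Zm t) 0 = 0) by (rewrite EZm, lam0 by auto; ring).
    assert (e := prim_coef L HL true (Zm t) (S k) cz (fun _ => z0)). simpl negb in e. simpl sg in e.
    rewrite EZm in e by auto. rewrite EF by lra. unfold fl2. simpl negb. assert (lk := lam_pos L HL (S k) ltac:(lia)).
    apply Rmult_eq_reg_l with (lam (S k)); [| lra]. rewrite Rmult_0_r, Rmult_minus_distr_l.
    change (cf true (RInt (Zm t) 0) (S k)) with (cf true (fun x => RInt (Zm t) 0 x) (S k)).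
    rewrite Rmult_1_l in e. rewrite <- e. ring. }
  exists (3 * d), (T - 3 * d), (fun t x => - uss (T - t) x), (fun t x => vx (T - t) x), Zm, (fun t x => / nu * (Zm t x - gx t x)).
  split; [lra |]. split; [ctn | split; [ctn | split; [auto | split; [ctn |]]]].
  intros t x Ht Hx.
  assert (Dvx : is_derive (fun y => v (T - t) y) x (vx (T - t) x)).
  { apply (derive_ext_in (fun y => RInt (vx (T - t)) 0 y) _ 0 L); auto; [intros y Hy; symmetry; apply Ev; lra |]. apply RI_derive. ctn. }
  assert (Dm : is_derive (fun y => m t y) x (/ nu * (F t x - ms t x))).
  { apply (derive_ext_in (fun y => m t 0 + RInt (fun y => / nu * (F t y - ms t y)) 0 y) _ 0 L); auto; [intros y Hy; symmetry; apply Em; lra |].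
    evar_last; [apply (is_derive_plus (fun _ => m t 0) (fun y => RInt (fun y => / nu * (F t y - ms t y)) 0 y));
      [apply is_derive_const | apply (RI_derive (fun y => / nu * (F t y - ms t y))); ctn] |].
    unfold plus, zero; simpl. ring. }
  assert (Dg : is_derive (fun y => Gs (T - t) y * m t y) x (gx t x)).
  { evar_last.
    - apply (is_derive_mult (fun y => Gs (T - t) y) (fun y => m t y)); [| apply Dm | intros; apply Rmult_comm].
      apply (is_derive_scal (fun y => p (T - (T - t)) - v (T - t) y)).
      apply (is_derive_minus (fun _ => p (T - (T - t))) (fun y => v (T - t) y)); [apply is_derive_const | apply Dvx].
    - unfold gx, plus, minus, opp, scal, zero, mult; simpl; unfold mult, plus, opp; simpl. ring. }
  split; [| split; [auto | split; [| split; [| split]]]].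
  - assert (Ds : is_derive (fun s => us s x) (T - t) (uss (T - t) x)).
    { unfold us. apply (is_derive_plus (fun s => / L * ub s) (fun s => pm L (v s) x)).
      - apply (is_derive_scal ub). apply ub_derive.
      - apply (derive_of_increment (fun s => pm L (v s) x) (fun s => pm L (Zv s) x) (3 * d) (T - 3 * d)); [lra | |].
        { intros q. apply (c_cont2 (fun s x => pm L (Zv s) x) (fun s => s) (fun _ => x) q cpz); [apply continuous_id | apply c_const]. }
        intros q1 q2 h1 h2 h3. apply pm_increment; auto; lra. }
    evar_last; [apply (is_derive_comp (fun s => us s x) (fun q => T - q)); [apply Ds | auto_derive; [trivial | reflexivity]] |].
    unfold scal; simpl; unfold mult; simpl. ring.
  - apply (derive_of_increment (fun q => m q x) (fun q => Zm q x) (3 * d) (T - 3 * d)); [lra | ctn |].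
    intros q1 q2 h1 h2 h3. apply DZm; auto; lra.
  - evar_last.
    + apply (is_derive_scal (fun y => F t y - ms t y)). apply (is_derive_minus (fun y => F t y) (fun y => ms t y)).
      * apply (derive_ext_in (fun y => RInt (Zm t) 0 y) _ 0 L); auto; [intros y Hy; symmetry; apply DF; lra |]. apply RI_derive. ctn.
      * apply (derive_ext_in (fun y => Gs (T - t) y * m t y) _ 0 L); [auto | | apply Dg].
        intros y Hy. unfold Gs, msrc. replace (T - (T - t)) with t by ring. rewrite clip_id by (apply vb; lra). auto.
    + unfold minus, plus, opp, scal, mult; simpl; unfold mult; simpl. ring.
  - assert (I := slope_identity (T - t) (Zv (T - t)) (vx (T - t)) ltac:(lra) ltac:(ctn) ltac:(ctn)
      (fun k => EZv (T - t) k ltac:(lra)) (fun x Hx => Ev (T - t) x ltac:(lra) Hx) x ltac:(lra)).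
    unfold uss. lra.
  - replace (Zm t x - nu * (/ nu * (Zm t x - gx t x))) with (gx t x) by (field; lra). auto.
Qed.

Lemma regular : exists u mx, cont2 u /\ cont2 mx /\ cont2 v /\ cont2 m /\
  (forall t x, is_derive (u t) x (v (T - t) x)) /\ (forall x, 0 <= x <= L -> u T x = uT x) /\
  (forall t x, 0 <= t <= T -> 0 <= x <= L -> m t x = m t 0 + RInt (mx t) 0 x) /\
  (forall t x, 0 <= t <= T -> x = 0 \/ x = L -> nu * mx t x + / 2 * (p t - v (T - t) x) * m t x = 0) /\
  (forall t, 0 <= t <= T -> v (T - t) 0 = 0 /\ v (T - t) L = 0) /\ (forall x, 0 <= x <= L -> m 0 x = m0 x) /\
  forall t0, 0 < t0 < T -> exists a0 a1 Ut Uxx Mt Mxx, (a0 < t0 < a1) /\ cont2 Ut /\ cont2 Uxx /\ cont2 Mt /\ cont2 Mxx /\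
  forall t x, a0 < t < a1 -> 0 < x < L ->
   is_derive (fun q => u q x) t (Ut t x) /\ is_derive (fun y => v (T - t) y) x (Uxx t x) /\
   is_derive (fun q => m q x) t (Mt t x) /\ is_derive (fun y => mx t y) x (Mxx t x) /\
   Ut t x + nu * Uxx t x - r * u t x + (/ 2 * (p t - v (T - t) x)) ^ 2 = 0 /\
   is_derive (fun y => / 2 * (p t - v (T - t) y) * m t y) x (Mt t x - nu * Mxx t x).
Proof.
  destruct m_slope as [F [cF [EF [BF Em]]]]. assert (c1 := cus). assert (c2 := cms). assert (c3 := cv). assert (c4 := cm).
  assert (cm0 : cont1 m0) by (apply (cont1_derive _ m0'); auto).
  exists (fun t x => us (T - t) x), (fun t y => / nu * (F t y - ms t y)).
  split; [ctn | split; [ctn | split; [auto | split; [auto | split; [| split; [| split; [auto | split; [| split; [| split]]]]]]]]].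
  - intros; apply us_x.
  - intros x Hx. rewrite Rminus_diag_eq by auto. apply us_0; auto.
  - intros t x Ht Hx. assert (Hx' : 0 <= x <= L) by (destruct Hx; lra).
    assert (F0 : F t x = 0) by (destruct Hx; subst x; apply BF). rewrite F0. unfold msrc. rewrite clip_id by (apply vb; lra). field. lra.
  - intros; apply hs_bdry; lra.
  - apply (hs_init L nu T HL HT false 0 m0 _ m cm0 (proj2 HC)).
  - intros t0 Ht0. destruct (local_reg F t0 cF EF Em Ht0) as [a0 [a1 [Ut [Uxx [Mt [Mxx [Ha [d1 [d2 [d3 [d4 R]]]]]]]]]]].
    exists a0, a1, Ut, Uxx, Mt, Mxx. split; [auto | split; [auto | split; [auto | split; [auto | split; [auto |]]]]].
    intros t x Ht Hx. assert (Q := R t x Ht Hx). unfold Gs in Q. replace (T - (T - t)) with t in Q by ring. exact Q.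
Qed.
End Regular.

(** * Existence and uniqueness *)

Lemma deriv_within_of (f g : R -> R) l x L : (forall y, 0 <= y <= L -> f y = g y) -> Icc 0 L x -> is_derive g x l ->
  deriv_within (Icc 0 L) f l x.
Proof.
  intros E Hx D. unfold deriv_within. apply filterlim_locally. intros ep. apply is_derive_Reals in D.
  destruct (D ep (cond_pos ep)) as [de K]. exists de. intros y Hb [Hy Hne].
  unfold ball in *; simpl in *. unfold AbsRing_ball, abs, minus, plus, opp in *; simpl in *.
  assert (k := K (y - x) ltac:(lra) Hb). replace (x + (y - x)) with y in k by ring.
  rewrite (E y Hy), (E x Hx). exact k.
Qed.
Lemma clamp_comp_cont L f : 0 <= L ->
  (forall x e, 0 <= x <= L -> 0 < e -> exists d, 0 < d /\ forall y, 0 <= y <= L -> Rabs (y - x) < d -> Rabs (f y - f x) < e) ->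
  cont1 (fun y => f (clamp L y)).
Proof.
  intros HL K. apply cont1_eps. intros x e He. destruct (K (clamp L x) e (clamp_in L x HL) He) as [d [Hd B]].
  exists d. split; auto. intros y Hy. left. apply B; [apply clamp_in; auto |]. eapply Rle_lt_trans; [apply clamp_lip; auto | auto].
Qed.
Lemma deriv_on_ext_cont L f f' : 0 <= L -> deriv_on 0 L f f' -> cont1 (fun y => f (clamp L y)).
Proof.
  intros HL D. apply clamp_comp_cont; auto. intros x e Hx He. assert (d := D x Hx). unfold deriv_within in d.
  apply (proj1 (filterlim_locally _ _)) with (eps := mkposreal 1 Rlt_0_1) in d. destruct d as [[de Hde] K].
  set (l := Rabs (f' x) + 1). assert (Hl : 0 < l) by (unfold l; assert (z := Rabs_pos (f' x)); lra).
  exists (Rmin de (e / l)). split; [apply Rmin_pos; auto; pos |]. intros y Hy Hb.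
  destruct (Req_dec y x) as [-> | Hne]; [rewrite Rminus_diag_eq, Rabs_R0 by auto; auto |].
  assert (b1 := Rmin_l de (e / l)). assert (b2 := Rmin_r de (e / l)).
  assert (k : Rabs ((f y - f x) / (y - x) - f' x) < 1) by (apply (K y); [unfold ball; simpl; unfold AbsRing_ball, abs, minus, plus, opp; simpl; unfold Rminus in Hb; lra | split; auto]).
  assert (k2 : Rabs ((f y - f x) / (y - x)) < l).
  { unfold l. assert (z := Rabs_triang ((f y - f x) / (y - x) - f' x) (f' x)).
    replace ((f y - f x) / (y - x) - f' x + f' x) with ((f y - f x) / (y - x)) in z by ring. lra. }
  replace (f y - f x) with ((f y - f x) / (y - x) * (y - x)) by (field; lra). rewrite Rabs_mult.
  assert (p0 : 0 < Rabs (y - x)) by (apply Rabs_pos_lt; lra).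
  apply Rlt_trans with (l * Rabs (y - x)); [apply Rmult_lt_compat_r; auto |].
  apply Rlt_le_trans with (l * (e / l)); [apply Rmult_lt_compat_l; lra |]. right. field. lra.
Qed.
Lemma holder_ext_cont L gamma f : 0 <= L -> 0 < gamma -> holder_on 0 L gamma f -> cont1 (fun y => f (clamp L y)).
Proof.
  intros HL Hg [C B]. apply clamp_comp_cont; auto. intros x e Hx He.
  set (C' := Rabs C + 1). assert (HC : 0 < C') by (unfold C'; assert (z := Rabs_pos C); lra).
  assert (q0 : 0 < e / (2 * C')) by (apply Rdiv_lt_0_compat; lra).
  exists (Rpower (e / (2 * C')) (1 / gamma)). split; [pos |]. intros y Hy Hb.
  destruct (Req_dec y x) as [-> | Hne]; [rewrite Rminus_diag_eq, Rabs_R0 by auto; auto |].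
  assert (p0 : 0 < Rabs (y - x)) by (apply Rabs_pos_lt; lra).
  assert (k := B y x Hy Hx Hne).
  assert (k2 := Rpower_le_l gamma (Rabs (y - x)) (Rpower (e / (2 * C')) (1 / gamma)) ltac:(lra) ltac:(lra)).
  rewrite Rpower_mult in k2. replace (1 / gamma * gamma) with 1 in k2 by (field; lra). rewrite Rpower_1 in k2 by auto.
  assert (p1 := Rpower_pos gamma (Rabs (y - x))).
  assert (c1 : C <= C') by (unfold C'; assert (z := Rle_abs C); lra).
  apply Rle_lt_trans with (C' * Rpower (Rabs (y - x)) gamma); [eapply Rle_trans; [apply k | apply Rmult_le_compat_r; lra] |].
  apply Rle_lt_trans with (C' * (e / (2 * C'))); [apply Rmult_le_compat_l; lra |].
  replace (C' * (e / (2 * C'))) with (e / 2) by (field; lra). lra.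
Qed.
(** Derivatives relative to the closed interval are ordinary ones inside, where the difference of
    the two sides is constant; continuity of the clamped function carries this to the ends. *)
Lemma primitive_on L f f' fe : 0 < L -> deriv_on 0 L f f' -> cont1 fe -> (forall x, 0 <= x <= L -> f' x = fe x) ->
  forall x, 0 <= x <= L -> f x = f 0 + RInt fe 0 x.
Proof.
  intros HL D c E. assert (cx := deriv_on_ext_cont L f f' ltac:(lra) D). assert (cI := RI_cont fe 0 c).
  set (d := (fun y => f (clamp L y) - RInt fe 0 y) : R -> R). assert (cd : cont1 d) by (unfold d; ctn).
  assert (K : forall a b, 0 < a -> a <= b -> b < L -> d b = d a).
  { intros a b Ha Hab Hb. apply const_of_derive; auto. intros y Hy. unfold d.
    evar_last; [apply (is_derive_minus (fun y => f (clamp L y)) (fun y => RInt fe 0 y)) |].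
    - apply (derive_ext_in f _ 0 L); [lra | intros z Hz; rewrite clamp_id by lra; auto | apply (within_interior f (f' y) y L); [lra | apply D; unfold Icc; lra]].
    - apply RI_derive; auto.
    - rewrite E by lra. unfold minus, plus, opp; simpl. ring. }
  assert (Z : forall x, 0 <= x <= L -> d x - d (L / 2) = 0).
  { apply (zero_closure L HL (fun x => d x - d (L / 2))); [ctn |]. intros y Hy. apply Rminus_diag_eq.
    destruct (Rle_dec y (L / 2)); [symmetry; apply K; lra | apply K; lra]. }
  intros x Hx. assert (z1 := Z x Hx). assert (z0 := Z 0 ltac:(lra)). unfold d in z1, z0.
  rewrite (clamp_id L x) in z1 by auto. rewrite (clamp_id L 0), RI_point in z0 by lra. lra.
Qed.
Lemma cont_on_local D f : (forall q, D q -> exists g a0 a1, cont2 g /\ a0 < fst q < a1 /\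
  forall q', D q' -> a0 < fst q' < a1 -> f (fst q') (snd q') = g (fst q') (snd q')) -> cont_on D f.
Proof.
  intros H [t x] Hq. destruct (H _ Hq) as [g [a0 [a1 [cg [Ha E]]]]]. simpl in Ha. rewrite E by auto.
  intros P HP. assert (K := cg (t, x) P HP). unfold filtermap, within in *.
  assert (N : locally (t, x) (fun q : R * R => a0 < fst q < a1)).
  { assert (Hm : 0 < Rmin (t - a0) (a1 - t)) by (apply Rmin_pos; lra).
    exists (mkposreal _ Hm). intros [s y] [Hb _]. simpl in *. unfold ball in Hb; simpl in Hb.
    unfold AbsRing_ball, abs, minus, plus, opp in Hb; simpl in Hb. apply Rabs_def2 in Hb.
    assert (h1 := Rmin_l (t - a0) (a1 - t)). assert (h2 := Rmin_r (t - a0) (a1 - t)). lra. }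
  apply (filter_imp (fun q => P (g (fst q) (snd q)) /\ a0 < fst q < a1)); [| apply filter_and; auto].
  intros q [h1 h2] Dq. rewrite E by auto. auto.
Qed.
Lemma cont_on_cont2 D f : cont2 f -> cont_on D f.
Proof. intros c. apply cont_on_local. intros q _. exists f, (fst q - 1), (fst q + 1). split; [auto | split; [lra | auto]]. Qed.

Lemma existence L T sigma r eps gamma uT uT1 uT2 m0 m01 m02 : 0 < L -> 0 < T -> 0 < sigma -> 0 < r -> 0 < eps -> 0 < gamma ->
  C2gamma 0 L gamma uT uT1 uT2 -> C2gamma 0 L gamma m0 m01 m02 -> uT1 0 = 0 /\ uT1 L = 0 ->
  m0 0 = 0 /\ m01 0 = 0 /\ m0 L = 0 /\ m01 L = 0 -> (forall x, 0 <= x <= L -> 0 <= m0 x) -> RInt m0 0 L = 1 ->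
  exists u m, classical_solution sigma r T L eps uT m0 u m.
Proof.
  intros HL HT Hs Hr He Hg [Du [Du1 Hu]] [Dm [Dm1 Hm]] [u0 uL] [m00 [m10 [m0L m1L]]] Hpos Hmass.
  (* The data are replaced by functions smooth on the whole line: the second derivative is extended
     by clamping and integrated back, agreeing with the given data on [0,L]. *)
  set (v0' := fun y => uT2 (clamp L y)). assert (cv0' : cont1 v0') by (apply (holder_ext_cont L gamma); auto; lra).
  set (v0 := (fun x => RInt v0' 0 x) : R -> R). assert (Dv0 : forall x, is_derive v0 x (v0' x)) by (intros; apply RI_derive; auto).
  assert (cv0 : cont1 v0) by (apply RI_cont; auto).
  assert (Ev0 : forall x, 0 <= x <= L -> uT1 x = v0 x).
  { intros x Hx. rewrite (primitive_on L uT1 uT2 v0' HL Du1 cv0') by (auto; intros; unfold v0'; rewrite clamp_id; auto).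
    rewrite u0. unfold v0. req. ring. }
  set (uTe := (fun x => uT 0 + RInt v0 0 x) : R -> R).
  assert (DuTe : forall x, is_derive uTe x (v0 x)).
  { intros x. evar_last; [apply (is_derive_plus (fun _ => uT 0) (fun x => RInt v0 0 x)); [apply is_derive_const | apply RI_derive; auto] |].
    unfold plus, zero; simpl. ring. }
  assert (EuT : forall x, 0 <= x <= L -> uT x = uTe x) by (intros; apply (primitive_on L uT uT1); auto).
  set (m2 := fun y => m02 (clamp L y)). assert (cm2 : cont1 m2) by (apply (holder_ext_cont L gamma); auto; lra).
  set (m1 := (fun x => RInt m2 0 x) : R -> R). assert (Dm1' : forall x, is_derive m1 x (m2 x)) by (intros; apply RI_derive; auto).
  assert (cm1 : cont1 m1) by (apply RI_cont; auto).
  assert (Em1 : forall x, 0 <= x <= L -> m01 x = m1 x).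
  { intros x Hx. rewrite (primitive_on L m01 m02 m2 HL Dm1 cm2) by (auto; intros; unfold m2; rewrite clamp_id; auto).
    rewrite m10. unfold m1. req. ring. }
  set (me := (fun x => RInt m1 0 x) : R -> R). assert (Dme : forall x, is_derive me x (m1 x)) by (intros; apply RI_derive; auto).
  assert (Eme : forall x, 0 <= x <= L -> m0 x = me x).
  { intros x Hx. rewrite (primitive_on L m0 m01 m1 HL Dm cm1) by auto. rewrite m00. unfold me. req. ring. }
  destruct (cont1_bound v0 0 L cv0) as [K0 [HK0 BK]].
  set (nu := sigma ^ 2 / 2). assert (Hnu : 0 < nu) by (unfold nu; pos).
  assert (Hb : 0 < bcoef eps) by (unfold bcoef; pos). assert (Hc : 0 < ccoef eps) by (unfold ccoef; pos).
  assert (Hbc : bcoef eps + ccoef eps = 1) by (unfold bcoef, ccoef; field; lra).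
  assert (v00 : v0 0 = 0) by apply RI_point. assert (v0L : v0 L = 0) by (rewrite <- Ev0 by lra; auto).
  assert (me0 : me 0 = 0) by apply RI_point. assert (meL : me L = 0) by (rewrite <- Eme by lra; auto).
  assert (m1_0 : m1 0 = 0) by apply RI_point. assert (m1_L : m1 L = 0) by (rewrite <- Em1 by lra; auto).
  assert (mep : forall x, 0 <= x <= L -> 0 <= me x) by (intros; rewrite <- Eme by auto; auto).
  assert (mem : RInt me 0 L = 1) by (rewrite <- Hmass; apply RI_ext; [lra | intros; rewrite Eme; auto]).
  destruct (fixed_point L nu r T K0 v0 me v0' m1 HL Hnu ltac:(lra) HT ltac:(lra) Dv0 cv0' v00 v0L BK Dme cm1 mep mem (bcoef eps) (ccoef eps) Hb Hc Hbc)
    as [p [v [m [cp [Hp [HC Hfix]]]]]].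
  assert (HP : 0 <= bcoef eps + ccoef eps * K0) by pos.
  destruct (regular L nu r T K0 v0 me v0' m1 m2 HL Hnu ltac:(lra) HT ltac:(lra) Dv0 cv0' v00 v0L BK Dme Dm1' cm2 me0 meL m1_0 m1_L
    (bcoef eps) (ccoef eps) (bcoef eps + ccoef eps * K0) p v m HP cp Hp HC Hfix uTe DuTe)
    as [u [mx [cu [cmx [cv [cm [Dx [Iu [Emx [Rb [Bv [Im Loc]]]]]]]]]]]].
  exists u, m.
  assert (GE : forall t x, 0 <= t <= T -> Gfun eps L (fun t x => v (T - t) x) m t x = / 2 * (p t - v (T - t) x)).
  { intros t x Ht. unfold Gfun. rewrite (Hfix t Ht). auto. }
  (* The interior derivatives are named by the total operator [Derive], which agrees on each time
     window with its local representative. *)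
  exists (fun t x => v (T - t) x), mx, (fun t x => Derive (fun q => u q x) t), (fun t x => Derive (fun y => v (T - t) y) x),
    (fun t x => Derive (fun q => m q x) t), (fun t x => Derive (fun y => mx t y) x).
  split; [apply cont_on_cont2; auto |]. split; [apply cont_on_cont2; auto |].
  split; [apply cont_on_cont2; ctn |]. split; [apply cont_on_cont2; auto |].
  split.
  { apply cont_on_local. intros [t x] [Ht Hx]. destruct (Loc t Ht) as [a0 [a1 [Ut [Uxx [Mt [Mxx [Ha [d1 [d2 [d3 [d4 Rg]]]]]]]]]]].
    exists Ut, a0, a1. split; [auto | split; [auto |]]. intros [t' x'] [Ht' Hx'] Ht''. apply is_derive_unique. apply Rg; auto. }
  split.
  { apply cont_on_local. intros [t x] [Ht Hx]. destruct (Loc t Ht) as [a0 [a1 [Ut [Uxx [Mt [Mxx [Ha [d1 [d2 [d3 [d4 Rg]]]]]]]]]]].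
    exists Uxx, a0, a1. split; [auto | split; [auto |]]. intros [t' x'] [Ht' Hx'] Ht''. apply is_derive_unique. apply (Rg t' x'); auto. }
  split.
  { apply cont_on_local. intros [t x] [Ht Hx]. destruct (Loc t Ht) as [a0 [a1 [Ut [Uxx [Mt [Mxx [Ha [d1 [d2 [d3 [d4 Rg]]]]]]]]]]].
    exists Mt, a0, a1. split; [auto | split; [auto |]]. intros [t' x'] [Ht' Hx'] Ht''. apply is_derive_unique. apply (Rg t' x'); auto. }
  split.
  { apply cont_on_local. intros [t x] [Ht Hx]. destruct (Loc t Ht) as [a0 [a1 [Ut [Uxx [Mt [Mxx [Ha [d1 [d2 [d3 [d4 Rg]]]]]]]]]]].
    exists Mxx, a0, a1. split; [auto | split; [auto |]]. intros [t' x'] [Ht' Hx'] Ht''. apply is_derive_unique. apply (Rg t' x'); auto. }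
  split.
  { intros t Ht. split; intros x Hx.
    - apply (deriv_within_of (u t) (u t)); auto.
    - apply (deriv_within_of (m t) (fun y => m t 0 + RInt (mx t) 0 y)); auto.
      evar_last; [apply (is_derive_plus (fun _ => m t 0) (fun y => RInt (mx t) 0 y)); [apply is_derive_const | apply RI_derive; ctn] |].
      unfold plus, zero; simpl. ring. }
  split.
  { intros t x Ht Hx. destruct (Loc t Ht) as [a0 [a1 [Ut [Uxx [Mt [Mxx [Ha [d1 [d2 [d3 [d4 Rg]]]]]]]]]]].
    destruct (Rg t x Ha Hx) as [r1 [r2 [r3 [r4 _]]]].
    assert (e1 : Derive (fun q : R => u q x) t = Ut t x) by (apply is_derive_unique; auto).
    assert (e2 : Derive (fun y : R => v (T - t) y) x = Uxx t x) by (apply is_derive_unique; auto).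
    assert (e3 : Derive (fun q : R => m q x) t = Mt t x) by (apply is_derive_unique; auto).
    assert (e4 : Derive (fun y : R => mx t y) x = Mxx t x) by (apply is_derive_unique; auto).
    rewrite e1, e2, e3, e4. auto. }
  split.
  { intros t x Ht Hx. destruct (Loc t Ht) as [a0 [a1 [Ut [Uxx [Mt [Mxx [Ha [d1 [d2 [d3 [d4 Rg]]]]]]]]]]].
    destruct (Rg t x Ha Hx) as [r1 [r2 [r3 [r4 [r5 _]]]]].
    assert (e1 : Derive (fun q : R => u q x) t = Ut t x) by (apply is_derive_unique; auto).
    assert (e2 : Derive (fun y : R => v (T - t) y) x = Uxx t x) by (apply is_derive_unique; auto).
    rewrite e1, e2, GE by lra. exact r5. }
  split.
  { intros t x Ht Hx. destruct (Loc t Ht) as [a0 [a1 [Ut [Uxx [Mt [Mxx [Ha [d1 [d2 [d3 [d4 Rg]]]]]]]]]]].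
    destruct (Rg t x Ha Hx) as [r1 [r2 [r3 [r4 [r5 r6]]]]].
    assert (e3 : Derive (fun q : R => m q x) t = Mt t x) by (apply is_derive_unique; auto).
    assert (e4 : Derive (fun y : R => mx t y) x = Mxx t x) by (apply is_derive_unique; auto).
    rewrite e3, e4. exists (Mt t x - nu * Mxx t x). split.
    - apply (is_derive_ext (fun y => / 2 * (p t - v (T - t) y) * m t y)); auto. intros y. rewrite GE by lra. auto.
    - unfold nu. ring. }
  split.
  { intros x Hx. rewrite (Eme x Hx), (EuT x Hx). auto. }
  split; [auto |].
  intros t x Ht Hx. rewrite GE by auto. apply Rb; auto.
Qed.

Theorem theorem2p5
  (L T sigma r eps gamma : R) (uT uT1 uT2 m0 m01 m02 : R -> R)
  (HL : 0 < L) (HT : 0 < T) (Hsigma : 0 < sigma) (Hr : 0 < r)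
  (Heps : 0 < eps) (Hgamma : 0 < gamma)
  (HuT : C2gamma 0 L gamma uT uT1 uT2)
  (Hm0 : C2gamma 0 L gamma m0 m01 m02)
  (HuTbc : uT1 0 = 0 /\ uT1 L = 0)
  (Hm0bc : m0 0 = 0 /\ m01 0 = 0 /\ m0 L = 0 /\ m01 L = 0)
  (Hm0pos : forall x, 0 <= x <= L -> 0 <= m0 x)
  (Hm0mass : RInt m0 0 L = 1)
  (HuTpos : forall x, 0 <= x <= L -> 0 <= uT x) :
  exists u m : R -> R -> R,
    classical_solution sigma r T L eps uT m0 u m /\
    forall u' m' : R -> R -> R,
      classical_solution sigma r T L eps uT m0 u' m' ->
      forall t x, 0 <= t <= T -> 0 <= x <= L ->
        u' t x = u t x /\ m' t x = m t x.
Proof.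
  destruct (existence L T sigma r eps gamma uT uT1 uT2 m0 m01 m02) as [u [m S]]; auto.
  exists u, m. split; auto. intros u' m' S' t x Ht Hx.
  destruct (classical_unpack sigma r T L eps uT m0 u m Hsigma HT HL S) as [U [V [M [N [ut [mt [Q E]]]]]]].
  destruct (classical_unpack sigma r T L eps uT m0 u' m' Hsigma HT HL S') as [U' [V' [M' [N' [ut' [mt' [Q' E']]]]]]].
  assert (nu0 : 0 < sigma ^ 2 / 2) by pos.
  assert (Hb : 0 < bcoef eps) by (unfold bcoef; pos). assert (Hc : 0 < ccoef eps) by (unfold ccoef; pos).
  assert (Hbc : bcoef eps + ccoef eps = 1) by (unfold bcoef, ccoef; field; lra).
  destruct (s_unique _ _ _ _ _ _ _ _ nu0 HT HL Hb Hc Hbc Hm0pos Hm0mass U V M N ut mt U' V' M' N' ut' mt' Q Q' t x Ht Hx) as [e1 e2].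
  destruct (E t x Ht Hx) as [e3 e4]. destruct (E' t x Ht Hx) as [e5 e6]. rewrite <- e3, <- e4, <- e5, <- e6. auto.
Qed.
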